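(* Let $m\ge 0$ be an integer. For any $m$-tensor $f\in L^2(SM)$, there exists a unique $m$-tensor $g\in L^2(SM)$ such that $If = Ig$ and $g$ is of the following form: (i) if $m=2n$ is even, then $g = g_0 + g_{\pm 2}e^{\pm i2\theta} + \cdots + g_{\pm 2n}e^{\pm i2n\theta}$ with $g_0\in L^2(M)$ and, for all even $k$ with $2\le k\le 2n$, $g_{k} e^{ik\theta} \in \ker^{k} \eta_{-}$ and $g_{-k}e^{-ik\theta}\in \ker^{-k}\eta_+$; (ii) if $m=2n+1$ is odd, then $g = X_\perp g_0 + g_{\pm 3}e^{\pm i3\theta} + \cdots + g_{\pm (2n+1)}e^{\pm i(2n+1)\theta}$, with $g_0\in \dot{H}^1(M)$ and, for all odd $k$ with $3\le k\le 2n+1$, $g_{k} e^{ik\theta} \in \ker^{k} \eta_{-}$ and $g_{-k}e^{-ik\theta}\in \ker^{-k}\eta_+$. In both statements above, there exists a constant $C_m$ independent of $f,g$ such that $\|g\|_{L^2(SM)} \le C_m\|f\|_{L^2(SM)}$.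
   Context: $M=\{(x,y)\in\mathbb{R}^2: x^2+y^2<1\}$ is the Euclidean unit disk (points also written $z=x+iy$), $\mathbb{S}^1=\mathbb{R}/2\pi\mathbb{Z}$, and $SM = M\times \mathbb{S}^1\ni(\mathrm{x},\theta)$ is its unit circle bundle, with measure $d\mathrm{x}\,d\theta$. All functions are complex-valued. Any $u\in L^2(SM)$ is uniquely written $u=\sum_{k\in\mathbb{Z}}u_k(\mathrm{x})e^{ik\theta}$ with $u_k(\mathrm{x})=\frac{1}{2\pi}\int_{\mathbb{S}^1}u(\mathrm{x},\theta)e^{-ik\theta}d\theta$. An $m$-tensor is a function in $L^2(SM)$ whose only (possibly) nonzero harmonics $u_k$ have $k\in\{-m,-m+2,\dots,m-2,m\}$. The notation $g_{\pm k}e^{\pm ik\theta}$ in a sum stands for $g_k(\mathrm{x})e^{ik\theta}+g_{-k}(\mathrm{x})e^{-ik\theta}$. $\partial_+SM$ (influx boundary) is parameterized by fan-beam coordinates $(\beta,\alpha)\in\mathbb{S}^1\times(-\frac{\pi}{2},\frac{\pi}{2})$, representing the boundary point $e^{i\beta}$ and the direction of angle $\beta+\pi+\alpha$; $L^2(\partial_+SM)$ is taken with respect to $d\beta\,d\alpha$. The X-ray transform $I:L^2(SM)\to L^2(\partial_+SM)$ is the continuous extension of $$If(\beta,\alpha)=\int_0^{2\cos\alpha}f(e^{i\beta}+te^{i(\beta+\pi+\alpha)},\,\beta+\pi+\alpha)\,dt.$$ With $\partial=\frac12(\partial_x-i\partial_y)$, $\overline{\partial}=\frac12(\partial_x+i\partial_y)$: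 $\eta_+=e^{i\theta}\partial$, $\eta_-=e^{-i\theta}\overline\partial$, $X=\eta_++\eta_-=\cos\theta\,\partial_x+\sin\theta\,\partial_y$, $X_\perp=\frac{1}{i}(\eta_+-\eta_-)=\sin\theta\,\partial_x-\cos\theta\,\partial_y$. For $k\in\mathbb{Z}$, $\ker^k\eta_+=\{f(\mathrm{x})e^{ik\theta}: f\in L^2(M),\ \partial f=0\}$ and $\ker^k\eta_-=\{f(\mathrm{x})e^{ik\theta}: f\in L^2(M),\ \overline\partial f=0\}$. $\dot H^1(M)=\{f\in H^1(M):\int_{\mathbb{S}^1}f(e^{i\beta})\,d\beta=0\}$ (boundary values in the trace sense). *)

(* Defs.v *)
From HB Require Import structures.
From mathcomp Require Import all_boot all_order all_algebra.
From mathcomp Require Import all_classical all_reals all_analysis.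
From mathcomp Require Import complex.

Set Implicit Arguments.
Unset Strict Implicit.
Unset Printing Implicit Defensive.

Import Order.TTheory GRing.Theory Num.Theory.
Import numFieldNormedType.Exports.

Local Open Scope classical_set_scope.
Local Open Scope ring_scope.
Local Open Scope complex_scope.

(* Complex-valued functions take values in [R[i]]; they are measured and
   integrated through their real and imaginary parts.  Elements of L^2 are
   represented by functions, and equality in L^2 by [ae_eq].

   Functions on S^1 = R/2piZ are 2pi-periodic functions on R; measure-theoretic
   notions on S^1 use the fundamental domain [0, 2pi]. *)

Section ComplexL2.
Context {d : measure_display} {T : measurableType d} {R : realType}.
Variables (mu : {measure set T -> \bar R}) (D : set T).

Definition cintegral (f : T -> R[i]) : R[i] :=
  Rintegral mu D (fun x => complex.Re (f x)) +i*
  Rintegral mu D (fun x => complex.Im (f x)).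

Definition L2norm (f : T -> R[i]) : \bar R :=
  Lnorm mu 2%:E ((fun x => (ComplexField.Normc.normc (f x))%:E) \_ D).

Definition L2 (f : T -> R[i]) : Prop :=
  [/\ measurable_fun D (fun x => complex.Re (f x)),
      measurable_fun D (fun x => complex.Im (f x)) &
      (L2norm f < +oo)%E].

Definition L2cvg (f_ : nat -> T -> R[i]) (f : T -> R[i]) : Prop :=
  (fun n => L2norm (fun x => f_ n x - f x)) @ \oo --> 0%E.

End ComplexL2.

Section Geometry.
Context {R : realType}.

Definition leb1 : {measure set (measurableTypeR R) -> \bar R} :=
  lebesgue_measure.
Definition leb2 :
    {measure set (measurableTypeR R * measurableTypeR R) -> \bar R} :=
  (lebesgue_measure \x lebesgue_measure)%E.
Definition leb3 :
    {measure set (measurableTypeR R * measurableTypeR R * measurableTypeR R)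
     -> \bar R} :=
  ((lebesgue_measure \x lebesgue_measure) \x lebesgue_measure)%E.

Definition circle : set R := [set t | 0 <= t <= pi *+ 2].

Definition M : set (R * R) := [set p | p.1 ^+ 2 + p.2 ^+ 2 < 1].

Definition SM : set ((R * R) * R) := M `*` circle.

(* fan-beam coordinates (beta, alpha) *)
Definition influx : set (R * R) :=
  circle `*` [set a | - (pi / 2) < a < pi / 2].

Definition L2M : (R * R -> R[i]) -> Prop := L2 leb2 M.

Definition L2SM (u : (R * R) * R -> R[i]) : Prop :=
  (forall x, M x -> periodic (fun t => u (x, t)) (pi *+ 2)) /\ L2 leb3 SM u.

Definition L2influx (w : R * R -> R[i]) : Prop :=
  (forall a, - (pi / 2) < a < pi / 2 ->
     periodic (fun b => w (b, a)) (pi *+ 2)) /\ L2 leb2 influx w.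

Definition expi (t : R) : R[i] := cos t +i* sin t.

Definition angular_harmonic (u : (R * R) * R -> R[i]) (k : int) (x : R * R) : R[i] :=
  ((pi *+ 2)^-1)%:C *
  cintegral leb1 circle (fun t => u (x, t) * expi (- (k%:~R * t))).

Definition mode (h : R * R -> R[i]) (k : int) (p : (R * R) * R) : R[i] :=
  h p.1 * expi (k%:~R * p.2).

Definition is_tensor (m : nat) (u : (R * R) * R -> R[i]) : Prop :=
  L2SM u /\
  forall k : int,
    ~ (exists2 j : nat, (j <= m)%N & k = m%:Z - (2 * j)%N%:Z) ->
    ae_eq leb2 M (angular_harmonic u k) (fun=> 0).

(* [u] is a continuous function on the whole of R^2 x S^1. *)
Definition continuousSM (u : (R * R) * R -> R[i]) : Prop :=
  [/\ forall x, periodic (fun t => u (x, t)) (pi *+ 2),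
      continuous (fun p => complex.Re (u p)) &
      continuous (fun p => complex.Im (u p))].

Definition xray_formula (u : (R * R) * R -> R[i]) (ba : R * R) : R[i] :=
  let: (b, a) := ba in
  let t := b + pi + a in
  cintegral leb1 [set s | 0 <= s <= 2 * cos a]
    (fun s => u ((cos b + s * cos t, sin b + s * sin t), t)).

(* The continuous extension of [xray_formula] from the continuous functions to
   L^2(SM), given by its graph: [is_xray f w] says that w is a representative
   of the class I f in L^2(influx), which is unique up to a.e. equality. *)
Definition is_xray (f : (R * R) * R -> R[i]) (w : R * R -> R[i]) : Prop :=
  L2influx w /\
  exists u_ : nat -> (R * R) * R -> R[i],
    [/\ forall n, continuousSM (u_ n),
        L2cvg leb3 SM u_ f &
        L2cvg leb2 influx (fun n => xray_formula (u_ n)) w].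

(* I f = I g: the two classes have a common representative. *)
Definition same_xray (f g : (R * R) * R -> R[i]) : Prop :=
  exists w, is_xray f w /\ is_xray g w.

Fixpoint Ck (k : nat) (phi : R * R -> R) : Prop :=
  if k is k'.+1 then
    [/\ forall p, derivable phi p (1, 0),
        forall p, derivable phi p (0, 1),
        Ck k' (fun p => derive phi p (1, 0)) &
        Ck k' (fun p => derive phi p (0, 1))]
  else continuous phi.

Definition smooth (phi : R * R -> R) : Prop := forall k, Ck k phi.

(* Real-valued test functions suffice below: the pairings are C-linear. *)
Definition test_function (phi : R * R -> R) : Prop :=
  smooth phi /\
  exists K : set (R * R),
    [/\ compact K, K `<=` M & forall p, ~ K p -> phi p = 0].

(* (a d_x + b d_y) f = h in the sense of distributions on M *)
Definition weak_op (a b : R[i]) (f h : R * R -> R[i]) : Prop :=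
  forall phi, test_function phi ->
    cintegral leb2 M (fun p =>
      f p * (a * (derive phi p (1, 0))%:C + b * (derive phi p (0, 1))%:C))
    = - cintegral leb2 M (fun p => h p * (phi p)%:C).

Definition weak_dx := weak_op 1 0.
Definition weak_dy := weak_op 0 1.
Definition weak_dz := weak_op (2^-1)%:C (0 -i* 2^-1).
Definition weak_dzbar := weak_op (2^-1)%:C (0 +i* 2^-1).

Definition ker_eta_plus (k : int) (u : (R * R) * R -> R[i]) : Prop :=
  exists f, [/\ L2M f, weak_dz f (fun=> 0) & ae_eq leb3 SM u (mode f k)].

Definition ker_eta_minus (k : int) (u : (R * R) * R -> R[i]) : Prop :=
  exists f, [/\ L2M f, weak_dzbar f (fun=> 0) & ae_eq leb3 SM u (mode f k)].

(* f is in H^1(M), with weak gradient (fx, fy) *)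
Definition H1 (f fx fy : R * R -> R[i]) : Prop :=
  [/\ L2M f, L2M fx, L2M fy, weak_dx f fx & weak_dy f fy].

Definition csmooth (f : R * R -> R[i]) : Prop :=
  smooth (fun p => complex.Re (f p)) /\ smooth (fun p => complex.Im (f p)).

Definition cderive (v : R * R) (f : R * R -> R[i]) (p : R * R) : R[i] :=
  derive (fun q => complex.Re (f q)) p v +i*
  derive (fun q => complex.Im (f q)) p v.

(* The trace operator H^1(M) -> L^2(S^1), given by its graph: the continuous
   extension of the restriction to the boundary of functions smooth up to the
   boundary; (fx, fy) is the weak gradient of f. *)
Definition is_trace (f fx fy : R * R -> R[i]) (tau : R -> R[i]) : Prop :=
  [/\ periodic tau (pi *+ 2), L2 leb1 circle tau &
  exists phi_ : nat -> R * R -> R[i],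
    [/\ forall n, csmooth (phi_ n),
        L2cvg leb2 M phi_ f,
        L2cvg leb2 M (fun n => cderive (1, 0) (phi_ n)) fx,
        L2cvg leb2 M (fun n => cderive (0, 1) (phi_ n)) fy &
        L2cvg leb1 circle (fun n b => phi_ n (cos b, sin b)) tau]].

Definition H1dot (f fx fy : R * R -> R[i]) : Prop :=
  H1 f fx fy /\
  exists2 tau, is_trace f fx fy tau & cintegral leb1 circle tau = 0.

(* X_perp f in terms of the weak gradient (fx, fy) of f *)
Definition Xperp (fx fy : R * R -> R[i]) (p : (R * R) * R) : R[i] :=
  (sin p.2)%:C * fx p.1 - (cos p.2)%:C * fy p.1.

Definition even_form (n : nat) (g : (R * R) * R -> R[i]) : Prop :=
  exists (g0 : R * R -> R[i]) (g_ : int -> R * R -> R[i]),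
    [/\ L2M g0,
        forall j : nat, (1 <= j <= n)%N -> let k := (2 * j)%N%:Z in
          ker_eta_minus k (mode (g_ k) k) /\
          ker_eta_plus (- k) (mode (g_ (- k)) (- k)) &
        ae_eq leb3 SM g (fun p =>
          g0 p.1 + \sum_(1 <= j < n.+1) (let k := (2 * j)%N%:Z in
            mode (g_ k) k p + mode (g_ (- k)) (- k) p))].

Definition odd_form (n : nat) (g : (R * R) * R -> R[i]) : Prop :=
  exists (g0 gx gy : R * R -> R[i]) (g_ : int -> R * R -> R[i]),
    [/\ H1dot g0 gx gy,
        forall j : nat, (1 <= j <= n)%N -> let k := (2 * j).+1%:Z in
          ker_eta_minus k (mode (g_ k) k) /\
          ker_eta_plus (- k) (mode (g_ (- k)) (- k)) &
        ae_eq leb3 SM g (fun p =>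
          Xperp gx gy p + \sum_(1 <= j < n.+1) (let k := (2 * j).+1%:Z in
            mode (g_ k) k p + mode (g_ (- k)) (- k) p))].

Definition normal_form (m : nat) (g : (R * R) * R -> R[i]) : Prop :=
  if odd m then odd_form m./2 g else even_form m./2 g.

Definition reduces_to (m : nat) (f g : (R * R) * R -> R[i]) : Prop :=
  [/\ is_tensor m g, same_xray f g & normal_form m g].

End Geometry.

(* Main.v *)
(* If [v] vanishes on the unit circle then [X (v e^{il theta})] has zero X-ray
   transform.  Existence: the harmonic of top degree [k] is projected onto the
   closure of the derivatives [d v] of such [v]; the remainder is holomorphic,
   and since [d v] and [dbar v] have the same L^2 norm, subtracting the limit of
   [X (v e^{i(k-1) theta})] only changes the harmonic of degree [k - 2], with
   control of the norm.  Negative degrees are conjugate.  When [m] is odd, the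
   harmonics of degree [1] and [-1] that remain are split into a limit of fields
   [X v] and a limit of fields [X_perp p]; a Poincare inequality along the chords
   makes the normalized potentials [p] converge in H^1, together with their traces.
   Uniqueness: by Santalo's formula a tensor with zero X-ray transform is
   orthogonal to the first integrals [e^{ij theta} (z e^{-i theta} - zbar e^{i theta})^n].
   Together with the linear relations between its moments imposed by the normal
   form, this forces all moments to vanish, and polynomials are dense. *)

From HB Require Import structures.
Require Import Defs.
From mathcomp Require Import all_boot all_order all_algebra.
From mathcomp Require Import all_classical all_reals all_analysis.
From mathcomp Require Import measurable_realfun complex.
From mathcomp Require Import ring lra zify.

Set Implicit Arguments.
Unset Strict Implicit.
Unset Printing Implicit Defensive.

Import Order.TTheory GRing.Theory Num.Theory.
Import numFieldNormedType.Exports.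

Local Open Scope classical_set_scope.
Local Open Scope ring_scope.
Local Open Scope complex_scope.

(** * Complex-valued L^2 functions as a real Hilbert space *)

Section HilbertL2.
Context {d : measure_display} {T : measurableType d} {R : realType}.
Variables (mu : {measure set T -> \bar R}) (D : set T).
Hypothesis mD : measurable D.
Implicit Types f g h : T -> R[i].

(** No regularity theory enters: a function that must vanish is shown to have zero moments against
    [c z^a zbar^b e^{ik theta}]. With s = 1 - |z|^2, orthogonality to the derivatives of s z^a
    zbar^b is a linear recursion between moments, so the holomorphy of remainders in the existence
    part and the uniqueness part both end in [holomorphic_recursion] or [diagonal_recursion]. One
    obstacle is that weak derivatives are tested on compactly supported functions, whereas s times a
    polynomial vanishes on the circle only. Cutoffs built from [flat] bridge this gap, and the class
    [csm] is closed under every operation involved. Another is that the X-ray transform and the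
    trace are given by graphs of closures: each limit must come with a sequence of continuous or
    smooth functions. This is why [L2_projection] returns approximants and why potentials are found
    by projection, not by solving an elliptic equation. The final constant is lossy: each gauge step
    at most doubles the bound on the harmonics, with at most m+1 steps on either side of degree
    0. *)

Definition dotc (z w : R[i]) : R :=
  complex.Re z * complex.Re w + complex.Im z * complex.Im w.

(** The real part of the Hermitian product. Complex orthogonality is recovered by letting a complex
    factor [c] range freely in the test functions, which is why monomials carry one throughout. *)
Definition rip f g : R := Rintegral mu D (fun x => dotc (f x) (g x)).

Definition nrm f : R := Num.sqrt (rip f f).

Definition cmeas f := measurable_fun D (fun x => complex.Re (f x)) /\
  measurable_fun D (fun x => complex.Im (f x)).

Lemma ReD (z w : R[i]) : complex.Re (z + w) = complex.Re z + complex.Re w.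
Proof. by case: z w => a b [c e]. Qed.
Lemma ImD (z w : R[i]) : complex.Im (z + w) = complex.Im z + complex.Im w.
Proof. by case: z w => a b [c e]. Qed.
Lemma ReN (z : R[i]) : complex.Re (- z) = - complex.Re z.
Proof. by case: z. Qed.
Lemma ImN (z : R[i]) : complex.Im (- z) = - complex.Im z.
Proof. by case: z. Qed.
Lemma ReM (z w : R[i]) : complex.Re (z * w) =
  complex.Re z * complex.Re w - complex.Im z * complex.Im w.
Proof. by case: z w => a b [c e]. Qed.
Lemma ImM (z w : R[i]) : complex.Im (z * w) =
  complex.Re z * complex.Im w + complex.Im z * complex.Re w.
Proof. by case: z w => a b [c e]. Qed.

Lemma cmeasD f g : cmeas f -> cmeas g -> cmeas (fun x => f x + g x).
Proof.
move=> [f1 f2] [g1 g2]; split.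
  by under eq_fun do rewrite ReD; exact: measurable_funD.
by under eq_fun do rewrite ImD; exact: measurable_funD.
Qed.

Lemma cmeasM f g : cmeas f -> cmeas g -> cmeas (fun x => f x * g x).
Proof.
move=> [f1 f2] [g1 g2]; split.
  by under eq_fun do rewrite ReM; apply: measurable_funB; exact: measurable_funM.
by under eq_fun do rewrite ImM; apply: measurable_funD; exact: measurable_funM.
Qed.

Lemma cmeas_cst (c : R[i]) : cmeas (fun=> c).
Proof. by split; exact: measurable_cst. Qed.

Lemma cmeasB f g : cmeas f -> cmeas g -> cmeas (fun x => f x - g x).
Proof.
move=> mf mg; under [fun _ => _]eq_fun do rewrite -mulN1r.
by apply: cmeasD => //; apply: cmeasM => //; exact: cmeas_cst.
Qed.

Lemma cmeas_dot f g : cmeas f -> cmeas g ->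
  measurable_fun D (fun x => dotc (f x) (g x)).
Proof.
by move=> [f1 f2] [g1 g2]; apply: measurable_funD; exact: measurable_funM.
Qed.

Lemma normc_dot (z : R[i]) : ComplexField.Normc.normc z = Num.sqrt (dotc z z).
Proof. by case: z => a b; rewrite /= /dotc/= -!expr2. Qed.

Lemma dotc_ge0 (z : R[i]) : 0 <= dotc z z.
Proof. by rewrite /dotc -!expr2 addr_ge0// sqr_ge0. Qed.

Lemma dotcC (z w : R[i]) : dotc z w = dotc w z.
Proof. by rewrite /dotc mulrC [X in _ + X]mulrC. Qed.

Lemma dotcDl (z w v : R[i]) : dotc (z + w) v = dotc z v + dotc w v.
Proof. by rewrite /dotc ReD ImD; ring. Qed.

Lemma dotcDr (z w v : R[i]) : dotc v (z + w) = dotc v z + dotc v w.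
Proof. by rewrite /dotc ReD ImD; ring. Qed.

Lemma dotcNl (z v : R[i]) : dotc (- z) v = - dotc z v.
Proof. by rewrite /dotc ReN ImN; ring. Qed.

Lemma dotc_young (z w : R[i]) : `|dotc z w| <= dotc z z + dotc w w.
Proof.
have H (a b : R) : `|a * b| <= a * a + b * b.
  rewrite ler_norml; apply/andP; split; last first.
    have := sqr_ge0 (a - b); have := sqr_ge0 a; have := sqr_ge0 b.
    by rewrite !expr2; lra.
  have := sqr_ge0 (a + b); have := sqr_ge0 a; have := sqr_ge0 b.
  by rewrite !expr2; lra.
rewrite (le_trans (ler_normD _ _))//.
have := H (complex.Re z) (complex.Re w).
have := H (complex.Im z) (complex.Im w); rewrite /dotc; lra.
Qed.

Lemma L2normE f :
  L2norm mu D f = ((\int[mu]_(x in D) (dotc (f x) (f x))%:E) `^ (2^-1))%E.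
Proof.
rewrite /L2norm unlock.
congr (_ `^ _)%E; rewrite [RHS]integral_mkcond; apply: eq_integral => x _.
rewrite !patchE; case: ifP => _; last by rewrite abse0 poweR0r// pnatr_eq0.
rewrite normc_dot abse_EFin poweR_EFin; congr EFin.
by rewrite powR_mulrn// ger0_norm ?sqrtr_ge0// sqr_sqrtr// dotc_ge0.
Qed.

Lemma L2P f : L2 mu D f <->
  cmeas f /\ mu.-integrable D (fun x => (dotc (f x) (f x))%:E).
Proof.
have E : (L2norm mu D f < +oo)%E <->
    (\int[mu]_(x in D) (dotc (f x) (f x))%:E < +oo)%E.
  rewrite L2normE.
  have : (0 <= \int[mu]_(x in D) (dotc (f x) (f x))%:E)%E.
    by apply: integral_ge0 => x _; rewrite lee_fin dotc_ge0.
  case: (\int[mu]_(x in D) _)%E => // [r|] _; first by rewrite poweR_EFin !ltry.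
  by rewrite poweRyr// invr_eq0 pnatr_eq0.
split=> [[m1 m2 /E fo]|[[m1 m2] /integrableP[_ fo]]].
  split=> //; apply/integrableP; split.
    by apply/measurable_EFinP; exact: cmeas_dot.
  by under eq_integral do rewrite gee0_abs ?lee_fin ?dotc_ge0//.
split=> //; apply/E.
by under eq_integral do rewrite -[X in X%:E]ger0_norm ?dotc_ge0//.
Qed.

Lemma L2_meas f : L2 mu D f -> cmeas f.
Proof. by move=> /L2P[]. Qed.

Lemma ripE f : L2 mu D f ->
  (\int[mu]_(x in D) (dotc (f x) (f x))%:E)%E = (rip f f)%:E.
Proof. by move=> /L2P[_ i]; rewrite fineK// integrable_fin_num. Qed.

Lemma L2norm_nrm f : L2 mu D f -> L2norm mu D f = (nrm f)%:E.
Proof.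
move=> Lf; rewrite L2normE ripE// poweR_EFin /nrm powR12_sqrt//.
by rewrite Rintegral_ge0// => x _; exact: dotc_ge0.
Qed.

Lemma L2_dot f g : L2 mu D f -> L2 mu D g ->
  mu.-integrable D (EFin \o (fun x => dotc (f x) (g x))).
Proof.
move=> /L2P[mf fi] /L2P[mg gi].
apply: (le_integrable mD _ _ (integrableD mD fi gi)).
  by apply/measurable_EFinP; exact: cmeas_dot.
move=> x _ /=; rewrite lee_fin [leRHS]ger0_norm; first exact: dotc_young.
by apply: addr_ge0; exact: dotc_ge0.
Qed.

Lemma L2D f g : L2 mu D f -> L2 mu D g -> L2 mu D (fun x => f x + g x).
Proof.
move=> Lf Lg; apply/L2P; split; first by apply: cmeasD; exact: L2_meas.
under [fun _ => _]eq_fun do rewrite dotcDl !dotcDr !EFinD.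
by apply: integrableD => //; apply: integrableD => //; exact: L2_dot.
Qed.

Lemma L2_bounded_mul f g (C : R) : cmeas g ->
  (forall x, D x -> dotc (g x) (g x) <= C) ->
  L2 mu D f -> L2 mu D (fun x => g x * f x).
Proof.
move=> mg gC /L2P[mf fi]; apply/L2P; split; first exact: cmeasM.
apply: (le_integrable mD _ _ (integrableZl mD C fi)).
  by apply/measurable_EFinP; apply: cmeas_dot; exact: cmeasM.
move=> x /gC gCx /=; rewrite lee_fin ger0_norm ?dotc_ge0//.
rewrite (le_trans _ (ler_norm _))//.
apply: (@le_trans _ _ (dotc (g x) (g x) * dotc (f x) (f x))).
  by rewrite /dotc ReM ImM; lra.
by rewrite ler_wpM2r// dotc_ge0.
Qed.

Lemma L2Z (c : R[i]) f : L2 mu D f -> L2 mu D (fun x => c * f x).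
Proof. by apply: (@L2_bounded_mul _ _ (dotc c c)) => //; exact: cmeas_cst. Qed.

Lemma L2B f g : L2 mu D f -> L2 mu D g -> L2 mu D (fun x => f x - g x).
Proof.
move=> Lf Lg; under [fun _ => _]eq_fun do rewrite -mulN1r.
by apply: L2D => //; exact: L2Z.
Qed.

Lemma L2N f : L2 mu D f -> L2 mu D (fun x => - f x).
Proof.
move=> Lf; under [fun _ => _]eq_fun do rewrite -mulN1r.
exact: L2Z.
Qed.

Lemma L2_0 : L2 mu D (fun=> 0).
Proof.
apply/L2P; split; first exact: cmeas_cst.
under [fun _ => _]eq_fun do rewrite /dotc !mul0r addr0.
exact: integrable0.
Qed.

Lemma L2_bounded f (C : R) : (mu D < +oo)%E -> cmeas f ->
  (forall x, D x -> dotc (f x) (f x) <= C) -> L2 mu D f.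
Proof.
move=> muD mf fC; apply/L2P; split=> //.
apply: measurable_bounded_integrable => //; first exact: cmeas_dot.
exists C; split; first exact: num_real.
move=> M CM x /= /fC fCx; rewrite ger0_norm ?dotc_ge0//.
by rewrite (le_trans fCx)// ltW.
Qed.

Lemma ripC f g : rip f g = rip g f.
Proof. by apply: eq_Rintegral => x _; exact: dotcC. Qed.

Lemma rip_ge0 f : 0 <= rip f f.
Proof. by apply: Rintegral_ge0 => x _; exact: dotc_ge0. Qed.

Lemma eq_rip f f' g g' : (forall x, D x -> f x = f' x) ->
  (forall x, D x -> g x = g' x) -> rip f g = rip f' g'.
Proof.
by move=> ff gg; apply: eq_Rintegral => x /[!inE] Dx; rewrite ff// gg.
Qed.

Lemma eq_rip2 f f' : (forall x, D x -> f x = f' x) -> rip f f = rip f' f'.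
Proof. by move=> ff; exact: eq_rip. Qed.

Lemma ripDl f g h : L2 mu D f -> L2 mu D g -> L2 mu D h ->
  rip (fun x => f x + g x) h = rip f h + rip g h.
Proof.
move=> Lf Lg Lh; rewrite -RintegralD//; [|exact: L2_dot..].
by apply: eq_Rintegral => x _; rewrite dotcDl.
Qed.

Lemma ripDr f g h : L2 mu D f -> L2 mu D g -> L2 mu D h ->
  rip h (fun x => f x + g x) = rip h f + rip h g.
Proof. by move=> *; rewrite ripC ripDl// ripC [X in _ + X]ripC. Qed.

Lemma ripBl f g h : L2 mu D f -> L2 mu D g -> L2 mu D h ->
  rip (fun x => f x - g x) h = rip f h - rip g h.
Proof.
move=> Lf Lg Lh; rewrite -RintegralB//; [|exact: L2_dot..].
by apply: eq_Rintegral => x _; rewrite dotcDl dotcNl.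
Qed.

Lemma ripBr f g h : L2 mu D f -> L2 mu D g -> L2 mu D h ->
  rip h (fun x => f x - g x) = rip h f - rip h g.
Proof. by move=> *; rewrite ripC ripBl// ripC [X in _ - X]ripC. Qed.

Lemma ripNl f g : L2 mu D f -> L2 mu D g -> rip (fun x => - f x) g = - rip f g.
Proof.
move=> Lf Lg; rewrite -mulN1r -RintegralZl//; last exact: L2_dot.
by apply: eq_Rintegral => x _; rewrite dotcNl mulN1r.
Qed.

Lemma ripZl (c : R) f g : L2 mu D f -> L2 mu D g ->
  rip (fun x => c%:C * f x) g = c * rip f g.
Proof.
move=> Lf Lg; rewrite -RintegralZl//; last exact: L2_dot.
by apply: eq_Rintegral => x _; rewrite /dotc ReM ImM/=; ring.
Qed.

Lemma rip0l f : rip (fun=> 0) f = 0.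
Proof.
transitivity (Rintegral mu D (fun=> 0)); last by rewrite Rintegral_cst ?mul0r.
by apply: eq_Rintegral => x _; rewrite /dotc/= !mul0r addr0.
Qed.

Lemma ae_eq_rip f f' g : cmeas f -> cmeas f' -> cmeas g ->
  ae_eq mu D f f' -> rip f g = rip f' g.
Proof.
move=> mf mf' mg ff'; congr fine; apply: ae_eq_integral => //.
- by apply/measurable_EFinP; exact: cmeas_dot.
- by apply/measurable_EFinP; exact: cmeas_dot.
- by apply: filterS ff' => x + Dx => /(_ Dx) ->.
Qed.

Lemma rip_eq0_ae f : L2 mu D f -> rip f f = 0 -> ae_eq mu D f (fun=> 0).
Proof.
move=> Lf f0; have [mf fi] := (L2P f).1 Lf.
have := (ae_eq_integral_abs mu mD (measurable_int mu fi)).1.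
under eq_integral do rewrite gee0_abs ?lee_fin ?dotc_ge0//.
rewrite ripE// f0 => /(_ erefl); apply: filterS => x + Dx => /(_ Dx) [].
rewrite /dotc -!expr2 => /eqP; rewrite paddr_eq0 ?sqr_ge0// !sqrf_eq0.
by case: (f x) => a b /= /andP[/eqP -> /eqP ->].
Qed.

Lemma rip_bilin f g (t : R) : L2 mu D f -> L2 mu D g ->
  rip (fun x => f x + t%:C * g x) (fun x => f x + t%:C * g x) =
  rip f f + 2 * t * rip f g + t ^+ 2 * rip g g.
Proof.
move=> Lf Lg; have Ltg := L2Z t%:C Lg.
rewrite ripDl//; last exact: L2D.
rewrite !ripDr// !ripZl// ![rip _ (fun x => t%:C * _)]ripC !ripZl// (ripC g f).
by ring.
Qed.

Lemma ripDD f g : L2 mu D f -> L2 mu D g ->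
  rip (fun x => f x + g x) (fun x => f x + g x) =
  rip f f + 2 * rip f g + rip g g.
Proof.
move=> Lf Lg; have := rip_bilin 1 Lf Lg; rewrite mulr1 expr1n mul1r => <-.
by apply: eq_rip => x _; rewrite mul1r.
Qed.

Lemma CauchySchwarz f g : L2 mu D f -> L2 mu D g ->
  `|rip f g| <= nrm f * nrm g.
Proof.
move=> Lf Lg; rewrite /nrm -sqrtrM ?rip_ge0// -sqrtr_sqr ler_wsqrtr//.
have pos t : 0 <= rip f f + 2 * t * rip f g + t ^+ 2 * rip g g.
  by rewrite -rip_bilin// rip_ge0.
have [g0|g0] := eqVneq (rip g g) 0.
  rewrite g0 mulr0; have [->|fg] := eqVneq (rip f g) 0; first by rewrite expr0n.
  (* When [rip g g = 0] the quadratic is affine in [t], and at this [t] it equals -1. *)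
  have := pos (- (rip f f + 1) / (2 * rip f g)); rewrite g0 mulr0 addr0.
  have -> : 2 * (- (rip f f + 1) / (2 * rip f g)) * rip f g = - (rip f f + 1).
    by field.
  by lra.
have gp : 0 < rip g g by rewrite lt_neqAle eq_sym g0 rip_ge0.
(* The minimizer of the quadratic in [t]. *)
have := pos (- rip f g / rip g g).
have -> : rip f f + 2 * (- rip f g / rip g g) * rip f g +
   (- rip f g / rip g g) ^+ 2 * rip g g =
   (rip f f * rip g g - rip f g ^+ 2) / rip g g by field.
by rewrite pmulr_lge0 ?invr_gt0// subr_ge0.
Qed.

Lemma nrm_ge0 f : 0 <= nrm f. Proof. exact: sqrtr_ge0. Qed.

Lemma nrm_sqr f : nrm f ^+ 2 = rip f f.
Proof. by rewrite sqr_sqrtr// rip_ge0. Qed.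

Lemma nrmD f g : L2 mu D f -> L2 mu D g ->
  nrm (fun x => f x + g x) <= nrm f + nrm g.
Proof.
move=> Lf Lg; rewrite -(ler_pXn2r (n := 2))// ?nnegrE ?addr_ge0 ?nrm_ge0//.
rewrite sqrrD !nrm_sqr ripDD//.
have := le_trans (ler_norm _) (CauchySchwarz Lf Lg); lra.
Qed.

Lemma eq_nrm f g : (forall x, D x -> f x = g x) -> nrm f = nrm g.
Proof. by move=> fg; congr Num.sqrt; exact: eq_rip. Qed.

Lemma nrmN f : L2 mu D f -> nrm (fun x => - f x) = nrm f.
Proof.
move=> Lf; congr Num.sqrt; apply: eq_Rintegral => x _.
by rewrite dotcNl dotcC dotcNl opprK.
Qed.

Lemma nrmB f g : L2 mu D f -> L2 mu D g ->
  nrm (fun x => f x - g x) <= nrm f + nrm g.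
Proof. by move=> Lf Lg; rewrite -(nrmN Lg); apply: nrmD => //; exact: L2N. Qed.

Lemma nrm_distC f g : nrm (fun x => f x - g x) = nrm (fun x => g x - f x).
Proof.
congr Num.sqrt; apply: eq_Rintegral => x _.
by rewrite -opprB dotcNl dotcC dotcNl opprK.
Qed.

Lemma nrm_tri f g h : L2 mu D f -> L2 mu D g -> L2 mu D h ->
  nrm (fun x => f x - h x) <=
  nrm (fun x => f x - g x) + nrm (fun x => g x - h x).
Proof.
move=> Lf Lg Lh; apply: le_trans (nrmD _ _); [|exact: L2B..].
by rewrite (@eq_nrm _ (fun x => f x - g x + (g x - h x)))// => x _; ring.
Qed.

Lemma L2cvgP (u : nat -> T -> R[i]) f : (forall n, L2 mu D (u n)) -> L2 mu D f ->
  L2cvg mu D u f <-> nrm (fun x => u n x - f x) @[n --> \oo] --> 0.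
Proof.
move=> Lu Lf; rewrite /L2cvg.
rewrite (_ : (fun n => _) = EFin \o (fun n => nrm (fun x => u n x - f x))); last first.
  by apply/funext => n /=; rewrite L2norm_nrm//; exact: L2B.
by split=> [/fine_cvg//|H]; apply: cvg_EFin => //; exact: nearW.
Qed.

Lemma cvg_ripl (u : nat -> T -> R[i]) f g : (forall n, L2 mu D (u n)) ->
  L2 mu D f -> L2 mu D g -> nrm (fun x => u n x - f x) @[n --> \oo] --> 0 ->
  rip (u n) g @[n --> \oo] --> rip f g.
Proof.
move=> Lu Lf Lg uf; apply/subr_cvg0.
apply: (@squeeze_cvgr _ _ _ _ (fun n => - (nrm (fun x => u n x - f x) * nrm g))
  (fun n => nrm (fun x => u n x - f x) * nrm g)).
- apply: nearW => n; rewrite -ler_norml -ripBl//.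
  by apply: CauchySchwarz => //; exact: L2B.
- by rewrite -oppr0 -(mul0r (nrm g)); apply: cvgN; apply: cvgMr_tmp.
- by rewrite -(mul0r (nrm g)); apply: cvgMr_tmp.
Qed.

Lemma cvg_nrm (u : nat -> T -> R[i]) f : (forall n, L2 mu D (u n)) ->
  L2 mu D f -> nrm (fun x => u n x - f x) @[n --> \oo] --> 0 ->
  nrm (u n) @[n --> \oo] --> nrm f.
Proof.
move=> Lu Lf uf; apply/subr_cvg0.
apply: (@squeeze_cvgr _ _ _ _ (fun n => - (nrm (fun x => u n x - f x)))
  (fun n => nrm (fun x => u n x - f x))) => //.
- apply: nearW => n; apply/andP; split.
    have := nrmD (L2B Lf (Lu n)) (Lu n); rewrite nrm_distC.
    rewrite (@eq_nrm (fun x => f x - u n x + u n x) f); first lra.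
    by move=> x _; rewrite subrK.
  have := nrmD (L2B (Lu n) Lf) Lf.
  rewrite (@eq_nrm (fun x => u n x - f x + f x) (u n)); first lra.
  by move=> x _; rewrite subrK.
- by rewrite -oppr0; exact: cvgN.
Qed.

Lemma cvg_nrm_unique (u : nat -> T -> R[i]) f g : (forall n, L2 mu D (u n)) ->
  L2 mu D f -> L2 mu D g ->
  nrm (fun x => u n x - f x) @[n --> \oo] --> 0 ->
  nrm (fun x => u n x - g x) @[n --> \oo] --> 0 ->
  ae_eq mu D f g.
Proof.
move=> Lu Lf Lg uf ug.
have fg0 : rip (fun x => f x - g x) (fun x => f x - g x) = 0.
  rewrite ripBl//; last exact: L2B.
  have h : L2 mu D (fun x => f x - g x) by exact: L2B.
  by rewrite (cvg_unique _ (cvg_ripl Lu Lf h uf) (cvg_ripl Lu Lg h ug)) ?subrr.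
have := rip_eq0_ae (L2B Lf Lg) fg0.
by apply: filterS => x + Dx => /(_ Dx)/eqP; rewrite subr_eq0 => /eqP.
Qed.

(** The increments are absolutely summable, so the telescoping series converges. Finiteness of the
    sum of [b] is taken in the extended reals because that is what holds at almost every point in
    the completeness proof. *)
Lemma cvg_summable_diff (a b : nat -> R) :
  (forall k, `|a k.+1 - a k| <= 2^-1 ^+ k + b k) -> (forall k, 0 <= b k) ->
  (\sum_(0 <= k <oo) (b k)%:E < +oo)%E -> cvgn a.
Proof.
move=> ab b0 bs.
have cb : cvgn (series b) by exact: nnseries_is_cvg.
have cg : cvgn (series (geometric 1 (2^-1 : R))).
  by apply: is_cvg_geometric_series; rewrite ger0_norm ?invr_ge0// invf_lt1// ltr1n.
have cs : cvgn (series (fun k => 2^-1 ^+ k + b k)).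
  rewrite (_ : series _ = series (geometric 1 (2^-1 : R)) \+ series b).
    exact: is_cvgD.
  apply/funext => n; rewrite /series/= -big_split/=.
  by apply: eq_bigr => k _; rewrite mul1r.
have ct : cvgn (series (telescope a)).
  apply: normed_cvg; apply: series_le_cvg cs => // n; first exact: normr_ge0.
  by rewrite addr_ge0// exprn_ge0// invr_ge0.
rewrite (_ : a = (fun n => a 0%N + series (telescope a) n)).
  by apply: is_cvgD => //; exact: is_cvg_cst.
by apply/funext => n; rewrite -eq_sum_telescope.
Qed.

Lemma limn_einf_le (w : nat -> \bar R) (e : \bar R) :
  (\forall k \near \oo, w k <= e)%E -> (limn_einf w <= e)%E.
Proof.
move=> we; rewrite limn_einf_lim; apply: lime_le; first exact: is_cvg_einfs.
apply: filterS we => k; apply: le_trans; apply: ereal_inf_lbound.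
by exists k => /=.
Qed.

(** Riesz-Fischer with an explicit pointwise limit along a fast subsequence. The last conclusion
    says that the limit inherits every invariance shared by all terms; it yields exact
    2pi-periodicity of limits, which an almost everywhere statement would lose. *)
Lemma L2_complete (u : nat -> T -> R[i]) : (forall n, L2 mu D (u n)) ->
  (forall e : R, 0 < e -> exists N, forall m n, (N <= m)%N -> (N <= n)%N ->
    nrm (fun x => u m x - u n x) <= e) ->
  exists f, [/\ L2 mu D f,
    nrm (fun x => u n x - f x) @[n --> \oo] --> 0 &
    forall x y, (forall n, u n x = u n y) -> f x = f y].
Proof.
move=> Lu cu.
have /choice[N HN] : forall k, exists N, forall m n, (N <= m)%N -> (N <= n)%N ->
    nrm (fun x => u m x - u n x) <= 2^-1 ^+ k.
  by move=> k; apply: cu; rewrite exprn_gt0// invr_gt0.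
(* Summing the thresholds makes the index monotone in [k] and at least both [N k] and [k]. *)
pose phi k := (\sum_(i < k.+1) (N i).+1)%N.
have phiN k : (N k <= phi k)%N by rewrite /phi big_ord_recr/=; lia.
have phik k : (k <= phi k)%N.
  rewrite /phi; elim: k => // k IH; rewrite big_ord_recr/= addnS ltnS.
  by rewrite (leq_trans IH)// leq_addr.
have phiS k : (phi k <= phi k.+1)%N by rewrite /phi [leqRHS]big_ord_recr/= leq_addr.
pose v k := u (phi k).
have Lv k : L2 mu D (v k) by exact: Lu.
(* Increments have squared norm at most 4^-k, so after the weight 2^k the integrals still sum to at
   most 2. Conversely |s| <= 2^-k + 2^k s^2 turns pointwise summability of [b] into summability of
   the increments. *)
pose b k x := 2 ^+ k * dotc (v k.+1 x - v k x) (v k.+1 x - v k x).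
have b0 k x : 0 <= b k x by rewrite mulr_ge0 ?exprn_ge0// dotc_ge0.
have mb k : measurable_fun D (EFin \o b k).
  apply/measurable_EFinP; apply: measurable_funM; first exact: measurable_cst.
  by apply: cmeas_dot; apply: L2_meas; exact: L2B.
have ib k : (\int[mu]_(x in D) (b k x)%:E <= (2^-1 ^+ k)%:E)%E.
  under eq_integral do rewrite EFinM.
  rewrite ge0_integralZl//; last 2 first.
  - by apply/measurable_EFinP/cmeas_dot; apply: L2_meas; exact: L2B.
  - by move=> x _; rewrite lee_fin dotc_ge0.
  rewrite ripE; last exact: L2B.
  rewrite lee_fin -nrm_sqr -ler_pdivlMl ?exprn_gt0//.
  have -> : (2 ^+ k)^-1 * 2^-1 ^+ k = (2^-1 ^+ k) ^+ 2 :> R.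
    by rewrite -exprVn -expr2.
  rewrite ler_pXn2r// ?nnegrE ?nrm_ge0 ?exprn_ge0 ?invr_ge0//.
  by apply: HN => //; rewrite (leq_trans (phiN k)).
have iS : (\int[mu]_(x in D) (\sum_(0 <= k <oo) (b k x)%:E) <= 2%:E)%E.
  rewrite integral_nneseries//; last by move=> n x _; rewrite lee_fin.
  apply: lime_le.
    by apply: is_cvg_nneseries => n _ _; apply: integral_ge0 => x _; rewrite lee_fin.
  apply: nearW => n.
  apply: (@le_trans _ _ (\sum_(0 <= k < n) (2^-1 ^+ k)%:E)%E).
    by apply: lee_sum => k _; exact: ib.
  rewrite sumEFin lee_fin big_mkord.
  suff -> : \sum_(i < n) 2^-1 ^+ i = 2 - 2 * 2^-1 ^+ n :> R.
    by rewrite gerBl mulr_ge0// exprn_ge0// invr_ge0.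
  elim: n => [|n IH]; first by rewrite big_ord0 expr0 mulr1 subrr.
  by rewrite big_ord_recr/= IH exprS; lra.
have mS : measurable_fun D (fun x => \sum_(0 <= k <oo) (b k x)%:E)%E.
  apply: (@ge0_emeasurable_sum _ _ _ _ (fun k x => (b k x)%:E) xpredT) => k.
    by move=> x _ _; rewrite lee_fin.
  by move=> _; exact: mb.
have aeS : {ae mu, forall x, D x -> (\sum_(0 <= k <oo) (b k x)%:E)%E \is a fin_num}.
  apply: integrable_ae => //; apply/integrableP; split=> //.
  rewrite (eq_integral (fun x => \sum_(0 <= k <oo) (b k x)%:E)%E); last first.
    by move=> x _; rewrite gee0_abs// nneseries_ge0// => k _ _; rewrite lee_fin.
  by rewrite (le_lt_trans iS)// ltry.
have cvgv x : (\sum_(0 <= k <oo) (b k x)%:E)%E \is a fin_num ->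
    cvgn (fun k => complex.Re (v k x)) /\ cvgn (fun k => complex.Im (v k x)).
  move=> Sfin; have Slt : (\sum_(0 <= k <oo) (b k x)%:E < +oo)%E.
    by rewrite -ge0_fin_numE// nneseries_ge0// => k _ _; rewrite lee_fin.
  have H k (s : R) : s ^+ 2 <= dotc (v k.+1 x - v k x) (v k.+1 x - v k x) ->
      `|s| <= 2^-1 ^+ k + b k x.
    move=> sd; apply: (@le_trans _ _ (2^-1 ^+ k + 2 ^+ k * s ^+ 2)); last first.
      by rewrite lerD2l /b ler_wpM2l// exprn_ge0.
    have c0 : 0 < 2 ^+ k :> R by rewrite exprn_gt0.
    rewrite exprVn -[in leRHS](real_normK (num_real s)); set t := `|s|.
    set c := 2 ^+ k in c0 *; rewrite -subr_ge0.
    have -> : c^-1 + c * t ^+ 2 - t = ((c * t - 2^-1) ^+ 2 + 3 / 4) / c.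
      by field; rewrite gt_eqF.
    by rewrite divr_ge0 ?addr_ge0 ?sqr_ge0 ?divr_ge0// ltW.
  split; apply: (@cvg_summable_diff _ (b^~ x)) => // k; apply: H.
    rewrite /dotc ReD ReN ImD ImN -!expr2 lerDl; exact: sqr_ge0.
  by rewrite /dotc ReD ReN ImD ImN -!expr2 lerDr; exact: sqr_ge0.
(* Upper limits are measurable without any convergence assumption; [fine] supplies some finite value
   on the null set where nothing is known. *)
pose f x := (fine (limn_esup (fun k => (complex.Re (v k x))%:E)) +i*
             fine (limn_esup (fun k => (complex.Im (v k x))%:E))).
have mf : cmeas f.
  have H (w : nat -> T -> R) : (forall k, measurable_fun D (w k)) ->
      measurable_fun D (fun x => fine (limn_esup (fun k => (w k x)%:E))).
    move=> mw; apply: (measurableT_comp (fine_measurable measurableT)).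
    by apply: measurable_fun_limn_esup => k; exact/measurable_EFinP.
  by split; apply: H => k; have [] := L2_meas (Lv k).
have fl x : (\sum_(0 <= k <oo) (b k x)%:E)%E \is a fin_num ->
    complex.Re (v k x) @[k --> \oo] --> complex.Re (f x) /\
    complex.Im (v k x) @[k --> \oo] --> complex.Im (f x).
  move=> /cvgv[/cvg_ex[/= l cl] /cvg_ex[/= l' cl']].
  have c1 : (complex.Re (v k x))%:E @[k --> \oo] --> l%:E.
    by apply: cvg_EFin => //; exact: nearW.
  have c2 : (complex.Im (v k x))%:E @[k --> \oo] --> l'%:E.
    by apply: cvg_EFin => //; exact: nearW.
  by rewrite /f !(cvg_limn_einf_sup c1).2 !(cvg_limn_einf_sup c2).2.
(* Fatou's lemma along the subsequence converts the Cauchy bound at [n] into a bound on the distance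
   to the limit. *)
have key e n : (forall m, (n <= m)%N -> nrm (fun x => u n x - u m x) <= e) -> 0 <= e ->
    (\int[mu]_(x in D) (dotc (u n x - f x) (u n x - f x))%:E <= (e ^+ 2)%:E)%E.
  move=> Hn e0.
  pose w k x := (dotc (u n x - v k x) (u n x - v k x))%:E.
  have mw k : measurable_fun D (w k).
    by apply/measurable_EFinP/cmeas_dot; apply: L2_meas; exact: L2B.
  have w0 k x : D x -> (0 <= w k x)%E by move=> _; rewrite lee_fin dotc_ge0.
  apply: (@le_trans _ _ (\int[mu]_(x in D) limn_einf (w^~ x))%E).
    apply: ae_ge0_le_integral => //.
    - by move=> x _; rewrite lee_fin dotc_ge0.
    - apply/measurable_EFinP/cmeas_dot; apply: cmeasB => //; exact: L2_meas.
    - move=> x _; rewrite limn_einf_lim; apply: lime_ge; first exact: is_cvg_einfs.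
      apply: nearW => k; apply: le_ereal_inf_tmp => _ /= [j _ <-].
      by rewrite lee_fin dotc_ge0.
    - under eq_fun do rewrite -[limn_einf _]oppeK -limn_esupN.
      apply: measurableT_comp => //; apply: measurable_fun_limn_esup => k.
      exact: measurableT_comp.
    apply: filterS aeS => x + Dx => /(_ Dx) /fl[c1 c2].
    have : w k x @[k --> \oo] --> (dotc (u n x - f x) (u n x - f x))%:E.
      apply: cvg_EFin; first exact: nearW.
      rewrite /comp/= /dotc.
      under eq_cvg do rewrite !(ReD, ImD, ReN, ImN).
      rewrite !(ReD, ImD, ReN, ImN).
      by apply: cvgD; apply: cvgM; apply: cvgB => //; exact: cvg_cst.
    by move=> /cvg_limn_einf_sup[-> _].
  apply: (le_trans (fatou mu mD mw w0)).
  apply: limn_einf_le; exists n => //= k nk.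
  rewrite ripE; last exact: L2B.
  rewrite lee_fin -nrm_sqr ler_pXn2r ?nnegrE ?nrm_ge0//.
  by apply: Hn; rewrite (leq_trans nk).
have key2 e n : (forall m, (n <= m)%N -> nrm (fun x => u n x - u m x) <= e) -> 0 <= e ->
    L2 mu D (fun x => u n x - f x) /\ nrm (fun x => u n x - f x) <= e.
  move=> Hn e0; have := key _ _ Hn e0 => ke.
  have L : L2 mu D (fun x => u n x - f x).
    apply/L2P; split; first by apply: cmeasB => //; exact: L2_meas.
    apply/integrableP; split.
      by apply/measurable_EFinP/cmeas_dot; apply: cmeasB => //; exact: L2_meas.
    under eq_integral do rewrite gee0_abs ?lee_fin ?dotc_ge0//.
    by rewrite (le_lt_trans ke)// ltry.
  split=> //; move: ke; rewrite ripE// lee_fin -nrm_sqr.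
  by rewrite ler_pXn2r ?nnegrE ?nrm_ge0.
exists f; split.
- have [M HM] := cu 1 ltr01.
  have [L _] := key2 1 M (fun m Mm => HM M m (leqnn _) Mm) ler01.
  have := L2B (Lu M) L; congr L2.
  by apply/funext => x /=; ring.
- apply/cvgrPdist_le => e e0; have [M HM] := cu e e0; exists M => //= n Mn.
  rewrite sub0r normrN ger0_norm ?nrm_ge0//.
  by have [] := key2 e n (fun m nm => HM n m Mn (leq_trans Mn nm)) (ltW e0).
- move=> x y xy; rewrite /f.
  by congr (fine (limn_esup _) +i* fine (limn_esup _)); apply/funext => k;
    rewrite /v xy.
Qed.

End HilbertL2.

(** * Orthogonal projection onto the closure of a subspace *)

Section Projection.
Context {d : measure_display} {T : measurableType d} {R : realType}.
Variables (mu : {measure set T -> \bar R}) (D : set T).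
Hypothesis mD : measurable D.
Local Notation rip := (rip mu D).
Local Notation nrm := (nrm mu D).

Lemma parallelogram (f g : T -> R[i]) : L2 mu D f -> L2 mu D g ->
  rip (fun x => f x - g x) (fun x => f x - g x) =
  2 * rip f f + 2 * rip g g - rip (fun x => f x + g x) (fun x => f x + g x).
Proof.
move=> Lf Lg; rewrite (ripDD mD Lf Lg).
have := rip_bilin mD (-1) Lf Lg; rewrite sqrrN expr1n.
rewrite (@eq_rip2 _ _ _ _ _ (fun x => f x + (-1)%:C * g x) (fun x => f x - g x)); first lra.
by move=> x _; rewrite rmorphN rmorph1 mulN1r.
Qed.

(** Near 0 the linear term dominates; the test value [r / (|G| + 1)] works whatever the sign of
    [G]. *)
Lemma quadratic_linear0 (r G : R) : (forall t, 0 <= - 2 * t * r + t ^+ 2 * G) -> r = 0.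
Proof.
move=> H; apply/eqP/negPn/negP => r0.
have G1 : 0 < `|G| + 1 by rewrite ltr_wpDl.
have := H (r / (`|G| + 1)).
have -> : - 2 * (r / (`|G| + 1)) * r + (r / (`|G| + 1)) ^+ 2 * G =
   r ^+ 2 / (`|G| + 1) ^+ 2 * (G - 2 * (`|G| + 1)) by field; rewrite gt_eqF.
have r2 : 0 < r ^+ 2 / (`|G| + 1) ^+ 2.
  by apply: divr_gt0; [rewrite exprn_even_gt0|exact: exprn_gt0].
rewrite pmulr_rge0//; have := ler_norm G; lra.
Qed.

(** The classical minimizing sequence, with [S] not assumed closed: [u] lies in the closure of [S]
    only. The sequence [s] is kept in the conclusion because membership of [u] in the graph of a
    closure has to be witnessed later by elements of [S]. *)
Lemma L2_projection (S : (T -> R[i]) -> Prop) (f : T -> R[i]) :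
  S (fun=> 0) -> (forall g h, S g -> S h -> S (fun x => g x + h x)) ->
  (forall (t : R) g, S g -> S (fun x => t%:C * g x)) ->
  (forall g, S g -> L2 mu D g) -> L2 mu D f ->
  exists (s : nat -> T -> R[i]) u, [/\ forall n, S (s n), L2 mu D u,
    nrm (fun x => s n x - u x) @[n --> \oo] --> 0 &
    forall g, S g -> rip (fun x => f x - u x) g = 0].
Proof.
move=> S0 SD SZ SL Lf.
pose A := [set rip (fun x => f x - g x) (fun x => f x - g x) | g in S].
have A0 : A !=set0 by exists (rip (fun x => f x - 0) (fun x => f x - 0)), (fun=> 0).
have lA : has_lbound A by exists 0 => _ [g _ <-]; exact: rip_ge0.
have hiA : has_inf A by [].
have dle g : S g -> inf A <= rip (fun x => f x - g x) (fun x => f x - g x).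
  by move=> Sg; apply: ge_inf => //; exists g.
have /choice[s Hs] : forall n : nat, exists s, S s /\
    rip (fun x => f x - s x) (fun x => f x - s x) <= inf A + n.+1%:R^-1.
  move=> n; have : 0 < n.+1%:R^-1 :> R by rewrite invr_gt0.
  by move=> /(inf_adherent)/(_ hiA)[_ [g Sg <-] /ltW h]; exists g.
have Ls n : L2 mu D (s n) by exact/SL/(Hs n).1.
have Lfs n : L2 mu D (fun x => f x - s n x) by exact: L2B.
have dist m n : rip (fun x => s m x - s n x) (fun x => s m x - s n x) <=
    2 * m.+1%:R^-1 + 2 * n.+1%:R^-1.
  rewrite (@eq_rip2 _ _ _ _ _ _ (fun x => (f x - s n x) - (f x - s m x)));
    last by move=> x _; ring.
  rewrite parallelogram//.
  (* The midpoint of two near-minimizers is again in [S], so its distance to [f] is at least the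
     infimum; the parallelogram law then bounds the gap between the two. *)
  have := dle (fun x => (2^-1)%:C * (s n x + s m x)) (SZ _ _ (SD _ _ (Hs n).1 (Hs m).1)).
  set a := rip _ _; set b := rip (fun x => f x - s n x + _) _ => ab.
  have -> : b = 4 * a.
    have -> : 4 * a = rip (fun x => 2%:C * (f x - (2^-1)%:C * (s n x + s m x)))
        (fun x => 2%:C * (f x - (2^-1)%:C * (s n x + s m x))).
      have L : L2 mu D (fun x => f x - (2^-1)%:C * (s n x + s m x)).
        by apply: L2B => //; apply: L2Z => //; exact: L2D.
      rewrite ripZl//; last exact: L2Z.
      by rewrite ripC ripZl// -/a; ring.
    apply: eq_rip2 => x _; rewrite mulrBr mulrA -rmorphM/= divff ?pnatr_eq0//.
    by rewrite rmorph1 rmorph_nat; ring.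
  move: (Hs n).2 (Hs m).2; move: (n.+1%:R^-1) (m.+1%:R^-1) => i j.
  move: (rip _ _) (rip _ _) => y z hy hz; lra.
have [|u [Lu su _]] := L2_complete mD Ls.
  (* The gap is at most 2/(m+1) + 2/(n+1) <= 4/(N+1), hence the factor 1/4. *)
  move=> e e0; have e2 : 0 < 4^-1 * e ^+ 2 by rewrite mulr_gt0 ?exprn_gt0.
  have [N HN] := ltr_add_invr (e2 : 0 < _).
  exists N => m n Nm Nn; rewrite -(ler_pXn2r (n := 2))// ?nnegrE ?nrm_ge0 ?(ltW e0)//.
  rewrite nrm_sqr (le_trans (dist m n))//.
  have inv k : (N <= k)%N -> k.+1%:R^-1 <= N.+1%:R^-1 :> R.
    by move=> Nk; rewrite lef_pV2 ?posrE// ler_nat.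
  have := inv _ Nm; have := inv _ Nn; rewrite add0r in HN.
  move: HN; move: (n.+1%:R^-1) (m.+1%:R^-1) (N.+1%:R^-1) => i j l; lra.
exists s, u; split=> // [n|g Sg]; first exact: (Hs n).1.
have Lg := SL _ Sg.
apply: (@quadratic_linear0 _ (rip g g)) => t.
pose r n := rip (fun x => f x - s n x) g.
have rl : r n @[n --> \oo] --> rip (fun x => f x - u x) g.
  apply: cvg_ripl => //; first exact: L2B.
  apply: cvg_trans su; apply: near_eq_cvg; apply: nearW => n.
  by rewrite nrm_distC; apply: eq_nrm => x _; ring.
have rn n : 0 <= n.+1%:R^-1 + (- 2 * t * r n + t ^+ 2 * rip g g).
  have Sh : S (fun x => s n x + t%:C * g x) by apply: SD; [exact: (Hs n).1|exact: SZ].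
  have := dle _ Sh.
  rewrite (@eq_rip2 _ _ _ _ _ _ (fun x => (f x - s n x) + (- t)%:C * g x)).
    rewrite rip_bilin// sqrrN -/(r n) => h.
    by move: (Hs n).2 h; move: (n.+1%:R^-1) => i; lra.
  by move=> x _; rewrite rmorphN; ring.
rewrite -[leRHS]add0r.
have c : n.+1%:R^-1 + (- 2 * t * r n + t ^+ 2 * rip g g) @[n --> \oo] -->
    0 + (- 2 * t * rip (fun x => f x - u x) g + t ^+ 2 * rip g g).
  apply: cvgD; first exact: cvg_harmonic.
  by apply: cvgD; [apply: cvgMl_tmp|exact: cvg_cst].
rewrite -(cvg_lim _ c)//; apply: limr_ge; first by apply/cvg_ex; eexists; exact: c.
by apply: nearW => n; exact: rn.
Qed.

End Projection.

(** * Measurability of functions continuous in one variable *)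

Section Measurability.
Context {R : realType}.
Local Notation mR := (measurableTypeR R).

(** Rounding [r] down to a multiple of 1/(n+1) gives a function whose preimages are countable unions
    of measurable rectangles; continuity in [r] makes these functions converge pointwise to [f].
    This yields measurability of continuous functions for the product sigma-algebras used on R^2 and
    R^3. *)
Lemma measurable_Caratheodory d (T : measurableType d) (f : T * mR -> R) :
  (forall r : R, measurable_fun setT (fun t => f (t, r))) ->
  (forall t, continuous (fun r : R => f (t, r))) -> measurable_fun setT f.
Proof.
move=> mf cf.
pose D n (r : R) : R := (Num.floor (r * n.+1%:R))%:~R / n.+1%:R.
apply: (@measurable_fun_cvg _ _ _ _ (fun n p => f (p.1, D n p.2))).
- move=> n _ Y mY; rewrite setTI.
  rewrite (_ : _ @^-1` Y = \bigcup_(i : int)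
    ([set t | Y (f (t, i%:~R / n.+1%:R))] `*`
     [set r : mR | (i%:~R / n.+1%:R <= r < (i + 1)%:~R / n.+1%:R)%R])); last first.
    apply/seteqP; split => -[t r] /=.
      move=> Yf; exists (Num.floor (r * n.+1%:R)) => //=; split => //=.
      rewrite ler_pdivrMr// ltr_pdivlMr//.
      exact: Num.Theory.floor_itv.
    move=> [i _ /= [Yf]]; rewrite ler_pdivrMr// ltr_pdivlMr// => ri.
    by rewrite /D (_ : Num.floor _ = i)//; exact: Num.Theory.floor_def.
  apply: countable_bigcupT_measurable => // i; apply: measurableX.
    by have := mf (i%:~R / n.+1%:R) measurableT Y mY; rewrite setTI.
  have -> : [set r : mR | (i%:~R / n.+1%:R <= r < (i + 1)%:~R / n.+1%:R)%R] =
    `[i%:~R / n.+1%:R, (i + 1)%:~R / n.+1%:R[%classic.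
    by apply/seteqP; split => r /=; rewrite in_itv.
  exact: measurable_itv.
- move=> [t r] _ /=; apply: (cvg_comp (D^~ r) (fun r => f (t, r))); last exact: cf.
  apply/cvgrPdist_le => e e0; near=> n.
  have n0 : 0 < n.+1%:R :> R by [].
  have -> : r - D n r = (r * n.+1%:R - (Num.floor (r * n.+1%:R))%:~R) / n.+1%:R.
    by rewrite mulrBl mulfK// gt_eqF.
  have /andP[h1 h2] := Num.Theory.floor_itv (r * n.+1%:R).
  rewrite ger0_norm ?divr_ge0 ?subr_ge0//.
  apply: (@le_trans _ _ n.+1%:R^-1).
    rewrite -[leRHS]mul1r ler_wpM2r ?invr_ge0//.
    by move: h2; rewrite intrD; lra.
  by apply: ltW; near: n; exact: (near_infty_natSinv_lt (PosNum e0)).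
Unshelve. all: by end_near. Qed.

End Measurability.

(** * Fubini for real-valued integrals *)

Section RealFubini.
Context {d1 d2} {T1 : measurableType d1} {T2 : measurableType d2} {R : realType}.
Variables (m1 : {sigma_finite_measure set T1 -> \bar R})
  (m2 : {sigma_finite_measure set T2 -> \bar R}).

Lemma Rintegral_fubini (f : T1 * T2 -> R) :
  (m1 \x m2)%E.-integrable setT (EFin \o f) ->
  Rintegral (m1 \x m2)%E setT f =
  Rintegral m1 setT (fun x => Rintegral m2 setT (fun y => f (x, y))).
Proof.
move=> fi; rewrite /Rintegral; congr fine.
rewrite -(integral12_prod_meas1 fi); apply: ae_eq_integral => //.
- exact: (measurable_fubini_F fi).
- apply/measurable_EFinP; apply: (measurableT_comp (fine_measurable measurableT)).
  exact: (measurable_fubini_F fi).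
have := integrable_ae measurableT (integrable_fubini_F fi).
by apply: filterS => x /(_ I) xf _; rewrite /= fineK.
Qed.

Lemma Rintegral_fubini2 (f : T1 * T2 -> R) :
  (m1 \x m2)%E.-integrable setT (EFin \o f) ->
  Rintegral (m1 \x m2)%E setT f =
  Rintegral m2 setT (fun y => Rintegral m1 setT (fun x => f (x, y))).
Proof.
move=> fi; rewrite /Rintegral; congr fine.
rewrite -(integral21_prod_meas1 fi); apply: ae_eq_integral => //.
- exact: (measurable_fubini_G fi).
- apply/measurable_EFinP; apply: (measurableT_comp (fine_measurable measurableT)).
  exact: (measurable_fubini_G fi).
have := ae_integrable2 fi.
by apply: filterS => x xf _; rewrite /= fineK//; exact: integrable_fin_num.
Qed.

Lemma Rintegral_fubiniX (D1 : set T1) (D2 : set T2) (f : T1 * T2 -> R) :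
  measurable D1 -> measurable D2 ->
  (m1 \x m2)%E.-integrable (D1 `*` D2) (EFin \o f) ->
  Rintegral (m1 \x m2)%E (D1 `*` D2) f =
  Rintegral m1 D1 (fun x => Rintegral m2 D2 (fun y => f (x, y))).
Proof.
move=> mD1 mD2 fi; rewrite Rintegral_mkcond Rintegral_fubini; last first.
  by have := (integrable_mkcond _ (measurableX mD1 mD2)).1 fi; rewrite restrict_EFin.
rewrite [RHS]Rintegral_mkcond; apply: eq_Rintegral => x _.
rewrite patchE; case: ifPn => xD.
  rewrite [RHS]Rintegral_mkcond; apply: eq_Rintegral => y _.
  by rewrite !patchE in_setX xD.
transitivity (Rintegral m2 setT (fun=> 0)); last by rewrite Rintegral_cst ?mul0r.
by apply: eq_Rintegral => y _; rewrite patchE in_setX (negbTE xD).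
Qed.

End RealFubini.

(** * Measurability and finite measure of the disk, of [SM] and of [influx] *)

Section Domains.
Context {R : realType}.
Local Notation mR := (measurableTypeR R).

Lemma continuous_pair1 (U V W : topologicalType) (f : U * V -> W) (r : V) :
  continuous f -> continuous (fun t => f (t, r)).
Proof.
move=> cf t.
have h : {for t, continuous (fun t : U => (t, r))}.
  by apply: cvg_pair; [exact: cvg_id|exact: cvg_cst].
exact: (continuous_comp h (cf _)).
Qed.

Lemma continuous_pair2 (U V W : topologicalType) (f : U * V -> W) (r : U) :
  continuous f -> continuous (fun t => f (r, t)).
Proof.
move=> cf t.
have h : {for t, continuous (fun t : V => (r, t))}.
  by apply: cvg_pair; [exact: cvg_cst|exact: cvg_id].
exact: (continuous_comp h (cf _)).
Qed.

Lemma continuous_measurable2 (f : R * R -> R) :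
  continuous f -> measurable_fun setT (f : mR * mR -> R).
Proof.
move=> cf; apply: measurable_Caratheodory => [r|t].
  by apply: continuous_measurable_fun; exact: continuous_pair1.
exact: continuous_pair2.
Qed.

Lemma continuous_measurable3 (f : (R * R) * R -> R) :
  continuous f -> measurable_fun setT (f : mR * mR * mR -> R).
Proof.
move=> cf; apply: measurable_Caratheodory => [r|t].
  by apply: (@continuous_measurable2 (fun t => f (t, r))); exact: continuous_pair1.
exact: continuous_pair2.
Qed.

Lemma measurable_M : measurable (M : set (mR * mR)).
Proof.
rewrite (_ : M = (fun p : mR * mR => p.1 ^+ 2 + p.2 ^+ 2) @^-1` `]-oo, 1%R[%classic); last first.
  by apply/seteqP; split => p /=; rewrite in_itv.
rewrite -[X in measurable X]setTI; apply: (_ : measurable_fun _ _) => //.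
by apply: measurable_funD; apply: measurable_funX.
Qed.

Lemma circleE : (@circle R) = `[0, pi *+ 2]%classic.
Proof. by apply/seteqP; split => p /=; rewrite in_itv. Qed.

Lemma measurable_circle : measurable (circle : set mR).
Proof. by rewrite circleE; exact: measurable_itv. Qed.

Lemma measurable_SM : measurable (SM : set (mR * mR * mR)).
Proof. by apply: measurableX; [exact: measurable_M|exact: measurable_circle]. Qed.

Lemma alphaE : [set a : R | - (pi / 2) < a < pi / 2] = `]- (pi / 2), pi / 2[%classic.
Proof. by apply/seteqP; split => p /=; rewrite in_itv. Qed.

Lemma measurable_influx : measurable (influx : set (mR * mR)).
Proof.
apply: measurableX; first exact: measurable_circle.
by rewrite alphaE; exact: measurable_itv.
Qed.

Lemma leb1_itv (b0 b1 : bool) (x y : R) :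
  leb1 [set` Interval (BSide b0 x) (BSide b1 y)] = (if x < y then (y - x)%:E else 0%E).
Proof. by rewrite [LHS]lebesgue_measure_itv/= lte_fin; case: ifP. Qed.

Lemma leb2X (A B : set mR) : measurable A -> measurable B ->
  leb2 (A `*` B) = (leb1 A * leb1 B)%E.
Proof. by move=> mA mB; exact: product_measure1E. Qed.

Lemma leb3X (A : set (mR * mR)) (B : set mR) : measurable A -> measurable B ->
  leb3 (A `*` B) = (leb2 A * leb1 B)%E.
Proof. by move=> mA mB; exact: product_measure1E. Qed.

Lemma leb2_M_lty : (leb2 (M : set (mR * mR)) < +oo)%E.
Proof.
apply: (@le_lt_trans _ _ (leb2 (`[(-1)%R, 1%R]%classic `*` `[(-1)%R, 1%R]%classic : set (mR * mR)))).
  apply: le_measure; rewrite ?inE.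
  - exact: measurable_M.
  - by apply: measurableX; exact: measurable_itv.
  - move=> [x y]; rewrite /M/= => h; rewrite !in_itv/=.
    have := sqr_ge0 x; have := sqr_ge0 y => hx hy.
    by split; apply/andP; split; nra.
rewrite leb2X; [|exact: measurable_itv..].
by rewrite leb1_itv; case: ifP => _; rewrite ?mule0 -?EFinM ltry.
Qed.

Lemma leb1_circle : leb1 (circle : set mR) = (pi *+ 2)%:E.
Proof.
by rewrite circleE leb1_itv mulrn_wgt0 ?pi_gt0// subr0.
Qed.

Lemma leb3_SM_lty : (leb3 (SM : set (mR * mR * mR)) < +oo)%E.
Proof.
rewrite /SM leb3X; [|exact: measurable_M|exact: measurable_circle].
rewrite leb1_circle; apply: lte_mul_pinfty; rewrite ?ltry//.
by rewrite ge0_fin_numE//; exact: leb2_M_lty.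
Qed.

Lemma leb2_influx_lty : (leb2 (influx : set (mR * mR)) < +oo)%E.
Proof.
rewrite /influx leb2X; [|exact: measurable_circle|]; last first.
  by rewrite alphaE; exact: measurable_itv.
rewrite leb1_circle alphaE leb1_itv.
by case: ifP => _; rewrite ?mule0 -?EFinM ltry.
Qed.

End Domains.

(** * Invariance of integrals under translations, shears and rotations *)

Section LebesgueInvariance.
Context {R : realType}.
Local Notation mR := (measurableTypeR R).
Local Notation leb := (@lebesgue_measure R).

Lemma lebesgue_measure_translate (c : R) (A : set mR) : measurable A ->
  pushforward leb ((fun x => x + c) : mR -> mR) A = leb A.
Proof.
move=> mA.
have mc : measurable_fun setT ((fun x => x + c) : mR -> mR).
  by apply: measurable_funD => //; exact: measurable_cst.
pose phi : {mfun mR >-> mR} :=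
  HB.pack ((fun x => x + c) : mR -> mR) (isMeasurableFun.Build _ _ _ _ _ mc).
apply/esym/(@lebesgue_measure_unique _ (pushforward leb phi)) => //= _ [[a b]] _ <-.
rewrite /pushforward.
have -> : (fun x : R => x + c) @^-1` `]a, b]%classic = `]a - c, b - c]%classic.
  by apply/seteqP; split => x /=; rewrite !in_itv/=; lra.
rewrite [LHS]leb1_itv [RHS]leb1_itv ltrBlDr subrK.
by rewrite opprB addrA subrK.
Qed.

Lemma ge0_integral_translate (c : R) (D : set mR) (f : mR -> \bar R) :
  measurable D -> measurable_fun D f -> (forall x, D x -> 0 <= f x)%E ->
  (\int[leb]_(x in (fun x => (x + c)%R) @^-1` D) f (x + c)%R = \int[leb]_(x in D) f x)%E.
Proof.
move=> mD mf f0.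
have mc : measurable_fun setT ((fun x => x + c) : mR -> mR).
  by apply: measurable_funD => //; exact: measurable_cst.
rewrite -(ge0_integral_pushforward mc leb mD mf); last by move=> x /[!inE]; exact: f0.
by apply: eq_measure_integral => A mA _; exact: lebesgue_measure_translate.
Qed.

Lemma ge0_integral_translateT (c : R) (f : mR -> \bar R) :
  measurable_fun setT f -> (forall x, 0 <= f x)%E ->
  (\int[leb]_x f (x + c)%R = \int[leb]_x f x)%E.
Proof.
by move=> mf f0; rewrite -(ge0_integral_translate c measurableT mf).
Qed.

(** The shifted interval overhangs 2pi by []2pi, c + 2pi]], and periodicity moves this piece back to
    []0, c]]. Half-open intervals keep the pieces disjoint. *)
Lemma ge0_integral_periodic (c : R) (f : mR -> \bar R) : 0 <= c <= pi *+ 2 ->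
  measurable_fun setT f -> (forall x, 0 <= f x)%E ->
  (forall x, f (x + pi *+ 2)%R = f x) ->
  (\int[leb]_(x in circle) f (x + c)%R = \int[leb]_(x in circle) f x)%E.
Proof.
move=> /andP[c0 c2] mf f0 fp.
have mfS (D : set mR) : measurable_fun D f by exact: measurable_funTS.
have mc : measurable_fun setT ((fun x => x + c) : mR -> mR).
  by apply: measurable_funD => //; exact: measurable_cst.
have mfc (D : set mR) : measurable_fun D (fun x => f (x + c)).
  by apply: measurable_funTS; exact: measurableT_comp.
rewrite !circleE -!integral_itv_obnd_cbnd; [|exact: mfS|exact: mfc].
have -> : `]0, pi *+ 2]%classic = (fun x => x + c) @^-1` `]c, c + pi *+ 2]%classic.
  by apply/seteqP; split => x /=; rewrite !in_itv/=; lra.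
rewrite (ge0_integral_translate c (measurable_itv _) (mfS _))//.
have -> : `]c, c + pi *+ 2]%classic = `]c, pi *+ 2]%classic `|` `]pi *+ 2, c + pi *+ 2]%classic.
  apply/seteqP; split => x /=; rewrite !in_itv/=.
    by case: (leP x (pi *+ 2)) => h /andP[h1 h2]; [left|right]; lra.
  by move=> [] /andP[h1 h2]; lra.
rewrite ge0_integral_setU//; last first.
  by apply/disj_setPS => x [/=]; rewrite !in_itv/= => /andP[_ h1] /andP[h2 _]; lra.
rewrite -(ge0_integral_translate (pi *+ 2) (measurable_itv `]pi *+ 2, c + pi *+ 2]) (mfS _))//.
rewrite [X in (_ + X)%E](_ : _ = \int[leb]_(x in `]0%R, c]) f x)%E; last first.
  have -> : (fun x => x + pi *+ 2) @^-1` `]pi *+ 2, c + pi *+ 2]%classic = `]0, c]%classic.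
    by apply/seteqP; split => x /=; rewrite !in_itv/=; lra.
  by apply: eq_integral => x _; exact: fp.
rewrite addeC -ge0_integral_setU//; last first.
  by apply/disj_setPS => x [/=]; rewrite !in_itv/= => /andP[_ h1] /andP[h2 _]; lra.
have <- : `]0, pi *+ 2]%classic = `]0, c]%classic `|` `]c, pi *+ 2]%classic.
  apply/seteqP; split => x /=; rewrite !in_itv/=.
    by case: (leP x c) => h /andP[h1 h2]; [left|right]; lra.
  by move=> [] /andP[h1 h2]; lra.
congr (integral _ _ _); apply/seteqP; split => x /=; rewrite !in_itv/=; last first.
  by case=> /andP[h1 h2]; lra.
by case: (leP (x + c) (pi *+ 2)) => h /andP[h1 h2]; [left|right]; lra.
Qed.

Lemma ge0_integral_shear1 (a : R) (f : mR * mR -> \bar R) :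
  measurable_fun setT f -> (forall p, 0 <= f p)%E ->
  (\int[(leb \x leb)%E]_p f (p.1 + a * p.2, p.2)%R = \int[(leb \x leb)%E]_p f p)%E.
Proof.
move=> mf f0.
have mg : measurable_fun setT (fun p : mR * mR => f (p.1 + a * p.2, p.2)).
  apply: measurableT_comp => //; apply: measurable_fun_pair => //.
  by apply: measurable_funD => //; apply: measurable_funM => //; exact: measurable_cst.
rewrite (fubini_tonelli2 _ mg (fun p => f0 _)) (fubini_tonelli2 _ mf f0).
apply: eq_integral => y _; rewrite /fubini_G/=.
rewrite (@ge0_integral_translateT (a * y) (fun x => f (x, y)))//.
exact: measurableT_comp.
Qed.

Lemma ge0_integral_shear2 (a : R) (f : mR * mR -> \bar R) :
  measurable_fun setT f -> (forall p, 0 <= f p)%E ->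
  (\int[(leb \x leb)%E]_p f (p.1, p.2 + a * p.1)%R = \int[(leb \x leb)%E]_p f p)%E.
Proof.
move=> mf f0.
have mg : measurable_fun setT (fun p : mR * mR => f (p.1, p.2 + a * p.1)).
  apply: measurableT_comp => //; apply: measurable_fun_pair => //.
  by apply: measurable_funD => //; apply: measurable_funM => //; exact: measurable_cst.
rewrite (fubini_tonelli1 _ mg (fun p => f0 _)) (fubini_tonelli1 _ mf f0).
apply: eq_integral => x _; rewrite /fubini_F/=.
rewrite (@ge0_integral_translateT (a * x) (fun y => f (x, y)))//.
exact: measurableT_comp.
Qed.

(* A rotation with nonzero sine is a product of three shears. *)
Lemma ge0_integral_rotate_neq0 (c s : R) (f : mR * mR -> \bar R) :
  c ^+ 2 + s ^+ 2 = 1 -> s != 0 ->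
  measurable_fun setT f -> (forall p, 0 <= f p)%E ->
  (\int[(leb \x leb)%E]_p f (c * p.1 - s * p.2, s * p.1 + c * p.2)%R =
   \int[(leb \x leb)%E]_p f p)%E.
Proof.
(* For the rotation by t this is -tan(t/2), the factor of the two outer shears. *)
move=> cs s0 mf f0; pose a := (c - 1) / s.
have sh1 : measurable_fun setT (fun p : mR * mR => (p.1 + a * p.2, p.2)).
  apply: measurable_fun_pair => //.
  by apply: measurable_funD => //; apply: measurable_funM => //; exact: measurable_cst.
have sh2 : measurable_fun setT (fun p : mR * mR => (p.1, p.2 + s * p.1)).
  apply: measurable_fun_pair => //.
  by apply: measurable_funD => //; apply: measurable_funM => //; exact: measurable_cst.
rewrite -(ge0_integral_shear1 a mf f0).
have m1 := measurableT_comp mf sh1.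
rewrite -(ge0_integral_shear2 s m1 (fun p => f0 _)).
rewrite -(ge0_integral_shear1 a (measurableT_comp m1 sh2) (fun p => f0 _)).
apply: eq_integral => -[x y] _ /=.
have c2 : c ^+ 2 = 1 - s ^+ 2 by rewrite -cs addrK.
congr (f (_, _)); rewrite /a; last by field.
have -> : x + (c - 1) / s * y + (c - 1) / s * (y + s * (x + (c - 1) / s * y)) =
  c * x + (c ^+ 2 - 1) / s * y by field.
by rewrite c2; field.
Qed.

Lemma ge0_integral_rotate (c s : R) (f : mR * mR -> \bar R) :
  c ^+ 2 + s ^+ 2 = 1 ->
  measurable_fun setT f -> (forall p, 0 <= f p)%E ->
  (\int[(leb \x leb)%E]_p f (c * p.1 - s * p.2, s * p.1 + c * p.2)%R =
   \int[(leb \x leb)%E]_p f p)%E.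
Proof.
move=> cs mf f0; have [s0|s0] := eqVneq s 0; last exact: ge0_integral_rotate_neq0.
have : c ^+ 2 == 1 ^+ 2 by rewrite expr1n -cs s0 expr0n addr0.
rewrite eqf_sqr => /orP[]/eqP ->; rewrite s0.
  by apply: eq_integral => -[x y] _ /=; rewrite !mul1r !mul0r subr0 add0r.
(* The case left is the rotation by pi: it is the square of the rotation by pi/2, whose sine is
   nonzero. *)
have h01 : 0 ^+ 2 + 1 ^+ 2 = 1 :> R by rewrite expr0n expr1n add0r.
have n1 : 1 != 0 :> R by exact: oner_neq0.
rewrite -(ge0_integral_rotate_neq0 h01 n1 mf f0).
rewrite -(ge0_integral_rotate_neq0 h01 n1 (f := (fun p => f (0 * p.1 - 1 * p.2, 1 * p.1 + 0 * p.2))) _ (fun p => f0 _)).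
  by apply: eq_integral => -[x y] _ /=; congr (f (_, _)); ring.
apply: measurableT_comp => //; apply: measurable_fun_pair.
  by apply: measurable_funB; apply: measurable_funM => //; exact: measurable_cst.
by apply: measurable_funD; apply: measurable_funM => //; exact: measurable_cst.
Qed.

End LebesgueInvariance.

(** * The fundamental theorem of calculus and the substitution y = sin a *)

Section Calculus1.
Context {R : realType}.
Local Notation mR := (measurableTypeR R).
Local Notation leb := (@lebesgue_measure R).

Lemma is_derive1_continuous (f g : R -> R) : (forall t : R, is_derive t 1 f (g t)) ->
  continuous f.
Proof. by move=> fg t; apply: differentiable_continuous; apply/derivable1_diffP; case: (fg t). Qed.

Lemma integral_FTC (f g : R -> R) (a b : R) : a <= b ->
  (forall t : R, is_derive t 1 f (g t)) -> continuous g ->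
  (\int[leb]_(x in `[a, b]) (g x)%:E = (f b - f a)%:E)%E.
Proof.
rewrite le_eqVlt => /predU1P[->|ab] fg cg.
  by rewrite set_itv1 integral_set1 subrr.
have cf := is_derive1_continuous fg.
rewrite (continuous_FTC2 (F := f) ab)//.
- exact: continuous_subspaceT.
- split; first by move=> x _; case: (fg x).
    by apply: cvg_at_right_filter; exact: cf.
  by apply: cvg_at_left_filter; exact: cf.
- by move=> x _; rewrite derive1E; case: (fg x).
Qed.

Lemma Rintegral_FTC (f g : R -> R) (a b : R) : a <= b ->
  (forall t : R, is_derive t 1 f (g t)) -> continuous g ->
  Rintegral leb1 `[a, b] g = f b - f a.
Proof. by move=> ab fg cg; rewrite /Rintegral [X in fine X](integral_FTC ab fg cg). Qed.

Let I : set mR := `]- (pi / 2), pi / 2[%classic.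
(** The region under the graph of the cosine: integrating out its second coordinate produces the
    density [cos a], so the measure cos a da is realized through planar Lebesgue measure. *)
Let Omega : set (mR * mR) := [set p | I p.1 /\ 0 < p.2 < cos p.1].

Let mOmega : measurable Omega.
Proof.
have -> : Omega = (I `*` `]0, +oo[%classic) `&`
    ((fun p : mR * mR => p.2 - cos p.1) @^-1` `]-oo, 0%R[%classic).
  apply/seteqP; split => -[a s] /=; rewrite !in_itv/= subr_lt0 andbT.
    by move=> [h /andP[h1 h2]].
  by move=> [[h1 h2] h3]; split=> //; rewrite h2.
apply: measurableI; first by apply: measurableX; exact: measurable_itv.
rewrite -[X in measurable X]setTI; apply: (_ : measurable_fun _ _) => //.
apply: measurable_funB => //; apply: measurableT_comp => //.
by apply: continuous_measurable_fun; exact: continuous_cos.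
Qed.

Let msin1 : measurable_fun setT (fun p : mR * mR => sin p.1 : mR).
Proof.
apply: measurableT_comp => //.
by apply: continuous_measurable_fun; exact: continuous_sin.
Qed.

Let I_cos (a : R) : I a -> 0 < cos a.
Proof. by rewrite /I/= in_itv/=; exact: cos_gt0_pihalf. Qed.

Let I_sin (a : R) : I a -> -1 < sin a < 1.
Proof.
move=> Ia; have c0 := I_cos Ia; have := cos2Dsin2 a.
by rewrite !expr2 => h; apply/andP; split; nra.
Qed.

(** Clamping endpoints to [-1, 1] lets one formula cover all intervals []a, b]], whatever their
    position relative to []-1, 1[]. *)
Let clip (x : R) := Num.max (-1) (Num.min x 1).

Let clip_itv x : -1 <= clip x <= 1.
Proof. by rewrite /clip le_max lexx/= ge_max ge_min lexx orbT andbT; lra. Qed.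

Let lt_clip (x y : R) : -1 < y < 1 -> (x < y) = (clip x < y).
Proof.
move=> /andP[h1 h2]; rewrite /clip gt_max h1/= gt_min.
by rewrite (_ : 1 < y = false) ?orbF//; apply/negbTE; rewrite -leNgt ltW.
Qed.

Let le_clip (x y : R) : -1 < y < 1 -> (y <= x) = (y <= clip x).
Proof.
move=> /andP[h1 h2]; rewrite /clip le_max le_min (ltW h2) andbT.
by rewrite (_ : y <= -1 = false)//; apply/negbTE; rewrite -ltNge.
Qed.

Let asin_pi2 (x : R) : -1 <= x <= 1 -> - (pi / 2) <= asin x <= pi / 2.
Proof. by move=> hx; rewrite asin_geNpi2// asin_lepi2. Qed.

Let Omega_itv (a b : R) :
  leb2 (((fun p : mR * mR => sin p.1) @^-1` `]a, b]%classic) `&` Omega) =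
  (if clip a < clip b then (clip b - clip a)%:E else 0%E).
Proof.
set X := (X in leb2 X).
have ca := clip_itv a; have cb := clip_itv b.
have -> : leb2 X = (\int[leb]_x leb (xsection X x))%E by [].
have E (x : R) : leb (xsection X x) =
    ((fun y => (cos y)%:E) \_ (`]asin (clip a), asin (clip b)]%classic)) x.
  have Ex : x != pi / 2 -> (I x /\ a < sin x <= b) <->
      (asin (clip a) < x <= asin (clip b)).
    move=> xpi.
    have mono (y : R) : -1 <= y <= 1 -> I x -> (y < sin x) = (asin y < x).
      move=> hy; rewrite /I/= in_itv/= => /andP[h1 h2].
      rewrite -[in LHS](asinK (x := y)) ?in_itv//= ltr_sin// ?in_itv/= ?asin_pi2//.
      by rewrite !ltW.
    split=> [[Ix]|].
      have s1 := I_sin Ix.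
      rewrite (lt_clip _ s1) (le_clip _ s1) mono// => /andP[-> /=].
      by rewrite leNgt mono// -leNgt.
    move=> /andP[h1 h2].
    have Ix : I x.
      have /andP[h3 _] := asin_pi2 ca; have /andP[_ h4] := asin_pi2 cb.
      rewrite /I/= in_itv/= (le_lt_trans h3 h1)/=.
      by rewrite lt_neqAle xpi/= (le_trans h2).
    split=> //; have s1 := I_sin Ix.
    by rewrite (lt_clip _ s1) (le_clip _ s1) mono// h1/= leNgt mono// -leNgt.
  (* The equivalence [Ex] may fail at this single point, which is outside [I]; the cosine vanishes
     there, so both sides are 0. *)
  have [->|xpi] := eqVneq x (pi / 2).
    rewrite patchE cos_pihalf if_same (_ : xsection X _ = set0); first exact: measure0.
    apply/seteqP; split=> y //; rewrite /xsection/= inE => -[_ [/=]].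
    by rewrite /I/= in_itv/= ltxx andbF.
  rewrite patchE; case: ifPn; rewrite ?inE ?notin_setE/= in_itv/=.
    move=> /Ex-/(_ xpi)[Ix ab].
    have -> : xsection X x = `]0, (cos x)[%classic.
      apply/seteqP; split=> y; rewrite /xsection/= inE.
        by move=> [_ [_ /=]]; rewrite in_itv.
      by rewrite in_itv/= => hy; split; [rewrite /= in_itv|split].
    by rewrite [LHS]leb1_itv I_cos// subr0.
  move=> nh; rewrite (_ : xsection X _ = set0); first exact: measure0.
  apply/seteqP; split=> y //; rewrite /xsection/= inE => -[/= h [/= Ix _]].
  by apply: nh; apply/Ex => //; split=> //; move: h; rewrite in_itv.
transitivity (\int[leb]_(x in `]asin (clip a), asin (clip b)]) (cos x)%:E)%E.
  by rewrite [RHS]integral_mkcond; apply: eq_integral => x _; exact: E.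
have [ab|ba] := ltP (clip a) (clip b); last first.
  rewrite set_itv_ge ?integral_set0// bnd_simp -leNgt.
  rewrite leNgt -ltr_sin ?in_itv/= ?asin_pi2// !asinK ?in_itv//=.
  by rewrite -leNgt.
have asab : asin (clip a) <= asin (clip b).
  by rewrite leNgt -ltr_sin ?in_itv/= ?asin_pi2// !asinK ?in_itv//= -leNgt ltW.
rewrite integral_itv_obnd_cbnd; last first.
  apply/measurable_EFinP/measurable_funTS.
  by apply: continuous_measurable_fun; exact: continuous_cos.
rewrite (integral_FTC (f := sin) asab) ?asinK ?in_itv//=.
exact: continuous_cos.
Qed.

Let leb_itv11 (a b : R) : leb (`]a, b]%classic `&` `]-1, 1[%classic) =
  (if clip a < clip b then (clip b - clip a)%:E else 0%E).
Proof.
have -> : (`]a, b]%classic `&` `]-1, 1[%classic : set R) =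
    [set` Interval (BSide false (clip a)) (BSide (1 <= b) (clip b))].
  apply/seteqP; split => x /=; rewrite !in_itv/=.
    move=> [/andP[h1 h2] h]; rewrite -(lt_clip _ h) h1/=.
    case: (leP 1 b) => b1 /=; last by rewrite -(le_clip _ h).
    case/andP: h => _ x1; rewrite /clip lt_max lt_min x1 (lt_le_trans x1 b1).
    by rewrite orbT.
  move=> /andP[h1 h2].
  have h : -1 < x < 1.
    rewrite (le_lt_trans _ h1); last by have /andP[] := clip_itv a.
    move: h2; case: (leP 1 b) => b1 /= h2.
      by rewrite (lt_le_trans h2)//; have /andP[] := clip_itv b.
    by rewrite (le_lt_trans h2)// /clip gt_max gt_min b1/= andbT; lra.
  split=> //; rewrite (lt_clip _ h) h1/= (le_clip _ h).
  by move: h2; case: (1 <= b) => //= /ltW.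
exact: leb1_itv.
Qed.

(** Holds for merely measurable [f]: the image of the area on [Omega] under (a, s) -> sin a and
    Lebesgue measure on []-1, 1[] agree on half-open intervals, hence on Borel sets. *)
Lemma ge0_integral_sin (f : mR -> \bar R) : measurable_fun setT f ->
  (forall y, 0 <= f y)%E ->
  (\int[leb]_(y in `](-1)%R, 1%R[) f y =
   \int[leb]_(a in `](- (pi / 2))%R, (pi / 2)%R[) ((cos a)%:E * f (sin a)))%E.
Proof.
move=> mf f0.
have mJ : measurable (`]-1, 1[%classic : set mR) by exact: measurable_itv.
pose phi : {mfun (mR * mR)%type >-> mR} :=
  HB.pack (fun p : mR * mR => sin p.1 : mR) (isMeasurableFun.Build _ _ _ _ _ msin1).
pose m1 : {measure set mR -> \bar R} := mrestr leb mJ.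
pose m2' : {measure set mR -> \bar R} := pushforward (mrestr leb2 mOmega) phi.
pose m2 := m2' msin1.
have m12 (A : set mR) : measurable A -> m1 A = m2 A.
  move=> mA; apply: (@measure_unique _ R mR (@ocitv R) (fun k : nat => `](- k%:R : R), (k%:R : R)]%classic) _ _ _ _ m1 m2 _ _ _ mA).
  - by [].
  - exact: ocitvI.
  - by move=> i; exact: is_ocitv.
  - rewrite -subTset => x _.
    have [n xn] : exists n, `|x| < n%:R by exists (Num.truncn `|x|).+1; exact: truncnS_gt.
    exists n => //=; rewrite in_itv/=.
    by move: xn; rewrite ltr_norml => /andP[-> /ltW ->].
  - move=> _ [[a b] _ <-].
    by rewrite /m1 /m2 /m2' /= /mrestr /pushforward /= leb_itv11 -Omega_itv.
  - move=> k; apply: (@le_lt_trans _ _ (leb (`]-1, 1[%classic : set R))).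
      by apply: le_measure; rewrite ?inE//; apply: measurableI => //; exact: measurable_itv.
    by rewrite [X in (X < _)%E]leb1_itv; case: ifP => _; rewrite ltry.
(* The value 2 lies outside []-1, 1[], so that the preimage of this interval is exactly [Omega]. *)
pose psi (p : mR * mR) : mR := if p \in Omega then sin p.1 else 2.
have mpsi : measurable_fun setT psi.
  apply: measurable_fun_if => //.
  - apply: (measurable_fun_bool true); rewrite setTI.
    rewrite (_ : _ @^-1` _ = Omega)//; apply/seteqP; split => p; first exact: set_mem.
    exact: mem_set.
  - exact: measurable_funTS.
have psiJ : psi @^-1` `]-1, 1[%classic = Omega.
  apply/seteqP; split => p; rewrite /preimage/= in_itv/= /psi.
    by case: ifPn => [/set_mem//|_]; lra.
  by move=> Op; rewrite mem_set//; case: Op => /I_sin.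
pose psi' : {mfun (mR * mR)%type >-> mR} :=
  HB.pack psi (isMeasurableFun.Build _ _ _ _ _ mpsi).
transitivity (\int[pushforward leb2 psi']_(y in `](-1)%R, 1%R[) f y)%E.
  apply: eq_measure_integral => A mA AJ.
  transitivity (m1 A); first by rewrite /m1/= /mrestr setIidl.
  rewrite m12// /m2/m2'/= /pushforward/mrestr/=; congr (leb2 _).
  apply/seteqP; split => p /=; rewrite /psi.
    by move=> [Ap Op]; rewrite mem_set.
  case: ifPn => [/set_mem//|_ /AJ].
  by rewrite /= in_itv/=; lra.
rewrite (ge0_integral_pushforward mpsi leb2)//; last exact: measurable_funTS.
rewrite psiJ integral_mkcond.
have mg : measurable_fun setT ((f \o psi) \_ Omega).
  by apply/(measurable_restrictT _ mOmega)/measurable_funTS/measurableT_comp.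
have g0 p : (0 <= ((f \o psi) \_ Omega) p)%E by rewrite patchE; case: ifP => //= _; exact: f0.
rewrite (fubini_tonelli1 _ mg g0 : (\int[leb2]_p _)%E = _) [RHS]integral_mkcond.
apply: eq_integral => a _; rewrite /fubini_F patchE.
case: ifPn; rewrite ?inE ?notin_setE => Ia; last first.
  rewrite integral0_eq// => s _; rewrite patchE ifF//.
  by apply/negbTE; rewrite notin_setE => -[].
transitivity (\int[leb]_(s in `]0%R, (cos a)[) f (sin a))%E.
  rewrite [RHS]integral_mkcond; apply: eq_integral => s _; rewrite !patchE.
  have -> : (s \in `]0, (cos a)[%classic) = ((a, s) \in Omega).
    apply/idP/idP; rewrite !inE/= in_itv/=; last by case.
    by move=> h; split.
  by case: ifPn => //; rewrite /psi/= => ->.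
rewrite integral_cst// [X in (_ * X)%E]leb1_itv I_cos//.
by rewrite subr0 muleC.
Qed.

End Calculus1.

(** * Sigma-finite products and Tonelli on rectangles *)

Section SigmaFiniteProduct.
Context d1 d2 (T1 : measurableType d1) (T2 : measurableType d2) (R : realType).
Variable m1 : {sigma_finite_measure set T1 -> \bar R}.
Variable m2 : {sigma_finite_measure set T2 -> \bar R}.

(* Keyed alias: the sigma-finite structure of [\x] is not inferred by the library. *)
Definition sfproduct : set (T1 * T2)%type -> \bar R := (m1 \x m2)%E.
HB.instance Definition _ := Measure.on sfproduct.

Lemma sfproduct_sigma_finite : sigma_finite setT sfproduct.
Proof.
have /sigma_finiteP[F [TF ndF Foo]] := sigma_finiteT m1.
have /sigma_finiteP[G [TG ndG Goo]] := sigma_finiteT m2.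
exists (fun n => F n `*` G n).
 rewrite -setXTT TF TG predeqE => -[x y]; split.
    move=> [/= [n _ Fnx] [k _ Gky]]; exists (maxn n k) => //; split.
    - by move: x Fnx; exact/subsetPset/ndF/leq_maxl.
    - by move: y Gky; exact/subsetPset/ndG/leq_maxr.
  by move=> [n _ []/= ? ?]; split; exists n.
move=> k; have [? ?] := Foo k; have [? ?] := Goo k.
split; first exact: measurableX.
by rewrite /sfproduct product_measure1E// lte_mul_pinfty// ge0_fin_numE.
Qed.

HB.instance Definition _ := Measure_isSigmaFinite.Build _ _ _ sfproduct sfproduct_sigma_finite.
End SigmaFiniteProduct.

Definition sleb1 {R : realType} :
  {sigma_finite_measure set (measurableTypeR R) -> \bar R} := lebesgue_measure.

Definition sleb2 {R : realType} :
  {sigma_finite_measure set (measurableTypeR R * measurableTypeR R)%type -> \bar R} := sfproduct (@sleb1 R) (@sleb1 R).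

Section TonelliX.
Context {d1 d2} {T1 : measurableType d1} {T2 : measurableType d2} {R : realType}.
Variables (m1 : {sigma_finite_measure set T1 -> \bar R})
  (m2 : {sigma_finite_measure set T2 -> \bar R}).
Variables (D1 : set T1) (D2 : set T2) (f : T1 * T2 -> \bar R).
Hypotheses (mD1 : measurable D1) (mD2 : measurable D2).
Hypotheses (mf : measurable_fun setT f) (f0 : forall p, (0 <= f p)%E).

Let mp : measurable_fun setT (f \_ (D1 `*` D2)).
Proof.
by apply/(measurable_restrictT _ (measurableX mD1 mD2)); exact: measurable_funTS.
Qed.

Let p0 p : (0 <= (f \_ (D1 `*` D2)) p)%E.
Proof. by rewrite patchE; case: ifP. Qed.

Lemma tonelliX1 : (\int[(m1 \x m2)%E]_(p in D1 `*` D2) f p =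
  \int[m1]_(x in D1) \int[m2]_(y in D2) f (x, y))%E.
Proof.
rewrite integral_mkcond (fubini_tonelli1 _ mp p0) [RHS]integral_mkcond.
apply: eq_integral => x _; rewrite /fubini_F patchE; case: ifPn => xD.
  rewrite [RHS]integral_mkcond; apply: eq_integral => y _.
  by rewrite !patchE in_setX xD.
by rewrite integral0_eq// => y _; rewrite patchE in_setX (negbTE xD).
Qed.

Lemma tonelliX2 : (\int[(m1 \x m2)%E]_(p in D1 `*` D2) f p =
  \int[m2]_(y in D2) \int[m1]_(x in D1) f (x, y))%E.
Proof.
rewrite integral_mkcond (fubini_tonelli2 _ mp p0) [RHS]integral_mkcond.
apply: eq_integral => y _; rewrite /fubini_G patchE; case: ifPn => yD.
  rewrite [RHS]integral_mkcond; apply: eq_integral => x _.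
  by rewrite !patchE in_setX yD andbT.
by rewrite integral0_eq// => x _; rewrite patchE in_setX (negbTE yD) andbF.
Qed.

End TonelliX.

(** * Santalo's formula on the unit disk *)

Section Santalo.
Context {R : realType}.
Local Notation mR := (measurableTypeR R).
Local Notation leb := (@lebesgue_measure R).

Definition chord (q : R * R) (t : R) : (R * R) * R :=
  ((cos q.1 + t * cos (q.1 + pi + q.2), sin q.1 + t * sin (q.1 + pi + q.2)),
   q.1 + pi + q.2).

Variable G : mR * mR * mR -> \bar R.
Hypotheses (mG : measurable_fun setT G) (G0 : forall p, (0 <= G p)%E).
Hypothesis Gper : forall x t, G (x, t + pi *+ 2) = G (x, t).

Let I : set mR := `]- (pi / 2), pi / 2[%classic.
(** The rotation by [th] of the point (t - cos al, sin al): the line of direction [th] at signed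
    distance sin al from the centre, parameterized from its entry into the disk. *)
Let pt (th al t : R) : R * R :=
  (cos th * (t - cos al) - sin th * sin al, sin th * (t - cos al) + cos th * sin al).
Let H (p : mR * mR * mR) : \bar R :=
  if (0 < p.2 < 2 * cos p.1.2)%R then G (pt p.1.1 p.1.2 p.2, p.1.1) else 0%E.
Let K (q : mR * mR) : \bar R := (\int[leb]_t H (q, t))%E.

Let mcos d (T : measurableType d) (f : T -> mR) : measurable_fun setT f ->
  measurable_fun setT (fun x => cos (f x) : mR).
Proof.
by apply: measurableT_comp; apply: continuous_measurable_fun; exact: continuous_cos.
Qed.

Let msin d (T : measurableType d) (f : T -> mR) : measurable_fun setT f ->
  measurable_fun setT (fun x => sin (f x) : mR).
Proof.
by apply: measurableT_comp; apply: continuous_measurable_fun; exact: continuous_sin.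
Qed.

Let m11 : measurable_fun setT (fun p : mR * mR * mR => p.1.1).
Proof. exact: measurableT_comp. Qed.

Let m12 : measurable_fun setT (fun p : mR * mR * mR => p.1.2).
Proof. exact: measurableT_comp. Qed.

Let mH : measurable_fun setT H.
Proof.
apply: measurable_fun_ifT.
- apply: measurable_and; apply: measurable_fun_ltr => //.
  by apply: measurable_funM => //; exact: mcos.
- apply: measurableT_comp => //; apply: measurable_fun_pair => //.
  by apply: measurable_fun_pair;
    [apply: measurable_funB|apply: measurable_funD];
    apply: measurable_funM; try exact: mcos; try exact: msin;
    apply: measurable_funB => //; exact: mcos.
- exact: measurable_cst.
Qed.

Let H0 p : (0 <= H p)%E.
Proof. by rewrite /H; case: ifP. Qed.

Let mK : measurable_fun setT K.
Proof. exact: (measurable_fun_fubini_tonelli_F (m2 := leb) _ mH H0). Qed.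

Let K0 q : (0 <= K q)%E.
Proof. by apply: integral_ge0 => t _; exact: H0. Qed.

Let Kper th al : K (th + pi *+ 2, al) = K (th, al).
Proof.
by apply: eq_integral => t _; rewrite /H/= /pt sinD2pi cosD2pi; case: ifP => // _.
Qed.

(** At a fixed direction, rotate the disk so that the chords become horizontal, substitute sin a for
    the height, and translate by cos a so that each chord starts at t = 0. The Jacobian of the
    middle substitution is the weight [cos a]. *)
Let slice (th : R) : (\int[(leb \x leb)%E]_(x in M) G (x, th) =
  \int[leb]_(a in I) ((cos a)%:E * K (th, a)))%E.
Proof.
pose g : mR * mR -> \bar R := (fun x => G (x, th)) \_ M.
have mg : measurable_fun setT g.
  apply/(measurable_restrictT _ measurable_M); apply: measurable_funTS.
  by apply: measurableT_comp => //; exact: measurable_fun_pair.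
have g0 p : (0 <= g p)%E by rewrite /g patchE; case: ifP => // _; exact: G0.
rewrite integral_mkcond -/g.
rewrite -(ge0_integral_rotate (cos2Dsin2 th) mg g0).
pose gr (p : mR * mR) := g (cos th * p.1 - sin th * p.2, sin th * p.1 + cos th * p.2).
have mgr : measurable_fun setT gr.
  apply: measurableT_comp => //; apply: measurable_fun_pair.
    by apply: measurable_funB; apply: measurable_funM => //; exact: measurable_cst.
  by apply: measurable_funD; apply: measurable_funM => //; exact: measurable_cst.
rewrite (fubini_tonelli2 gr mgr (fun p => g0 _)).
have mF := measurable_fun_fubini_tonelli_G (m1 := leb) gr mgr (fun p => g0 _).
have F0 y : (0 <= fubini_G leb gr y)%E by apply: integral_ge0 => s _; exact: g0.
have rot (s y : R) : (cos th * s - sin th * y) ^+ 2 + (sin th * s + cos th * y) ^+ 2 =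
    s ^+ 2 + y ^+ 2.
  transitivity ((cos th ^+ 2 + sin th ^+ 2) * (s ^+ 2 + y ^+ 2)); first by ring.
  by rewrite cos2Dsin2 mul1r.
transitivity (\int[leb]_(y in `](-1)%R, 1%R[) fubini_G leb gr y)%E.
  rewrite [RHS]integral_mkcond; apply: eq_integral => y _; rewrite patchE.
  case: ifPn => // /negP yn; apply: integral0_eq => s _.
  rewrite /gr /g patchE; case: ifPn => // /set_mem; rewrite /M/= rot => sy.
  exfalso; apply: yn; rewrite inE/= in_itv/=.
  by have := sqr_ge0 s; rewrite !expr2 in sy * => s0; apply/andP; split; nra.
rewrite (ge0_integral_sin mF F0); apply: eq_integral => a /set_mem Ia.
congr (_ * _)%E; rewrite /fubini_G.
have mgs : measurable_fun setT (fun s : mR => gr (s, sin a)).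
  by apply: measurableT_comp => //; exact: measurable_fun_pair.
rewrite -(ge0_integral_translateT (- cos a) mgs); last by move=> s; exact: g0.
apply: eq_integral => t _; rewrite /H/gr/g/= patchE /pt.
have -> : ((cos th * (t - cos a) - sin th * sin a,
      sin th * (t - cos a) + cos th * sin a) \in M) = (0 < t < 2 * cos a).
  have c0 : 0 < cos a by move: Ia; rewrite /I/= in_itv/=; exact: cos_gt0_pihalf.
  apply/idP/idP; rewrite inE /M/= rot sin2cos2.
    have -> : (t - cos a) ^+ 2 + (1 - cos a ^+ 2) = 1 + t * (t - 2 * cos a) by ring.
    by move=> h; apply/andP; split; nra.
  have -> : (t - cos a) ^+ 2 + (1 - cos a ^+ 2) = 1 + t * (t - 2 * cos a) by ring.
  by move=> /andP[h1 h2]; nra.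
by [].
Qed.

Let pt_chord (b a t : R) : (pt (b + (pi + a)) a t, b + (pi + a)) = chord (b, a) t.
Proof.
rewrite /chord/pt/= addrA.
have -> : cos b = - cos ((b + pi + a) - a) by rewrite addrK cosDpi opprK.
have -> : sin b = - sin ((b + pi + a) - a) by rewrite addrK sinDpi opprK.
rewrite [in RHS]cosB [in RHS]sinB.
by congr (_, _, _); ring.
Qed.

Let I_pi (a : R) : I a -> 0 <= pi + a <= pi *+ 2.
Proof.
rewrite /I/= in_itv/= => /andP[h1 h2]; have p0 := @pi_gt0 R.
by move: (pi : R) p0 h1 h2 => p p0 h1 h2; apply/andP; split; lra.
Qed.

(** In the coordinates (beta, alpha, t) the measure dx dtheta becomes cos alpha dbeta dalpha dt:
    [slice] handles each direction, and periodicity then trades the direction for the entry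
    angle. *)
Lemma ge0_santalo : (\int[leb3]_(p in SM) G p = \int[leb2]_(q in influx)
  ((cos q.2)%:E * \int[leb1]_(t in [set t | 0 <= t <= 2 * cos q.2]%R) G (chord q t)))%E.
Proof.
transitivity (\int[sleb1]_(th in circle) \int[sleb2]_(x in M) G (x, th))%E.
  exact: (tonelliX2 sleb2 sleb1 measurable_M measurable_circle mG G0).
transitivity (\int[leb]_(th in circle) \int[leb]_(a in I) ((cos a)%:E * K (th, a)))%E.
  by apply: eq_integral => th _; exact: slice.
have mI : measurable I by exact: measurable_itv.
have mC := @measurable_circle R.
(* The absolute value makes the integrand nonnegative everywhere, as needed for Tonelli; on [I] it
   changes nothing. *)
pose F (q : mR * mR) := (`|cos q.2|%:E * K q)%E.
have mF : measurable_fun setT F.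
  apply: emeasurable_funM => //; apply/measurable_EFinP.
  by apply: measurableT_comp => //; exact: mcos.
have F0 q : (0 <= F q)%E by rewrite mule_ge0// lee_fin.
have cI a : I a -> 0 < cos a by rewrite /I/= in_itv/=; exact: cos_gt0_pihalf.
transitivity (\int[leb]_(th in circle) \int[leb]_(a in I) F (th, a))%E.
  apply: eq_integral => th _; apply: eq_integral => a /set_mem/cI ca.
  by rewrite /F/= gtr0_norm.
rewrite -(tonelliX1 leb leb mC mI mF F0) (tonelliX2 leb leb mC mI mF F0).
(* For fixed alpha the direction beta + pi + alpha is a translate of beta, so the change of variable
   is a shift on the circle by an amount in [0, 2pi]. *)
pose F' (q : mR * mR) := F (q.1 + (pi + q.2), q.2).
have mF' : measurable_fun setT F'.
  apply: measurableT_comp => //; apply: measurable_fun_pair => //.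
  by apply: measurable_funD => //; apply: measurable_funD => //; exact: measurable_cst.
transitivity (\int[leb]_(a in I) \int[leb]_(b in circle) F' (b, a))%E.
  apply: eq_integral => a /set_mem Ia.
  have mFa : measurable_fun setT (fun b : mR => F (b, a)).
    by apply: measurableT_comp => //; exact: measurable_fun_pair.
  have pa := I_pi Ia.
  rewrite -(ge0_integral_periodic pa mFa)//.
  by move=> b; rewrite /F/= Kper.
rewrite -(tonelliX2 leb leb mC mI mF' (fun q => F0 _)) /influx alphaE.
apply: eq_integral => -[b a] /set_mem[/= _ Ia]; have ca := cI _ Ia.
rewrite /F'/F/= gtr0_norm//; congr (_ * _)%E.
have -> : [set t | 0 <= t <= 2 * cos a] = `[0, 2 * cos a]%classic.
  by apply/seteqP; split => t /=; rewrite in_itv.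
have mGc : measurable_fun setT (fun t : mR => G (chord (b, a) t)).
  apply: measurableT_comp => //; apply: measurable_fun_pair => //.
  by apply: measurable_fun_pair; apply: measurable_funD => //;
    apply: measurable_funM => //; exact: measurable_cst.
rewrite [RHS]integral_itv_bndoo; last exact: measurable_funTS.
rewrite [RHS]integral_mkcond; apply: eq_integral => t _.
by rewrite /H/= patchE mem_setE in_itv/= -pt_chord.
Qed.

End Santalo.

Lemma continuous_pairing (T U V : topologicalType) (f : T -> U) (g : T -> V) :
  continuous f -> continuous g -> continuous (fun x => (f x, g x)).
Proof. by move=> cf cg x; exact: (cvg_pair (cf x) (cg x)). Qed.

(** * Integration along chords of continuous functions *)

Section Chords.
Context {R : realType}.
Local Notation mR := (measurableTypeR R).
Implicit Types q : R * R.
Implicit Types F : (R * R) * R -> R.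

Definition rcont F := continuous F /\ forall x, periodic (fun t => F (x, t)) (pi *+ 2).

Lemma rcontD F F' : rcont F -> rcont F' -> rcont (fun p => F p + F' p).
Proof.
move=> [cF pF] [cG pG]; split; first by move=> p; apply: cvgD; [exact: cF|exact: cG].
by move=> x t; rewrite (pF x t) (pG x t).
Qed.

Lemma rcontM F F' : rcont F -> rcont F' -> rcont (fun p => F p * F' p).
Proof.
move=> [cF pF] [cG pG]; split; first by move=> p; apply: cvgM; [exact: cF|exact: cG].
by move=> x t; rewrite (pF x t) (pG x t).
Qed.

Lemma rcont_cst (c : R) : rcont (fun=> c).
Proof. by split=> // p; exact: cvg_cst. Qed.

(** The angle is allowed up to 4pi because the direction beta + pi + alpha of a chord leaves the
    fundamental domain: it can approach 7pi/2. *)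
Lemma continuous_bounded3 F : continuous F -> exists2 C : R, 0 <= C &
  forall p : (R * R) * R, p.1.1 ^+ 2 + p.1.2 ^+ 2 <= 1 -> 0 <= p.2 <= pi *+ 4 -> `|F p| <= C.
Proof.
move=> cF.
pose K : set ((R * R) * R) := (`[(-1), 1]%classic `*` `[(-1), 1]%classic) `*` `[0, pi *+ 4]%classic.
have cK : compact K by apply: compact_setX; [apply: compact_setX|]; exact: segment_compact.
have /compact_bounded[C [_ HC]] : compact (F @` K).
  by apply: continuous_compact => //; exact: continuous_subspaceT.
exists (`|C| + 1); first by rewrite addr_ge0.
move=> [[x y] t] /= xy tp; apply: (HC (`|C| + 1)).
  by rewrite (le_lt_trans (ler_norm C))// ltrDl.
exists ((x, y), t) => //; rewrite /K/= !in_itv/= tp.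
have := sqr_ge0 x; have := sqr_ge0 y => hx hy.
by split=> //; split; apply/andP; split; nra.
Qed.

Lemma continuous_bounded2 (f : R * R -> R) : continuous f -> exists2 C : R, 0 <= C &
  forall p : R * R, p.1 ^+ 2 + p.2 ^+ 2 <= 1 -> `|f p| <= C.
Proof.
move=> cf; have [|C C0 HC] := @continuous_bounded3 (fun p => f p.1).
  by move=> p; apply: (@continuous_comp _ _ _ fst f); [exact: cvg_fst|exact: cf].
exists C => // p pM; apply: (HC (p, 0)) => //=.
by rewrite lexx mulrn_wge0// pi_ge0.
Qed.

Lemma chord_disk (q : R * R) (t : R) : 0 <= t <= 2 * cos q.2 ->
  (chord q t).1.1 ^+ 2 + (chord q t).1.2 ^+ 2 <= 1.
Proof.
move=> /andP[t0 t2]; rewrite /chord/=.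
set b := q.1; set a := q.2.
have e1 : cos (b + pi + a) = - (cos b * cos a - sin b * sin a).
  by rewrite addrAC cosDpi cosD.
have e2 : sin (b + pi + a) = - (sin b * cos a + cos b * sin a).
  by rewrite addrAC sinDpi sinD.
have -> : (cos b + t * cos (b + pi + a)) ^+ 2 + (sin b + t * sin (b + pi + a)) ^+ 2 =
    (cos b ^+ 2 + sin b ^+ 2) * (1 + t ^+ 2 * (cos a ^+ 2 + sin a ^+ 2) - 2 * t * cos a).
  by rewrite e1 e2; ring.
rewrite !cos2Dsin2 mul1r mulr1; move: t2; rewrite -/a; nra.
Qed.

Lemma influxP (q : R * R) : influx q ->
  [/\ 0 <= q.1, q.1 <= pi *+ 2, 0 < cos q.2 & 0 <= q.1 + pi + q.2 <= pi *+ 4].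
Proof.
move=> [/= /andP[h1 h2] h3]; split=> //; first exact: cos_gt0_pihalf.
move: h2 h3; have := @pi_gt0 R; move: (pi : R) => p p0 h2 /andP[h3 h4].
by apply/andP; split; lra.
Qed.

Definition cseg (q : R * R) : set R := [set t | 0 <= t <= 2 * cos q.2].

Lemma csegE q : cseg q = `[0, 2 * cos q.2]%classic.
Proof. by apply/seteqP; split => t /=; rewrite in_itv. Qed.

Lemma measurable_cseg q : measurable (cseg q : set mR).
Proof. by rewrite csegE; exact: measurable_itv. Qed.

Lemma leb1_cseg q : influx q -> leb1 (cseg q : set mR) = (2 * cos q.2)%:E.
Proof.
move=> /influxP[_ _ c0 _]; rewrite csegE leb1_itv.
by rewrite mulr_gt0// subr0.
Qed.

Definition chord_int F (q : R * R) : R := Rintegral leb1 (cseg q) (fun t => F (chord q t)).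

Lemma continuous_chord q : continuous (chord q).
Proof.
have h (c d : R) : continuous (fun t : R => c + t * d).
  by move=> t; apply: cvgD; [exact: cvg_cst|apply: cvgM; [exact: cvg_id|exact: cvg_cst]].
apply: continuous_pairing; last by move=> t; exact: cvg_cst.
exact: continuous_pairing.
Qed.

Lemma chord_integrable F q : continuous F ->
  leb1.-integrable (cseg q) (EFin \o (fun t => F (chord q t))).
Proof.
move=> cF; rewrite csegE; apply: continuous_compact_integrable.
  exact: segment_compact.
apply: continuous_subspaceT => t.
by apply: (@continuous_comp _ _ _ (chord q) F); [exact: continuous_chord|exact: cF].
Qed.

Lemma chord_intB F F' q : continuous F -> continuous F' ->
  chord_int (fun p => F p - F' p) q = chord_int F q - chord_int F' q.
Proof.
by move=> cF cG; apply: RintegralB; [exact: measurable_cseg|exact: chord_integrable..].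
Qed.

Lemma chord_intD F F' q : continuous F -> continuous F' ->
  chord_int (fun p => F p + F' p) q = chord_int F q + chord_int F' q.
Proof.
by move=> cF cG; apply: RintegralD; [exact: measurable_cseg|exact: chord_integrable..].
Qed.

Lemma chord_intZr F (c : R) q : continuous F ->
  chord_int (fun p => F p * c) q = chord_int F q * c.
Proof.
by move=> cF; apply: RintegralZr; [exact: measurable_cseg|exact: chord_integrable].
Qed.

Lemma chord_int_bound F (C : R) q : continuous F -> influx q -> 0 <= C ->
  (forall p : (R * R) * R, p.1.1 ^+ 2 + p.1.2 ^+ 2 <= 1 -> 0 <= p.2 <= pi *+ 4 -> `|F p| <= C) ->
  `|chord_int F q| <= 2 * C.
Proof.
move=> cF iq C0 HC; have [_ _ c0 th] := influxP iq.
apply: le_trans (le_normr_Rintegral (measurable_cseg q) (chord_integrable _ cF)) _.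
apply: (@le_trans _ _ (Rintegral leb1 (cseg q) (fun=> C))).
  apply: le_Rintegral; first exact: measurable_cseg.
  - by apply: (@integrable_norm _ _ _ leb1 (cseg q) (fun t => F (chord q t))); exact: chord_integrable.
  - by apply: (chord_integrable (F := fun=> C)) => p; exact: cvg_cst.
  - by move=> t tq; apply: HC => //; exact: chord_disk.
rewrite Rintegral_cst ?leb1_cseg//=; last exact: measurable_cseg.
by rewrite mulrC ler_wpM2r//; have := cos_le1 q.2; lra.
Qed.

Lemma chord_int_measurable_ge0 F : rcont F -> (forall p, 0 <= F p) ->
  measurable_fun setT (chord_int F : mR * mR -> mR).
Proof.
move=> [cF _] F0; have mF := continuous_measurable3 cF.
pose H (p : mR * mR * mR) : \bar R :=
  if (0 <= p.2 <= 2 * cos p.1.2) then (F (chord p.1 p.2))%:E else 0%E.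
have mcos d (T : measurableType d) (f : T -> mR) : measurable_fun setT f ->
    measurable_fun setT (fun x => cos (f x) : mR).
  by apply: measurableT_comp; apply: continuous_measurable_fun; exact: continuous_cos.
have msin d (T : measurableType d) (f : T -> mR) : measurable_fun setT f ->
    measurable_fun setT (fun x => sin (f x) : mR).
  by apply: measurableT_comp; apply: continuous_measurable_fun; exact: continuous_sin.
have m11 : measurable_fun setT (fun p : mR * mR * mR => p.1.1) by exact: measurableT_comp.
have m12 : measurable_fun setT (fun p : mR * mR * mR => p.1.2) by exact: measurableT_comp.
have mth : measurable_fun setT (fun p : mR * mR * mR => p.1.1 + pi + p.1.2 : mR).
  by apply: measurable_funD => //; apply: measurable_funD => //; exact: measurable_cst.
have mH : measurable_fun setT H.
  apply: measurable_fun_ifT.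
  - apply: measurable_and; apply: measurable_fun_ler => //.
    by apply: measurable_funM => //; exact: mcos.
  - apply/measurable_EFinP; apply: measurableT_comp => //.
    apply: measurable_fun_pair => //; apply: measurable_fun_pair;
    by apply: measurable_funD; try exact: mcos; try exact: msin;
      apply: measurable_funM => //; try exact: mcos; exact: msin.
  - exact: measurable_cst.
have H0 p : (0 <= H p)%E by rewrite /H; case: ifP => // _; rewrite lee_fin.
have := measurable_fun_fubini_tonelli_F (m2 := sleb1) _ mH H0.
move=> /(measurableT_comp (fine_measurable measurableT)).
congr (measurable_fun _ _); apply/funext => q /=; congr fine.
rewrite /fubini_F [RHS]integral_mkcond; apply: eq_integral => t _.
by rewrite /H patchE /= csegE mem_setE in_itv.
Qed.

(** Any [F] is the difference of 1 + F^2 + F and 1 + F^2, both nonnegative and still in [rcont].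
    This reduces signed integrands to nonnegative ones without losing continuity or periodicity. *)
Let quad_ge0 (x : R) : 0 <= 1 + x ^+ 2 + x.
Proof. by have := sqr_ge0 (x + 2^-1); rewrite !expr2; lra. Qed.

Let quad2_ge0 (x : R) : 0 <= 1 + x ^+ 2.
Proof. by rewrite addr_ge0// sqr_ge0. Qed.

Let rc1 F : rcont F -> rcont (fun p => 1 + F p ^+ 2).
Proof. by move=> cF; apply: rcontD; [exact: rcont_cst|exact: rcontM]. Qed.

Let rc2 F : rcont F -> rcont (fun p => 1 + F p ^+ 2 + F p).
Proof. by move=> cF; apply: rcontD => //; exact: rc1. Qed.

Let FE F : F = (fun p => (1 + F p ^+ 2 + F p) - (1 + F p ^+ 2)).
Proof. by apply/funext => p; ring. Qed.

Lemma chord_int_measurable F : rcont F ->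
  measurable_fun setT (chord_int F : mR * mR -> mR).
Proof.
move=> cF; rewrite (FE F).
rewrite (_ : chord_int _ = (fun q => chord_int (fun p => 1 + F p ^+ 2 + F p) q -
     chord_int (fun p => 1 + F p ^+ 2) q)); last first.
  by apply/funext => q; rewrite chord_intB//; [have [] := rc2 cF|have [] := rc1 cF].
apply: measurable_funB; apply: chord_int_measurable_ge0 => //; first exact: rc2.
exact: rc1.
Qed.

Lemma rcont_integrable F : rcont F -> leb3.-integrable SM (EFin \o F).
Proof.
move=> [cF _]; have [C C0 HC] := continuous_bounded3 cF.
apply: measurable_bounded_integrable.
- exact: measurable_SM.
- exact: leb3_SM_lty.
- by apply: measurable_funTS; exact: continuous_measurable3.
- exists C; split; first exact: num_real.
  move=> D CD [x t] [/= xM tC]; rewrite (le_trans _ (ltW CD))//.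
  apply: HC => //=; first by rewrite ltW.
  by move: tC; rewrite /circle/= => /andP[-> h]; have := @pi_gt0 R; lra.
Qed.

Lemma measurable_cos2 : measurable_fun setT (fun q : mR * mR => cos q.2 : mR).
Proof.
apply: measurableT_comp => //.
by apply: continuous_measurable_fun; exact: continuous_cos.
Qed.

Lemma chord_int_integrable F : rcont F ->
  leb2.-integrable influx (EFin \o (fun q => cos q.2 * chord_int F q)).
Proof.
move=> rF; have [C C0 HC] := continuous_bounded3 rF.1.
apply: measurable_bounded_integrable.
- exact: measurable_influx.
- exact: leb2_influx_lty.
- apply: measurable_funTS; apply: measurable_funM; first exact: measurable_cos2.
  exact: chord_int_measurable.
- exists (2 * C); split; first exact: num_real.
  move=> D CD q iq /=; rewrite (le_trans _ (ltW CD))// normrM.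
  rewrite -[leRHS]mul1r ler_pM// ?cos_max//.
  by apply: (chord_int_bound _ iq C0 HC); case: rF.
Qed.

Let Rsantalo_ge0 F : rcont F -> (forall p, 0 <= F p) ->
  Rintegral leb3 SM F = Rintegral leb2 influx (fun q => cos q.2 * chord_int F q).
Proof.
move=> rF F0; rewrite /Rintegral; congr fine.
rewrite (ge0_santalo (G := EFin \o F)).
- apply: eq_integral => q _; rewrite EFinM; congr (_ * _)%E.
  rewrite /chord_int /Rintegral fineK//; apply: integrable_fin_num.
    exact: measurable_cseg.
  by apply: chord_integrable; case: rF.
- by apply/measurable_EFinP; apply: continuous_measurable3; case: rF.
- by move=> p; rewrite lee_fin.
- by move=> x t; case: rF => _ /(_ x t) /= ->.
Qed.

Lemma Rsantalo F : rcont F ->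
  Rintegral leb3 SM F = Rintegral leb2 influx (fun q => cos q.2 * chord_int F q).
Proof.
move=> rF; have r1 := rc1 rF; have r2 := rc2 rF.
rewrite (FE F) RintegralB; [|exact: measurable_SM|exact: rcont_integrable..].
rewrite !Rsantalo_ge0//.
rewrite -RintegralB; [|exact: measurable_influx|exact: chord_int_integrable..].
apply: eq_Rintegral => q _; rewrite -mulrBr chord_intB//; [by case: r2|by case: r1].
Qed.

End Chords.

(** * The L^2 bound for the X-ray transform and its pairing with first integrals *)

Section XrayL2.
Context {R : realType}.
Local Notation mR := (measurableTypeR R).
Implicit Types u v : (R * R) * R -> R[i].
Implicit Types q : R * R.

Lemma continuousSMP u : continuousSM u <->
  rcont (fun p => complex.Re (u p)) /\ rcont (fun p => complex.Im (u p)).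
Proof.
split=> [[pu cRe cIm]|[[cRe pRe] [cIm pIm]]].
  by split; split=> // x t; rewrite (pu x t).
split=> // x t; move: (pRe x t) (pIm x t) => /=.
by case: (u (x, t + _)) => a b; case: (u (x, t)) => c d /= -> ->.
Qed.

Lemma rcont_dot u v : continuousSM u -> continuousSM v ->
  rcont (fun p => dotc (u p) (v p)).
Proof.
move=> /continuousSMP[u1 u2] /continuousSMP[v1 v2].
by apply: rcontD; exact: rcontM.
Qed.

Lemma continuousSM_cmeas u (D : set (mR * mR * mR)) : continuousSM u -> cmeas D u.
Proof.
by move=> [_ c1 c2]; split; apply: measurable_funTS; exact: continuous_measurable3.
Qed.

Lemma continuousSM_L2 u : continuousSM u -> L2 leb3 (SM : set (mR * mR * mR)) u.
Proof.
move=> cu; apply/L2P; split; first exact: continuousSM_cmeas.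
by apply: rcont_integrable; exact: rcont_dot.
Qed.

Lemma continuousSMB u v : continuousSM u -> continuousSM v ->
  continuousSM (fun p => u p - v p).
Proof.
move=> /continuousSMP[u1 u2] /continuousSMP[v1 v2]; apply/continuousSMP; split.
  rewrite (_ : (fun _ => _) = (fun p => complex.Re (u p) + (- 1) * complex.Re (v p))).
    by apply: rcontD => //; apply: rcontM => //; exact: rcont_cst.
  by apply/funext => p; rewrite ReD ReN mulN1r.
rewrite (_ : (fun _ => _) = (fun p => complex.Im (u p) + (- 1) * complex.Im (v p))).
  by apply: rcontD => //; apply: rcontM => //; exact: rcont_cst.
by apply/funext => p; rewrite ImD ImN mulN1r.
Qed.

Lemma xray_formulaE u q : xray_formula u q =
  chord_int (fun p => complex.Re (u p)) q +i* chord_int (fun p => complex.Im (u p)) q.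
Proof. by case: q. Qed.

Lemma xray_formulaB u v q : continuousSM u -> continuousSM v ->
  xray_formula (fun p => u p - v p) q = xray_formula u q - xray_formula v q.
Proof.
move=> [_ u1 u2] [_ v1 v2]; rewrite !xray_formulaE.
rewrite (_ : (fun p => complex.Re (u p - v p)) =
  (fun p => complex.Re (u p) - complex.Re (v p))); last first.
  by apply/funext => p; rewrite ReD ReN.
rewrite (_ : (fun p => complex.Im (u p - v p)) =
  (fun p => complex.Im (u p) - complex.Im (v p))); last first.
  by apply/funext => p; rewrite ImD ImN.
by rewrite !chord_intB.
Qed.

Lemma xray_formula_periodic u (a : R) : continuousSM u ->
  periodic (fun b => xray_formula u (b, a)) (pi *+ 2).
Proof.
move=> [pu _ _] b; rewrite /xray_formula.
have -> : b + pi *+ 2 + pi + a = (b + pi + a) + pi *+ 2 by ring.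
rewrite cosD2pi sinD2pi cosD2pi sinD2pi.
by congr cintegral; apply/funext => s; rewrite pu.
Qed.

Lemma cmeas_xray u (D : set (mR * mR)) : continuousSM u ->
  cmeas D (xray_formula u : mR * mR -> R[i]).
Proof.
move=> /continuousSMP[u1 u2]; split; apply: measurable_funTS.
  by under eq_fun do rewrite xray_formulaE; exact: chord_int_measurable.
by under eq_fun do rewrite xray_formulaE; exact: chord_int_measurable.
Qed.

(** Cauchy-Schwarz on a chord of length 2 cos alpha, applied once for the real and once for the
    imaginary part; the two factors 2 cos alpha add up to 4 cos alpha. *)
Lemma xray_dot_le u q : continuousSM u -> influx q ->
  dotc (xray_formula u q) (xray_formula u q) <=
  4 * (cos q.2 * chord_int (fun p => dotc (u p) (u p)) q).
Proof.
move=> cu iq; have [_ _ c0 _] := influxP iq.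
have mq := measurable_cseg q.
pose f t := u (chord q t).
have Lf : L2 leb1 (cseg q : set mR) f.
  have [rc1 rc2] := (continuousSMP u).1 cu.
  have ch : continuous (chord q) by exact: continuous_chord.
  apply/L2P; split; last by apply: (chord_integrable (F := fun p => dotc (u p) (u p)));
    case: (rcont_dot cu cu).
  split; apply: measurable_funTS; apply: continuous_measurable_fun => t.
    by apply: (@continuous_comp _ _ _ (chord q) (fun p => complex.Re (u p)));
      [exact: ch|case: rc1 => + _; apply].
  by apply: (@continuous_comp _ _ _ (chord q) (fun p => complex.Im (u p)));
    [exact: ch|case: rc2 => + _; apply].
have Lc (c : R[i]) : L2 leb1 (cseg q : set mR) (fun=> c).
  apply: (@L2_bounded _ _ _ _ _ mq _ (dotc c c)); [|exact: cmeas_cst|by []].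
  by rewrite leb1_cseg// ltry.
have key (c : R[i]) : dotc c c = 1 ->
    rip leb1 (cseg q) f (fun=> c) ^+ 2 <= rip leb1 (cseg q) f f * (2 * cos q.2).
  move=> c1; have := CauchySchwarz mq Lf (Lc c).
  rewrite -[_ <= _](ler_pXn2r (n := 2))// ?nnegrE ?mulr_ge0 ?nrm_ge0//.
  rewrite real_normK ?num_real// exprMn !nrm_sqr => /le_trans; apply.
  rewrite ler_wpM2l ?rip_ge0// /rip c1 Rintegral_cst// leb1_cseg//=.
  by rewrite mul1r.
have e1 : rip leb1 (cseg q) f (fun=> 1) = complex.Re (xray_formula u q).
  rewrite xray_formulaE/=; apply: eq_Rintegral => t _.
  by rewrite /dotc/= mulr1 mulr0 addr0.
have e2 : rip leb1 (cseg q) f (fun=> 'i) = complex.Im (xray_formula u q).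
  rewrite xray_formulaE/=; apply: eq_Rintegral => t _.
  by rewrite /dotc/= mulr1 mulr0 add0r.
have h1 : dotc (1 : R[i]) 1 = 1 by rewrite /dotc/= mulr1 mulr0 addr0.
have hi : dotc ('i : R[i]) 'i = 1 by rewrite /dotc/= mulr1 mulr0 add0r.
have := key _ h1; have := key _ hi; rewrite e1 e2 /dotc -!expr2.
rewrite (_ : rip leb1 (cseg q) f f = chord_int (fun p => dotc (u p) (u p)) q)//.
by move: (chord_int _ _) => r; lra.
Qed.

Lemma xray_L2 u : continuousSM u -> L2 leb2 (influx : set (mR * mR)) (xray_formula u).
Proof.
move=> cu; apply/L2P; split; first exact: cmeas_xray.
have := integrableZl (measurable_influx) 4 (chord_int_integrable (rcont_dot cu cu)).
apply: le_integrable; first exact: measurable_influx.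
  apply/measurable_EFinP; apply: cmeas_dot; exact: cmeas_xray.
move=> q iq /=; rewrite lee_fin ger0_norm ?dotc_ge0// (le_trans _ (ler_norm _))//.
exact: xray_dot_le.
Qed.

(** The cosine lost in the chordwise estimate is exactly the density of Santalo's formula, and the
    constant is the square root of 4. *)
Lemma xray_nrm u : continuousSM u ->
  nrm leb2 (influx : set (mR * mR)) (xray_formula u) <= 2 * nrm leb3 SM u.
Proof.
move=> cu; rewrite -(ler_pXn2r (n := 2))// ?nnegrE ?mulr_ge0 ?nrm_ge0//.
rewrite exprMn !nrm_sqr {2}/rip (Rsantalo (rcont_dot cu cu)).
have ci := chord_int_integrable (rcont_dot cu cu).
rewrite (_ : 2 ^+ 2 = 4); last by rewrite expr2 -natrM.
rewrite -RintegralZl; [|exact: measurable_influx|exact: ci].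
have := xray_L2 cu => /L2P[_ xi].
apply: le_Rintegral; [exact: measurable_influx|exact: xi| |].
  exact: (integrableZl measurable_influx 4 ci).
by move=> q iq; exact: xray_dot_le.
Qed.

Definition first_integral u := forall q t, influx q -> cseg q t -> u (chord q t) = u (chord q 0).

(** The function on the influx boundary that plays the role of [A] once its constant value on each
    chord is factored out of Santalo's formula. *)
Definition xray_weight (A : (R * R) * R -> R[i]) q : R[i] := (cos q.2)%:C * A (chord q 0).

Lemma xray_weight_L2 A : continuousSM A -> L2 leb2 (influx : set (mR * mR)) (xray_weight A).
Proof.
move=> [_ c1 c2].
have mch : measurable_fun setT (fun q : mR * mR => chord q 0 : mR * mR * mR).
  have m1 : measurable_fun setT (fun q : mR * mR => cos q.1 : mR).
    by apply: measurableT_comp => //; apply: continuous_measurable_fun; exact: continuous_cos.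
  have m2 : measurable_fun setT (fun q : mR * mR => sin q.1 : mR).
    by apply: measurableT_comp => //; apply: continuous_measurable_fun; exact: continuous_sin.
  rewrite /chord; apply: measurable_fun_pair; last first.
    by apply: measurable_funD => //; apply: measurable_funD => //; exact: measurable_cst.
  by apply: measurable_fun_pair; under eq_fun do rewrite mul0r addr0.
have [C1 C10 HC1] := continuous_bounded3 c1.
have [C2 C20 HC2] := continuous_bounded3 c2.
apply: (@L2_bounded _ _ _ _ _ measurable_influx _ (C1 ^+ 2 + C2 ^+ 2)).
- exact: leb2_influx_lty.
- apply: cmeasM.
    by split; apply: measurable_funTS; [exact: measurable_cos2|exact: measurable_cst].
  by split; apply: measurable_funTS; apply: (measurableT_comp (f := _ \o _)) => //;
    [exact: (continuous_measurable3 c1)|exact: (continuous_measurable3 c2)].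
move=> q iq; have [_ _ c0 th] := influxP iq.
have ch : (chord q 0).1.1 ^+ 2 + (chord q 0).1.2 ^+ 2 <= 1.
  by apply: chord_disk; rewrite lexx/= mulr_ge0// ltW.
have := HC1 _ ch th; have := HC2 _ ch th; rewrite /xray_weight /dotc ReM ImM/= !mul0r subr0 addr0.
move: (complex.Re _) (complex.Im _) => a b.
rewrite !ler_norml => /andP[b1 b2] /andP[a1 a2].
have cc := cos_le1 q.2; rewrite !expr2.
have -> : cos q.2 * a * (cos q.2 * a) + cos q.2 * b * (cos q.2 * b) =
  (cos q.2 * cos q.2) * (a * a + b * b) by ring.
apply: (@le_trans _ _ (1 * (a * a + b * b))).
  by rewrite ler_wpM2r ?addr_ge0 -?expr2 ?sqr_ge0// -[leRHS]expr1n lerXn2r ?nnegrE// ltW.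
by rewrite mul1r; apply: lerD; nra.
Qed.

Lemma xray_pair u A : continuousSM u -> continuousSM A -> first_integral A ->
  rip leb3 SM u A = rip leb2 (influx : set (mR * mR)) (xray_formula u) (xray_weight A).
Proof.
move=> cu cA fA; rewrite {1}/rip (Rsantalo (rcont_dot cu cA)).
apply: eq_Rintegral => q /set_mem iq.
rewrite /xray_weight; set a := A (chord q 0).
have /continuousSMP[[u1 _] [u2 _]] := cu.
have -> : chord_int (fun p => dotc (u p) (A p)) q = dotc (xray_formula u q) a.
  rewrite xray_formulaE /dotc /= -!chord_intZr//.
  rewrite -chord_intD; last 2 first.
  - by move=> p; apply: cvgM; [exact: u1|exact: cvg_cst].
  - by move=> p; apply: cvgM; [exact: u2|exact: cvg_cst].
  by apply: eq_Rintegral => t /set_mem tq; rewrite fA.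
by rewrite /dotc ReM ImM/=; ring.
Qed.

(** Both sides are continuous for the two L^2 convergences in the definition of [is_xray], so the
    identity for continuous functions survives the closure. The X-ray class thus determines every
    pairing with a first integral. *)
Lemma is_xray_pair f w A : L2 leb3 (SM : set (mR * mR * mR)) f -> is_xray f w ->
  continuousSM A -> first_integral A ->
  rip leb3 SM f A = rip leb2 (influx : set (mR * mR)) w (xray_weight A).
Proof.
move=> Lf [[_ Lw] [u [cu uf Iuw]]] cA fA.
have Lu n := continuousSM_L2 (cu n).
have LIu n := xray_L2 (cu n).
have h1 := cvg_ripl measurable_SM Lu Lf (continuousSM_L2 cA)
  ((L2cvgP measurable_SM Lu Lf).1 uf).
have h2 := cvg_ripl measurable_influx LIu Lw (xray_weight_L2 cA)
  ((L2cvgP measurable_influx LIu Lw).1 Iuw).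
have E : (fun n => rip leb3 SM (u n) A) =
    (fun n => rip leb2 (influx : set (mR * mR)) (xray_formula (u n)) (xray_weight A)).
  by apply/funext => n; exact: xray_pair.
by rewrite E in h1; exact: (cvg_unique _ h1 h2).
Qed.

Lemma same_xray_pair f g A : L2 leb3 (SM : set (mR * mR * mR)) f ->
  L2 leb3 (SM : set (mR * mR * mR)) g -> same_xray f g ->
  continuousSM A -> first_integral A -> rip leb3 SM f A = rip leb3 SM g A.
Proof.
move=> Lf Lg [w [fw gw]] cA fA.
by rewrite (is_xray_pair Lf fw cA fA) (is_xray_pair Lg gw cA fA).
Qed.

End XrayL2.

(** * Vanishing integrals propagate from a pi-system *)

Section DynkinIntegral.
Context {d d'} {T : measurableType d} {T' : measurableType d'} {R : realType}.
Variables (mu : {measure set T -> \bar R}) (D : set T) (H : T -> R).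
Hypotheses (mD : measurable D) (iH : mu.-integrable D (EFin \o H)).
Variables (phi : T -> T') (G : set (set T')).
Hypotheses (mphi : measurable_fun setT phi) (GE : @measurable _ T' = <<s G >>)
  (GI : setI_closed G).

(** The sets whose preimages carry zero integral form a Dynkin system; the vanishing of the integral
    over all of [D] is what gives closure under complements. *)
Lemma dynkin_integral_eq0 : (\int[mu]_(x in D) (H x)%:E = 0)%E ->
  (forall B, G B -> \int[mu]_(x in D `&` phi @^-1` B) (H x)%:E = 0)%E ->
  forall B, measurable B -> (\int[mu]_(x in D `&` phi @^-1` B) (H x)%:E = 0)%E.
Proof.
move=> HD HG B mB.
have mp (A : set T') : measurable A -> measurable (phi @^-1` A).
  by move=> mA; rewrite -[X in measurable X]setTI; exact: mphi.
have mH (A : set T) : A `<=` D -> measurable_fun A (EFin \o H).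
  by move=> AD; apply: (measurable_funS mD AD); exact: (measurable_int mu).
apply: (@dynkin_induction _ T' G
  (fun B => (\int[mu]_(x in D `&` phi @^-1` B) (H x)%:E = 0)%E)) => //.
- by rewrite preimage_setT setIT.
- move=> S mS HS; have := HD.
  have {1}-> : D = (D `&` phi @^-1` S) `|` (D `&` phi @^-1` (~` S)).
    by rewrite -setIUr -preimage_setU setUv preimage_setT setIT.
  rewrite integral_setU.
  + by rewrite HS add0e.
  + by apply: measurableI => //; exact: mp.
  + by apply: measurableI => //; apply: mp; exact: measurableC.
  + by apply: mH => x [] [].
  + by apply/disj_setPS => x [[_ h1] [_ h2]].
- move=> F mF tF HF; rewrite preimage_bigcup setI_bigcupr.
  rewrite integral_bigcup.
  + by rewrite eseries0// => i _ _; exact: HF.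
  + apply/trivIsetP => i j _ _ ij; rewrite setIACA -[X in _ `&` X]preimage_setI.
    by move/trivIsetP : tF => /(_ i j I I ij) ->; rewrite preimage_set0 setI0.
  + by move=> k; apply: measurableI => //; exact: mp.
  + apply: (integrableS mD) => //; last by move=> x [k _ []].
    by apply: bigcup_measurable => k _; apply: measurableI => //; exact: mp.
- by rewrite -GE.
Qed.

End DynkinIntegral.

(** * Polynomials converging to the indicator of u < 1/2 *)

Section ThresholdPolynomials.
Context {R : realType}.

Lemma Bernoulli_ge (v : R) N : -1 <= v -> 1 + N%:R * v <= (1 + v) ^+ N.
Proof.
move=> v1; elim: N => [|n IH]; first by rewrite mul0r addr0 expr0.
rewrite exprS; apply: (@le_trans _ _ ((1 + v) * (1 + n%:R * v))).
  rewrite -natr1; have : 0 <= n%:R * (v * v) by rewrite mulr_ge0// -expr2 sqr_ge0.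
  by lra.
by rewrite ler_wpM2l//; lra.
Qed.

(** With t = (1+r)/2 one has r <= t^2, so r^n leaves two factors t^n: Bernoulli for 1/t keeps n t^n
    bounded, and the other factor tends to 0. *)
Lemma cvg_mulrn_exp (r : R) : 0 <= r < 1 -> n%:R * r ^+ n @[n --> \oo] --> 0.
Proof.
move=> /andP[r0 r1]; pose t := (1 + r) / 2.
have t0 : 0 < t by rewrite /t; lra.
have t1 : t < 1 by rewrite /t; lra.
have rt : r <= t ^+ 2.
  rewrite -subr_ge0; have -> : t ^+ 2 - r = ((1 - r) / 2) ^+ 2 by rewrite /t; field.
  exact: sqr_ge0.
pose d := t^-1 - 1.
have d0 : 0 < d by rewrite subr_gt0 invf_gt1.
have nt n : n%:R * t ^+ n <= d^-1.
  have h : 1 + n%:R * d <= (t^-1) ^+ n.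
    have -> : t^-1 = 1 + d by rewrite /d; ring.
    by apply: Bernoulli_ge; lra.
  rewrite -(ler_pM2l (exprn_gt0 n (_ : 0 < t^-1))) ?invr_gt0//.
  rewrite mulrCA exprVn mulVf ?expf_neq0 ?gt_eqF// mulr1.
  rewrite ler_pdivlMr// -exprVn; lra.
apply: (@squeeze_cvgr _ _ _ _ (fun=> 0) (fun n => d^-1 * t ^+ n)).
- apply: nearW => n; rewrite mulr_ge0 ?exprn_ge0//=.
  apply: (@le_trans _ _ (n%:R * t ^+ n * t ^+ n)).
    by rewrite -mulrA ler_wpM2l// -exprD addnn -mul2n exprM lerXn2r ?nnegrE// sqr_ge0.
  by rewrite ler_wpM2r// exprn_ge0// ltW.
- exact: cvg_cst.
- rewrite -(mulr0 d^-1); apply: cvgMl_tmp.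
  have := @cvg_geometric R 1 t; rewrite ger0_norm ?ltW// => /(_ t1).
  by apply: cvg_trans; apply: near_eq_cvg; apply: nearW => n; rewrite /geometric/= mul1r.
Qed.

(** By Bernoulli the behaviour is governed by u^n times the exponent, that is n (2u)^n, which tends
    to 0 for u < 1/2 and to infinity otherwise. The extra factor n in the exponent settles u = 1/2,
    where the limit is 0. *)
Definition threshold (n : nat) (u : R) : R := (1 - u ^+ n) ^+ (n * 2 ^ n).

Lemma threshold_itv n u : 0 <= u <= 1 -> 0 <= threshold n u <= 1.
Proof.
move=> /andP[u0 u1]; have h0 : 0 <= u ^+ n by exact: exprn_ge0.
have h1 : u ^+ n <= 1 by exact: exprn_ile1.
by rewrite exprn_ge0 ?subr_ge0//= exprn_ile1 ?subr_ge0// gerBl.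
Qed.

Lemma threshold_cvg u : 0 <= u <= 1 ->
  threshold n u @[n --> \oo] --> ((u < 2^-1)%R%:R : R).
Proof.
move=> u01; have /andP[u0 u1] := u01.
have w0 n : 0 <= u ^+ n <= 1 by rewrite exprn_ge0//= exprn_ile1.
have E n : (n * 2 ^ n)%N%:R * u ^+ n = n%:R * (2 * u) ^+ n :> R.
  by rewrite natrM natrX exprMn mulrA.
case: ltP => h.
  apply: (@squeeze_cvgr _ _ _ _ (fun n => 1 - n%:R * (2 * u) ^+ n) (fun=> 1)).
  - apply: nearW => n; have /andP[_ ->] := threshold_itv n u01; rewrite andbT.
    have := @Bernoulli_ge (- u ^+ n) (n * 2 ^ n); rewrite mulrN E; apply.
    by have := w0 n; lra.
  - rewrite -[X in _ --> X](subr0 (1 : R)); apply: cvgB; first exact: cvg_cst.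
    by apply: cvg_mulrn_exp; lra.
  - exact: cvg_cst.
apply: (@squeeze_cvgr _ _ _ _ (fun=> 0) (fun n => n.+1%:R^-1)).
- apply: nearW => n; have /andP[-> _] := threshold_itv n u01; rewrite /=.
  have ge : n.+1%:R <= (1 + u ^+ n) ^+ (n * 2 ^ n).
    apply: (@le_trans _ _ (1 + (n * 2 ^ n)%N%:R * u ^+ n)); last first.
      by apply: Bernoulli_ge; have := w0 n; lra.
    rewrite E -natr1 addrC lerD2l -[leLHS]mulr1 ler_wpM2l// exprn_ege1//.
    by lra.
  rewrite -[leRHS]mul1r ler_pdivlMr//.
  (* Since (1 - w)^N (1 + w)^N <= 1 for w in [0, 1], Bernoulli's lower bound on the second factor
     bounds the first from above. *)
  apply: (@le_trans _ _ (threshold n u * (1 + u ^+ n) ^+ (n * 2 ^ n))).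
    by rewrite ler_wpM2l//; have /andP[] := threshold_itv n u01.
  rewrite /threshold -exprMn; apply: exprn_ile1; have := w0 n; move: (u ^+ n) => w; nra.
- exact: cvg_cst.
- exact: cvg_harmonic.
Qed.

End ThresholdPolynomials.

(** * Continuous complex-valued functions *)

Section ComplexContinuity.
Context {R : realType} {T : topologicalType}.
Implicit Types f g : T -> R[i].

Definition ccont f := continuous (fun x => complex.Re (f x)) /\
  continuous (fun x => complex.Im (f x)).

Lemma ccont_cst (c : R[i]) : ccont (fun=> c).
Proof. by split=> x; exact: cvg_cst. Qed.

Lemma ccontD f g : ccont f -> ccont g -> ccont (fun x => f x + g x).
Proof.
move=> [f1 f2] [g1 g2]; split=> x; under eq_fun do rewrite ?ReD ?ImD.
  exact: (cvgD (f1 x) (g1 x)).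
exact: (cvgD (f2 x) (g2 x)).
Qed.

Lemma ccontM f g : ccont f -> ccont g -> ccont (fun x => f x * g x).
Proof.
move=> [f1 f2] [g1 g2]; split=> x; under eq_fun do rewrite ?ReM ?ImM.
  exact: (cvgB (cvgM (f1 x) (g1 x)) (cvgM (f2 x) (g2 x))).
exact: (cvgD (cvgM (f1 x) (g2 x)) (cvgM (f2 x) (g1 x))).
Qed.

Lemma ccontX f n : ccont f -> ccont (fun x => f x ^+ n).
Proof.
move=> cf; elim: n => [|n IH]; first exact: ccont_cst.
by under [fun _ => _]eq_fun do rewrite exprS; exact: ccontM.
Qed.

Lemma ccont_conj f : ccont f -> ccont (fun x => (f x)^*).
Proof.
move=> [f1 f2]; split=> x.
  by rewrite (_ : (fun _ => _) = (fun x => complex.Re (f x)));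
    [case: (f x) (f1 x)|apply/funext => y; case: (f y)].
rewrite (_ : (fun _ => _) = (fun x => - complex.Im (f x))).
  by apply: cvgN; exact: f2.
by apply/funext => y; case: (f y).
Qed.

End ComplexContinuity.

(** * Polynomials in z, its conjugate and e^{i theta} *)

Section TensorPolynomials.
Context {R : realType}.
Local Notation mR := (measurableTypeR R).
Local Notation term := (R[i] * (nat * nat) * int)%type.

Definition zc (x : R * R) : R[i] := x.1 +i* x.2.

Definition tmono (a b : nat) (k : int) (p : (R * R) * R) : R[i] :=
  zc p.1 ^+ a * conjc (zc p.1) ^+ b * expi (k%:~R * p.2).

Definition teval (s : seq term) (p : (R * R) * R) : R[i] :=
  \sum_(t <- s) t.1.1 * tmono t.1.2.1 t.1.2.2 t.2 p.

Lemma expiD (x y : R) : expi (x + y) = expi x * expi y.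
Proof.
apply/eqP; rewrite eq_complex /= cosD sinD; apply/andP; split; apply/eqP => //.
by rewrite addrC; congr (_ + _); rewrite mulrC.
Qed.

Lemma expi0 : expi (0 : R) = 1.
Proof. by rewrite /expi cos0 sin0. Qed.

Lemma expiN (x : R) : expi (- x) = (expi x)^*.
Proof. by rewrite /expi cosN sinN. Qed.

Lemma expi2pi (x : R) : expi (x + pi *+ 2) = expi x.
Proof. by rewrite /expi cosD2pi sinD2pi. Qed.

Lemma expi_2pik (k : int) (x : R) : expi (k%:~R * (x + pi *+ 2)) = expi (k%:~R * x).
Proof.
rewrite mulrDr expiD [X in _ * X](_ : _ = 1) ?mulr1//.
have H (n : nat) : expi (n%:R * (pi *+ 2)) = 1 :> R[i].
  elim: n => [|n IH]; first by rewrite mul0r expi0.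
  by rewrite -natr1 mulrDl mul1r expi2pi.
case: k => n; first exact: H.
by rewrite NegzE intrN mulNr expiN (H n.+1) conjc1.
Qed.

Lemma tmonoM a b k a' b' k' p :
  tmono a b k p * tmono a' b' k' p = tmono (a + a') (b + b') (k + k') p.
Proof.
rewrite /tmono intrD mulrDl expiD !exprD.
by rewrite mulrACA; congr (_ * _); rewrite mulrACA.
Qed.

Definition term_mul (t u : term) : term :=
  (t.1.1 * u.1.1, ((t.1.2.1 + u.1.2.1)%N, (t.1.2.2 + u.1.2.2)%N), t.2 + u.2).

Lemma teval_cat s t p : teval (s ++ t) p = teval s p + teval t p.
Proof. by rewrite /teval big_cat. Qed.

Lemma tevalM s t p : teval s p * teval t p =
  teval [seq term_mul x y | x <- s, y <- t] p.
Proof.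
rewrite /teval big_allpairs_dep mulr_suml; apply: eq_bigr => x _.
rewrite mulr_sumr; apply: eq_bigr => y _.
by rewrite /= -tmonoM; ring.
Qed.

Definition tscale (c : R[i]) (s : seq term) : seq term :=
  [seq (c * t.1.1, t.1.2, t.2) | t <- s].

Lemma teval_scale c s p : teval (tscale c s) p = c * teval s p.
Proof.
by rewrite /teval big_map mulr_sumr; apply: eq_bigr => t _; rewrite mulrA.
Qed.

Lemma ccont_zc {T : topologicalType} (f : T -> R * R) : continuous f ->
  ccont (fun p => zc (f p)).
Proof.
move=> cf; split=> p.
  by apply: (@continuous_comp _ _ _ f fst); [exact: cf|exact: cvg_fst].
by apply: (@continuous_comp _ _ _ f snd); [exact: cf|exact: cvg_snd].
Qed.

Lemma ccont_expi {T : topologicalType} (f : T -> R) : continuous f ->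
  ccont (fun p => expi (f p)).
Proof.
move=> cf; split=> p.
  by apply: (@continuous_comp _ _ _ f cos); [exact: cf|exact: continuous_cos].
by apply: (@continuous_comp _ _ _ f sin); [exact: cf|exact: continuous_sin].
Qed.

Lemma ccont_tmono a b k : ccont (tmono a b k).
Proof.
have c1 : ccont (fun p : (R * R) * R => zc p.1).
  by apply: ccont_zc => p; exact: cvg_fst.
apply: ccontM; last first.
  by apply: ccont_expi => p; apply: cvgMl_tmp; exact: cvg_snd.
by apply: ccontM; apply: ccontX => //; exact: ccont_conj.
Qed.

Lemma ccont_teval s : ccont (teval s).
Proof.
elim: s => [|t s IH].
  rewrite (_ : teval [::] = fun=> 0); first exact: ccont_cst.
  by apply/funext => p; rewrite /teval big_nil.
rewrite (_ : teval (t :: s) =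
  fun p => t.1.1 * tmono t.1.2.1 t.1.2.2 t.2 p + teval s p); last first.
  by apply/funext => p; rewrite /teval big_cons.
apply: ccontD => //; apply: ccontM; first exact: ccont_cst.
exact: ccont_tmono.
Qed.

Lemma teval_periodic s x : periodic (fun t => teval s (x, t)) (pi *+ 2).
Proof.
by move=> t; apply: eq_bigr => y _; rewrite /tmono/= expi_2pik.
Qed.

Lemma continuousSM_teval s : continuousSM (teval s).
Proof. by have [c1 c2] := ccont_teval s; split=> // x; exact: teval_periodic. Qed.

Lemma continuousSM_tmono c a b k : continuousSM (fun p => c * tmono a b k p).
Proof.
rewrite (_ : (fun _ => _) = teval [:: (c, (a, b), k)]); first exact: continuousSM_teval.
by apply/funext => p; rewrite /teval big_seq1.
Qed.

(** The real-valued members of the span. Thresholds compose real functions, and this algebra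
    contains the coordinates and the cosine and sine of the angle. *)
Definition treal (phi : (R * R) * R -> R) := exists s, forall p, (phi p)%:C = teval s p.

Lemma trealD phi psi : treal phi -> treal psi -> treal (fun p => phi p + psi p).
Proof.
by move=> [s Hs] [t Ht]; exists (s ++ t) => p; rewrite teval_cat -Hs -Ht rmorphD.
Qed.

Lemma trealM phi psi : treal phi -> treal psi -> treal (fun p => phi p * psi p).
Proof.
move=> [s Hs] [t Ht]; exists [seq term_mul x y | x <- s, y <- t] => p.
by rewrite -tevalM -Hs -Ht rmorphM.
Qed.

Lemma treal_cst c : treal (fun=> c).
Proof.
exists [:: (c%:C, (0, 0)%N, 0)] => p.
by rewrite /teval big_seq1 /tmono/= !expr0 mul0r expi0 !mulr1.
Qed.

Lemma trealX phi n : treal phi -> treal (fun p => phi p ^+ n).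
Proof.
move=> h; elim: n => [|n IH]; first exact: treal_cst.
by under [fun _ => _]eq_fun do rewrite exprS; exact: trealM.
Qed.

Lemma trealB phi psi : treal phi -> treal psi -> treal (fun p => phi p - psi p).
Proof.
move=> h1 h2; under [fun _ => _]eq_fun do rewrite -mulN1r.
by apply: trealD => //; apply: trealM => //; exact: treal_cst.
Qed.

Lemma treal_x : treal (fun p => p.1.1).
Proof.
exists [:: ((2^-1)%:C, (1, 0)%N, 0); ((2^-1)%:C, (0, 1)%N, 0)] => -[[x y] t].
rewrite /teval big_cons big_seq1 /tmono/= !expr0 !expr1 mul0r expi0 !mulr1 mul1r.
by apply/eqP; rewrite eq_complex /=; apply/andP; split; apply/eqP; field.
Qed.

Lemma treal_y : treal (fun p => p.1.2).
Proof.
exists [:: (0 -i* 2^-1, (1, 0)%N, 0); (0 +i* 2^-1, (0, 1)%N, 0)] => -[[x y] t].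
rewrite /teval big_cons big_seq1 /tmono/= !expr0 !expr1 mul0r expi0 !mulr1 mul1r.
by apply/eqP; rewrite eq_complex /=; apply/andP; split; apply/eqP; field.
Qed.

Lemma treal_cos : treal (fun p => cos p.2).
Proof.
exists [:: ((2^-1)%:C, (0, 0)%N, 1); ((2^-1)%:C, (0, 0)%N, -1)] => -[x t].
rewrite /teval big_cons big_seq1 /tmono/= !expr0 !mul1r mulrN1z mulN1r.
rewrite expiN /expi.
by apply/eqP; rewrite eq_complex /=; apply/andP; split; apply/eqP; field.
Qed.

Lemma treal_sin : treal (fun p => sin p.2).
Proof.
exists [:: (0 -i* 2^-1, (0, 0)%N, 1); (0 +i* 2^-1, (0, 0)%N, -1)] => -[x t].
rewrite /teval big_cons big_seq1 /tmono/= !expr0 !mul1r mulrN1z mulN1r.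
rewrite expiN /expi.
by apply/eqP; rewrite eq_complex /=; apply/andP; split; apply/eqP; field.
Qed.

Lemma treal_threshold n phi : treal phi -> treal (fun p => threshold n (phi p)).
Proof.
move=> h; apply: trealX; apply: trealB; first exact: treal_cst.
exact: trealX.
Qed.

End TensorPolynomials.

(** * Totality of the monomials in L^2(SM) *)

Section TensorDensity.
Context {R : realType}.
Local Notation mR := (measurableTypeR R).
Local Notation T3 := (mR * mR * mR)%type.

(** The angles 0 and 2pi are removed: they are the same point of the circle, so no trigonometric
    polynomial separates them, and the two slices are null. *)
Let D0 : set T3 := (M : set (mR * mR)) `*` `]0, pi *+ 2[%classic.

Let mD0 : measurable D0.
Proof. by apply: measurableX; [exact: measurable_M|exact: measurable_itv]. Qed.

Let N0 : set T3 := (M : set (mR * mR)) `*` ([set 0] `|` [set pi *+ 2]).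

Let mN0 : measurable N0.
Proof. by apply: measurableX; [exact: measurable_M|apply: measurableU]. Qed.

Let N0_null : leb3 N0 = 0%E.
Proof.
rewrite leb3X; [|exact: measurable_M|exact: measurableU].
rewrite (_ : leb1 _ = 0%E) ?mule0//.
apply/eqP; rewrite eq_le measure_ge0 andbT.
apply: (le_trans (measureU2 _ _ _)) => //.
by rewrite [X in (X + _)%E]lebesgue_measure_set1 [X in (_ + X)%E]lebesgue_measure_set1 adde0.
Qed.

Let SMD0 : (SM : set T3) `\` N0 = D0.
Proof.
apply/seteqP; split => -[x t] /=; rewrite /D0 /N0 /SM /circle/= in_itv/=.
  move=> [[xM /andP[t0 t1]] nN]; split=> //.
  rewrite !lt_neqAle t0 t1 !andbT; apply/andP; split; apply/eqP => tE; apply: nN; split=> //.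
    by left.
  by right.
move=> [xM /andP[t0 t1]]; split; first by rewrite !ltW.
by move=> [_ [] /= tE]; move: t0 t1; rewrite tE ltxx.
Qed.

Let D0SM : D0 `<=` SM.
Proof. by rewrite -SMD0; exact: subDsetl. Qed.

Let clip (l r x : R) := Num.max l (Num.min x r).

Let clip_itv l r x : l <= r -> l <= clip l r x <= r.
Proof.
move=> lr; rewrite /clip; case: (leP x r) => h1; case: (leP l x) => h2.
all: by rewrite ?lexx ?lr ?h1 ?h2 // ?maxEle ?h2 ?lr ?lexx //; case: ifP; lra.
Qed.

Let lt_clip l r (x y : R) : l <= r -> l < y < r -> (y < clip l r x) = (y < x).
Proof.
move=> lr /andP[h1 h2]; rewrite /clip lt_max lt_min h2 andbT.
by rewrite (_ : y < l = false)//; apply/negbTE; rewrite -leNgt ltW.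
Qed.

(** The arc from 0 to tau is centred at tau/2, so membership is a comparison of cosines of distances
    to the centre. This turns a half-line condition on the angle into a condition on a trigonometric
    polynomial. *)
Let arc (tau t : R) : 0 <= tau <= pi *+ 2 -> 0 < t < pi *+ 2 ->
  (t < tau) = (cos (tau / 2) < cos (t - tau / 2)).
Proof.
move=> /andP[tau0 tau2] /andP[t0 t2]; have p0 := @pi_gt0 R.
have hpi : tau / 2 \in `[0, pi] by rewrite in_itv/=; apply/andP; split; lra.
case: (ltP t (tau / 2)) => h.
  have -> : cos (t - tau / 2) = cos (tau / 2 - t) by rewrite -cosN opprB.
  rewrite ltr_cos// ?in_itv/=; last by apply/andP; split; lra.
  by apply/idP/idP => ?; lra.
case: (leP (t - tau / 2) pi) => h2.
  rewrite ltr_cos// ?in_itv/=; last by apply/andP; split; lra.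
  by apply/idP/idP => ?; lra.
have -> : cos (t - tau / 2) = cos (pi *+ 2 - (t - tau / 2)).
  by rewrite -[RHS]cosN opprB -(cosD2pi (t - tau / 2 - pi *+ 2)) subrK.
rewrite ltr_cos// ?in_itv/=; last by apply/andP; split; lra.
by apply/idP/idP => ?; lra.
Qed.

Section Annihilated.
Variable H : T3 -> R.
Hypothesis iH : leb3.-integrable SM (EFin \o H).
Hypothesis annH : forall phi, treal phi -> Rintegral leb3 SM (fun p => H p * phi p) = 0.

Let iH0 : leb3.-integrable D0 (EFin \o H).
Proof. exact: (integrableS measurable_SM mD0 D0SM iH). Qed.

Let mH0 : measurable_fun D0 H.
Proof. by apply/measurable_EFinP; exact: (measurable_int leb3). Qed.

Let mtreal (phi : T3 -> R) (D : set T3) : treal phi -> measurable_fun D phi.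
Proof.
move=> [s Hs]; apply: measurable_funTS; apply: continuous_measurable3.
have [c _] := ccont_teval s.
have E : phi = (fun p => complex.Re (teval s p)) by apply/funext => p; rewrite -Hs.
by rewrite E; exact: c.
Qed.

Let intD0 (phi : T3 -> R) : treal phi -> (forall p, SM p -> `|phi p| <= 1) ->
  (\int[leb3]_(p in D0) (H p * phi p)%:E = 0)%E.
Proof.
move=> tphi phi1.
have ip : leb3.-integrable SM (EFin \o (fun p => H p * phi p)).
  apply: (le_integrable measurable_SM _ _ iH).
    apply/measurable_EFinP; apply: measurable_funM; last exact: mtreal.
    by apply/measurable_EFinP; exact: (measurable_int leb3).
  move=> p pSM /=; rewrite lee_fin normrM.
  by rewrite -[leRHS]mulr1 ler_wpM2l// phi1.
rewrite -SMD0 -(negligible_integral mN0 measurable_SM ip N0_null).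
rewrite -[LHS]fineK; last by apply: integrable_fin_num => //; exact: measurable_SM.
by congr EFin; exact: annH.
Qed.

Let X (p : T3) : mR := p.1.1.
Let Y (p : T3) : mR := p.1.2.
Let Th (p : T3) : mR := p.2.

Let mX : measurable_fun setT X. Proof. exact: measurableT_comp. Qed.
Let mY : measurable_fun setT Y. Proof. exact: measurableT_comp. Qed.
Let mTh : measurable_fun setT Th. Proof. exact: measurable_snd. Qed.

Let ray (a : R) : set mR := `]-oo, a[%classic.

Let D0_itv p : D0 p -> [/\ -1 < X p < 1, -1 < Y p < 1 & 0 < Th p < pi *+ 2].
Proof.
move=> [/= xM]; rewrite in_itv/= => th; split=> //; rewrite /X/Y; move: xM; rewrite /M/=.
  by have := sqr_ge0 p.1.2; rewrite !expr2 => h1 h2; apply/andP; split; nra.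
by have := sqr_ge0 p.1.1; rewrite !expr2 => h1 h2; apply/andP; split; nra.
Qed.

(** Products of thresholds are polynomials bounded by 1 that converge on [D0] to the indicator of
    the product of three half-lines; dominated convergence by [|H|] concludes. *)
Let base (a b c : R) :
  (\int[leb3]_(p in D0 `&` (X @^-1` ray a `&` (Y @^-1` ray b `&` Th @^-1` ray c)))
     (H p)%:E = 0)%E.
Proof.
pose a' := clip (-1) 1 a; pose b' := clip (-1) 1 b; pose c' := clip 0 (pi *+ 2) c.
have l11 : -1 <= 1 :> R by lra.
have l0p : 0 <= pi *+ 2 :> R by have := @pi_gt0 R; lra.
have a11 := clip_itv a l11; have b11 := clip_itv b l11; have c11 := clip_itv c l0p.
(* Each function stays in [0, 1], as the differences involved are at most 2 in absolute value, and
   it crosses 1/2 exactly at the desired half-line. *)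
pose ux (p : T3) : R := 2^-1 + (p.1.1 - a') / 4.
pose uy (p : T3) : R := 2^-1 + (p.1.2 - b') / 4.
pose ut (p : T3) : R := 2^-1 + (cos (c' / 2) - cos (p.2 - c' / 2)) / 4.
have tux : treal ux.
  apply: trealD; first exact: treal_cst.
  by apply: trealM; [apply: trealB; [exact: treal_x|exact: treal_cst]|exact: treal_cst].
have tuy : treal uy.
  apply: trealD; first exact: treal_cst.
  by apply: trealM; [apply: trealB; [exact: treal_y|exact: treal_cst]|exact: treal_cst].
have tut : treal ut.
  apply: trealD; first exact: treal_cst.
  apply: trealM; last exact: treal_cst.
  apply: trealB; first exact: treal_cst.
  under [fun _ => _]eq_fun do rewrite cosB.
  by apply: trealD; apply: trealM; [exact: treal_cos|exact: treal_cst
    |exact: treal_sin|exact: treal_cst].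
pose phi n (p : T3) := threshold n (ux p) * (threshold n (uy p) * threshold n (ut p)).
have tphi n : treal (phi n).
  by apply: trealM; [|apply: trealM]; exact: treal_threshold.
have u01 p : SM p -> [/\ 0 <= ux p <= 1, 0 <= uy p <= 1 & 0 <= ut p <= 1].
  move=> [/= pM _]; have [h1 h2] : -1 <= p.1.1 <= 1 /\ -1 <= p.1.2 <= 1.
    have := sqr_ge0 p.1.2; have := sqr_ge0 p.1.1; move: pM; rewrite /M/= !expr2.
    by move=> h1 h2 h3; split; apply/andP; split; nra.
  have h3 := cos_geN1 (c' / 2); have h4 := cos_le1 (c' / 2).
  have h5 := cos_geN1 (p.2 - c' / 2); have h6 := cos_le1 (p.2 - c' / 2).
  by rewrite /ux /uy /ut -/a' -/b' in a11 b11 *; split; apply/andP; split; lra.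
have phi1 n p : SM p -> `|phi n p| <= 1.
  move=> /u01[/(threshold_itv n)/andP[x0 x1] /(threshold_itv n)/andP[y0 y1]
    /(threshold_itv n)/andP[t0 t1]].
  rewrite /phi ger0_norm ?mulr_ge0//.
  by rewrite mulr_ile1 ?mulr_ge0// mulr_ile1.
set P := X @^-1` ray a `&` _.
have mP : measurable P.
  have h (f : T3 -> mR) r : measurable_fun setT f -> measurable (f @^-1` ray r).
    by move=> mf; rewrite -[X in measurable X]setTI; apply: mf => //; exact: measurable_itv.
  by apply: measurableI; [exact: h|apply: measurableI; exact: h].
rewrite integral_mkcondr.
have lim p : D0 p -> (H p * phi n p)%:E @[n --> \oo] --> ((fun p => (H p)%:E) \_ P) p.
  move=> D0p; have [Xp Yp Tp] := D0_itv D0p.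
  have [ux1 uy1 ut1] := u01 _ (D0SM D0p).
  have -> : ((fun p => (H p)%:E) \_ P) p =
     (H p * ((ux p < 2^-1)%R%:R * ((uy p < 2^-1)%R%:R * (ut p < 2^-1)%R%:R)))%:E.
    have -> : (ux p < 2^-1) = (X p < a).
      by rewrite -(lt_clip a l11 Xp) -/a' /ux /X; apply/idP/idP; lra.
    have -> : (uy p < 2^-1) = (Y p < b).
      by rewrite -(lt_clip b l11 Yp) -/b' /uy /Y; apply/idP/idP; lra.
    have -> : (ut p < 2^-1) = (Th p < c).
      by rewrite -(lt_clip c l0p Tp) -/c' (arc c11 Tp) /ut; apply/idP/idP; lra.
    rewrite patchE; have -> : (p \in P) = [&& X p < a, Y p < b & Th p < c].
      apply/idP/idP; rewrite inE /P/= /ray/= !in_itv/=; first by move=> [-> [-> ->]].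
      by move=> /and3P[-> -> ->].
    by case: (X p < a) => /=; case: (Y p < b) => /=; case: (Th p < c) => /=;
      rewrite ?mul1r ?mulr1 ?mul0r ?mulr0.
  apply: cvg_EFin; first exact: nearW.
  apply: cvgMl_tmp; apply: cvgM; first exact: threshold_cvg.
  by apply: cvgM; exact: threshold_cvg.
have mfn n : measurable_fun D0 (fun p => (H p * phi n p)%:E).
  by apply/measurable_EFinP; apply: measurable_funM => //; exact: mtreal.
have mf : measurable_fun D0 ((fun p => (H p)%:E) \_ P).
  apply/(measurable_restrict _ mP mD0); apply: (measurable_funS mD0) => //.
  exact/measurable_EFinP.
have dom n p : D0 p -> (`|(H p * phi n p)%:E| <= `|(H p)%:E|)%E.
  move=> D0p; rewrite lee_fin normrM -[leRHS]mulr1 ler_wpM2l//.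
  by apply: phi1; exact: D0SM.
have [_ _] := dominated_convergence mD0 mfn mf (aeW _ lim)
  (integrable_abse iH0) (aeW _ (fun p n => dom n p)).
rewrite (_ : [sequence _]_n = fun=> 0%E).
  by move=> /(cvg_unique _ (cvg_cst _)) <-.
by apply/funext => n /=; apply: intD0 => //; exact: phi1.
Qed.

(** Half-lines are replaced by Borel sets one coordinate at a time. *)
Let SMint0 (A B C : set mR) : measurable A -> measurable B -> measurable C ->
  (\int[leb3]_(p in D0 `&` ((A `*` B) `*` C)) (H p)%:E = 0)%E.
Proof.
move=> mA mB mC.
have GI : setI_closed (@RGenInftyO.G R).
  move=> _ _ [x ->] [y ->]; exists (Num.min x y).
  by apply/seteqP; split => t /=; rewrite !in_itv/= lt_min; [move=> [-> ->]|move/andP].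
have GE : @measurable _ mR = <<s @RGenInftyO.G R >> by exact: RGenInftyO.measurableE.
have mpre (f : T3 -> mR) S : measurable_fun setT f -> measurable S -> measurable (f @^-1` S).
  by move=> mf mS; rewrite -[X in measurable X]setTI; apply: mf.
have mray r : measurable (ray r) by exact: measurable_itv.
have iS (S : set T3) : measurable S -> leb3.-integrable (D0 `&` S) (EFin \o H).
  by move=> mS; apply: (integrableS mD0) => //; exact: measurableI.
(* A half-line containing the whole range of the coordinate imposes nothing; it yields the total
   integral that [dynkin_integral_eq0] asks for. *)
have full (f : T3 -> mR) r (S : set T3) : (forall p, D0 p -> f p < r) ->
    D0 `&` (f @^-1` ray r `&` S) = D0 `&` S.
  move=> fr; apply/seteqP; split => p [D0p]; first by move=> [].
  by move=> Sp; do 2!split=> //; rewrite /ray/= in_itv/= fr.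
have X2 p : D0 p -> X p < 2 by move=> /D0_itv[h _ _]; lra.
have Y2 p : D0 p -> Y p < 2 by move=> /D0_itv[_ h _]; lra.
have Th2 p : D0 p -> Th p < pi *+ 2 by move=> /D0_itv[_ _ /andP[]].
have s1 A' b c : measurable A' ->
    (\int[leb3]_(p in D0 `&` (X @^-1` A' `&` (Y @^-1` ray b `&` Th @^-1` ray c))) (H p)%:E = 0)%E.
  move=> mA'; rewrite (setIC (X @^-1` A')) setIA.
  have mS : measurable (Y @^-1` ray b `&` Th @^-1` ray c).
    by apply: measurableI; exact: mpre.
  apply: (dynkin_integral_eq0 (measurableI _ _ mD0 mS) (iS _ mS) mX GE GI) => //.
    by rewrite -(full X 2)//; exact: base.
  move=> _ [a ->]; rewrite -(base a b c).
  by congr (integral _ _ _); apply/seteqP; split=> p /=; tauto.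
have s2 A' B' c : measurable A' -> measurable B' ->
    (\int[leb3]_(p in D0 `&` (Y @^-1` B' `&` (X @^-1` A' `&` Th @^-1` ray c))) (H p)%:E = 0)%E.
  move=> mA' mB'; rewrite (setIC (Y @^-1` B')) setIA.
  have mS : measurable (X @^-1` A' `&` Th @^-1` ray c).
    by apply: measurableI; exact: mpre.
  apply: (dynkin_integral_eq0 (measurableI _ _ mD0 mS) (iS _ mS) mY GE GI) => //.
    rewrite -(full Y 2)// -(s1 A' 2 c mA').
    by congr (integral _ _ _); apply/seteqP; split=> p /=; tauto.
  move=> _ [b ->]; rewrite -(s1 A' b c mA').
  by congr (integral _ _ _); apply/seteqP; split=> p /=; tauto.
rewrite (_ : (A `*` B) `*` C = (Y @^-1` B `&` X @^-1` A) `&` Th @^-1` C); last first.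
  by apply/seteqP; split => -[[x y] t] /=; rewrite /X/Y/Th/=; tauto.
rewrite setIA.
have mS : measurable (Y @^-1` B `&` X @^-1` A) by apply: measurableI; exact: mpre.
apply: (dynkin_integral_eq0 (measurableI _ _ mD0 mS) (iS _ mS) mTh GE GI) => //.
  rewrite -(full Th (pi *+ 2))// -(s2 A B (pi *+ 2) mA mB).
  by congr (integral _ _ _); apply/seteqP; split=> p /=; tauto.
move=> _ [c ->]; rewrite -(s2 A B c mA mB).
by congr (integral _ _ _); apply/seteqP; split=> p /=; tauto.
Qed.

Lemma annihilated_ae_eq0 : ae_eq leb3 SM H (fun=> 0).
Proof.
pose G2 : set (set (mR * mR)) := [set A1 `*` A2 | A1 in measurable & A2 in measurable].
pose G3 : set (set T3) := [set A1 `*` A2 | A1 in measurable & A2 in measurable].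
have GI2 : setI_closed G2.
  move=> _ _ [A mA [B mB <-]] [A' mA' [B' mB' <-]]; rewrite -setXI.
  by exists (A `&` A'); [exact: measurableI|exists (B `&` B') => //; exact: measurableI].
have GI3 : setI_closed G3.
  move=> _ _ [A mA [B mB <-]] [A' mA' [B' mB' <-]]; rewrite -setXI.
  by exists (A `&` A'); [exact: measurableI|exists (B `&` B') => //; exact: measurableI].
have GE2 : @measurable _ (mR * mR)%type = <<s G2 >> by exact: measurable_prod_measurableType.
have GE3 : @measurable _ T3 = <<s G3 >> by exact: measurable_prod_measurableType.
have D0T : (\int[leb3]_(p in D0) (H p)%:E = 0)%E.
  by rewrite -(SMint0 measurableT measurableT measurableT) !setXTT setIT.
have s4 (E : set (mR * mR)) (C : set mR) : measurable E -> measurable C ->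
    (\int[leb3]_(p in D0 `&` (E `*` C)) (H p)%:E = 0)%E.
  move=> mE mC.
  have mTC : measurable (Th @^-1` C) by rewrite -[X in measurable X]setTI; exact: mTh.
  have -> : D0 `&` (E `*` C) = (D0 `&` Th @^-1` C) `&` fst @^-1` E.
    by apply/seteqP; split => -[x t] /=; rewrite /Th/=; tauto.
  apply: (dynkin_integral_eq0 _ _ (_ : measurable_fun setT fst) GE2 GI2) => //.
  - exact: measurableI.
  - by apply: (integrableS mD0) => //; exact: measurableI.
  - rewrite -(SMint0 measurableT measurableT mC); congr (integral _ _ _).
    by apply/seteqP; split => -[[x y] t] /=; rewrite /Th/=; tauto.
  - move=> _ [A mA [B mB <-]]; rewrite -(SMint0 mA mB mC); congr (integral _ _ _).
    by apply/seteqP; split => -[[x y] t] /=; rewrite /Th/=; tauto.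
have aeD0 : ae_eq leb3 D0 (EFin \o H) (fun=> 0%E).
  apply: integral_ae_eq => // E ED0 mE; rewrite integral0.
  rewrite -[E](setIidr ED0) -[E in D0 `&` E]preimage_id.
  apply: (dynkin_integral_eq0 mD0 iH0 _ GE3 GI3) => //.
  by move=> _ [A mA [B mB <-]]; exact: s4.
have aeN : {ae leb3, forall p, ~ N0 p}.
  by exists N0; split=> // p /=; exact: contrapT.
apply: filterS2 aeD0 aeN => p hp nN pSM.
have : D0 p by rewrite -SMD0.
by move=> /hp [].
Qed.

End Annihilated.

(** [rip] is real, so the arbitrary [c] in the hypothesis is what separates the real and imaginary
    parts of [h]: the first is tested against [teval s], the second against its multiple by i. *)
Lemma tensor_total (h : T3 -> R[i]) : L2 leb3 SM h ->
  (forall c a b k, rip leb3 SM h (fun p => c * tmono a b k p) = 0) ->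
  ae_eq leb3 SM h (fun=> 0).
Proof.
move=> Lh hmono.
have hs s : rip leb3 SM h (teval s) = 0.
  elim: s => [|t s IH].
    rewrite ripC (@eq_rip _ _ _ _ _ _ (fun=> 0) h h) ?rip0l//; first exact: measurable_SM.
    by move=> p _; rewrite /teval big_nil.
  have -> : teval (t :: s) =
      (fun p => t.1.1 * tmono t.1.2.1 t.1.2.2 t.2 p + teval s p).
    by apply/funext => p; rewrite /teval big_cons.
  rewrite ripDr ?IH ?hmono ?addr0//; [exact: measurable_SM| |].
    by apply: continuousSM_L2; exact: continuousSM_tmono.
  by apply: continuousSM_L2; exact: continuousSM_teval.
have L1c : L2 leb3 (SM : set T3) (fun=> 1).
  apply: (@L2_bounded _ _ _ _ _ measurable_SM _ 1); first exact: leb3_SM_lty.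
    exact: cmeas_cst.
  by move=> p _; rewrite /dotc/= mulr1 mulr0 addr0.
have Lic : L2 leb3 (SM : set T3) (fun=> 'i).
  apply: (@L2_bounded _ _ _ _ _ measurable_SM _ 1); first exact: leb3_SM_lty.
    exact: cmeas_cst.
  by move=> p _; rewrite /dotc/= mulr1 mulr0 add0r.
have aeRe : ae_eq leb3 SM (fun p => complex.Re (h p)) (fun=> 0).
  apply: annihilated_ae_eq0.
    have := L2_dot measurable_SM Lh L1c; congr (integrable _ _ _).
    by apply/funext => p /=; rewrite /dotc/= mulr1 mulr0 addr0.
  move=> phi [s Hs]; rewrite -(hs s); apply: eq_Rintegral => p _.
  by rewrite /dotc -Hs/= mulr0 addr0.
have aeIm : ae_eq leb3 SM (fun p => complex.Im (h p)) (fun=> 0).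
  apply: annihilated_ae_eq0.
    have := L2_dot measurable_SM Lh Lic; congr (integrable _ _ _).
    by apply/funext => p /=; rewrite /dotc/= mulr1 mulr0 add0r.
  move=> phi [s Hs]; rewrite -(hs (tscale 'i s)); apply: eq_Rintegral => p _.
  by rewrite /dotc teval_scale -Hs/= !mul0r !mulr0 subrr mulr0 add0r mul1r add0r.
apply: filterS2 aeRe aeIm => p hRe hIm pSM.
by move: (hRe pSM) (hIm pSM); case: (h p) => x y /= -> ->.
Qed.

End TensorDensity.

(** * Integrals that vanish slice by slice *)

Section FubiniZero.
Context {d1 d2} {T1 : measurableType d1} {T2 : measurableType d2} {R : realType}.
Variables (m1 : {sigma_finite_measure set T1 -> \bar R})
  (m2 : {sigma_finite_measure set T2 -> \bar R}).

(** The inner integral only has to vanish on integrable slices; almost every slice is one. *)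
Lemma Rintegral_fubini_eq0 (D1 : set T1) (D2 : set T2) (f : T1 * T2 -> R) :
  measurable D1 -> measurable D2 ->
  (m1 \x m2)%E.-integrable (D1 `*` D2) (EFin \o f) ->
  {ae m1, forall x, D1 x -> m2.-integrable D2 (fun y => (f (x, y))%:E) ->
     Rintegral m2 D2 (fun y => f (x, y)) = 0} ->
  Rintegral (m1 \x m2)%E (D1 `*` D2) f = 0.
Proof.
move=> mD1 mD2 fi h0.
have mX := measurableX mD1 mD2.
have fi' : (m1 \x m2)%E.-integrable setT ((EFin \o f) \_ (D1 `*` D2)).
  exact: (integrable_mkcond _ mX).1.
rewrite /Rintegral integral_mkcond -(integral12_prod_meas1 fi').
rewrite (_ : integral _ _ _ = 0%E)//.
transitivity (\int[m1]_x (fun=> 0%E) x)%E; last exact: integral0.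
apply: ae_eq_integral => //; first exact: measurable_fubini_F fi'.
apply: filterS2 h0 (ae_integrable1 fi') => x hx ix _.
have [xD|xD] := boolP (x \in D1); last first.
  rewrite /fubini_F; apply: integral0_eq => y _.
  by rewrite patchE in_setX (negbTE xD).
have E : (fun y => ((EFin \o f) \_ (D1 `*` D2)) (x, y)) = (fun y => (f (x, y))%:E) \_ D2.
  by apply/funext => y; rewrite !patchE in_setX xD.
have ixD : m2.-integrable D2 (fun y => (f (x, y))%:E).
  by apply/(integrable_mkcond _ mD2); rewrite -E.
rewrite /fubini_F E -integral_mkcond.
rewrite -[LHS]fineK; last exact: integrable_fin_num.
by congr EFin; apply: hx => //; rewrite inE in xD.
Qed.

End FubiniZero.

(** * Orthogonality of angular modes *)

Section Modes.
Context {R : realType}.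
Local Notation mR := (measurableTypeR R).
Local Notation T2 := (mR * mR)%type.
Local Notation T3 := (mR * mR * mR)%type.

Lemma integrable_fst (F : T2 -> R) : leb2.-integrable M (EFin \o F) ->
  leb3.-integrable SM (fun p : T3 => (F p.1)%:E).
Proof.
move=> iF; have mF : measurable_fun M F.
  by apply/measurable_EFinP; exact: (measurable_int leb2).
have mM := @measurable_M R.
have mFr : measurable_fun setT (F \_ M) by exact/(measurable_restrictT _ mM).
have mSMF : measurable_fun (SM : set T3) (fun p : T3 => F p.1).
  apply: (measurable_comp mM) => //; last exact: measurable_funTS.
  by move=> _ [p [pM _] <-].
apply/integrableP; split; first exact/measurable_EFinP.
pose G (p : T3) : \bar R := (`|(F \_ M) p.1|)%:E.
have mG : measurable_fun setT G.
  apply/measurable_EFinP; apply: measurableT_comp => //.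
  by apply: (measurableT_comp mFr); exact: measurable_fst.
have -> : (\int[leb3]_(x in SM) `|(F x.1)%:E| = \int[leb3]_(x in SM) G x)%E.
  apply: eq_integral => -[x t]; rewrite inE => -[/= xM _].
  by rewrite /G patchE mem_set.
rewrite (tonelliX1 sleb2 sleb1 mM measurable_circle mG) => [|p]; last by rewrite lee_fin.
have -> : (\int[sleb2]_(x in M) \int[sleb1]_(y in circle) G (x, y) =
    \int[sleb2]_(x in M) ((pi *+ 2)%:E * `|(EFin \o F) x|))%E.
  apply: eq_integral => x; rewrite inE => xM.
  rewrite /G/= integral_cst; last exact: measurable_circle.
  by rewrite patchE mem_set// muleC; congr (_ * _)%E; exact: leb1_circle.
have [_ iF2] := integrableP _ _ _ iF.
rewrite ge0_integralZl//; last 2 first.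
- by apply: measurableT_comp => //; exact/measurable_EFinP.
- by rewrite lee_fin; have := @pi_gt0 R; lra.
by rewrite lte_mul_pinfty// ?lee_fin//; have := @pi_gt0 R; lra.
Qed.

Lemma dotcM (z w e : R[i]) : dotc (z * e) (w * e) = dotc z w * dotc e e.
Proof. by case: z w e => [a b] [c d] [x y]; rewrite /dotc/=; ring. Qed.

Lemma dot_expi (x : R) : dotc (expi x) (expi x) = 1.
Proof. by rewrite /dotc /expi/= -!expr2 cos2Dsin2. Qed.

Lemma mode_L2 (u : T2 -> R[i]) k : L2 leb2 M u -> L2 leb3 SM (mode u k).
Proof.
move=> /L2P[[mu1 mu2] iu]; apply/L2P; split.
  apply: cmeasM.
    have sub : [set p.1 | p in (SM : set T3)] `<=` (M : set T2) by move=> _ [p [pM _] <-].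
    have mf : measurable_fun (SM : set T3) (fst : T3 -> T2).
      by apply: measurable_funTS; exact: measurable_fst.
    split; first exact: (measurable_comp measurable_M sub mu1 mf).
    exact: (measurable_comp measurable_M sub mu2 mf).
  have [c1 c2] : ccont (fun p : T3 => expi (k%:~R * p.2)).
    by apply: ccont_expi => p; apply: cvgMl_tmp; exact: cvg_snd.
  by split; apply: measurable_funTS; apply: continuous_measurable3.
have := integrable_fst iu; congr (integrable _ _ _).
by apply/funext => p; rewrite /mode/= dotcM dot_expi mulr1.
Qed.

Lemma Rintegral_expi (c : R[i]) (n : int) : n != 0 ->
  Rintegral leb1 (circle : set mR) (fun t => complex.Re (c * expi (n%:~R * t))) = 0.
Proof.
move=> n0; have nR : n%:~R != 0 :> R by rewrite intr_eq0.
(* A primitive: -i/n is the inverse of i n. It takes equal values at 0 and 2pi. *)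
pose F (t : R) := complex.Re (c * (0 -i* n%:~R^-1) * expi (n%:~R * t)).
have FE : F = fun t => n%:~R^-1 *
    (complex.Re c * sin (n%:~R * t) + complex.Im c * cos (n%:~R * t)).
  apply/funext => t; rewrite /F /expi !ReM ImM/=; ring.
have p0 : (0 : R) <= pi *+ 2 by have := @pi_gt0 R; lra.
have dF (t : R) : is_derive t 1 F (complex.Re (c * expi (n%:~R * t))).
  rewrite FE; apply: is_derive_eq.
  rewrite /GRing.scale/= /expi ReM/= mulr1.
  by field.
have [cE _] : ccont (fun t : R => c * expi (n%:~R * t)).
  apply: ccontM; first exact: ccont_cst.
  by apply: ccont_expi => p; apply: cvgMl_tmp; exact: cvg_id.
rewrite circleE (Rintegral_FTC p0 dF cE).
have -> : F (pi *+ 2) = F (0 + pi *+ 2) by rewrite add0r.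
by rewrite {1}/F expi_2pik /F subrr.
Qed.

Lemma dotc_mode (z w : R[i]) (k j : int) (t : R) :
  dotc (z * expi (k%:~R * t)) (w * expi (j%:~R * t)) =
  complex.Re (z * conjc w * expi ((k - j)%:~R * t)).
Proof.
rewrite intrD mulrDl expiD intrN mulNr expiN.
by case: z w => [a b] [c d]; rewrite /dotc /expi/=; ring.
Qed.

Lemma rip_mode (u v : T2 -> R[i]) (k j : int) : L2 leb2 M u -> L2 leb2 M v ->
  rip leb3 SM (mode u k) (mode v j) = (k == j)%:R * (pi *+ 2) * rip leb2 M u v.
Proof.
move=> Lu Lv.
have := L2_dot measurable_SM (mode_L2 k Lu) (mode_L2 j Lv) => iuv.
rewrite /rip; transitivity (Rintegral sleb2 M (fun x => Rintegral sleb1 circle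
    (fun t => dotc (mode u k (x, t)) (mode v j (x, t))))).
  exact: (@Rintegral_fubiniX _ _ _ _ R sleb2 sleb1 M circle
    (fun p => dotc (mode u k p) (mode v j p)) measurable_M measurable_circle iuv).
have [->|kj] := eqVneq k j.
  rewrite mul1r -RintegralZl; [|exact: measurable_M|exact: (L2_dot measurable_M Lu Lv)].
  apply: eq_Rintegral => x _.
  transitivity (Rintegral leb1 (circle : set mR) (fun=> dotc (u x) (v x))).
    by apply: eq_Rintegral => t _; rewrite /mode/= dotcM dot_expi mulr1.
  rewrite Rintegral_cst; last exact: measurable_circle.
  by rewrite leb1_circle mulrC.
rewrite mul0r mul0r; transitivity (Rintegral leb2 (M : set T2) (fun=> 0)); last first.
  by rewrite Rintegral_cst ?mul0r//; exact: measurable_M.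
apply: eq_Rintegral => x _.
rewrite -[RHS](Rintegral_expi (u x * conjc (v x)) (n := k - j)) ?subr_eq0//.
by apply: eq_Rintegral => t _; rewrite /mode/= dotc_mode.
Qed.

(** On almost every fibre, the pairing with v(x) e^{ik theta} is a real combination, with weights Re
    v(x) and Im v(x), of the two components of the k-th Fourier coefficient. Pairing with the
    constant modes 1 and i first ensures that both components are integrable there. *)
Lemma rip_harmonic0 (f : T3 -> R[i]) (v : T2 -> R[i]) (k : int) :
  L2 leb3 SM f -> L2 leb2 M v ->
  ae_eq leb2 M (angular_harmonic f k) (fun=> 0) ->
  rip leb3 SM f (mode v k) = 0.
Proof.
move=> Lf Lv f0.
have ifv := L2_dot measurable_SM Lf (mode_L2 k Lv).
pose e1 : T3 -> R[i] := mode (fun=> 1) k; pose ei : T3 -> R[i] := mode (fun=> 'i) k.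
have L1 : L2 leb2 (M : set T2) (fun=> 1).
  apply: (L2_bounded measurable_M (C := 1)); [exact: leb2_M_lty|exact: cmeas_cst|].
  by move=> x _; rewrite /dotc/= mulr1 mulr0 addr0.
have Li : L2 leb2 (M : set T2) (fun=> 'i).
  apply: (L2_bounded measurable_M (C := 1)); [exact: leb2_M_lty|exact: cmeas_cst|].
  by move=> x _; rewrite /dotc/= mulr1 mulr0 add0r.
have i1 := L2_dot measurable_SM Lf (mode_L2 k L1).
have i2 := L2_dot measurable_SM Lf (mode_L2 k Li).
pose s (F : T3 -> R) := {ae leb2, forall x, M x ->
   leb1.-integrable (circle : set mR) (fun t => (F (x, t))%:E)}.
have secP (F : T3 -> R) : leb3.-integrable SM (EFin \o F) -> s F.
  move=> iF; have mX := @measurable_SM R.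
  have iF' : (sleb2 \x sleb1)%E.-integrable setT ((EFin \o F) \_ (SM : set T3)).
    exact: (integrable_mkcond _ mX).1.
  have := @ae_integrable1 _ _ _ _ R sleb2 sleb1 _ iF'; apply: filterS => x ix xM.
  apply/(integrable_mkcond _ measurable_circle); move: ix; congr (integrable _ _ _).
  by apply/funext => t; rewrite !patchE in_setX (mem_set xM).
apply: (@Rintegral_fubini_eq0 _ _ _ _ R sleb2 sleb1 M circle
  (fun p => dotc (f p) (mode v k p)) measurable_M measurable_circle ifv).
apply: filterS3 f0 (secP _ i1) (secP _ i2) => x hx j1 j2 xM _.
have {}j1 := j1 xM; have {}j2 := j2 xM; have {}hx := hx xM.
have c0 : cintegral leb1 (circle : set mR) (fun t => f (x, t) * expi (- (k%:~R * t))) = 0.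
  move/eqP: hx; rewrite mulf_eq0 => /orP[|/eqP//]; rewrite (_ : 0 = 0%:C)//.
  by rewrite (inj_eq (@complexI R)) invr_eq0 mulrn_eq0/= gt_eqF ?pi_gt0.
move: c0 => [c1 c2].
have E1 t : dotc (f (x, t)) (mode (fun=> 1) k (x, t)) =
    complex.Re (f (x, t) * expi (- (k%:~R * t))).
  by rewrite /mode/= mul1r expiN; case: (f _) => a b; rewrite /dotc /expi/=; ring.
have E2 t : dotc (f (x, t)) (mode (fun=> 'i) k (x, t)) =
    complex.Im (f (x, t) * expi (- (k%:~R * t))).
  by rewrite /mode/= expiN; case: (f _) => a b; rewrite /dotc /expi/=; ring.
transitivity (Rintegral leb1 (circle : set mR) (fun t =>
   complex.Re (v x) * dotc (f (x, t)) (mode (fun=> 1) k (x, t)) +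
   complex.Im (v x) * dotc (f (x, t)) (mode (fun=> 'i) k (x, t)))).
  apply: eq_Rintegral => t _; rewrite E1 E2 /mode/= expiN.
  by case: (f _) (v x) => a b [c d]; rewrite /dotc /expi/=; ring.
have mc := @measurable_circle R.
rewrite RintegralD//; last 2 first.
- exact: (integrableZl mc _ j1).
- exact: (integrableZl mc _ j2).
rewrite !RintegralZl//.
under [X in _ * X + _]eq_Rintegral do rewrite E1.
under [X in _ + _ * X]eq_Rintegral do rewrite E2.
by rewrite c1 c2 !mulr0 addr0.
Qed.

End Modes.

(** * Flat functions on the line *)

Section FlatFunctions.
Context {R : realType}.

(* Powers of [x^-1] times [exp (- 1 / x)], a family closed under differentiation. *)
Definition flat (j : nat) (x : R) : R :=
  if 0 < x then x^-1 ^+ j * expR (- x^-1) else 0.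

Lemma flat0 j x : x <= 0 -> flat j x = 0.
Proof. by move=> x0; rewrite /flat ltNge x0. Qed.

Lemma flat_ge0 j x : 0 <= flat j x.
Proof.
rewrite /flat; case: ifPn => // x0.
by rewrite mulr_ge0 ?expR_ge0// exprn_ge0// invr_ge0 ltW.
Qed.

(** From 1 + y/n <= e^{y/n}, raised to the power n. For n = 0 the bound reads 0^0 = 1. *)
Lemma exp_pow_bound (n : nat) (y : R) : 0 <= y -> y ^+ n * expR (- y) <= n%:R ^+ n.
Proof.
case: n => [|n] y0.
  by rewrite !expr0 mul1r -expR0 ler_expR; lra.
have n0 : 0 < n.+1%:R :> R by rewrite ltr0n.
rewrite expRN ler_pdivrMr ?expR_gt0//.
have -> : expR y = expR (y / n.+1%:R) ^+ n.+1.
  by rewrite -expRM_natl; congr expR; field; rewrite gt_eqF.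
rewrite -exprMn; apply: lerXn2r.
- by rewrite nnegrE.
- by rewrite nnegrE mulr_ge0 ?expR_ge0// ltW.
have h := @expR_ge1Dx R (y / n.+1%:R).
rewrite [leLHS](_ : _ = n.+1%:R * (y / n.+1%:R)); last by field; rewrite gt_eqF.
by rewrite ler_pM2l//; apply: le_trans h; rewrite lerDr.
Qed.

Lemma flat_le j x : flat j x <= j%:R ^+ j.
Proof.
rewrite /flat; case: ifPn => x0; last by rewrite exprn_ge0.
by apply: exp_pow_bound; rewrite invr_ge0 ltW.
Qed.

Lemma flatS j x : flat j x = x * flat j.+1 x.
Proof.
rewrite /flat; case: ifPn => x0; last by rewrite mulr0.
by rewrite exprS !mulrA mulfV ?mul1r// gt_eqF.
Qed.

Lemma flat_cvg0 j : flat j h @[h --> 0^'] --> (0 : R).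
Proof.
apply: (@squeeze_cvgr _ _ _ _ (fun=> 0) (fun h => j.+1%:R ^+ j.+1 * `|h|)).
- near=> h; rewrite flat_ge0/=.
  have [h0|h0] := leP h 0; first by rewrite flat0// mulr_ge0// exprn_ge0.
  by rewrite flatS mulrC ler_pM ?flat_ge0 ?ler_norm ?flat_le// ltW.
- exact: cvg_cst.
- rewrite -[X in _ --> X](mulr0 (j.+1%:R ^+ j.+1)); apply: cvgMl_tmp.
  have : `|h| @[h --> (0 : R)] --> `|0 : R| by apply: cvg_norm; exact: cvg_id.
  by rewrite normr0; apply: cvg_trans; apply: cvg_app; exact: cvg_within.
Unshelve. all: by end_near. Qed.

Let pflat (j : nat) (x : R) : R := x^-1 ^+ j * expR (- x^-1).

Let is_derive_pflat j (x : R) : x != 0 ->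
  is_derive x 1 (pflat j) (pflat j.+2 x - j%:R * pflat j.+1 x).
Proof.
move=> x0; have dV : is_derive x 1 (fun y : R => y^-1) (- x^-1 ^+ 2).
  have := @is_deriveV R id x 1 1 x0 (is_derive_id _ _).
  by rewrite /GRing.scale/= mulr1 exprVn.
elim: j => [|j IH].
  have -> : pflat 0 = expR \o (fun y => - y^-1).
    by apply/funext => y; rewrite /pflat expr0 mul1r.
  have d1 : is_derive x 1 (fun y : R => - y^-1) (x^-1 ^+ 2).
    by rewrite -[x^-1 ^+ 2]opprK; exact: is_deriveN.
  have := @is_derive1_comp R expR (fun y => - y^-1) x _ _ (is_derive_expR (- x^-1)) d1.
  by rewrite /pflat mul0r subr0 mulrC.
have -> : pflat j.+1 = (fun y : R => y^-1) * pflat j.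
  by apply/funext => y; rewrite /pflat exprS mulrA.
apply: is_derive_eq; rewrite /GRing.scale/= /pflat -[j.+1%:R]natr1 !exprS; ring.
Qed.

(** Away from 0 this is the ordinary rule. At 0 the difference quotient of [flat j] is [flat j.+1],
    which tends to 0 because it is in turn h times a bounded function. *)
Lemma is_derive_flat j (x : R) :
  is_derive x 1 (flat j) (flat j.+2 x - j%:R * flat j.+1 x).
Proof.
have [x0|x0|<-] := ltgtP 0 x.
- have nF : \near x, pflat j x = flat j x.
    by near=> y; rewrite /flat ifT//; near: y; exact: lt_nbhsr.
  apply: (near_eq_is_derive nF).
  by rewrite /flat x0; apply: is_derive_pflat; rewrite gt_eqF.
- have nF : \near x, cst (0 : R) x = flat j x.
    by near=> y; rewrite flat0//; apply: ltW; near: y; exact: lt_nbhsl.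
  apply: (near_eq_is_derive nF).
  by rewrite !flat0 ?ltW// mulr0 subr0; exact: is_derive_cst.
- rewrite !flat0// mulr0 subr0.
  have h : (fun h => h^-1 *: ((flat j \o shift 0) (h *: 1) - flat j 0)) @ 0^' --> (0 : R).
    have := flat_cvg0 j.+1; apply: cvg_trans; apply: near_eq_cvg; near=> h.
    have h0 : h != 0 by near: h; exact: nbhs_dnbhs_neq.
    rewrite /= addr0 [flat j 0]flat0// subr0 [_%:A]mulr1 (flatS j) /GRing.scale/=.
    by rewrite mulrA mulVf ?mul1r.
  by split; [apply/cvg_ex; exists 0|exact: cvg_lim h].
Unshelve. all: by end_near. Qed.

End FlatFunctions.

(** * Wirtinger calculus and a differential ring of smooth functions *)

Section WirtingerDerivatives.
Context {R : realType}.
Implicit Types f g fz fzb gz gzb : R * R -> R[i].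

Lemma conjcD (x y : R[i]) : conjc (x + y) = conjc x + conjc y.
Proof. exact: rmorphD. Qed.

Lemma conjcM (x y : R[i]) : conjc (x * y) = conjc x * conjc y.
Proof. exact: rmorphM. Qed.

Lemma Re_conj (x : R[i]) : complex.Re (conjc x) = complex.Re x.
Proof. by case: x. Qed.

Lemma Im_conj (x : R[i]) : complex.Im (conjc x) = - complex.Im x.
Proof. by case: x. Qed.

(* [fz] and [fzb] are the two Wirtinger derivatives of [f]. *)
Definition cdiff f fz fzb := forall p v : R * R,
  is_derive p v (fun q => complex.Re (f q))
    (complex.Re (zc v * fz p + conjc (zc v) * fzb p)) /\
  is_derive p v (fun q => complex.Im (f q))
    (complex.Im (zc v * fz p + conjc (zc v) * fzb p)).

(** Restricting to a line makes the one-variable chain rule available for directional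
    derivatives. *)
Lemma is_derive_lineP (f : R * R -> R) p v d :
  is_derive p v f d <-> is_derive (0 : R) 1 (fun t : R => f (t *: v + p)) d.
Proof.
have E : (fun h : R => h^-1 *: ((f \o shift p) (h *: v) - f p)) =
    (fun h : R => h^-1 *: (((fun t : R => f (t *: v + p)) \o shift 0) (h *: 1) -
       (fun t : R => f (t *: v + p)) 0)).
  by apply/funext => h /=; rewrite addr0 scale0r add0r [_%:A]mulr1.
by split=> -[]; rewrite /derivable /derive; [rewrite E|rewrite -E].
Qed.

Lemma cdiff_ext f fz fzb gz gzb : cdiff f fz fzb -> fz =1 gz -> fzb =1 gzb ->
  cdiff f gz gzb.
Proof. by move=> h /funext <- /funext <-. Qed.

Lemma cdiff_cst c : cdiff (fun=> c) (fun=> 0) (fun=> 0).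
Proof. by move=> p v; rewrite !mulr0 addr0; split; exact: is_derive_cst. Qed.

Lemma is_derive_affine (a b t : R) : is_derive t 1 (fun s : R => s * a + b) a.
Proof.
have -> : (fun s : R => s * a + b) = (id : R -> R) * cst a + cst b by [].
by apply: is_derive_eq; rewrite /GRing.scale/= mulr0 mulr1 add0r addr0.
Qed.

Lemma cdiff_zc : cdiff zc (fun=> 1) (fun=> 0).
Proof.
move=> p v; rewrite mulr1 mulr0 addr0.
by split; apply/is_derive_lineP; exact: is_derive_affine.
Qed.

Lemma cdiff_conj f fz fzb : cdiff f fz fzb ->
  cdiff (fun p => conjc (f p)) (fun p => conjc (fzb p)) (fun p => conjc (fz p)).
Proof.
move=> df p v; have [d1 d2] := df p v.
have -> : zc v * conjc (fzb p) + conjc (zc v) * conjc (fz p) =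
    conjc (zc v * fz p + conjc (zc v) * fzb p).
  by rewrite conjcD !conjcM conjcK addrC.
split; first by under eq_fun do rewrite Re_conj; rewrite Re_conj.
under eq_fun do rewrite Im_conj.
by rewrite Im_conj; exact: is_deriveN.
Qed.

Lemma cdiffD f fz fzb g gz gzb : cdiff f fz fzb -> cdiff g gz gzb ->
  cdiff (fun p => f p + g p) (fun p => fz p + gz p) (fun p => fzb p + gzb p).
Proof.
move=> df dg p v; have [d1 d2] := df p v; have [e1 e2] := dg p v.
rewrite !mulrDr addrACA; split.
  under eq_fun do rewrite ReD.
  by rewrite ReD; exact: is_deriveD.
under eq_fun do rewrite ImD.
by rewrite ImD; exact: is_deriveD.
Qed.

Lemma cdiffM f fz fzb g gz gzb : cdiff f fz fzb -> cdiff g gz gzb ->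
  cdiff (fun p => f p * g p) (fun p => fz p * g p + f p * gz p)
    (fun p => fzb p * g p + f p * gzb p).
Proof.
move=> df dg p v; have [d1 d2] := df p v; have [e1 e2] := dg p v.
have -> : zc v * (fz p * g p + f p * gz p) + conjc (zc v) * (fzb p * g p + f p * gzb p) =
  f p * (zc v * gz p + conjc (zc v) * gzb p) + g p * (zc v * fz p + conjc (zc v) * fzb p).
  by ring.
set a := (zc v * fz p + _) in d1 d2 *; set b := (zc v * gz p + _) in e1 e2 *; split.
  under eq_fun do rewrite ReM.
  apply: (is_derive_eq (is_deriveB (is_deriveM d1 e1) (is_deriveM d2 e2))).
  by move: (f p) (g p) a b {d1 d2 e1 e2} => [x y] [x' y'] [x2 y2] [x3 y3]; rewrite /GRing.scale/=; ring.
under eq_fun do rewrite ImM.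
apply: (is_derive_eq (is_deriveD (is_deriveM d1 e2) (is_deriveM d2 e1))).
by move: (f p) (g p) a b {d1 d2 e1 e2} => [x y] [x' y'] [x2 y2] [x3 y3]; rewrite /GRing.scale/=; ring.
Qed.

Lemma cdiff_comp (h : R -> R) (dh : R -> R) (u : R * R -> R) (uz uzb : R * R -> R[i]) :
  (forall x : R, is_derive x 1 h (dh x)) -> cdiff (fun p => (u p)%:C) uz uzb ->
  cdiff (fun p => (h (u p))%:C) (fun p => (dh (u p))%:C * uz p)
    (fun p => (dh (u p))%:C * uzb p).
Proof.
move=> hd ud p v; have [d1 d2] := ud p v.
(* The function differentiated is real-valued, so the imaginary part of its derivative in direction
   [v] is 0. *)
have im0 : complex.Im (zc v * uz p + conjc (zc v) * uzb p) = 0.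
  by have [_ <-] := d2; rewrite (_ : (fun q => _) = cst 0)// derive_cst.
have -> : zc v * ((dh (u p))%:C * uz p) + conjc (zc v) * ((dh (u p))%:C * uzb p) =
  (dh (u p))%:C * (zc v * uz p + conjc (zc v) * uzb p) by ring.
set a := (zc v * uz p + _) in d1 im0 *; split; last first.
  by rewrite ImM im0/= mulr0 mul0r addr0; exact: is_derive_cst.
rewrite ReM/= mul0r subr0; move/is_derive_lineP: d1 => d1; apply/is_derive_lineP.
have h0 : is_derive (u (0 *: v + p)) 1 h (dh (u p)) by rewrite scale0r add0r.
exact: (is_derive1_comp h0 d1).
Qed.

Lemma cdiff_partial f fz fzb : cdiff f fz fzb -> forall p : R * R,
  (is_derive p (1, 0) (fun q => complex.Re (f q)) (complex.Re (fz p + fzb p)) /\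
   is_derive p (1, 0) (fun q => complex.Im (f q)) (complex.Im (fz p + fzb p))) /\
  (is_derive p (0, 1) (fun q => complex.Re (f q)) (complex.Re ('i * (fz p - fzb p))) /\
   is_derive p (0, 1) (fun q => complex.Im (f q)) (complex.Im ('i * (fz p - fzb p)))).
Proof.
move=> df p; split.
  have := df p (1, 0); rewrite (_ : zc _ = 1)// conjc1 !mul1r//.
have := df p (0, 1); rewrite (_ : zc _ = 'i)// (_ : conjc 'i = - 'i); last first.
  by apply/eqP; rewrite eq_complex/= oppr0 !eqxx.
by rewrite mulNr -mulrBr.
Qed.

Lemma cderiveE f fz fzb : cdiff f fz fzb ->
  (forall p, cderive (1, 0) f p = fz p + fzb p) /\
  (forall p, cderive (0, 1) f p = 'i * (fz p - fzb p)).
Proof.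
move=> df; split=> p; have [[[_ h1] [_ h2]] [[_ h3] [_ h4]]] := cdiff_partial df p.
  by rewrite /cderive h1 h2; case: (fz p + fzb p).
by rewrite /cderive h3 h4; case: ('i * _).
Qed.

Lemma cdiff_open0 f fz fzb (U : set (R * R)) : cdiff f fz fzb -> open U ->
  (forall p, U p -> f p = 0) -> forall p, U p -> fz p = 0 /\ fzb p = 0.
Proof.
move=> df oU f0 p Up.
have nU : \forall q \near p, U q by exact: open_nbhs_nbhs.
have nr : \forall q \near p, complex.Re (f q) = cst 0 q.
  by move: nU; apply: filterS => q /f0 ->.
have ni : \forall q \near p, complex.Im (f q) = cst 0 q.
  by move: nU; apply: filterS => q /f0 ->.
have z v : cderive v f p = 0.
  by rewrite /cderive (near_eq_derive _ nr) (near_eq_derive _ ni) !derive_cst.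
have [e1 e2] := cderiveE df.
have := z (1, 0); have := z (0, 1); rewrite e1 e2.
case: (fz p) (fzb p) => a b [c d] /eqP; rewrite eq_complex/= => /andP[/eqP h1 /eqP h2].
move=> /eqP; rewrite eq_complex/= => /andP[/eqP h3 /eqP h4].
by split; apply/eqP; rewrite eq_complex/=; apply/andP; split; apply/eqP; lra.
Qed.

(** The function s = 1 - |z|^2, positive exactly on the disk and zero on the circle; its Wirtinger
    derivatives are -zbar and -z. *)
Definition bdist (p : R * R) : R := 1 - p.1 ^+ 2 - p.2 ^+ 2.

Lemma bdistE p : (bdist p)%:C = 1 - zc p * conjc (zc p).
Proof.
by apply/eqP; rewrite eq_complex/= /bdist; apply/andP; split; apply/eqP; ring.
Qed.

Lemma cdiff_bdist : cdiff (fun p => (bdist p)%:C) (fun p => - conjc (zc p)) (fun p => - zc p).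
Proof.
have -> : (fun p => (bdist p)%:C) = (fun p => 1 + (- 1) * (zc p * conjc (zc p))).
  by apply/funext => p; rewrite bdistE mulN1r.
apply: cdiff_ext (cdiffD (cdiff_cst 1) (cdiffM (cdiff_cst (- 1))
    (cdiffM cdiff_zc (cdiff_conj cdiff_zc)))) _ _ => p.
  by rewrite conjc0; ring.
by rewrite conjc1; ring.
Qed.

(* Polynomials in the coordinates and flat functions of [n s - 1], where
   [s = 1 - |z|^2]: a ring of smooth functions stable under differentiation
   that contains both the polynomials and the cutoffs. *)
Inductive csm : (R * R -> R[i]) -> Prop :=
| csm_cst c : csm (fun=> c)
| csm_zc : csm zc
| csm_conjz : csm (fun p => conjc (zc p))
| csm_flat j n : csm (fun p => (flat j (n%:R * bdist p - 1))%:C)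
| csmD f g : csm f -> csm g -> csm (fun p => f p + g p)
| csmM f g : csm f -> csm g -> csm (fun p => f p * g p).

Lemma csm_ext f g : csm f -> f =1 g -> csm g.
Proof. by move=> h /funext <-. Qed.

Lemma csmN f : csm f -> csm (fun p => - f p).
Proof.
move=> h; apply: csm_ext (csmM (csm_cst (- 1)) h) _ => p.
by rewrite mulN1r.
Qed.

Lemma csmB f g : csm f -> csm g -> csm (fun p => f p - g p).
Proof. by move=> hf hg; exact: csmD hf (csmN hg). Qed.

Lemma csmX f n : csm f -> csm (fun p => f p ^+ n).
Proof.
move=> h; elim: n => [|n IH]; first exact: csm_cst.
by under eq_fun do rewrite exprS; exact: csmM.
Qed.

Lemma csm_conj f : csm f -> csm (fun p => conjc (f p)).
Proof.
elim=> [c|||j n|g h _ IHg _ IHh|g h _ IHg _ IHh].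
- exact: csm_cst.
- exact: csm_conjz.
- by apply: csm_ext csm_zc _ => p; rewrite conjcK.
- by apply: csm_ext (csm_flat j n) _ => p; rewrite conjc_real.
- by apply: csm_ext (csmD IHg IHh) _ => p; rewrite conjcD.
- by apply: csm_ext (csmM IHg IHh) _ => p; rewrite conjcM.
Qed.

Lemma csm_bdist : csm (fun p => (bdist p)%:C).
Proof.
apply: csm_ext (csmB (csm_cst 1) (csmM csm_zc csm_conjz)) _ => p.
by rewrite bdistE.
Qed.

Definition flatd (j : nat) (x : R) : R := flat j.+2 x - j%:R * flat j.+1 x.

Lemma cdiff_flat j n : cdiff (fun p => (flat j (n%:R * bdist p - 1))%:C)
  (fun p => (flatd j (n%:R * bdist p - 1))%:C * (- n%:R * conjc (zc p)))
  (fun p => (flatd j (n%:R * bdist p - 1))%:C * (- n%:R * zc p)).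
Proof.
apply: cdiff_comp; first exact: is_derive_flat.
have -> : (fun p => (n%:R * bdist p - 1)%:C) = (fun p => n%:R * (bdist p)%:C + (- 1)).
  by apply/funext => p; rewrite rmorphB rmorphM/= rmorph1 rmorph_nat.
apply: cdiff_ext (cdiffD (cdiffM (cdiff_cst n%:R) cdiff_bdist) (cdiff_cst (- 1))) _ _ => p.
  by ring.
by ring.
Qed.

Lemma csm_flatd j n : csm (fun p => (flatd j (n%:R * bdist p - 1))%:C).
Proof.
apply: csm_ext (csmB (csm_flat j.+2 n) (csmM (csm_cst j%:R) (csm_flat j.+1 n))) _ => p.
by rewrite /flatd rmorphB rmorphM/= rmorph_nat.
Qed.

(** The same [fw] is the dbar-derivative of [fz] and the d-derivative of [fzb]. The symmetry of
    mixed derivatives is thus obtained by induction on the construction of [f]; exactness of the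
    Jacobian and the curl identity both rest on it. *)
Lemma csm_diff f : csm f -> exists fz fzb fw, [/\ csm fz, csm fzb, csm fw,
  cdiff f fz fzb & (exists a, cdiff fz a fw) /\ (exists b, cdiff fzb fw b)].
Proof.
elim=> [c|||j n|g h _ [gz [gzb [gw [sgz sgzb sgw dg [[ga dga] [gb dgb]]]]]]
  sh [hz [hzb [hw [shz shzb shw dh [[ha dha] [hb dhb]]]]]]
  |g h sg [gz [gzb [gw [sgz sgzb sgw dg [[ga dga] [gb dgb]]]]]]
  sh [hz [hzb [hw [shz shzb shw dh [[ha dha] [hb dhb]]]]]]].
- exists (fun=> 0), (fun=> 0), (fun=> 0); split; try exact: csm_cst.
    exact: cdiff_cst.
  by split; exists (fun=> 0); exact: cdiff_cst.
- exists (fun=> 1), (fun=> 0), (fun=> 0); split; try exact: csm_cst.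
    exact: cdiff_zc.
  by split; exists (fun=> 0); exact: cdiff_cst.
- exists (fun=> 0), (fun=> 1), (fun=> 0); split; try exact: csm_cst.
    apply: cdiff_ext (cdiff_conj cdiff_zc) _ _ => p; first exact: conjc0.
    exact: conjc1.
  by split; exists (fun=> 0); exact: cdiff_cst.
- pose fd (p : R * R) : R[i] := (flatd j (n%:R * bdist p - 1))%:C.
  pose fd2 (p : R * R) : R[i] :=
    (flatd j.+2 (n%:R * bdist p - 1) - j%:R * flatd j.+1 (n%:R * bdist p - 1))%:C.
  have fd2E p : fd2 p = (flatd j.+2 (n%:R * bdist p - 1))%:C -
      j%:R * (flatd j.+1 (n%:R * bdist p - 1))%:C.
    by rewrite /fd2 rmorphB rmorphM/= rmorph_nat.
  have dfd : cdiff fd (fun p => fd2 p * (- n%:R * conjc (zc p))) (fun p => fd2 p * (- n%:R * zc p)).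
    have -> : fd = (fun p => (flat j.+2 (n%:R * bdist p - 1))%:C +
        (- j%:R) * (flat j.+1 (n%:R * bdist p - 1))%:C).
      by apply/funext => p; rewrite /fd /flatd rmorphB rmorphM/= rmorph_nat mulNr.
    apply: cdiff_ext (cdiffD (cdiff_flat j.+2 n)
      (cdiffM (cdiff_cst (- j%:R)) (cdiff_flat j.+1 n))) _ _ => p.
      by rewrite fd2E; ring.
    by rewrite fd2E; ring.
  have sfd2 : csm fd2.
    apply: csm_ext (csmB (csm_flatd j.+2 n) (csmM (csm_cst j%:R) (csm_flatd j.+1 n))) _ => p.
    by rewrite fd2E.
  exists (fun p => fd p * (- n%:R * conjc (zc p))), (fun p => fd p * (- n%:R * zc p)),
    (fun p => fd2 p * (- n%:R * zc p) * (- n%:R * conjc (zc p)) + fd p * (- n%:R)).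
  split.
  + exact: csmM (csm_flatd j n) (csmM (csm_cst _) csm_conjz).
  + exact: csmM (csm_flatd j n) (csmM (csm_cst _) csm_zc).
  + apply: csmD (csmM (csm_flatd j n) (csm_cst _)).
    exact: csmM (csmM sfd2 (csmM (csm_cst _) csm_zc)) (csmM (csm_cst _) csm_conjz).
  + exact: cdiff_flat.
  split; eexists.
    apply: cdiff_ext (cdiffM dfd (cdiffM (cdiff_cst (- n%:R)) (cdiff_conj cdiff_zc))) _ _.
      by move=> p; reflexivity.
    by move=> p; rewrite conjc1; ring.
  apply: cdiff_ext (cdiffM dfd (cdiffM (cdiff_cst (- n%:R)) cdiff_zc)) _ _.
    by move=> p; ring.
  by move=> p; reflexivity.
- exists (fun p => gz p + hz p), (fun p => gzb p + hzb p), (fun p => gw p + hw p).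
  split; try exact: csmD.
    exact: cdiffD.
  by split; eexists; apply: cdiffD; eassumption.
- exists (fun p => gz p * h p + g p * hz p), (fun p => gzb p * h p + g p * hzb p),
    (fun p => gw p * h p + gz p * hzb p + (gzb p * hz p + g p * hw p)).
  split.
  + by apply: csmD; exact: csmM.
  + by apply: csmD; exact: csmM.
  + by apply: csmD; apply: csmD; exact: csmM.
  + exact: cdiffM.
  split; eexists.
    apply: cdiff_ext (cdiffD (cdiffM dga dh) (cdiffM dg dha)) _ _.
      by move=> p; reflexivity.
    by move=> p; ring.
  apply: cdiff_ext (cdiffD (cdiffM dgb dh) (cdiffM dg dhb)) _ _.
    by move=> p; ring.
  by move=> p; reflexivity.
Qed.

Lemma continuous_bdist : continuous bdist.
Proof.
move=> p; apply: cvgB; last by apply: cvgM; exact: cvg_snd.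
by apply: cvgB; [exact: cvg_cst|apply: cvgM; exact: cvg_fst].
Qed.

Lemma continuous_flat j : continuous (flat j : R -> R).
Proof. exact: is_derive1_continuous (is_derive_flat j). Qed.

Lemma csm_ccont f : csm f -> ccont f.
Proof.
have cz : ccont (zc : R * R -> R[i]) by apply: ccont_zc => p; exact: cvg_id.
elim=> [c|||j n|g h _ IHg _ IHh|g h _ IHg _ IHh].
- exact: ccont_cst.
- exact: cz.
- exact: ccont_conj.
- split=> p; last exact: cvg_cst.
  apply: (@continuous_comp _ _ _ (fun p => n%:R * bdist p - 1) (flat j)).
    apply: cvgB; last exact: cvg_cst.
    by apply: cvgMl_tmp; exact: continuous_bdist.
  exact: continuous_flat.
- exact: ccontD.
- exact: ccontM.
Qed.

Lemma csm_csmooth f : csm f -> csmooth f.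
Proof.
have H k : forall g, csm g -> Ck k (fun p => complex.Re (g p)) /\
    Ck k (fun p => complex.Im (g p)).
  elim: k => [|k IH] g sg; first exact: csm_ccont.
  have [gz [gzb [_ [sgz sgzb _ dg _]]]] := csm_diff sg.
  have hp := cdiff_partial dg.
  have [a1 a2] := IH _ (csmD sgz sgzb).
  have [b1 b2] := IH _ (csmM (csm_cst 'i) (csmB sgz sgzb)).
  split=> /=; split.
  + by move=> p; have [[[]]] := hp p.
  + by move=> p; have [_ [[]]] := hp p.
  + move: a1; congr (Ck k _); apply/funext => p.
    by have [[[_ ->]]] := hp p.
  + move: b1; congr (Ck k _); apply/funext => p.
    by have [_ [[_ ->]]] := hp p.
  + by move=> p; have [[_ []]] := hp p.
  + by move=> p; have [_ [_ []]] := hp p.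
  + move: a2; congr (Ck k _); apply/funext => p.
    by have [[_ [_ ->]]] := hp p.
  + move: b2; congr (Ck k _); apply/funext => p.
    by have [_ [_ [_ ->]]] := hp p.
by move=> sf; split=> k; have [] := H k f sf.
Qed.

End WirtingerDerivatives.

(** * Integration by parts on the disk *)

Section IntegrationByParts.
Context {R : realType}.
Local Notation mR := (measurableTypeR R).
Local Notation T2 := (mR * mR)%type.

Lemma Rintegral_chord0 (F G : R -> R) (r : R) :
  (forall t : R, is_derive t 1 F (G t)) -> continuous G ->
  (forall t, t ^+ 2 = r -> F t = 0) ->
  Rintegral leb1 ([set t | t ^+ 2 < r] : set mR) G = 0.
Proof.
move=> FG cG F0; have [r0|r0] := leP r 0.
  rewrite (_ : [set t | _] = set0) ?Rintegral_set0//.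
  by apply/seteqP; split=> // t /=; have := sqr_ge0 t; lra.
pose q := Num.sqrt r; have q0 : 0 < q by rewrite sqrtr_gt0.
have qq : q ^+ 2 = r by rewrite sqr_sqrtr// ltW.
have -> : [set t | t ^+ 2 < r] = `]- q, q[%classic.
  apply/seteqP; split=> t /=; rewrite in_itv/= -qq !expr2 => h.
    by apply/andP; split; nra.
  by move/andP: h => [h1 h2]; nra.
have qNq : - q <= q by lra.
have ic : (leb1 : {measure set mR -> \bar R}).-integrable `[(- q), q] (EFin \o G).
  apply: continuous_compact_integrable; first exact: segment_compact.
  exact: continuous_subspaceT.
rewrite Rintegral_itv_obnd_cbnd; last first.
  by apply: (integrableS _ _ _ ic) => //; exact: subset_itvW.
rewrite Rintegral_itv_bndo_bndc; last first.
  by apply: (integrableS _ _ _ ic) => //; apply: subset_itvl; rewrite bnd_simp.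
by rewrite (Rintegral_FTC qNq FG cG) !F0 ?subrr// ?sqrrN.
Qed.

Lemma continuous_M_bounded (f : R * R -> R) : continuous f ->
  exists2 C : R, 0 <= C & forall p, M p -> `|f p| <= C.
Proof.
move=> cf; have [C C0 HC] := continuous_bounded2 cf; exists C => // p pM.
by apply: HC; apply: ltW.
Qed.

Lemma ccont_cmeas (f : R * R -> R[i]) : ccont f -> cmeas (M : set T2) f.
Proof.
by move=> [c1 c2]; split; apply: measurable_funTS; exact: continuous_measurable2.
Qed.

Lemma ccont_L2M (f : R * R -> R[i]) : ccont f -> L2 leb2 M f.
Proof.
move=> cf; have [c1 c2] := cf.
have [C1 C10 H1] := continuous_M_bounded c1; have [C2 C20 H2] := continuous_M_bounded c2.
apply: (L2_bounded measurable_M (C := C1 * C1 + C2 * C2)); first exact: leb2_M_lty.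
  exact: ccont_cmeas.
move=> p pM; rewrite /dotc; apply: lerD.
  by rewrite -expr2 -real_normK ?num_real// expr2 ler_pM//; exact: H1.
by rewrite -expr2 -real_normK ?num_real// expr2 ler_pM//; exact: H2.
Qed.

Lemma continuous_integrable_M (f : R * R -> R) : continuous f ->
  leb2.-integrable (M : set T2) (EFin \o f).
Proof.
move=> cf.
have Lf : L2 leb2 M (fun p => (f p)%:C : R[i]).
  by apply: ccont_L2M; split=> //= p; exact: cvg_cst.
have L1 : L2 leb2 M (fun p : R * R => 1 : R[i]) by apply: ccont_L2M; exact: ccont_cst.
have := L2_dot measurable_M Lf L1; congr (integrable _ _ _).
by apply/funext => p; rewrite /dotc/= mulr1 mul0r addr0.
Qed.

Lemma mkcond_M (G : R * R -> R) : continuous G ->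
  (sleb1 \x sleb1)%E.-integrable setT (EFin \o (G \_ (M : set T2))).
Proof.
move=> cG; rewrite -restrict_EFin; apply/(integrable_mkcond _ measurable_M).
exact: continuous_integrable_M.
Qed.

(** Each horizontal slice of the disk is an interval whose ends lie on the circle, where [F]
    vanishes; Fubini then integrates zeros. *)
Lemma Rintegral_dx_eq0 (F G : R * R -> R) :
  (forall p : R * R, is_derive p (1, 0) F (G p)) -> continuous G ->
  (forall p, p.1 ^+ 2 + p.2 ^+ 2 = 1 -> F p = 0) ->
  Rintegral leb2 (M : set T2) G = 0.
Proof.
move=> FG cG F0; rewrite Rintegral_mkcond.
transitivity (Rintegral sleb1 setT (fun y : mR => Rintegral sleb1 setT
    (fun x : mR => (G \_ M) (x, y)))).
  exact: (@Rintegral_fubini2 _ _ _ _ R sleb1 sleb1 _ (mkcond_M cG)).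
transitivity (Rintegral sleb1 (setT : set mR) (fun=> 0)); last by rewrite Rintegral_cst ?mul0r.
apply: eq_Rintegral => y _.
transitivity (Rintegral leb1 ([set x | x ^+ 2 < 1 - y ^+ 2] : set mR) (fun x => G (x, y))).
  rewrite [RHS]Rintegral_mkcond; apply: eq_Rintegral => x _; rewrite !patchE.
  rewrite (_ : ((x, y) \in (M : set T2)) = (x \in [set x | x ^+ 2 < 1 - y ^+ 2]))//.
  by apply/idP/idP; rewrite !inE /M/=; lra.
apply: (@Rintegral_chord0 (fun x => F (x, y))).
- move=> x; have := FG (x, y).
  have E : (fun h : R => h^-1 *: ((F \o shift (x, y)) (h *: ((1, 0) : R * R)) - F (x, y))) =
    (fun h : R => h^-1 *: (((fun x => F (x, y)) \o shift x) (h *: 1) - F (x, y))).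
    apply/funext => h /=; congr (_ *: (F _ - _)).
    by apply: injective_projections => //=; rewrite /GRing.scale/= mulr0 add0r.
  by move=> []; rewrite /derivable /derive E.
- by move=> x; exact: (continuous_pair1 (r := y) cG).
- by move=> x xy; apply: F0 => /=; rewrite xy subrK.
Qed.

Lemma Rintegral_dy_eq0 (F G : R * R -> R) :
  (forall p : R * R, is_derive p (0, 1) F (G p)) -> continuous G ->
  (forall p, p.1 ^+ 2 + p.2 ^+ 2 = 1 -> F p = 0) ->
  Rintegral leb2 (M : set T2) G = 0.
Proof.
move=> FG cG F0; rewrite Rintegral_mkcond.
transitivity (Rintegral sleb1 setT (fun x : mR => Rintegral sleb1 setT
    (fun y : mR => (G \_ M) (x, y)))).
  exact: (@Rintegral_fubini _ _ _ _ R sleb1 sleb1 _ (mkcond_M cG)).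
transitivity (Rintegral sleb1 (setT : set mR) (fun=> 0)); last by rewrite Rintegral_cst ?mul0r.
apply: eq_Rintegral => x _.
transitivity (Rintegral leb1 ([set y | y ^+ 2 < 1 - x ^+ 2] : set mR) (fun y => G (x, y))).
  rewrite [RHS]Rintegral_mkcond; apply: eq_Rintegral => y _; rewrite !patchE.
  rewrite (_ : ((x, y) \in (M : set T2)) = (y \in [set y | y ^+ 2 < 1 - x ^+ 2]))//.
  by apply/idP/idP; rewrite !inE /M/=; lra.
apply: (@Rintegral_chord0 (fun y => F (x, y))).
- move=> y; have := FG (x, y).
  have E : (fun h : R => h^-1 *: ((F \o shift (x, y)) (h *: ((0, 1) : R * R)) - F (x, y))) =
    (fun h : R => h^-1 *: (((fun y => F (x, y)) \o shift y) (h *: 1) - F (x, y))).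
    apply/funext => h /=; congr (_ *: (F _ - _)).
    by apply: injective_projections => //=; rewrite /GRing.scale/= mulr0 add0r.
  by move=> []; rewrite /derivable /derive E.
- by move=> y; exact: (continuous_pair2 (r := x) cG).
- by move=> y xy; apply: F0 => /=; rewrite xy addrC subrK.
Qed.

(** Derivatives along the two axes only, which is what [Ck] provides for a test function; [cdiff]
    asks for all directions. *)
Definition pdiff (f fx fy : R * R -> R[i]) := forall p : R * R,
  (is_derive p (1, 0) (fun q => complex.Re (f q)) (complex.Re (fx p)) /\
   is_derive p (1, 0) (fun q => complex.Im (f q)) (complex.Im (fx p))) /\
  (is_derive p (0, 1) (fun q => complex.Re (f q)) (complex.Re (fy p)) /\
   is_derive p (0, 1) (fun q => complex.Im (f q)) (complex.Im (fy p))).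

Definition on_circle (p : R * R) := p.1 ^+ 2 + p.2 ^+ 2 = 1.

Lemma pdiff_int0 (f fx fy : R * R -> R[i]) : pdiff f fx fy -> ccont fx -> ccont fy ->
  (forall p, on_circle p -> f p = 0) ->
  cintegral leb2 M fx = 0 /\ cintegral leb2 M fy = 0.
Proof.
move=> df [cx1 cx2] [cy1 cy2] f0; rewrite /cintegral.
have r0 p : on_circle p -> complex.Re (f p) = 0 by move=> /f0 ->.
have i0 p : on_circle p -> complex.Im (f p) = 0 by move=> /f0 ->.
rewrite (Rintegral_dx_eq0 (fun p => (df p).1.1) cx1 r0).
rewrite (Rintegral_dx_eq0 (fun p => (df p).1.2) cx2 i0).
rewrite (Rintegral_dy_eq0 (fun p => (df p).2.1) cy1 r0).
by rewrite (Rintegral_dy_eq0 (fun p => (df p).2.2) cy2 i0).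
Qed.

(** Rewrites the bilinear pairing of [weak_op] as two real inner products, so that L^2 limits can be
    taken in it. *)
Lemma cintegral_rip (f g : R * R -> R[i]) :
  cintegral leb2 M (fun p => f p * g p) =
  rip leb2 M f (fun p => conjc (g p)) +i* rip leb2 M f (fun p => conjc (- 'i * g p)).
Proof.
rewrite /cintegral /rip; congr (_ +i* _); apply: eq_Rintegral => p _.
  by case: (f p) (g p) => a b [c d]; rewrite /dotc/=; ring.
by case: (f p) (g p) => a b [c d]; rewrite /dotc/=; ring.
Qed.

Lemma cintegralD (f g : R * R -> R[i]) : ccont f -> ccont g ->
  cintegral leb2 M (fun p => f p + g p) = cintegral leb2 M f + cintegral leb2 M g.
Proof.
move=> [f1 f2] [g1 g2]; rewrite /cintegral; apply/eqP; rewrite eq_complex/=.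
have i1 := continuous_integrable_M f1; have i2 := continuous_integrable_M f2.
have j1 := continuous_integrable_M g1; have j2 := continuous_integrable_M g2.
rewrite -!RintegralD//; [|exact: measurable_M..].
by apply/andP; split; apply/eqP; apply: eq_Rintegral => p _; rewrite ?ReD ?ImD.
Qed.

Lemma cintegralZ (c : R[i]) (f : R * R -> R[i]) : ccont f ->
  cintegral leb2 M (fun p => c * f p) = c * cintegral leb2 M f.
Proof.
move=> [f1 f2]; rewrite /cintegral; apply/eqP; rewrite eq_complex/=.
have i1 := continuous_integrable_M f1; have i2 := continuous_integrable_M f2.
have mM := @measurable_M R.
rewrite ReM ImM/= -!RintegralZl// -RintegralB//; last 2 first.
- exact: (integrableZl mM _ i1).
- exact: (integrableZl mM _ i2).
rewrite -RintegralD//; last 2 first.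
- exact: (integrableZl mM _ i2).
- exact: (integrableZl mM _ i1).
by apply/andP; split; apply/eqP; apply: eq_Rintegral => p _; rewrite ?ReM ?ImM.
Qed.

Lemma cdiff_pdiff (f fz fzb : R * R -> R[i]) : cdiff f fz fzb ->
  pdiff f (fun p => fz p + fzb p) (fun p => 'i * (fz p - fzb p)).
Proof. by move=> df p; exact: cdiff_partial. Qed.

Lemma cdiff_int0 (f fz fzb : R * R -> R[i]) : cdiff f fz fzb -> ccont fz -> ccont fzb ->
  (forall p, on_circle p -> f p = 0) ->
  cintegral leb2 M fz = 0 /\ cintegral leb2 M fzb = 0.
Proof.
move=> df cz czb f0.
have cN (g : R * R -> R[i]) : ccont g -> ccont (fun p => - g p).
  move=> cg; have := ccontM (ccont_cst (-1)) cg; congr ccont.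
  by apply/funext => p; rewrite mulN1r.
have cs : ccont (fun p => fz p + fzb p) by exact: ccontD.
have cd : ccont (fun p => 'i * (fz p - fzb p)).
  by apply: ccontM; [exact: ccont_cst|exact: ccontD cz (cN _ czb)].
have [h1 h2] := pdiff_int0 (cdiff_pdiff df) cs cd f0.
have i2 : 'i * 'i = -1 :> R[i].
  by apply/eqP; rewrite eq_complex/= !mul0r !mulr0 mulr1 sub0r addr0 oppr0 !eqxx.
have half (x : R[i]) : (2^-1)%:C * (x + x) = x.
  by apply/eqP; rewrite eq_complex; case: x => a b /=; apply/andP; split; apply/eqP; field.
split.
  rewrite (_ : fz = fun p => (2^-1)%:C * ((fz p + fzb p) + (- 'i) * ('i * (fz p - fzb p)))).
    rewrite cintegralZ; last by apply: ccontD => //; apply: ccontM => //; exact: ccont_cst.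
    rewrite cintegralD//; last by apply: ccontM => //; exact: ccont_cst.
    by rewrite cintegralZ// h1 h2 !mulr0 addr0 mulr0.
  apply/funext => p; rewrite mulrA mulNr i2 opprK mul1r.
  by rewrite addrACA subrr addr0 half.
rewrite (_ : fzb = fun p => (2^-1)%:C * ((fz p + fzb p) + 'i * ('i * (fz p - fzb p)))).
  rewrite cintegralZ; last by apply: ccontD => //; apply: ccontM => //; exact: ccont_cst.
  rewrite cintegralD//; last by apply: ccontM => //; exact: ccont_cst.
  by rewrite cintegralZ// h1 h2 !mulr0 addr0 mulr0.
apply/funext => p; rewrite mulrA i2 mulN1r opprB.
by rewrite [fz p + _]addrC addrACA subrr addr0 half.
Qed.

End IntegrationByParts.

(** * Weak derivatives of smooth functions and their limits *)

Section WeakDerivatives.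
Context {R : realType}.
Local Notation mR := (measurableTypeR R).
Implicit Types f h fz fzb : R * R -> R[i].

Lemma ccontN f : ccont f -> ccont (fun p => - f p).
Proof.
move=> cf; have := ccontM (ccont_cst (-1)) cf; congr ccont.
by apply/funext => p; rewrite mulN1r.
Qed.

Lemma ccontB f h : ccont f -> ccont h -> ccont (fun p => f p - h p).
Proof. by move=> cf ch; exact: ccontD cf (ccontN ch). Qed.

Lemma ccontZ (c : R[i]) f : ccont f -> ccont (fun p => c * f p).
Proof. by move=> cf; apply: ccontM => //; exact: ccont_cst. Qed.

Lemma ccont_real (phi : R * R -> R) : continuous phi -> ccont (fun p => (phi p)%:C).
Proof. by move=> c; split; [exact: c|move=> p; exact: cvg_cst]. Qed.

Lemma pdiffM f fx fy (g gx gy : R * R -> R[i]) : pdiff f fx fy -> pdiff g gx gy ->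
  pdiff (fun p => f p * g p) (fun p => fx p * g p + f p * gx p)
    (fun p => fy p * g p + f p * gy p).
Proof.
have rule v (p : R * R) (u u' w w' : R * R -> R[i]) :
  is_derive p v (fun q => complex.Re (u q)) (complex.Re (u' p)) ->
  is_derive p v (fun q => complex.Im (u q)) (complex.Im (u' p)) ->
  is_derive p v (fun q => complex.Re (w q)) (complex.Re (w' p)) ->
  is_derive p v (fun q => complex.Im (w q)) (complex.Im (w' p)) ->
  is_derive p v (fun q => complex.Re (u q * w q)) (complex.Re (u' p * w p + u p * w' p)) /\
  is_derive p v (fun q => complex.Im (u q * w q)) (complex.Im (u' p * w p + u p * w' p)).
  move=> d1 d2 e1 e2; split.
    under eq_fun do rewrite ReM.
    apply: (is_derive_eq (is_deriveB (is_deriveM d1 e1) (is_deriveM d2 e2))).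
    by rewrite /GRing.scale/= ReD !ReM; ring.
  under eq_fun do rewrite ImM.
  apply: (is_derive_eq (is_deriveD (is_deriveM d1 e2) (is_deriveM d2 e1))).
  by rewrite /GRing.scale/= ImD !ImM; ring.
by move=> df dg p; have [[a1 a2] [a3 a4]] := df p; have [[b1 b2] [b3 b4]] := dg p;
  split; exact: rule.
Qed.

Lemma test_pdiff (phi : R * R -> R) : test_function phi ->
  [/\ pdiff (fun p => (phi p)%:C) (fun p => (derive phi p (1, 0))%:C)
        (fun p => (derive phi p (0, 1))%:C),
      ccont (fun p : R * R => (phi p)%:C), ccont (fun p : R * R => (derive phi p (1, 0))%:C),
      ccont (fun p : R * R => (derive phi p (0, 1))%:C) &
      forall p, on_circle p -> phi p = 0].
Proof.
move=> [sphi [K [_ KM phi0]]].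
have [d1 d2 c1 c2] := sphi 1; have c0 := sphi 0.
split.
- move=> p; split; split=> /=; try exact: is_derive_cst.
    exact: (DeriveDef (d1 p) erefl).
  exact: (DeriveDef (d2 p) erefl).
- exact: ccont_real c0.
- exact: ccont_real c1.
- exact: ccont_real c2.
- by move=> p pc; apply: phi0 => /KM; rewrite /M/= pc ltxx.
Qed.

(** The product with the test function vanishes on the circle, so its partial derivatives have zero
    integral; no boundary condition on [f] is involved. *)
Lemma csm_weak (a b : R[i]) f fz fzb : csm f -> csm fz -> csm fzb -> cdiff f fz fzb ->
  weak_op a b f (fun p => a * (fz p + fzb p) + b * ('i * (fz p - fzb p))).
Proof.
move=> /csm_ccont cf /csm_ccont cfz /csm_ccont cfzb df phi /test_pdiff[dphi cphi cx cy phi0].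
have cs := ccontD cfz cfzb; have cd := ccontZ 'i (ccontB cfz cfzb).
have [] := pdiff_int0 (pdiffM (cdiff_pdiff df) dphi).
- exact: (ccontD (ccontM cs cphi) (ccontM cf cx)).
- exact: (ccontD (ccontM cd cphi) (ccontM cf cy)).
- by move=> p /phi0 ->; rewrite mulr0.
move=> i1 i2; apply/eqP; rewrite -subr_eq0 opprK -cintegralD; last 2 first.
- exact: (ccontM cf (ccontD (ccontZ a cx) (ccontZ b cy))).
- exact: (ccontM (ccontD (ccontZ a cs) (ccontZ b cd)) cphi).
set G1 := (fun p => _) in i1; set G2 := (fun p => _) in i2.
rewrite [X in cintegral _ _ X](_ : _ = fun p => a * G1 p + b * G2 p).
  have c1 : ccont G1 := ccontD (ccontM cs cphi) (ccontM cf cx).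
  have c2 : ccont G2 := ccontD (ccontM cd cphi) (ccontM cf cy).
  have e1 := cintegralZ a c1; have e2 := cintegralZ b c2.
  rewrite i1 mulr0 in e1; rewrite i2 mulr0 in e2.
  have e3 := cintegralD (ccontZ a c1) (ccontZ b c2).
  by rewrite e1 e2 addr0 in e3; apply/eqP; exact: e3.
by apply/funext => p; rewrite /G1 /G2; ring.
Qed.

(** Closedness of weak derivatives: both pairings are L^2-continuous. It transfers weak equations
    from smooth approximants to the limits produced by projection. *)
Lemma weak_op_lim (a b : R[i]) (f_ h_ : nat -> R * R -> R[i]) f h :
  (forall n, L2M (f_ n)) -> (forall n, L2M (h_ n)) -> L2M f -> L2M h ->
  (forall n, weak_op a b (f_ n) (h_ n)) ->
  nrm leb2 M (fun p => f_ n p - f p) @[n --> \oo] --> (0 : R) ->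
  nrm leb2 M (fun p => h_ n p - h p) @[n --> \oo] --> (0 : R) ->
  weak_op a b f h.
Proof.
move=> Lf_ Lh_ Lf Lh w cf ch phi tphi.
have [_ cphi cx cy _] := test_pdiff tphi.
set psi := fun p : R * R => a * (derive phi p (1, 0))%:C + b * (derive phi p (0, 1))%:C.
have cpsi : ccont psi := ccontD (ccontZ a cx) (ccontZ b cy).
have Lc (c : R[i]) (g : R * R -> R[i]) : ccont g -> L2 leb2 M (fun p => conjc (c * g p)).
  by move=> cg; exact: (ccont_L2M (ccont_conj (ccontZ c cg))).
have L1 (g : R * R -> R[i]) : ccont g -> L2 leb2 M (fun p => conjc (g p)).
  by move=> cg; exact: (ccont_L2M (ccont_conj cg)).
have E n : rip leb2 M (f_ n) (fun p => conjc (psi p)) =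
      - rip leb2 M (h_ n) (fun p => conjc ((phi p)%:C)) /\
    rip leb2 M (f_ n) (fun p => conjc (- 'i * psi p)) =
      - rip leb2 M (h_ n) (fun p => conjc (- 'i * (phi p)%:C)).
  by have := w n phi tphi; rewrite !cintegral_rip => -[].
rewrite !cintegral_rip.
have mM := @measurable_M R.
have key g k : L2 leb2 M g -> L2 leb2 M k ->
    (forall n, rip leb2 M (f_ n) g = - rip leb2 M (h_ n) k) ->
    rip leb2 M f g = - rip leb2 M h k.
  move=> Lg Lk H.
  have h1 := cvg_ripl mM Lf_ Lf Lg cf.
  have h2 : - rip leb2 M (h_ n) k @[n --> \oo] --> - rip leb2 M h k.
    by apply: cvgN; exact: (cvg_ripl mM Lh_ Lh Lk ch).
  have E1 : (fun n => rip leb2 M (f_ n) g) = (fun n => - rip leb2 M (h_ n) k).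
    by apply/funext => n; exact: H.
  by rewrite E1 in h1; exact: (cvg_unique _ h1 h2).
have k1 := key _ _ (L1 _ cpsi) (L1 _ cphi) (fun n => (E n).1).
have k2 := key _ _ (Lc _ _ cpsi) (Lc _ _ cphi) (fun n => (E n).2).
by rewrite k1 k2.
Qed.

Lemma test_csm (e : R) f : 0 < e -> csm f -> (forall p, bdist p <= e -> f p = 0) ->
  test_function (fun p => complex.Re (f p)) /\ test_function (fun p => complex.Im (f p)).
Proof.
move=> e0 sf f0; have [s1 s2] := csm_csmooth sf.
pose K : set (R * R) := [set p | e <= bdist p].
have cK : compact K.
  have cI : compact ((`[(-1), 1]%classic `*` `[(-1), 1]%classic) : set (R * R)).
    by apply: compact_setX; exact: segment_compact.
  apply: (subclosed_compact _ cI).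
    apply: (@closed_comp _ _ bdist [set x | e <= x]) => [p _|]; last exact: closed_ge.
    exact: continuous_bdist.
  move=> [x y]; rewrite /K /bdist/= !in_itv/= => h.
  by have := sqr_ge0 x; have := sqr_ge0 y; rewrite !expr2 in h * => hx hy;
    split; apply/andP; split; nra.
have KM : K `<=` M by move=> p; rewrite /K /M /bdist/=; lra.
have f0' p : ~ K p -> f p = 0.
  by move=> nK; apply: f0; rewrite leNgt; apply/negP => /ltW; exact: nK.
by split; split=> //; exists K; split=> // p /f0' ->.
Qed.

Lemma weak_op_rip (a b : R[i]) f h phi : weak_op a b f h -> test_function phi ->
  rip leb2 M f (fun p => conjc (a * (derive phi p (1, 0))%:C + b * (derive phi p (0, 1))%:C)) =
    - rip leb2 M h (fun p => conjc (phi p)%:C) /\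
  rip leb2 M f (fun p => conjc (- 'i * (a * (derive phi p (1, 0))%:C + b * (derive phi p (0, 1))%:C))) =
    - rip leb2 M h (fun p => conjc (- 'i * (phi p)%:C)).
Proof.
move=> w tphi; have := w phi tphi; rewrite !cintegral_rip => e.
by split; [exact: (congr1 (@complex.Re R) e)|exact: (congr1 (@complex.Im R) e)].
Qed.

(** Test functions are real, so a complex [phi] is split into its real and imaginary parts, and the
    two weak identities are recombined. *)
Lemma weak_op_csm (a b : R[i]) f h (e : R) (phi phiz phizb : R * R -> R[i]) :
  L2M f -> L2M h -> weak_op a b f h -> 0 < e ->
  csm phi -> cdiff phi phiz phizb ->
  (forall p, bdist p <= e -> phi p = 0) ->
  rip leb2 M f (fun p => conjc (a * (phiz p + phizb p) + b * ('i * (phiz p - phizb p)))) =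
  - rip leb2 M h (fun p => conjc (phi p)).
Proof.
move=> Lf Lh w e0 sphi dphi phi0.
have [t1 t2] := test_csm e0 sphi phi0.
have [d1 c1 x1 y1 _] := test_pdiff t1; have [d2 c2 x2 y2 _] := test_pdiff t2.
have [w1 _] := weak_op_rip w t1; have [_ w2] := weak_op_rip w t2.
pose psi1 (p : R * R) : R[i] := a * (derive (fun p => complex.Re (phi p)) p (1, 0))%:C +
  b * (derive (fun p => complex.Re (phi p)) p (0, 1))%:C.
pose psi2 (p : R * R) : R[i] := a * (derive (fun p => complex.Im (phi p)) p (1, 0))%:C +
  b * (derive (fun p => complex.Im (phi p)) p (0, 1))%:C.
have mM := @measurable_M R.
have cp1 : ccont psi1 := ccontD (ccontZ a x1) (ccontZ b y1).
have cp2 : ccont psi2 := ccontD (ccontZ a x2) (ccontZ b y2).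
have Lc (c : R[i]) (g : R * R -> R[i]) : ccont g -> L2 leb2 M (fun p => conjc (c * g p)).
  by move=> cg; exact: (ccont_L2M (ccont_conj (ccontZ c cg))).
have L1 (g : R * R -> R[i]) : ccont g -> L2 leb2 M (fun p => conjc (g p)).
  by move=> cg; exact: (ccont_L2M (ccont_conj cg)).
have [ex ey] := cderiveE dphi.
have E1 : (fun p => conjc (a * (phiz p + phizb p) + b * ('i * (phiz p - phizb p)))) =
    fun p => conjc (psi1 p) - conjc (- 'i * psi2 p).
  apply/funext => p; rewrite -ex -ey /psi1 /psi2 /cderive.
  set u := derive _ p (1, 0); set v := derive _ p (1, 0).
  set u' := derive _ p (0, 1); set v' := derive _ p (0, 1).
  have cE (x y : R) : x +i* y = x%:C + 'i * y%:C.
    by apply/eqP; rewrite eq_complex/=; apply/andP; split; apply/eqP; ring.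
  by rewrite !cE -raddfB; congr conjc; ring.
have E2 : (fun p => conjc (phi p)) =
    fun p => conjc ((complex.Re (phi p))%:C) - conjc (- 'i * (complex.Im (phi p))%:C).
  apply/funext => p; rewrite -raddfB; congr conjc.
  by case: (phi p) => x y; apply/eqP; rewrite eq_complex/=; apply/andP; split; apply/eqP; ring.
rewrite E1 E2 (ripBr mM (L1 _ cp1) (Lc _ _ cp2) Lf) (ripBr mM (L1 _ c1) (Lc _ _ c2) Lh).
by rewrite /psi1 /psi2 w1 w2; ring.
Qed.

Lemma weak_dzbar_csm f (e : R) (phi phiz phizb : R * R -> R[i]) :
  L2M f -> weak_dzbar f (fun=> 0) -> 0 < e ->
  csm phi -> cdiff phi phiz phizb ->
  (forall p, bdist p <= e -> phi p = 0) ->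
  rip leb2 M f (fun p => conjc (phizb p)) = 0.
Proof.
move=> Lf w e0 s1 d z.
have L0 : L2M (fun=> 0 : R[i]) by exact: L2_0.
have := weak_op_csm Lf L0 w e0 s1 d z; rewrite (rip0l _ (@measurable_M R)) oppr0 => <-.
congr (rip _ _ _ _); apply/funext => p; congr conjc.
by case: (phiz p) (phizb p) => x y [x' y'];
  apply/eqP; rewrite eq_complex/=; apply/andP; split; apply/eqP; field.
Qed.

Lemma weak_dz_csm f (e : R) (phi phiz phizb : R * R -> R[i]) :
  L2M f -> weak_dz f (fun=> 0) -> 0 < e ->
  csm phi -> cdiff phi phiz phizb ->
  (forall p, bdist p <= e -> phi p = 0) ->
  rip leb2 M f (fun p => conjc (phiz p)) = 0.
Proof.
move=> Lf w e0 s1 d z.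
have L0 : L2M (fun=> 0 : R[i]) by exact: L2_0.
have := weak_op_csm Lf L0 w e0 s1 d z; rewrite (rip0l _ (@measurable_M R)) oppr0 => <-.
congr (rip _ _ _ _); apply/funext => p; congr conjc.
by case: (phiz p) (phizb p) => x y [x' y'];
  apply/eqP; rewrite eq_complex/=; apply/andP; split; apply/eqP; field.
Qed.

Lemma csm_weak_dzbar f fz : csm f -> csm fz -> cdiff f fz (fun=> 0) ->
  weak_dzbar f (fun=> 0).
Proof.
move=> sf sfz df; have := csm_weak (2^-1)%:C (0 +i* 2^-1) sf sfz (csm_cst 0) df.
congr weak_op; apply/funext => p; case: (fz p) => x y.
by apply/eqP; rewrite eq_complex/=; apply/andP; split; apply/eqP; field.
Qed.

Lemma csm_weak_grad f fz fzb : csm f -> csm fz -> csm fzb -> cdiff f fz fzb ->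
  weak_dx f (fun p => fz p + fzb p) /\ weak_dy f (fun p => 'i * (fz p - fzb p)).
Proof.
move=> sf sfz sfzb df; split.
  have := csm_weak 1 0 sf sfz sfzb df; congr weak_op; apply/funext => p.
  by rewrite mul0r addr0 mul1r.
have := csm_weak 0 1 sf sfz sfzb df; congr weak_op; apply/funext => p.
by rewrite mul0r add0r mul1r.
Qed.

End WeakDerivatives.

(** * Testing weak derivatives against functions that vanish only on the circle *)

Section Cutoffs.
Context {R : realType}.
Local Notation mR := (measurableTypeR R).
Implicit Types f h q qz qzb u : R * R -> R[i].

(** [flat j.+1] is [flat j] divided by x, and [flat j] is at most j^j, which is 1 for j = 0 and j =
    1. *)
Lemma flat_le_inv j (x : R) : (j < 2)%N -> 0 < x -> flat j.+1 x <= x^-1.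
Proof.
move=> j2 x0; have h : flat j x = x * flat j.+1 x by exact: flatS.
have -> : flat j.+1 x = x^-1 * flat j x by rewrite h mulrA mulVf ?mul1r// gt_eqF.
rewrite -[leRHS]mulr1 ler_pM2l ?invr_gt0//; apply: le_trans (flat_le j x) _.
by case: j j2 {h} => [|[|//]] _; rewrite ?expr0 ?expr1.
Qed.

Lemma flat0_ge (x : R) : 0 < x -> 1 - x^-1 <= flat 0 x.
Proof.
by move=> x0; rewrite /flat x0 expr0 mul1r; exact: expR_ge1Dx.
Qed.

Lemma near_inv (s : R) : 0 < s ->
  \forall n \near \oo, 0 < n.+1%:R * s - 1 /\ (n.+1%:R * s - 1)^-1 <= (s / 2)^-1 * n.+1%:R^-1.
Proof.
move=> s0; near=> n.
have h : 2 / s <= n.+1%:R.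
  apply: (@le_trans _ _ n%:R); last by rewrite ler_nat.
  by near: n; exact: nbhs_infty_ger.
have h2 : 2 <= n.+1%:R * s by rewrite -ler_pdivrMr.
have h3 : 0 < n.+1%:R * s - 1 by lra.
split=> //; rewrite -invfM lef_pV2 ?posrE//; first by lra.
by rewrite mulr_gt0// ?ltr0n// divr_gt0.
Unshelve. all: by end_near. Qed.

Lemma cvg_inv_cut (s : R) : (s / 2)^-1 * n.+1%:R^-1 @[n --> \oo] --> (0 : R).
Proof. by rewrite -[X in _ --> X](mulr0 (s / 2)^-1); apply: cvgMl_tmp; exact: cvg_harmonic. Qed.

Lemma flatS_cvg j (s : R) : (j < 2)%N -> 0 < s ->
  flat j.+1 (n.+1%:R * s - 1) @[n --> \oo] --> (0 : R).
Proof.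
move=> j2 s0; apply: (squeeze_cvgr _ (cvg_cst 0) (cvg_inv_cut s)).
apply: filterS (near_inv s0) => n [n0 nle].
by rewrite flat_ge0/= (le_trans _ nle)// flat_le_inv.
Qed.

Lemma flat0_cvg (s : R) : 0 < s -> flat 0 (n.+1%:R * s - 1) @[n --> \oo] --> (1 : R).
Proof.
move=> s0; have h : 1 - (s / 2)^-1 * n.+1%:R^-1 @[n --> \oo] --> (1 : R).
  by rewrite -[X in _ --> X]subr0; apply: cvgB; [exact: cvg_cst|exact: cvg_inv_cut].
apply: (@squeeze_cvgr _ _ _ _ (fun n => 1 - (s / 2)^-1 * n.+1%:R^-1) (fun=> 1));
  [|exact: h|exact: cvg_cst].
apply: filterS (near_inv s0) => n [n0 nle].
apply/andP; split; last by rewrite (le_trans (flat_le 0 _))// expr0.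
by apply: le_trans (flat0_ge n0); rewrite lerD2l lerN2.
Qed.

(** Dominated convergence with bound |f|^2 + C, integrable because the disk has finite area. *)
Lemma cvg_rip_bounded f (g_ : nat -> R * R -> R[i]) (g : R * R -> R[i]) (C : R) :
  L2M f -> (forall n, ccont (g_ n)) -> ccont g ->
  (forall n p, M p -> dotc (g_ n p) (g_ n p) <= C) ->
  (forall p, M p -> dotc (f p) (g_ n p) @[n --> \oo] --> dotc (f p) (g p)) ->
  rip leb2 M f (g_ n) @[n --> \oo] --> rip leb2 M f g.
Proof.
move=> Lf cg_ cg gC gcvg.
have mM := @measurable_M R.
have [mf i_f] := (L2P _ _ _).1 Lf.
have m_ n : measurable_fun (M : set (mR * mR)) (fun p : mR * mR => (dotc (f p) (g_ n p))%:E).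
  by apply/measurable_EFinP; apply: cmeas_dot => //; exact: ccont_cmeas.
have m0 : measurable_fun (M : set (mR * mR)) (fun p : mR * mR => (dotc (f p) (g p))%:E).
  by apply/measurable_EFinP; apply: cmeas_dot => //; exact: ccont_cmeas.
have idom : leb2.-integrable (M : set (mR * mR)) (fun p => (dotc (f p) (f p) + C)%:E).
  under eq_fun do rewrite EFinD.
  apply: integrableD => //; apply/integrableP; split; first exact: measurable_cst.
  rewrite integral_cst//= lte_mul_pinfty//; exact: leb2_M_lty.
have dom n p : M p -> (`|(dotc (f p) (g_ n p))%:E| <= (dotc (f p) (f p) + C)%:E)%E.
  by move=> pM; rewrite lee_fin (le_trans (dotc_young _ _))// lerD2l gC.
have cv p : M p -> (dotc (f p) (g_ n p))%:E @[n --> \oo] --> (dotc (f p) (g p))%:E.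
  by move=> pM; apply: cvg_EFin; [exact: nearW|exact: gcvg].
have cva : {ae leb2, forall p : mR * mR, M p ->
    (dotc (f p) (g_ n p))%:E @[n --> \oo] --> (dotc (f p) (g p))%:E}.
  by apply: aeW => p; exact: cv.
have doma : {ae leb2, forall (p : mR * mR) n, M p ->
    (`|(dotc (f p) (g_ n p))%:E| <= (dotc (f p) (f p) + C)%:E)%E}.
  by apply: aeW => p n; exact: dom.
have [ig _ c] := dominated_convergence mM m_ m0 cva idom doma.
have fi n : leb2.-integrable (M : set (mR * mR)) (fun p => (dotc (f p) (g_ n p))%:E).
  by apply: (L2_dot mM Lf); exact: ccont_L2M.
have E n : (\int[leb2]_(p in M) (dotc (f p) (g_ n p))%:E)%E = (rip leb2 M f (g_ n))%:E.
  by rewrite /rip /Rintegral fineK//; exact: integrable_fin_num.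
have E0 : (\int[leb2]_(p in M) (dotc (f p) (g p))%:E)%E = (rip leb2 M f g)%:E.
  by rewrite /rip /Rintegral fineK//; exact: integrable_fin_num.
have c' : (rip leb2 M f (g_ n))%:E @[n --> \oo] --> (rip leb2 M f g)%:E.
  rewrite -E0; move: c; rewrite (_ : [sequence _]_n = fun n => (rip leb2 M f (g_ n))%:E)//.
  by apply/funext => n; exact: E.
exact: (fine_cvg c').
Qed.

(** The product s chi_n q with chi_n = e^{-1/(ns-1)} cut off at s = 1/n. The factor s compensates
    for the slope of order n of the cutoff, so gradients stay bounded. *)
Definition cut n q (p : R * R) : R[i] :=
  (bdist p * flat 0 (n.+1%:R * bdist p - 1))%:C * q p.
(** The derivative of s chi_n with respect to s. With x = (n+1)s - 1, the term (n+1)s chi' equals (x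
    + 1) [flat 2 x], that is [flat 1 x + flat 2 x], in which no factor n remains. *)
Definition cutd n (p : R * R) : R[i] :=
  (flat 0 (n.+1%:R * bdist p - 1) + flat 1 (n.+1%:R * bdist p - 1) +
   flat 2 (n.+1%:R * bdist p - 1))%:C.

Lemma csm_cut n q : csm q -> csm (cut n q).
Proof.
move=> sq; apply: csm_ext (csmM (csmM csm_bdist (csm_flat 0 n.+1)) sq) _ => p.
by rewrite /cut rmorphM.
Qed.

Lemma csm_cutd n : csm (cutd n).
Proof.
apply: csm_ext (csmD (csmD (csm_flat 0 n.+1) (csm_flat 1 n.+1)) (csm_flat 2 n.+1)) _ => p.
by rewrite /cutd !rmorphD.
Qed.

Lemma cut_eq0 n q p : bdist p <= n.+1%:R^-1 -> cut n q p = 0.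
Proof.
move=> h; rewrite /cut flat0 ?mulr0 ?mul0r// subr_le0.
by rewrite mulrC -ler_pdivlMr ?ltr0n// div1r.
Qed.

Lemma cdiff_cut n q qz qzb : cdiff q qz qzb -> cdiff (cut n q)
  (fun p => - conjc (zc p) * cutd n p * q p +
     (bdist p * flat 0 (n.+1%:R * bdist p - 1))%:C * qz p)
  (fun p => - zc p * cutd n p * q p +
     (bdist p * flat 0 (n.+1%:R * bdist p - 1))%:C * qzb p).
Proof.
move=> dq.
have E p : cutd n p = (flat 0 (n.+1%:R * bdist p - 1))%:C +
    n.+1%:R * (bdist p)%:C * (flatd 0 (n.+1%:R * bdist p - 1))%:C.
  rewrite /cutd /flatd mul0r subr0; set x := n.+1%:R * bdist p - 1.
  have -> : n.+1%:R * (bdist p)%:C = (x + 1)%:C :> R[i].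
    by rewrite /x subrK rmorphM/= rmorph_nat.
  rewrite -rmorphM -rmorphD; congr (_%:C).
  by rewrite mulrDl mul1r -flatS addrA.
have -> : cut n q = fun p => ((bdist p)%:C * (flat 0 (n.+1%:R * bdist p - 1))%:C) * q p.
  by apply/funext => p; rewrite /cut rmorphM.
apply: cdiff_ext (cdiffM (cdiffM cdiff_bdist (cdiff_flat 0 n.+1)) dq) _ _ => p.
  by rewrite E [in RHS]rmorphM/=; ring.
by rewrite E [in RHS]rmorphM/=; ring.
Qed.

(** The bound 6 is 1 + 1 + 4, from j^j for j = 0, 1, 2. *)
Lemma cut_bound n p : M p ->
  `|complex.Re (cutd n p)| <= 6 /\ `|bdist p * flat 0 (n.+1%:R * bdist p - 1)| <= 1.
Proof.
rewrite /M/= => pM; have := sqr_ge0 p.1; have := sqr_ge0 p.2 => h1 h2.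
set x := _ - 1; have f0 := flat_le 0 x; have f1 := flat_le 1 x; have f2 := flat_le 2 x.
have g0 := flat_ge0 0 x; have g1 := flat_ge0 1 x; have g2 := flat_ge0 2 x.
have b : 0 <= bdist p <= 1 by rewrite /bdist; apply/andP; split; lra.
rewrite expr0 in f0; rewrite expr1 in f1; rewrite (_ : 2%:R ^+ 2 = 4) in f2; last by rewrite -natrX.
move/andP: b => [b0 b1]; split.
  by rewrite /cutd/= -/x ger0_norm; lra.
by rewrite ger0_norm ?mulr_ge0//; apply: mulr_ile1.
Qed.

Lemma dotc_bounded_M f : ccont f ->
  exists2 C : R, 0 <= C & forall p, M p -> dotc (f p) (f p) <= C.
Proof.
move=> [c1 c2]; have [C C0 HC] : exists2 C : R, 0 <= C &
    forall p, M p -> `|dotc (f p) (f p)| <= C.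
  apply: continuous_M_bounded => p; apply: cvgD; apply: cvgM; first exact: c1.
  - exact: c1.
  - exact: c2.
  - exact: c2.
by exists C => // p pM; apply: le_trans (HC p pM); exact: ler_norm.
Qed.

Lemma dotc_realr (z w : R[i]) (c : R) : dotc z (c%:C * w) = c * dotc z w.
Proof. by case: z w => [a b] [a' b']; rewrite /dotc/=; ring. Qed.

(* With [s = 1 - |z|^2], the functions [s q] are limits of test functions in the
   sense needed to test weak derivatives against them. *)
Lemma cvg_rip_cut f q u (a : R * R -> R[i]) : L2M f -> ccont q -> ccont u -> ccont a ->
  rip leb2 M f (fun p => conjc (- a p * cutd n p * q p +
     (bdist p * flat 0 (n.+1%:R * bdist p - 1))%:C * u p)) @[n --> \oo] -->
  rip leb2 M f (fun p => conjc (- a p * q p + (bdist p)%:C * u p)).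
Proof.
move=> Lf cq cu ca.
pose A p := conjc (- a p * q p); pose B p := conjc (u p).
have cA : ccont A := ccont_conj (ccontM (ccontN ca) cq).
have cB : ccont B := ccont_conj cu.
pose x n p : R := complex.Re (cutd n p).
pose y n p : R := bdist p * flat 0 (n.+1%:R * bdist p - 1).
have E n : (fun p => conjc (- a p * cutd n p * q p + (y n p)%:C * u p)) =
    fun p => (x n p)%:C * A p + (y n p)%:C * B p.
  apply/funext => p; rewrite conjcD; congr (_ + _); last by rewrite conjcM conjc_real.
  rewrite /A (_ : cutd n p = (x n p)%:C)//.
  by rewrite -mulrA mulrCA conjcM conjc_real.
have E0 : (fun p => conjc (- a p * q p + (bdist p)%:C * u p)) =
    fun p => 1%:C * A p + (bdist p)%:C * B p.
  by apply/funext => p; rewrite conjcD mul1r; congr (_ + _); rewrite conjcM conjc_real.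
have [CA CA0 HA] := dotc_bounded_M cA.
have [CB CB0 HB] := dotc_bounded_M cB.
have cx n : ccont (fun p : R * R => (x n p)%:C).
  have -> : (fun p : R * R => (x n p)%:C) = cutd n by [].
  exact: csm_ccont (csm_cutd n).
have cy n : ccont (fun p : R * R => (y n p)%:C).
  have -> : (fun p : R * R => (y n p)%:C) = cut n (fun=> 1).
    by apply/funext => p; rewrite /cut mulr1.
  exact: csm_ccont (csm_cut n (csm_cst 1)).
have cb : ccont (fun p : R * R => (bdist p)%:C) := csm_ccont csm_bdist.
under eq_cvg do rewrite E.
(* From |xA + yB|^2 <= 2(x^2 |A|^2 + y^2 |B|^2) with |x| <= 6 and |y| <= 1. *)
rewrite E0; apply: (cvg_rip_bounded (C := 2 * (36 * CA + CB))) => //.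
- by move=> n; exact: (ccontD (ccontM (cx n) cA) (ccontM (cy n) cB)).
- exact: (ccontD (ccontM (ccont_cst 1%:C) cA) (ccontM cb cB)).
- move=> n p pM; have [bx by_] := cut_bound n pM.
  have hA := HA p pM; have hB := HB p pM; have gA := dotc_ge0 (A p); have gB := dotc_ge0 (B p).
  rewrite -/(x n p) in bx; rewrite -/(y n p) in by_.
  have x2 : x n p ^+ 2 <= 36.
    by rewrite -real_normK ?num_real// (_ : 36 = 6 ^+ 2); [rewrite lerXn2r ?nnegrE//|rewrite -natrX].
  have y2 : y n p ^+ 2 <= 1.
    by rewrite -real_normK ?num_real// -(expr1n _ 2) lerXn2r ?nnegrE.
  have : dotc ((x n p)%:C * A p + (y n p)%:C * B p) ((x n p)%:C * A p + (y n p)%:C * B p) <=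
      2 * (x n p ^+ 2 * dotc (A p) (A p) + y n p ^+ 2 * dotc (B p) (B p)).
    case: (A p) (B p) => a1 a2 [b1 b2]; rewrite /dotc/=.
    move: (x n p) (y n p) => X Y.
    have := sqr_ge0 (X * a1 - Y * b1); have := sqr_ge0 (X * a2 - Y * b2); rewrite !expr2; nra.
  move=> h; apply: le_trans h _; rewrite ler_pM2l//; apply: lerD.
    by apply: le_trans (_ : 36 * dotc (A p) (A p) <= _); [rewrite ler_wpM2r|rewrite ler_pM2l].
  by apply: le_trans hB; rewrite ler_piMl.
move=> p pM; rewrite dotcDr !dotc_realr.
under eq_cvg do rewrite dotcDr !dotc_realr.
have s0 : 0 < bdist p by move: pM; rewrite /M /bdist/=; lra.
apply: cvgD; apply: cvgMr_tmp.
  rewrite -[X in _ --> X]addr0; rewrite -[X in _ --> X]addr0.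
  by apply: cvgD; [apply: cvgD; [exact: flat0_cvg|exact: flatS_cvg]|exact: flatS_cvg].
by rewrite -[X in _ --> X]mulr1; apply: cvgMl_tmp; exact: flat0_cvg.
Qed.

(** The bracket is dbar(s q), because dbar s = -z; the identity is the limit of weak holomorphy
    tested on the functions [cut n q]. *)
Lemma rip_weak_dzbar f q qz qzb : L2M f -> weak_dzbar f (fun=> 0) -> csm q -> ccont qzb ->
  cdiff q qz qzb ->
  rip leb2 M f (fun p => conjc (- zc p * q p + (bdist p)%:C * qzb p)) = 0.
Proof.
move=> Lf w sq cqzb dq.
have cz : ccont (zc : R * R -> R[i]) by exact: csm_ccont csm_zc.
have := cvg_rip_cut Lf (csm_ccont sq) cqzb cz.
under eq_cvg => n.
  rewrite (weak_dzbar_csm Lf w (e := n.+1%:R^-1) _ (csm_cut n sq) (cdiff_cut n dq)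
    (@cut_eq0 n q)) ?invr_gt0 ?ltr0n//.
  over.
by move=> h; apply: esym; exact: (cvg_unique _ (cvg_cst (0 : R)) h).
Qed.

Lemma rip_weak_dz f q qz qzb : L2M f -> weak_dz f (fun=> 0) -> csm q -> ccont qz ->
  cdiff q qz qzb ->
  rip leb2 M f (fun p => conjc (- conjc (zc p) * q p + (bdist p)%:C * qz p)) = 0.
Proof.
move=> Lf w sq cqz dq.
have cz : ccont (fun p : R * R => conjc (zc p)) by exact: csm_ccont csm_conjz.
have := cvg_rip_cut Lf (csm_ccont sq) cqz cz.
under eq_cvg => n.
  rewrite (weak_dz_csm Lf w (e := n.+1%:R^-1) _ (csm_cut n sq) (cdiff_cut n dq)
    (@cut_eq0 n q)) ?invr_gt0 ?ltr0n//.
  over.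
by move=> h; apply: esym; exact: (cvg_unique _ (cvg_cst (0 : R)) h).
Qed.

Lemma cdiff_unique f fz fzb gz gzb : cdiff f fz fzb -> cdiff f gz gzb ->
  fz = gz /\ fzb = gzb.
Proof.
move=> /cderiveE[d1 d2] /cderiveE[e1 e2].
suff H p : fz p = gz p /\ fzb p = gzb p by split; apply/funext => p; have [] := H p.
have := d1 p; have := d2 p; rewrite e1 e2.
case: (fz p) (fzb p) (gz p) (gzb p) => a b [c d] [a' b'] [c' d'].
move=> /eqP; rewrite eq_complex/= => /andP[/eqP h1 /eqP h2].
move=> /eqP; rewrite eq_complex/= => /andP[/eqP h3 /eqP h4].
by split; apply/eqP; rewrite eq_complex/=; apply/andP; split; apply/eqP; lra.
Qed.

(* Mixed derivatives commute, so the rotated weak gradient is divergence free. *)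
Lemma weak_grad_curl f fx fy (e : R) phi phiz phizb : H1 f fx fy -> 0 < e ->
  csm phi -> cdiff phi phiz phizb -> (forall p, bdist p <= e -> phi p = 0) ->
  rip leb2 M fx (fun p => conjc ('i * (phiz p - phizb p))) =
  rip leb2 M fy (fun p => conjc (phiz p + phizb p)).
Proof.
move=> [Lf Lfx Lfy wx wy] e0 sphi dphi phi0.
have [gz [gzb [gw [sz szb sw dg [[ga dga] [gb dgb]]]]]] := csm_diff sphi.
have [] := cdiff_unique dphi dg => -> ->.
have oU : open [set p : R * R | bdist p < e].
  apply: (@open_comp _ _ bdist [set x | x < e]) => [p _|]; last exact: open_lt.
  exact: continuous_bdist.
have U0 p : bdist p < e -> gz p = 0 /\ gzb p = 0.
  by apply: (cdiff_open0 dg oU) => q qe; apply: phi0; exact: ltW.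
(* Derivatives of [phi] vanish on the open set where s < e; halving [e] gives the closed condition
   required by [weak_op_csm]. *)
have e20 : 0 < e / 2 by rewrite divr_gt0.
have zX p : bdist p <= e / 2 -> gz p + gzb p = 0.
  by move=> pe; have [|-> ->] := U0 p; [lra|rewrite addr0].
have zY p : bdist p <= e / 2 -> 'i * (gz p - gzb p) = 0.
  by move=> pe; have [|-> ->] := U0 p; [lra|rewrite subrr mulr0].
have dX := cdiffD dga dgb.
have dY := cdiffM (cdiff_cst 'i%R) (cdiffD dga (cdiffM (cdiff_cst (-1)) dgb)).
have sX := csmD sz szb.
have sY := csmM (csm_cst 'i%R) (csmD sz (csmM (csm_cst (-1)) szb)).
have zY' p : bdist p <= e / 2 -> 'i * (gz p + -1 * gzb p) = 0.
  by move=> /zY; rewrite mulN1r.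
have hx := weak_op_csm Lf Lfx wx e20 sY dY zY'.
have hy := weak_op_csm Lf Lfy wy e20 sX dX zX.
have EY : (fun p => conjc ('i * (gz p - gzb p))) = fun p => conjc ('i * (gz p + -1 * gzb p)).
  by apply/funext => p; rewrite mulN1r.
rewrite EY; apply: oppr_inj; rewrite -hx -hy; congr (rip _ _ _ _).
apply/funext => p; congr conjc; ring.
Qed.

(** The curl identity with s q in place of a compactly supported function, by the same passage to
    the limit on both sides. *)
Lemma rip_weak_grad f fx fy q qz qzb : H1 f fx fy -> csm q -> ccont qz -> ccont qzb ->
  cdiff q qz qzb ->
  rip leb2 M fx (fun p => conjc ('i * ((- conjc (zc p) * q p + (bdist p)%:C * qz p) -
     (- zc p * q p + (bdist p)%:C * qzb p)))) =
  rip leb2 M fy (fun p => conjc ((- conjc (zc p) * q p + (bdist p)%:C * qz p) +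
     (- zc p * q p + (bdist p)%:C * qzb p))).
Proof.
move=> Hf sq cqz cqzb dq; have [Lf Lfx Lfy wx wy] := Hf.
have cz : ccont (zc : R * R -> R[i]) by exact: csm_ccont csm_zc.
have czb : ccont (fun p : R * R => conjc (zc p)) by exact: csm_ccont csm_conjz.
have cq := csm_ccont sq.
have hx := cvg_rip_cut Lfx (ccontZ 'i%R cq) (ccontZ 'i%R (ccontB cqz cqzb)) (ccontB czb cz).
have hy := cvg_rip_cut Lfy cq (ccontD cqz cqzb) (ccontD czb cz).
set X := (X in X = _); set Y := (X in _ = X).
rewrite (_ : rip _ _ _ _ = X) in hx; last first.
  by congr (rip _ _ _ _); apply/funext => p; congr conjc; ring.
rewrite (_ : rip _ _ _ _ = Y) in hy; last first.
  by congr (rip _ _ _ _); apply/funext => p; congr conjc; ring.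
pose y n (p : R * R) : R[i] := (bdist p * flat 0 (n.+1%:R * bdist p - 1))%:C.
pose u n : R := rip leb2 M fx (fun p => conjc (- (conjc (zc p) - zc p) * cutd n p * ('i * q p) +
  y n p * ('i * (qz p - qzb p)))).
pose v n : R := rip leb2 M fy (fun p => conjc (- (conjc (zc p) + zc p) * cutd n p * q p +
  y n p * (qz p + qzb p))).
have uv : u = v.
  apply/funext => n; have n0 : (0 : R) < n.+1%:R^-1 by rewrite invr_gt0 ltr0n.
  have := weak_grad_curl Hf n0 (csm_cut n sq) (cdiff_cut n dq) (@cut_eq0 n q).
  congr (_ = _); congr (rip _ _ _ _); apply/funext => p; congr conjc; rewrite /y.
    by ring.
  by ring.
have hu : u n @[n --> \oo] --> X by exact: hx.
have hv : u n @[n --> \oo] --> Y by rewrite uv; exact: hy.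
exact: (cvg_unique _ hu hv).
Qed.

End Cutoffs.

(** * The linear algebra of moments behind uniqueness *)

Section GaugeAlgebra.
Context {R : realType}.

Definition harmonics (m : nat) (k : int) :=
  exists2 j : nat, (j <= m)%N & k = m%:Z - (2 * j)%N%:Z.

(** Each step lowers both indices by one, so every moment reduces to one with b = 0, or dies through
    the factor a = 0. At a = 0 the value of the truncated predecessor is harmless, as it is
    multiplied by 0. *)
Lemma holomorphic_recursion (F : nat -> nat -> R) :
  (forall a b, a%:R * F a.-1 b = a.+1%:R * F a b.+1) -> (forall n, F n 0%N = 0) ->
  forall a b, F a b = 0.
Proof.
move=> rec F0 a b; elim: b a => [//|b IH] a.
have := rec a b; rewrite IH mulr0 => /esym/eqP.
by rewrite mulf_eq0 pnatr_eq0 => /eqP.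
Qed.

(** Eliminating [N] shows that a P(a-1, b) is constant along diagonals, and it vanishes on both
    axes. *)
Lemma diagonal_recursion (P N : nat -> nat -> R) :
  (forall a b, b%:R * N a b.-1 = a%:R * P a.-1 b) ->
  (forall a b, a%:R * P a.-1 b + b%:R * N a b.-1 =
     a.+1%:R * P a b.+1 + b.+1%:R * N a.+1 b) ->
  forall a b, P a b = 0 /\ N a b = 0.
Proof.
move=> NP rec; pose U a b := a%:R * P a.-1 b.
have US a b : U a.+1 b.+1 = U a b.
  have := rec a b; have := NP a b; have := NP a.+1 b.+1; rewrite /U/= => -> ->; lra.
have U0 a b : U a b = 0.
  elim: a b => [|a IH] b; first by rewrite /U mul0r.
  by case: b => [|b]; [rewrite /U -NP mul0r|rewrite US].
move=> a b; split; apply/eqP.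
  have := U0 a.+1 b; rewrite /U/= => /eqP.
  by rewrite mulf_eq0 pnatr_eq0.
have := U0 a b.+1; rewrite /U -NP/= => /eqP.
by rewrite mulf_eq0 pnatr_eq0.
Qed.

(** [L a b k] stands for the moment of a tensor against c z^a zbar^b e^{ik theta}. [L_pos], [L_neg]
    and [L_odd] encode the normal form, while [L_xray] is orthogonality to a binomially expanded
    first integral. *)
Variables (m : nat) (L : nat -> nat -> int -> R).
Hypothesis L_off : forall a b k, ~ harmonics m k -> L a b k = 0.
Hypothesis L_pos : forall a b k, 1 < k -> a%:R * L a.-1 b k = a.+1%:R * L a b.+1 k.
Hypothesis L_neg : forall a b k, k < -1 -> b%:R * L a b.-1 k = b.+1%:R * L a.+1 b k.
Hypothesis L_xray : forall (j : int) (n : nat),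
  \sum_(l < n.+1) (-1) ^+ l * 'C(n, l)%:R * L (n - l) l (j - n%:Z + (2 * l)%N%:Z) = 0.
Hypothesis L_odd : odd m -> forall a b,
  a%:R * L a.-1 b 1 + b%:R * L a b.-1 (-1) = a.+1%:R * L a b.+1 1 + b.+1%:R * L a.+1 b (-1).

Lemma harmonics_bound k : harmonics m k -> - m%:Z <= k <= m%:Z.
Proof. by move=> [j jm ->]; lia. Qed.

(** Downward induction from the top degree; [N] bounds how far [k] may lie below it. *)
Let Lpos a b k : 1 < k -> L a b k = 0.
Proof.
have H (N : nat) : forall k, 1 < k -> m%:Z < k + N%:Z -> forall a b, L a b k = 0.
  elim: N => [|N IH] {}k k1 kN.
    by move=> {}a {}b; apply: L_off => /harmonics_bound; lia.
  apply: holomorphic_recursion => [{}a {}b|n]; first exact: L_pos.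
  (* With j = k + n the term l has degree k + 2l: all but l = 0 vanish by induction, leaving the
     moment of z^n. *)
  have := L_xray (k + n%:Z) n; rewrite big_ord_recl big1 => [|i _].
    by rewrite addr0 expr0 mul1r bin0 mul1r subn0 addrK muln0 addr0.
  by rewrite [L _ _ _]IH ?mulr0//= /bump/=; lia.
by move=> k1; apply: (H m); lia.
Qed.

Let Lneg a b k : k < -1 -> L a b k = 0.
Proof.
have H (N : nat) : forall k, k < -1 -> k - N%:Z < - m%:Z -> forall a b, L a b k = 0.
  elim: N => [|N IH] {}k k1 kN.
    by move=> {}a {}b; apply: L_off => /harmonics_bound; lia.
  move=> {}a {}b; apply: (holomorphic_recursion (F := fun a b => L b a k)) => [{}a {}b|n].
    exact: L_neg.
  have := L_xray (k - n%:Z) n; rewrite big_ord_recr/= big1 => [|i _].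
    rewrite add0r binn mulr1 subnn (_ : k - n%:Z - n%:Z + (2 * n)%N%:Z = k); last by lia.
    by move/eqP; rewrite mulf_eq0 signr_eq0 => /eqP.
  by rewrite [L _ _ _]IH ?mulr0//=; have := ltn_ord i; lia.
by move=> k1; apply: (H m); lia.
Qed.

(** For j = a - b and n = a + b, the term of degree 0 is l = b, the moment wanted; all others have
    degree at least 2 in absolute value. *)
Let L0 a b : L a b 0 = 0.
Proof.
have bn : (b < (a + b).+1)%N by lia.
have := L_xray (a%:Z - b%:Z) (a + b); rewrite (bigD1 (Ordinal bn)) //= big1 ?addr0 => [|i ib].
  rewrite addnK (_ : a%:Z - b%:Z - (a + b)%N%:Z + (2 * b)%N%:Z = 0); last by lia.
  move/eqP; rewrite -mulrA mulf_eq0 signr_eq0 mulf_eq0 pnatr_eq0 -leqn0 leqNgt bin_gt0.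
  by rewrite leq_addl => /eqP.
have {}ib : (i : nat) <> b by move=> e; move/eqP: ib; apply; apply: val_inj.
by have [l|l] := ltnP i b; [rewrite [L _ _ _]Lneg|rewrite [L _ _ _]Lpos]; rewrite ?mulr0//; lia.
Qed.

(** Once the other degrees are gone, first integrals relate only degrees 1 and -1. This is the first
    hypothesis of [diagonal_recursion], and the normal form gives the second. *)
Let Lpm1 a b : odd m -> L a b 1 = 0 /\ L a b (-1) = 0.
Proof.
move=> om; apply: (diagonal_recursion (P := fun a b => L a b 1) (N := fun a b => L a b (-1)));
  last exact: L_odd.
move=> {}a {}b; case: a => [|a]; case: b => [|b]; rewrite ?mul0r//=.
- have := L_xray (- b.+1%:Z) b; rewrite big_ord_recr/= big1 => [|i _].
    rewrite add0r binn mulr1 subnn (_ : - b.+1%:Z - b%:Z + (2 * b)%N%:Z = -1); last by lia.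
    by move/eqP; rewrite mulf_eq0 signr_eq0 => /eqP ->; rewrite mulr0.
  by rewrite [L _ _ _]Lneg ?mulr0//; have := ltn_ord i; lia.
- have := L_xray a.+1%:Z a; rewrite big_ord_recl big1 => [|i _].
    rewrite addr0 expr0 mul1r bin0 mul1r subn0 muln0 addr0 (_ : a.+1%:Z - a%:Z = 1); last by lia.
    by move=> ->; rewrite mulr0.
  by rewrite [L _ _ _]Lpos ?mulr0//= /bump/=; lia.
(* With this n and j = a - b, only l = b (degree -1) and l = b + 1 (degree 1) survive. *)
pose n := (a + b).+1.
have b0 : (b < n.+1)%N by rewrite /n; lia.
have b1 : (b.+1 < n.+1)%N by rewrite /n; lia.
have := L_xray (a.+1%:Z - b.+1%:Z) n.
rewrite (bigD1 (Ordinal b0)) //= (bigD1 (Ordinal b1)) //=; last first.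
  by apply/eqP => /(congr1 val)/=; lia.
rewrite big1 ?addr0 => [|i /andP[i0 i1]]; last first.
  have {}i0 : (i : nat) <> b by move=> e; move/eqP: i0; apply; apply: val_inj.
  have {}i1 : (i : nat) <> b.+1 by move=> e; move/eqP: i1; apply; apply: val_inj.
  by have [l|l] := ltnP i b; [rewrite [L _ _ _]Lneg|rewrite [L _ _ _]Lpos]; rewrite ?mulr0//; lia.
rewrite (_ : (n - b)%N = a.+1); last by rewrite /n; lia.
rewrite (_ : (n - b.+1)%N = a); last by rewrite /n; lia.
rewrite (_ : a.+1%:Z - b.+1%:Z - n%:Z + (2 * b)%N%:Z = -1); last by rewrite /n; lia.
rewrite (_ : a.+1%:Z - b.+1%:Z - n%:Z + (2 * b.+1)%N%:Z = 1); last by rewrite /n; lia.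
rewrite exprS mulN1r !mulNr -!mulrA -mulrBr => /eqP.
rewrite mulf_eq0 signr_eq0/= subr_eq0 => /eqP h.
(* Since n - b = a + 1, this ratio of consecutive binomials is precisely the ratio of the
   coefficients in the diagonal recursion. *)
have hb : b.+1%:R * 'C(n, b.+1)%:R = a.+1%:R * 'C(n, b)%:R :> R.
  by rewrite -!natrM mul_bin_left; congr (_ * _)%:R; rewrite /n; lia.
have c0 : 'C(n, b)%:R != 0 :> R by rewrite pnatr_eq0 -lt0n bin_gt0 /n; lia.
apply: (mulfI c0); rewrite mulrCA h mulrA hb; ring.
Qed.

Lemma gauge_eq0 a b k : L a b k = 0.
Proof.
have [k1|k1] := ltP 1 k; first exact: Lpos.
have [k2|k2] := ltP k (-1); first exact: Lneg.
have [->|kn0] := eqVneq k 0; first exact: L0.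
have [om|em] := boolP (odd m).
  have [->|->] : k = 1 \/ k = -1 by lia.
    by have [] := Lpm1 a b om.
  by have [] := Lpm1 a b om.
apply: L_off => -[j jm]; have := odd_double_half m; rewrite (negbTE em) add0n; lia.
Qed.

End GaugeAlgebra.

(** * Monomials and their derivatives *)

Section Monomials.
Context {R : realType}.

Definition mono (a b : nat) (x : R * R) : R[i] := zc x ^+ a * conjc (zc x) ^+ b.

Lemma tmono_mode (c : R[i]) a b k :
  (fun p => c * tmono a b k p) = mode (fun x => c * mono a b x) k.
Proof. by apply/funext => p; rewrite /mode /tmono mulrA. Qed.

Lemma conjcX (y : R[i]) n : conjc (y ^+ n) = conjc y ^+ n.
Proof. by elim: n => [|n IH]; [exact: conjc1|rewrite !exprS conjcM IH]. Qed.

Lemma conjcN (y : R[i]) : conjc (- y) = - conjc y.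
Proof. by rewrite raddfN. Qed.

Lemma conjcB (y z : R[i]) : conjc (y - z) = conjc y - conjc z.
Proof. by rewrite conjcD conjcN. Qed.

Lemma conjc_mono a b x : conjc (mono a b x) = mono b a x.
Proof. by rewrite /mono conjcM !conjcX conjcK mulrC. Qed.

Lemma csm_mono a b : csm (mono a b).
Proof. by apply: csmM; apply: csmX; [exact: csm_zc|exact: csm_conjz]. Qed.

Lemma csmZ (c : R[i]) f : csm f -> csm (fun p => c * f p).
Proof. by move=> sf; exact: csmM (csm_cst c) sf. Qed.

Lemma cdiffZ (c : R[i]) f fz fzb : cdiff f fz fzb ->
  cdiff (fun p => c * f p) (fun p => c * fz p) (fun p => c * fzb p).
Proof.
move=> df; apply: cdiff_ext (cdiffM (cdiff_cst c) df) _ _ => p; by rewrite mul0r add0r.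
Qed.

Lemma cdiffX (f fz fzb : R * R -> R[i]) n : cdiff f fz fzb ->
  cdiff (fun p => f p ^+ n) (fun p => n%:R * f p ^+ n.-1 * fz p)
    (fun p => n%:R * f p ^+ n.-1 * fzb p).
Proof.
move=> df; elim: n => [|n IH].
  by apply: cdiff_ext (cdiff_cst 1) _ _ => p; rewrite !mul0r.
have -> : (fun p => f p ^+ n.+1) = fun p => f p * f p ^+ n.
  by apply/funext => p; rewrite exprS.
have E p (y : R[i]) : y * f p ^+ n + f p * (n%:R * f p ^+ n.-1 * y) = n.+1%:R * f p ^+ n * y.
  case: n {IH} => [|n] /=; first by rewrite !expr0; ring.
  by rewrite -[n.+2%:R]natr1 exprS; ring.
by apply: cdiff_ext (cdiffM df IH) _ _ => p; exact: E.
Qed.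

Lemma cdiff_mono a b : cdiff (mono a b) (fun p => a%:R * mono a.-1 b p)
  (fun p => b%:R * mono a b.-1 p).
Proof.
apply: cdiff_ext (cdiffM (cdiffX a cdiff_zc) (cdiffX b (cdiff_conj cdiff_zc))) _ _ => p.
  by rewrite conjc0 /mono; ring.
by rewrite conjc1 /mono; ring.
Qed.

(** The conjugate of dbar(s z^b zbar^a), expanded: its two terms are the two sides of the recursion
    on moments. *)
Lemma mono_dzbar a b (x : R * R) :
  conjc (- zc x * mono b a x + (bdist x)%:C * (a%:R * mono b a.-1 x)) =
  a%:R * mono a.-1 b x - a.+1%:R * mono a b.+1 x.
Proof.
rewrite bdistE !(conjcD, conjcM, conjcN, conjc_mono) conjc1 conjcK conjc_nat.
rewrite /mono; move: (zc x) (conjc (zc x)) => z w.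
case: a => [|a] /=; rewrite !exprS; first by ring.
by rewrite -[a.+2%:R]natr1; ring.
Qed.

Lemma mono_dz a b (x : R * R) :
  conjc (- conjc (zc x) * mono b a x + (bdist x)%:C * (b%:R * mono b.-1 a x)) =
  b%:R * mono a b.-1 x - b.+1%:R * mono a.+1 b x.
Proof.
rewrite bdistE !(conjcD, conjcM, conjcN, conjc_mono) conjc1 conjcK conjc_nat.
rewrite /mono; move: (zc x) (conjc (zc x)) => z w.
case: b => [|b] /=; rewrite !exprS; first by ring.
by rewrite -[b.+2%:R]natr1; ring.
Qed.

End Monomials.

(** * Orthogonality relations satisfied by normal forms *)

Section Gauged.
Context {R : realType}.
Local Notation mR := (measurableTypeR R).
Local Notation T2 := (mR * mR)%type.
Local Notation T3 := (mR * mR * mR)%type.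
Variable m : nat.
Implicit Types q qz qzb f : R * R -> R[i].
Implicit Types g h : (R * R) * R -> R[i].

(** The conjugate of dbar(s q). Conjugation appears because [weak_op] is a bilinear pairing whereas
    [rip] conjugates its second argument. *)
Definition dzb_bd q qzb (x : R * R) : R[i] := conjc (- zc x * q x + (bdist x)%:C * qzb x).
Definition dz_bd q qz (x : R * R) : R[i] := conjc (- conjc (zc x) * q x + (bdist x)%:C * qz x).

(* The linear conditions satisfied by normal forms: orthogonality to the
   functions of the form [d (s q) e^{ik theta}] with the appropriate operator
   and degree. *)
Record gauged (g : (R * R) * R -> R[i]) : Prop := Gauged {
  gauged_L2 : L2 leb3 SM g;
  gauged_off : forall k v, ~ harmonics m k -> L2M v -> rip leb3 SM g (mode v k) = 0;
  gauged_pos : forall (k : int) q qz qzb, 1 < k -> csm q -> ccont qzb -> cdiff q qz qzb ->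
    rip leb3 SM g (mode (dzb_bd q qzb) k) = 0;
  gauged_neg : forall (k : int) q qz qzb, k < -1 -> csm q -> ccont qz -> cdiff q qz qzb ->
    rip leb3 SM g (mode (dz_bd q qz) k) = 0;
  gauged_odd : odd m -> forall q qz qzb, csm q -> ccont qz -> ccont qzb -> cdiff q qz qzb ->
    rip leb3 SM g (mode (dzb_bd q qzb) 1) + rip leb3 SM g (mode (dz_bd q qz) (-1)) = 0 }.

Lemma dzb_bd_L2 q qzb : csm q -> ccont qzb -> L2M (dzb_bd q qzb).
Proof.
move=> sq cq; have cz : ccont (zc : R * R -> R[i]) by exact: csm_ccont csm_zc.
exact: (ccont_L2M (ccont_conj (ccontD (ccontM (ccontN cz) (csm_ccont sq))
  (ccontM (csm_ccont csm_bdist) cq)))).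
Qed.

Lemma dz_bd_L2 q qz : csm q -> ccont qz -> L2M (dz_bd q qz).
Proof.
move=> sq cq; have cz : ccont (fun p : R * R => conjc (zc p)) by exact: csm_ccont csm_conjz.
exact: (ccont_L2M (ccont_conj (ccontD (ccontM (ccontN cz) (csm_ccont sq))
  (ccontM (csm_ccont csm_bdist) cq)))).
Qed.

Let mSM := @measurable_SM R.
Let mM := @measurable_M R.

Lemma gaugedD g h : gauged g -> gauged h -> gauged (fun p => g p + h p).
Proof.
move=> [Lg g1 g2 g3 g4] [Lh h1 h2 h3 h4].
have D v k : L2M v -> rip leb3 SM (fun p => g p + h p) (mode v k) =
    rip leb3 SM g (mode v k) + rip leb3 SM h (mode v k).
  by move=> Lv; exact: (ripDl mSM Lg Lh (mode_L2 k Lv)).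
split.
- exact: (L2D mSM Lg Lh).
- by move=> k v nk Lv; rewrite D// g1// h1// addr0.
- move=> k q qz qzb k1 sq cq dq; rewrite D; last exact: dzb_bd_L2.
  by rewrite (g2 _ _ _ _ k1 sq cq dq) (h2 _ _ _ _ k1 sq cq dq) addr0.
- move=> k q qz qzb k1 sq cq dq; rewrite D; last exact: dz_bd_L2.
  by rewrite (g3 _ _ _ _ k1 sq cq dq) (h3 _ _ _ _ k1 sq cq dq) addr0.
- move=> om q qz qzb sq cqz cqzb dq.
  rewrite D; last exact: dzb_bd_L2.
  rewrite D; last exact: dz_bd_L2.
  by rewrite addrACA (g4 om _ _ _ sq cqz cqzb dq) (h4 om _ _ _ sq cqz cqzb dq) addr0.
Qed.

Lemma gaugedN g : gauged g -> gauged (fun p => - g p).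
Proof.
move=> [Lg g1 g2 g3 g4].
have N v k : L2M v -> rip leb3 SM (fun p => - g p) (mode v k) = - rip leb3 SM g (mode v k).
  by move=> Lv; exact: (ripNl mSM Lg (mode_L2 k Lv)).
split.
- exact: (L2N mSM Lg).
- by move=> k v nk Lv; rewrite N// g1// oppr0.
- move=> k q qz qzb k1 sq cq dq; rewrite N; last exact: dzb_bd_L2.
  by rewrite (g2 _ _ _ _ k1 sq cq dq) oppr0.
- move=> k q qz qzb k1 sq cq dq; rewrite N; last exact: dz_bd_L2.
  by rewrite (g3 _ _ _ _ k1 sq cq dq) oppr0.
- move=> om q qz qzb sq cqz cqzb dq.
  rewrite N; last exact: dzb_bd_L2.
  rewrite N; last exact: dz_bd_L2.
  by rewrite -opprD (g4 om _ _ _ sq cqz cqzb dq) oppr0.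
Qed.

Lemma gauged_ae g h : L2 leb3 SM h -> ae_eq leb3 SM h g -> gauged g -> gauged h.
Proof.
move=> Lh hg [Lg g1 g2 g3 g4].
have E v k : L2M v -> rip leb3 SM h (mode v k) = rip leb3 SM g (mode v k).
  by move=> Lv; exact: (ae_eq_rip mSM (L2_meas Lh) (L2_meas Lg) (L2_meas (mode_L2 k Lv)) hg).
split=> //.
- by move=> k v nk Lv; rewrite E// g1.
- by move=> k q qz qzb k1 sq cq dq; rewrite E ?(g2 _ _ _ _ k1 sq cq dq)//; exact: dzb_bd_L2.
- by move=> k q qz qzb k1 sq cq dq; rewrite E ?(g3 _ _ _ _ k1 sq cq dq)//; exact: dz_bd_L2.
- move=> om q qz qzb sq cqz cqzb dq.
  by rewrite !E ?(g4 om _ _ _ sq cqz cqzb dq)//; [exact: dz_bd_L2|exact: dzb_bd_L2].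
Qed.

Lemma gauged_mode f k : L2M f -> harmonics m k ->
  (1 < k -> weak_dzbar f (fun=> 0)) -> (k < -1 -> weak_dz f (fun=> 0)) ->
  k != 1 -> k != -1 -> gauged (mode f k).
Proof.
move=> Lf hk wp wn k1 kN1; split.
- exact: mode_L2.
- move=> j v nj Lv; rewrite rip_mode//; case: eqVneq => [e|_]; last by rewrite !mul0r.
  by rewrite e in hk.
- move=> j q qz qzb j1 sq cq dq; rewrite rip_mode//; last exact: dzb_bd_L2.
  case: eqVneq => [e|_]; last by rewrite !mul0r.
  rewrite -e in j1; by rewrite (rip_weak_dzbar Lf (wp j1) sq cq dq) mulr0.
- move=> j q qz qzb j1 sq cq dq; rewrite rip_mode//; last exact: dz_bd_L2.
  case: eqVneq => [e|_]; last by rewrite !mul0r.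
  rewrite -e in j1; by rewrite (rip_weak_dz Lf (wn j1) sq cq dq) mulr0.
- move=> om q qz qzb sq cqz cqzb dq; rewrite !rip_mode//; last 2 first.
  + exact: dz_bd_L2.
  + exact: dzb_bd_L2.
  by rewrite (negbTE k1) (negbTE kN1) !mul0r addr0.
Qed.

(** Together with [Xp_neg], the e^{i theta} and e^{-i theta} components of the field
    [Xperp fx fy]. *)
Definition Xp_pos (fx fy : R * R -> R[i]) (x : R * R) : R[i] :=
  (- 2^-1)%:C * ('i * fx x + fy x).
Definition Xp_neg (fx fy : R * R -> R[i]) (x : R * R) : R[i] :=
  (2^-1)%:C * ('i * fx x - fy x).

Lemma XperpE fx fy : Xperp fx fy =
  (fun p : (R * R) * R => mode (Xp_pos fx fy) 1 p + mode (Xp_neg fx fy) (-1) p).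
Proof.
apply/funext => -[x t]; rewrite /Xperp /mode /Xp_pos /Xp_neg/= mul1r mulN1r.
rewrite expiN /expi; case: (fx x) (fy x) => a b [c d].
by apply/eqP; rewrite eq_complex/=; apply/andP; split; apply/eqP; field.
Qed.

Lemma Xp_L2 fx fy : L2M fx -> L2M fy -> L2M (Xp_pos fx fy) /\ L2M (Xp_neg fx fy).
Proof.
move=> Lx Ly; split; apply: (L2Z mM).
  exact: (L2D mM (L2Z mM _ Lx) Ly).
exact: (L2B mM (L2Z mM _ Lx) Ly).
Qed.

(** The only nontrivial condition, [gauged_odd], is the curl identity [rip_weak_grad] rewritten in
    the components of degree 1 and -1. *)
Lemma gauged_Xperp f fx fy : odd m -> H1 f fx fy -> gauged (Xperp fx fy).
Proof.
move=> om Hf; have [_ Lx Ly _ _] := Hf; have [Lp Ln] := Xp_L2 Lx Ly.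
have h1 : harmonics m 1.
  by exists m./2; rewrite ?half_leq//; have := odd_double_half m; rewrite om; lia.
have hN1 : harmonics m (-1).
  by exists (m./2).+1; have := odd_double_half m; rewrite om; lia.
have E v k : L2M v -> rip leb3 SM (Xperp fx fy) (mode v k) =
    (1 == k)%:R * (pi *+ 2) * rip leb2 M (Xp_pos fx fy) v +
    (-1 == k)%:R * (pi *+ 2) * rip leb2 M (Xp_neg fx fy) v.
  move=> Lv; rewrite XperpE (ripDl mSM (mode_L2 1 Lp) (mode_L2 (-1) Ln) (mode_L2 k Lv)).
  by rewrite !rip_mode.
split.
- by rewrite XperpE; exact: (L2D mSM (mode_L2 1 Lp) (mode_L2 (-1) Ln)).
- move=> k v nk Lv; rewrite E//; case: eqVneq => [e|_]; first by rewrite e in h1.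
  by case: eqVneq => [e|_]; [rewrite e in hN1|rewrite !mul0r addr0].
- move=> k q qz qzb k1 sq cq dq; rewrite E; last exact: dzb_bd_L2.
  have [-> ->] : (1 == k) = false /\ (-1 == k) = false by move: k1; clear; lia.
  by rewrite !mul0r addr0.
- move=> k q qz qzb k1 sq cq dq; rewrite E; last exact: dz_bd_L2.
  have [-> ->] : (1 == k) = false /\ (-1 == k) = false by move: k1; clear; lia.
  by rewrite !mul0r addr0.
- move=> _ q qz qzb sq cqz cqzb dq.
  have LA := dzb_bd_L2 sq cqzb; have LB := dz_bd_L2 sq cqz.
  rewrite !E// !mul0r addr0 add0r !mul1r -mulrDr.
  have := rip_weak_grad Hf sq cqz cqzb dq.
  set u := fun p => conjc ('i * _); set w := fun p => conjc (_ + _ + _) => uw.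
  have Lu : L2 leb2 (M : set T2) u.
    have := L2Z mM (conjc 'i%R) (L2B mM LB LA); congr (L2 _ _ _).
    by apply/funext => p; rewrite /dz_bd /dzb_bd -conjcB -conjcM.
  have Lw : L2 leb2 (M : set T2) w.
    have := L2D mM LB LA; congr (L2 _ _ _).
    by apply/funext => p; rewrite /dz_bd /dzb_bd -conjcD.
  suff -> : rip leb2 M (Xp_pos fx fy) (dzb_bd q qzb) + rip leb2 M (Xp_neg fx fy) (dz_bd q qz) =
      2^-1 * (rip leb2 M fx u - rip leb2 M fy w) by rewrite uw subrr !mulr0.
  rewrite {1 2 3 4}/rip -RintegralD//; [|exact: (L2_dot mM Lp LA)|exact: (L2_dot mM Ln LB)].
  rewrite -RintegralB//; [|exact: (L2_dot mM Lx Lu)|exact: (L2_dot mM Ly Lw)].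
  rewrite -RintegralZl//; last first.
    by have := integrableB mM (L2_dot mM Lx Lu) (L2_dot mM Ly Lw).
  apply: eq_Rintegral => p _; rewrite /Xp_pos /Xp_neg /dzb_bd /dz_bd /u /w.
  move: (- zc p * _ + _) (- conjc (zc p) * _ + _) => A B.
  by case: A B (fx p) (fy p) => a a' [b b'] [x x'] [y y']; rewrite /dotc/=; field.
Qed.

Lemma gauged0 : gauged (fun=> 0).
Proof.
split.
- exact: L2_0.
- by move=> k v _ _; rewrite (rip0l _ mSM).
- by move=> *; rewrite (rip0l _ mSM).
- by move=> *; rewrite (rip0l _ mSM).
- by move=> *; rewrite !(rip0l _ mSM) addr0.
Qed.

(** Membership in the kernels is only up to null sets, so the sum is replaced by an almost
    everywhere equal [G] made of the actual holomorphic and antiholomorphic representatives. *)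
Lemma gauged_sum (n : nat) (kk : nat -> int) (g_ : int -> R * R -> R[i]) :
  (forall j, (1 <= j <= n)%N -> [/\ 1 < kk j, harmonics m (kk j), harmonics m (- kk j),
    ker_eta_minus (kk j) (mode (g_ (kk j)) (kk j)) &
    ker_eta_plus (- kk j) (mode (g_ (- kk j)) (- kk j))]) ->
  exists2 G, gauged G & ae_eq leb3 SM (fun p => \sum_(1 <= j < n.+1)
    (mode (g_ (kk j)) (kk j) p + mode (g_ (- kk j)) (- kk j) p)) G.
Proof.
elim: n => [|n IH] H.
  exists (fun=> 0); first exact: gauged0.
  by apply: aeW => p _; rewrite big_geq.
have [|G gG eG] := IH.
  by move=> j /andP[j1 jn]; apply: H; rewrite j1/=; lia.
have [|k1 hk hNk [f1 [Lf1 w1 e1]] [f2 [Lf2 w2 e2]]] := H n.+1; first by lia.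
exists (fun p => G p + (mode f1 (kk n.+1) p + mode f2 (- kk n.+1) p)).
  apply: gaugedD => //; apply: gaugedD.
    by apply: gauged_mode => //; [lia|apply/eqP; lia|apply/eqP; lia].
  by apply: gauged_mode => //; [lia|apply/eqP; lia|apply/eqP; lia].
apply: filterS3 eG e1 e2 => p hG h1 h2 pSM.
by rewrite big_nat_recr//= hG// h1// h2.
Qed.

Lemma normal_form_gauged g : L2SM g -> normal_form m g -> gauged g.
Proof.
move=> [_ Lg]; rewrite /normal_form; have mE := odd_double_half m.
case: ifPn => om; rewrite ?om ?(negbTE om) in mE.
  move=> [g0 [gx [gy [g_ [[Hg0 _] hk eg]]]]].
  have [j|G gG eG] := @gauged_sum m./2 (fun j => (2 * j).+1%:Z) g_.
    move=> /andP[j1 jn]; have [a b] := hk j ltac:(by rewrite j1 jn).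
    split=> //; first lia.
      by exists (m./2 - j)%N; lia.
    by exists (m./2 + j).+1; lia.
  apply: (gauged_ae Lg) (gaugedD (gauged_Xperp om Hg0) gG).
  by apply: filterS2 eg eG => p h1 h2 pSM; rewrite h1// h2.
move=> [g0 [g_ [Lg0 hk eg]]].
have [j|G gG eG] := @gauged_sum m./2 (fun j => (2 * j)%N%:Z) g_.
  move=> /andP[j1 jn]; have [a b] := hk j ltac:(by rewrite j1 jn).
  split=> //; first lia.
    by exists (m./2 - j)%N; lia.
  by exists (m./2 + j)%N; lia.
have h0 : harmonics m 0 by exists m./2; lia.
apply: (gauged_ae Lg) (gaugedD (gauged_mode Lg0 h0 _ _ _ _) gG) => //.
apply: filterS2 eg eG => p h1 h2 pSM; rewrite h1// h2//; congr (_ + _).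
by rewrite /mode mul0r expi0 mulr1.
Qed.

End Gauged.

Lemma ripZr {d : measure_display} {T : measurableType d} {R : realType}
  (mu : {measure set T -> \bar R}) (D : set T) (c : R) (f g : T -> R[i]) :
  measurable D -> L2 mu D f -> L2 mu D g ->
  rip mu D g (fun x => c%:C * f x) = c * rip mu D g f.
Proof. by move=> mD Lf Lg; rewrite ripC ripZl// ripC. Qed.

(** * Uniqueness of the normal form *)

Section Uniqueness.
Context {R : realType}.
Local Notation mR := (measurableTypeR R).
Local Notation T2 := (mR * mR)%type.
Local Notation T3 := (mR * mR * mR)%type.
Implicit Types (u v : R * R -> R[i]) (g h : (R * R) * R -> R[i]).

Let mSM := @measurable_SM R.

Lemma csm_L2M u : csm u -> L2M u.
Proof. by move=> /csm_ccont cu; exact: ccont_L2M. Qed.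

Lemma natrC (n : nat) : (n%:R : R[i]) = (n%:R : R)%:C.
Proof. by rewrite rmorph_nat. Qed.

Lemma rip_mode_comb h (s t : R) u v k : L2 leb3 SM h -> L2M u -> L2M v ->
  rip leb3 SM h (mode (fun x => s%:C * u x - t%:C * v x) k) =
  s * rip leb3 SM h (mode u k) - t * rip leb3 SM h (mode v k).
Proof.
move=> Lh Lu Lv; have Mu := mode_L2 k Lu; have Mv := mode_L2 k Lv.
have -> : mode (fun x => s%:C * u x - t%:C * v x) k =
    (fun p => s%:C * mode u k p - t%:C * mode v k p).
  by apply/funext => p; rewrite /mode; ring.
rewrite (ripBr mSM (L2Z mSM _ Mu) (L2Z mSM _ Mv) Lh).
by rewrite !ripZr.
Qed.

Lemma dzb_bd_mono (c : R[i]) a b :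
  dzb_bd (fun p => conjc c * mono b a p) (fun p => conjc c * (a%:R * mono b a.-1 p)) =
  fun x => a%:R%:C * (c * mono a.-1 b x) - a.+1%:R%:C * (c * mono a b.+1 x).
Proof.
apply/funext => x; transitivity (conjc (conjc c *
    (- zc x * mono b a x + (bdist x)%:C * (a%:R * mono b a.-1 x)))).
  by congr conjc; ring.
by rewrite conjcM conjcK mono_dzbar -!natrC; ring.
Qed.

Lemma dz_bd_mono (c : R[i]) a b :
  dz_bd (fun p => conjc c * mono b a p) (fun p => conjc c * (b%:R * mono b.-1 a p)) =
  fun x => b%:R%:C * (c * mono a b.-1 x) - b.+1%:R%:C * (c * mono a.+1 b x).
Proof.
apply/funext => x; transitivity (conjc (conjc c *
    (- conjc (zc x) * mono b a x + (bdist x)%:C * (b%:R * mono b.-1 a x)))).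
  by congr conjc; ring.
by rewrite conjcM conjcK mono_dz -!natrC; ring.
Qed.

Lemma gauged_mono_pos m h (c : R[i]) a b (k : int) : gauged m h -> 1 < k ->
  a%:R * rip leb3 SM h (mode (fun x => c * mono a.-1 b x) k) =
  a.+1%:R * rip leb3 SM h (mode (fun x => c * mono a b.+1 x) k).
Proof.
move=> [Lh _ H _ _] k1.
have sm x y : csm (fun p => c * mono x y p : R[i]) by exact: csmZ (csm_mono x y).
have Ls x y := csm_L2M (sm x y).
have := H k _ _ _ k1 (csmZ (conjc c) (csm_mono b a)) _ (cdiffZ (conjc c) (cdiff_mono b a)).
rewrite dzb_bd_mono (rip_mode_comb _ _ _ Lh (Ls _ _) (Ls _ _)) => h0; apply/eqP; rewrite -subr_eq0; apply/eqP.
apply: h0; apply: csm_ccont; exact: csmZ (csmZ _ (csm_mono _ _)).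
Qed.

Lemma gauged_mono_neg m h (c : R[i]) a b (k : int) : gauged m h -> k < -1 ->
  b%:R * rip leb3 SM h (mode (fun x => c * mono a b.-1 x) k) =
  b.+1%:R * rip leb3 SM h (mode (fun x => c * mono a.+1 b x) k).
Proof.
move=> [Lh _ _ H _] k1.
have sm x y : csm (fun p => c * mono x y p : R[i]) by exact: csmZ (csm_mono x y).
have Ls x y := csm_L2M (sm x y).
have := H k _ _ _ k1 (csmZ (conjc c) (csm_mono b a)) _ (cdiffZ (conjc c) (cdiff_mono b a)).
rewrite dz_bd_mono (rip_mode_comb _ _ _ Lh (Ls _ _) (Ls _ _)) => h0; apply/eqP; rewrite -subr_eq0; apply/eqP.
apply: h0; apply: csm_ccont; exact: csmZ (csmZ _ (csm_mono _ _)).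
Qed.

Lemma gauged_mono_odd m h (c : R[i]) a b : gauged m h -> odd m ->
  a%:R * rip leb3 SM h (mode (fun x => c * mono a.-1 b x) 1) +
  b%:R * rip leb3 SM h (mode (fun x => c * mono a b.-1 x) (-1)) =
  a.+1%:R * rip leb3 SM h (mode (fun x => c * mono a b.+1 x) 1) +
  b.+1%:R * rip leb3 SM h (mode (fun x => c * mono a.+1 b x) (-1)).
Proof.
move=> [Lh _ _ _ H] om.
have sm x y : csm (fun p => c * mono x y p : R[i]) by exact: csmZ (csm_mono x y).
have Ls x y := csm_L2M (sm x y).
have := H om _ _ _ (csmZ (conjc c) (csm_mono b a)) _ _ (cdiffZ (conjc c) (cdiff_mono b a)).
rewrite dz_bd_mono dzb_bd_mono !(rip_mode_comb _ _ _ Lh (Ls _ _) (Ls _ _)) => h0.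
have := h0 (csm_ccont (csmZ _ (csmZ _ (csm_mono _ _)))) (csm_ccont (csmZ _ (csmZ _ (csm_mono _ _)))).
lra.
Qed.

(** The base of the power is 2i times Im(z e^{-i theta}), the signed distance from the origin to the
    oriented line through z of direction theta; both it and theta are constant along the line. *)
Definition ffint (c : R[i]) (j : int) (n : nat) (p : (R * R) * R) : R[i] :=
  c * expi (j%:~R * p.2) * (zc p.1 * expi (- p.2) - conjc (zc p.1) * expi p.2) ^+ n.

Lemma ffint_continuous c j n : continuousSM (ffint c j n).
Proof.
have c1 : ccont (fun p : (R * R) * R => zc p.1).
  by apply: ccont_zc => p; exact: cvg_fst.
have c2 : ccont (fun p : (R * R) * R => expi (- p.2)).
  by apply: ccont_expi => p; apply: cvgN; exact: cvg_snd.
have c3 : ccont (fun p : (R * R) * R => expi p.2).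
  by apply: ccont_expi => p; exact: cvg_snd.
have c4 : ccont (fun p : (R * R) * R => expi (j%:~R * p.2)).
  by apply: ccont_expi => p; apply: cvgMl_tmp; exact: cvg_snd.
have c5 : ccont (fun p : (R * R) * R => - (conjc (zc p.1) * expi p.2)).
  have := ccontM (ccont_cst (-1)) (ccontM (ccont_conj c1) c3); congr ccont.
  by apply/funext => p; rewrite mulN1r.
have [h1 h2] := ccontM (ccontM (ccont_cst c) c4) (ccontX n (ccontD (ccontM c1 c2) c5)).
split=> // x t; rewrite /ffint/= expi_2pik expi2pi; congr (_ * (_ * _ - _) ^+ _).
by rewrite !expiN expi2pi.
Qed.

Lemma ffint_first_integral c j n : first_integral (ffint c j n).
Proof.
move=> q t _ _; rewrite /ffint /chord /=; congr (_ * _ ^+ _).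
rewrite !mul0r !addr0 expiN; set th := q.1 + pi + q.2.
have h := cos2Dsin2 th; apply/eqP; rewrite eq_complex/=; apply/andP; split; apply/eqP; ring.
Qed.

(** The binomial expansion by angular degree; pairing with it produces the relation [L_xray]. *)
Lemma ffintE c j n : ffint c j n = fun p => \sum_(l < n.+1)
  ((-1) ^+ l * 'C(n, l)%:R : R)%:C * mode (fun x => c * mono (n - l) l x)
    (j - n%:Z + (2 * l)%N%:Z) p.
Proof.
apply/funext => -[x t]; rewrite /ffint exprBn mulr_sumr; apply: eq_bigr => l _ /=.
rewrite /mode /mono/= rmorphM/= rmorph_nat rmorphXn/= rmorphN1 !exprMn.
have expiX (y : R) (i : nat) : expi y ^+ i = expi (i%:R * y).
  by elim: i => [|i IH]; [rewrite expr0 mul0r expi0|rewrite exprS IH -expiD -natr1; congr expi; ring].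
rewrite !expiX.
have -> : expi ((j - n%:Z + (2 * l)%N%:Z)%:~R * t) =
    expi (j%:~R * t) * (expi ((n - l)%:R * - t) * expi (l%:R * t)).
  rewrite -!expiD; congr expi.
  have ln : (l <= n)%N by rewrite -ltnS.
  rewrite natrB// intrD intrB -!pmulrn natrM; ring.
by rewrite -mulr_natr; ring.
Qed.

Lemma rip_sum (n : nat) h (u_ : 'I_n -> T3 -> R[i]) : L2 leb3 SM h ->
  (forall i, L2 leb3 SM (u_ i)) ->
  L2 leb3 SM (fun p => \sum_(i < n) u_ i p) /\
  rip leb3 SM h (fun p => \sum_(i < n) u_ i p) = \sum_(i < n) rip leb3 SM h (u_ i).
Proof.
move=> Lh; elim: n u_ => [|n IH] u_ Lu.
  rewrite big_ord0 (_ : (fun p => _) = fun=> 0); last by apply/funext => p; rewrite big_ord0.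
  by split; [exact: L2_0|rewrite ripC (rip0l _ mSM)].
have [|LS E] := IH (fun i => u_ (widen_ord (leqnSn n) i)); first by move=> i; exact: Lu.
rewrite (_ : (fun p => _) = fun p => \sum_(i < n) u_ (widen_ord (leqnSn n) i) p + u_ ord_max p).
  split; first exact: (L2D mSM LS (Lu _)).
  by rewrite (ripDr mSM LS (Lu _) Lh) E big_ord_recr.
by apply/funext => p; rewrite big_ord_recr.
Qed.

(** [gauge_eq0] is applied for each fixed [c] separately: the relations between moments have real
    coefficients, so they never mix different [c]. *)
Lemma gauged_xray_eq0 m h : gauged m h ->
  (forall A, continuousSM A -> first_integral A -> rip leb3 SM h A = 0) ->
  ae_eq leb3 SM h (fun=> 0).
Proof.
move=> gh hA; have Lh := gauged_L2 gh; apply: tensor_total => // c a b k.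
rewrite tmono_mode.
have sm x y : csm (fun p => c * mono x y p : R[i]) by exact: csmZ (csm_mono x y).
apply: (gauge_eq0 (m := m) (L := fun a b k => rip leb3 SM h (mode (fun x => c * mono a b x) k)))
    => [{}a {}b {}k nk|{}a {}b {}k k1|{}a {}b {}k k1|j n|om {}a {}b].
- by apply: (gauged_off gh nk); exact: csm_L2M (sm _ _).
- exact: (gauged_mono_pos c a b gh k1).
- exact: (gauged_mono_neg c a b gh k1).
- have := hA _ (ffint_continuous c j n) (ffint_first_integral c j n).
  rewrite ffintE.
  have Lm (l : 'I_n.+1) : L2 leb3 SM (mode (fun x => c * mono (n - l) l x) (j - n%:Z + (2 * l)%N%:Z)).
    by apply: mode_L2; exact: csm_L2M (sm _ _).
  have [|_ ->] := @rip_sum n.+1 h (fun l p => ((-1) ^+ l * 'C(n, l)%:R : R)%:C *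
    mode (fun x => c * mono (n - l) l x) (j - n%:Z + (2 * l)%N%:Z) p) Lh.
    by move=> l; exact: (L2Z mSM _ (Lm l)).
  move=> S0; rewrite -[RHS]S0; apply: eq_bigr => l _.
  by rewrite ripZr.
- exact: (gauged_mono_odd c a b gh om).
Qed.

Lemma reduction_unique m f g g' : L2SM f -> reduces_to m f g -> reduces_to m f g' ->
  ae_eq leb3 SM g' g.
Proof.
move=> [_ Lf] [[Lg _] fg ng] [[Lg' _] fg' ng'].
have gg := normal_form_gauged Lg ng; have gg' := normal_form_gauged Lg' ng'.
have h0 : ae_eq leb3 SM (fun p => g' p + - g p) (fun=> 0).
  apply: (gauged_xray_eq0 (gaugedD gg' (gaugedN gg))) => A cA fA.
  have LA : L2 leb3 SM A by exact: continuousSM_L2.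
  rewrite (ripBl mSM (gauged_L2 gg') (gauged_L2 gg) LA).
  rewrite -(same_xray_pair Lf (gauged_L2 gg) fg cA fA).
  by rewrite -(same_xray_pair Lf (gauged_L2 gg') fg' cA fA) subrr.
apply: filterS h0 => p hp pSM; apply/eqP; rewrite -subr_eq0; apply/eqP.
exact: hp.
Qed.

End Uniqueness.

(** * Limits, norms and orthogonality in L^2 *)

Section HilbertComplements.
Context {d : measure_display} {T : measurableType d} {R : realType}.
Variables (mu : {measure set T -> \bar R}) (D : set T).
Hypothesis mD : measurable D.
Implicit Types (f g u : T -> R[i]).

Lemma rip_lim0 (s : nat -> T -> R[i]) u g : (forall n, L2 mu D (s n)) -> L2 mu D u ->
  L2 mu D g -> nrm mu D (fun x => s n x - u x) @[n --> \oo] --> (0 : R) ->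
  (forall n, rip mu D (s n) g = 0) -> rip mu D u g = 0.
Proof.
move=> Ls Lu Lg su h; have c := cvg_ripl mD Ls Lu Lg su.
have E : (fun n => rip mu D (s n) g) = fun=> 0 by apply/funext => n; exact: h.
by rewrite E in c; apply: esym; exact: (cvg_unique _ (cvg_cst (0 : R)) c).
Qed.

Lemma nrm_pythagoras f g : L2 mu D f -> L2 mu D g -> rip mu D f g = 0 ->
  nrm mu D (fun x => f x + g x) ^+ 2 = nrm mu D f ^+ 2 + nrm mu D g ^+ 2.
Proof.
move=> Lf Lg fg; have Lfg := L2D mD Lf Lg.
rewrite !nrm_sqr (ripDl mD Lf Lg Lfg) !(ripDr mD Lf Lg)// [rip _ _ g f]ripC fg; ring.
Qed.

Lemma nrm_proj_le f u : L2 mu D f -> L2 mu D u ->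
  rip mu D (fun x => f x - u x) u = 0 ->
  nrm mu D u <= nrm mu D f /\ nrm mu D (fun x => f x - u x) <= nrm mu D f.
Proof.
move=> Lf Lu h; have := nrm_pythagoras (L2B mD Lf Lu) Lu h.
rewrite (@eq_nrm _ _ _ _ _ (fun x => f x - u x + u x) f); last by move=> x _; rewrite subrK.
move=> e; have := sqr_ge0 (nrm mu D u); have := sqr_ge0 (nrm mu D (fun x => f x - u x)).
by move=> h1 h2; split; rewrite -(@ler_pXn2r _ 2%N)// ?nnegrE ?nrm_ge0//; lra.
Qed.

Lemma cvg_cauchy (s : nat -> T -> R[i]) u : (forall n, L2 mu D (s n)) -> L2 mu D u ->
  nrm mu D (fun x => s n x - u x) @[n --> \oo] --> (0 : R) ->
  forall e : R, 0 < e -> exists N : nat, forall m n : nat,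
    (N <= m)%N -> (N <= n)%N -> nrm mu D (fun x => s m x - s n x) <= e.
Proof.
move=> Ls Lu su e e0; have e20 : 0 < e / 2 by rewrite divr_gt0.
move/cvgr0Pnorm_le : (su) => /(_ _ e20)[N _ HN]; exists N => k n Nk Nn.
have hk := HN k Nk; have hn := HN n Nn; rewrite /= ger0_norm ?nrm_ge0// in hk; rewrite /= ger0_norm ?nrm_ge0// in hn.
apply: le_trans (nrm_tri mD (Ls k) Lu (Ls n)) _.
by rewrite [nrm _ _ (fun x => u x - _)]nrm_distC; lra.
Qed.

Lemma cvg_nrm_ae (s : nat -> T -> R[i]) u u' : (forall n, L2 mu D (s n)) -> L2 mu D u ->
  L2 mu D u' -> nrm mu D (fun x => u x - u' x) = 0 ->
  nrm mu D (fun x => s n x - u x) @[n --> \oo] --> (0 : R) ->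
  nrm mu D (fun x => s n x - u' x) @[n --> \oo] --> (0 : R).
Proof.
move=> Ls Lu Lu' uu su; apply: (@squeeze_cvgr _ _ _ _ (fun=> 0) (fun n => nrm mu D (fun x => s n x - u x)));
  [|exact: cvg_cst|exact: su].
apply: nearW => n; rewrite nrm_ge0/= (le_trans (nrm_tri mD (Ls n) Lu Lu'))//.
by rewrite uu addr0.
Qed.

Lemma cvg_nrmD (s t : nat -> T -> R[i]) u v : (forall n, L2 mu D (s n)) ->
  (forall n, L2 mu D (t n)) -> L2 mu D u -> L2 mu D v ->
  nrm mu D (fun x => s n x - u x) @[n --> \oo] --> (0 : R) ->
  nrm mu D (fun x => t n x - v x) @[n --> \oo] --> (0 : R) ->
  nrm mu D (fun x => (s n x + t n x) - (u x + v x)) @[n --> \oo] --> (0 : R).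
Proof.
move=> Ls Lt Lu Lv su tv.
apply: (@squeeze_cvgr _ _ _ _ (fun=> 0) (fun n => nrm mu D (fun x => s n x - u x) +
    nrm mu D (fun x => t n x - v x))); [|exact: cvg_cst|]; last first.
  by rewrite -[X in _ --> X](addr0 (0 : R)); exact: cvgD.
apply: nearW => n; rewrite nrm_ge0/=.
rewrite (@eq_nrm _ _ _ _ _ _ (fun x => (s n x - u x) + (t n x - v x))); last first.
  by move=> x _; rewrite opprD addrACA.
exact: (nrmD mD (L2B mD (Ls n) Lu) (L2B mD (Lt n) Lv)).
Qed.

Lemma dotc_scale (c z : R[i]) : dotc (c * z) (c * z) = dotc c c * dotc z z.
Proof. by case: c z => [a b] [x y]; rewrite /dotc/=; ring. Qed.

Lemma nrmZ (c : R[i]) f : L2 mu D f ->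
  nrm mu D (fun x => c * f x) = Num.sqrt (dotc c c) * nrm mu D f.
Proof.
move=> Lf; rewrite /nrm -sqrtrM ?dotc_ge0//; congr Num.sqrt.
rewrite /rip -RintegralZl//; last exact: (L2_dot mD Lf Lf).
by apply: eq_Rintegral => x _; exact: dotc_scale.
Qed.

Lemma cvg_nrmZ (c : R[i]) (s : nat -> T -> R[i]) u : (forall n, L2 mu D (s n)) -> L2 mu D u ->
  nrm mu D (fun x => s n x - u x) @[n --> \oo] --> (0 : R) ->
  nrm mu D (fun x => c * s n x - c * u x) @[n --> \oo] --> (0 : R).
Proof.
move=> Ls Lu su.
have E n : nrm mu D (fun x => c * s n x - c * u x) =
    Num.sqrt (dotc c c) * nrm mu D (fun x => s n x - u x).
  by rewrite -nrmZ; [apply: eq_nrm => x _; rewrite mulrBr|exact: L2B].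
have h : Num.sqrt (dotc c c) * nrm mu D (fun x => s n x - u x) @[n --> \oo] --> (0 : R).
  by rewrite -[X in _ --> X](mulr0 (Num.sqrt (dotc c c))); exact: cvgMl_tmp.
by rewrite (eq_cvg _ _ E).
Qed.

End HilbertComplements.

(** * Splitting a function on the disk into a holomorphic part and a limit of d v *)

Section DiskDecomposition.
Context {R : realType}.
Local Notation mR := (measurableTypeR R).
Local Notation T2 := (mR * mR)%type.
Implicit Types f g u v : R * R -> R[i].

Let mM := @measurable_M R.
Let mSM := @measurable_SM R.

Lemma disk_total u : L2M u -> (forall (c : R[i]) a b, rip leb2 M u (fun x => c * mono a b x) = 0) ->
  nrm leb2 M u = 0.
Proof.
move=> Lu h.
have Lm (c : R[i]) a b : L2M (fun x => c * mono a b x).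
  exact: csm_L2M (csmZ c (csm_mono a b)).
have : ae_eq leb3 SM (mode u 0) (fun=> 0).
  apply: tensor_total => [|c a b k]; first exact: mode_L2.
  by rewrite tmono_mode (rip_mode 0 k Lu (Lm c a b)) h mulr0.
move=> u0; have := rip_mode 0 0 Lu Lu; rewrite eqxx mul1r.
rewrite (ae_eq_rip mSM (L2_meas (mode_L2 0 Lu)) (cmeas_cst _ 0) (L2_meas (mode_L2 0 Lu)) u0).
rewrite (rip0l _ mSM) => /esym/eqP; rewrite mulf_eq0 mulrn_eq0/= gt_eqF ?pi_gt0//=.
by move=> /eqP e; rewrite /nrm e sqrtr0.
Qed.

Lemma Re_cint0 (f : R * R -> R[i]) : cintegral leb2 M f = 0 ->
  Rintegral leb2 (M : set T2) (fun x => complex.Re (f x)) = 0.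
Proof. by move=> /(congr1 (@complex.Re R)). Qed.

(** For holomorphic f, (d v) conj(f) is d(v conj(f)), and v vanishes on the circle. *)
Lemma rip_dz_hol v vz vzb f fz : csm v -> csm vz -> csm f -> csm fz -> csm vzb ->
  cdiff v vz vzb -> cdiff f fz (fun=> 0) -> (forall p, on_circle p -> v p = 0) ->
  rip leb2 M vz f = 0.
Proof.
move=> sv svz sf sfz svzb dv df v0.
have [] := cdiff_int0 (cdiffM dv (cdiff_conj df)).
- apply: csm_ccont; apply: csmD; apply: csmM => //; apply: csm_conj => //; exact: csm_cst.
- by apply: csm_ccont; apply: csmD; apply: csmM => //; exact: csm_conj.
- by move=> p /v0 ->; rewrite mul0r.
move=> /Re_cint0 h _; rewrite -[RHS]h; apply: eq_Rintegral => p _.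
rewrite conjc0 mulr0 addr0; case: (vz p) (f p) => a b [c d]; rewrite /dotc/=; ring.
Qed.

(* The Jacobian [d p dbar w - dbar p d w] is exact. *)
Lemma int_jacobian0 (c : R[i]) p pz pzb (w wz wzb : R * R -> R[i]) :
  csm p -> csm w -> cdiff p pz pzb -> cdiff w wz wzb -> (forall x, on_circle x -> w x = 0) ->
  Rintegral leb2 (M : set T2)
    (fun x => complex.Re (c * (pz x * wzb x - pzb x * wz x))) = 0.
Proof.
move=> sp sw dp dw w0.
have [az [azb [aw [saz sazb saw da [[a da1] [b db1]]]]]] := csm_diff sp.
have [cz [czb [_ [scz sczb _ dc _]]]] := csm_diff saz.
have [ez [ezb [_ [sez sezb _ de _]]]] := csm_diff sazb.
have [bz [bzb [_ [sbz sbzb _ db _]]]] := csm_diff sw.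
have [pE1 pE2] := cdiff_unique dp da; have [wE1 wE2] := cdiff_unique dw db.
have [aE1 aE2] := cdiff_unique da1 dc; have [bE1 bE2] := cdiff_unique db1 de; subst.
have z0 (g : R * R -> R[i]) x : on_circle x -> c * (w x * g x) = 0.
  by move=> /w0 ->; rewrite mul0r mulr0.
(* The Jacobian is dbar(w d p) - d(w dbar p); the two terms with mixed second derivatives of p
   cancel. *)
have [_ h1] := cdiff_int0 (cdiffZ c (cdiffM dw dc))
  (csm_ccont (csmZ c (csmD (csmM sbz saz) (csmM sw scz))))
  (csm_ccont (csmZ c (csmD (csmM sbzb saz) (csmM sw sczb))))
  (z0 _).
have [h2 _] := cdiff_int0 (cdiffZ c (cdiffM dw de))
  (csm_ccont (csmZ c (csmD (csmM sbz sazb) (csmM sw sez))))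
  (csm_ccont (csmZ c (csmD (csmM sbzb sazb) (csmM sw sezb))))
  (z0 _).
have [i1 _] := csm_ccont (csmZ c (csmD (csmM sbzb saz) (csmM sw sczb))).
have [i2 _] := csm_ccont (csmZ c (csmD (csmM sbz sazb) (csmM sw sez))).
have := RintegralB mM (continuous_integrable_M i1) (continuous_integrable_M i2).
rewrite (Re_cint0 h1) (Re_cint0 h2) subr0 => <-; apply: eq_Rintegral => x _.
by rewrite -ReN -ReD; congr complex.Re; ring.
Qed.

(** With w = conj(v), the Jacobian is |d v|^2 - |dbar v|^2. *)
Lemma nrm_dz_dzbar v vz vzb : csm v -> csm vz -> csm vzb -> cdiff v vz vzb ->
  (forall p, on_circle p -> v p = 0) -> nrm leb2 M vz = nrm leb2 M vzb.
Proof.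
move=> sv svz svzb dv v0; rewrite /nrm; congr Num.sqrt; apply/eqP; rewrite -subr_eq0.
rewrite /rip -RintegralB//; [|exact: (L2_dot mM (csm_L2M svz) (csm_L2M svz))
  |exact: (L2_dot mM (csm_L2M svzb) (csm_L2M svzb))].
have w0 x : on_circle x -> conjc (v x) = 0 by move=> /v0 ->; exact: conjc0.
rewrite -[X in _ == X](int_jacobian0 1 sv (csm_conj sv) dv (cdiff_conj dv) w0); apply/eqP.
apply: eq_Rintegral => x _; case: (vz x) (vzb x) => a b [c e]; rewrite /dotc/=; ring.
Qed.

Definition bdry0 v vz vzb :=
  [/\ csm v, csm vz, csm vzb, cdiff v vz vzb & forall p, on_circle p -> v p = 0].

Lemma bdry0D v vz vzb u uz uzb : bdry0 v vz vzb -> bdry0 u uz uzb ->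
  bdry0 (fun x => v x + u x) (fun x => vz x + uz x) (fun x => vzb x + uzb x).
Proof.
move=> [s1 s2 s3 s4 s5] [t1 t2 t3 t4 t5]; split; try exact: csmD.
  exact: cdiffD.
by move=> p pc; rewrite s5// t5// addr0.
Qed.

Lemma bdry0Z c v vz vzb : bdry0 v vz vzb ->
  bdry0 (fun x => c * v x) (fun x => c * vz x) (fun x => c * vzb x).
Proof.
move=> [s1 s2 s3 s4 s5]; split; try exact: csmZ.
  exact: cdiffZ.
by move=> p pc; rewrite s5// mulr0.
Qed.

Lemma bdry0_0 : bdry0 (fun=> 0) (fun=> 0) (fun=> 0).
Proof. by split; [exact: csm_cst..|exact: cdiff_cst|]. Qed.

Lemma bdry0_nrm v vz vzb : bdry0 v vz vzb -> nrm leb2 M vz = nrm leb2 M vzb.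
Proof. by move=> [s1 s2 s3 s4 s5]; exact: (nrm_dz_dzbar s1 s2 s3 s4 s5). Qed.

Lemma bdry0_mono (c : R[i]) a b : bdry0 (fun x => (bdist x)%:C * (c * mono a b x))
  (fun x => a%:R%:C * (c * mono a.-1 b x) - a.+1%:R%:C * (c * mono a b.+1 x))
  (fun x => b%:R%:C * (c * mono a b.-1 x) - b.+1%:R%:C * (c * mono a.+1 b x)).
Proof.
have sm x y : csm (fun p => c * mono x y p : R[i]) by exact: csmZ (csm_mono x y).
split.
- exact: csmM csm_bdist (sm _ _).
- by apply: csmB; exact: csmZ.
- by apply: csmB; exact: csmZ.
- apply: cdiff_ext (cdiffM cdiff_bdist (cdiffZ c (cdiff_mono a b))) _ _ => x.
    rewrite bdistE -!natrC /mono; move: (zc x) (conjc (zc x)) => z w.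
    by case: a => [|a] /=; rewrite !exprS; [ring|rewrite -[a.+2%:R]natr1; ring].
  rewrite bdistE -!natrC /mono; move: (zc x) (conjc (zc x)) => z w.
  by case: b => [|b] /=; rewrite !exprS; [ring|rewrite -[b.+2%:R]natr1; ring].
- by move=> x xc; rewrite (_ : bdist x = 0) ?mul0r// /bdist -addrA -opprD xc subrr.
Qed.

(** Weak holomorphy of the remainder [r] is proved by a second projection, onto smooth holomorphic
    functions: what is left is orthogonal to these and to all d v, so its moments vanish and [r] is
    a limit of holomorphic functions. The field [q] is the limit of dbar v and is what a gauge step
    moves two degrees away. *)
Lemma disk_step u0 : L2M u0 -> exists r u q, exists v_ vz_ vzb_ : nat -> R * R -> R[i],
  [/\ [/\ L2M r, L2M u, L2M q & forall x, u0 x = r x + u x],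
      weak_dzbar r (fun=> 0),
      nrm leb2 M r <= nrm leb2 M u0 /\ (nrm leb2 M u <= nrm leb2 M u0 /\ nrm leb2 M q <= nrm leb2 M u0),
      forall n, bdry0 (v_ n) (vz_ n) (vzb_ n) &
      nrm leb2 M (fun x => vz_ n x - u x) @[n --> \oo] --> (0 : R) /\
      nrm leb2 M (fun x => vzb_ n x - q x) @[n --> \oo] --> (0 : R)].
Proof.
move=> Lu0.
pose S f := exists v vzb, bdry0 v f vzb.
have SL g : S g -> L2M g by move=> [v [vzb [_ sg _ _ _]]]; exact: csm_L2M.
have S0 : S (fun=> 0) by exists (fun=> 0), (fun=> 0); exact: bdry0_0.
have SD g h : S g -> S h -> S (fun x => g x + h x).
  move=> [v [vzb hg]] [w [wzb hh]].
  by exists (fun x => v x + w x), (fun x => vzb x + wzb x); exact: bdry0D.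
have SZ (t : R) g : S g -> S (fun x => t%:C * g x).
  by move=> [v [vzb h]]; exists (fun x => t%:C * v x), (fun x => t%:C * vzb x); exact: bdry0Z.
have [s [u [Ss Lu su orth]]] := L2_projection mM S0 SD SZ SL Lu0.
have /choice[v_ /choice[vzb_ bv]] := Ss.
have Ls n : L2M (s n) := SL _ (Ss n).
have Lvzb n : L2M (vzb_ n) by have [_ _ sg _ _] := bv n; exact: csm_L2M.
pose r x := u0 x - u x; have Lr : L2M r := L2B mM Lu0 Lu.
have ru : rip leb2 M r u = 0.
  by rewrite ripC; apply: (rip_lim0 mM Ls Lu Lr su) => n; rewrite ripC; exact: orth.
have [nu nr] := nrm_proj_le mM Lu0 Lu ru.
(* The equality of norms, applied to differences, makes dbar v_n Cauchy as soon as d v_n is. *)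
have ndiff m n : nrm leb2 M (fun x => vzb_ m x - vzb_ n x) = nrm leb2 M (fun x => s m x - s n x).
  have := bdry0_nrm (bdry0D (bv m) (bdry0Z (-1) (bv n))).
  rewrite (@eq_nrm _ _ _ _ _ _ (fun x => s m x - s n x)); last by move=> x _; rewrite mulN1r.
  by move=> ->; apply: eq_nrm => x _; rewrite mulN1r.
have cau e : 0 < e -> exists N : nat, forall m n : nat, (N <= m)%N -> (N <= n)%N ->
    nrm leb2 M (fun x => vzb_ m x - vzb_ n x) <= e.
  by move=> /(cvg_cauchy mM Ls Lu su)[N HN]; exists N => m n h1 h2; rewrite ndiff HN.
have [q [Lq vq _]] := L2_complete mM Lvzb cau.
have nq : nrm leb2 M q = nrm leb2 M u.
  have c1 := cvg_nrm mM Ls Lu su; have c2 := cvg_nrm mM Lvzb Lq vq.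
  have E : (fun n => nrm leb2 M (s n)) = (fun n => nrm leb2 M (vzb_ n)).
    by apply/funext => n; exact: (bdry0_nrm (bv n)).
  by rewrite E in c1; exact: (cvg_unique _ c2 c1).
exists r, u, q, v_, s, vzb_; split => //.
- by split=> // x; rewrite /r subrK.
- pose S2 f := exists fz, [/\ csm f, csm fz & cdiff f fz (fun=> 0)].
  have S2L g : S2 g -> L2M g by move=> [gz [sg _ _]]; exact: csm_L2M.
  have S20 : S2 (fun=> 0).
    by exists (fun=> 0); split; [exact: csm_cst|exact: csm_cst|exact: cdiff_cst].
  have S2D g h : S2 g -> S2 h -> S2 (fun x => g x + h x).
    move=> [gz [a1 a2 a3]] [hz [b1 b2 b3]]; exists (fun x => gz x + hz x).
    split; [exact: csmD|exact: csmD|].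
    by apply: cdiff_ext (cdiffD a3 b3) _ _ => // x; rewrite addr0.
  have S2Z (t : R) g : S2 g -> S2 (fun x => t%:C * g x).
    move=> [gz [h1 h2 h3]]; exists (fun x => t%:C * gz x); split; [exact: csmZ|exact: csmZ|].
    by apply: cdiff_ext (cdiffZ t%:C h3) _ _ => // x; rewrite mulr0.
  have [s2 [r1 [Ss2 Lr1 sr1 orth2]]] := L2_projection mM S20 S2D S2Z S2L Lr.
  have Ls2 n : L2M (s2 n) := S2L _ (Ss2 n).
  have Lr2 : L2M (fun x => r x - r1 x) := L2B mM Lr Lr1.
  have r2S g : S g -> rip leb2 M (fun x => r x - r1 x) g = 0.
    move=> Sg; have Lg := SL _ Sg; rewrite (ripBl mM Lr Lr1 Lg) (orth _ Sg) sub0r.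
    rewrite (rip_lim0 mM Ls2 Lr1 Lg sr1) ?oppr0// => n.
    have [fz [sf sfz df]] := Ss2 n; have [w [wzb [sw sg swzb dw w0]]] := Sg.
    by rewrite ripC; exact: (rip_dz_hol sw sg sf sfz swzb dw df w0).
  have sm (c : R[i]) x y : csm (fun p => c * mono x y p : R[i]) by exact: csmZ (csm_mono x y).
  (* Orthogonality to d(s z^a zbar^b) is the recursion, and orthogonality to z^n its initial
     condition. *)
  have r20 : nrm leb2 M (fun x => r x - r1 x) = 0.
    apply: disk_total => // c; apply: holomorphic_recursion => [a b|n].
      have := r2S _ (ex_intro _ _ (ex_intro _ _ (bdry0_mono c a b))).
      have La := csm_L2M (sm c a.-1 b); have Lb := csm_L2M (sm c a b.+1).
      rewrite (ripBr mM (L2Z mM _ La) (L2Z mM _ Lb) Lr2) !ripZr// => /eqP.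
      by rewrite subr_eq0 => /eqP.
    apply: orth2; exists (fun x => c * (n%:R * mono n.-1 0 x)).
    split; [exact: sm|by apply: csmZ; apply: csmZ; exact: csm_mono|].
    by apply: cdiff_ext (cdiffZ c (cdiff_mono n 0)) _ _ => // x; rewrite mul0r mulr0.
  have s2r : nrm leb2 M (fun x => s2 n x - r x) @[n --> \oo] --> (0 : R).
    by apply: (cvg_nrm_ae mM Ls2 Lr1 Lr _ sr1); rewrite nrm_distC.
  apply: (weak_op_lim Ls2 (fun=> L2_0 _ _) Lr (L2_0 _ _) _ s2r).
    by move=> n; have [fz [sf sfz df]] := Ss2 n; exact: (csm_weak_dzbar sf sfz df).
  rewrite (_ : (fun n => _) = fun=> 0); first exact: cvg_cst.
  apply/funext => n; rewrite (@eq_nrm _ _ _ _ _ _ (fun=> 0)); last by move=> x _; rewrite subr0.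
  by rewrite /nrm (rip0l _ mM) sqrtr0.
- by rewrite nq.
Qed.

End DiskDecomposition.

(** * The conjugate splitting for negative degrees *)

Section ConjugateStep.
Context {R : realType}.
Local Notation mR := (measurableTypeR R).
Implicit Types f g u v : R * R -> R[i].
Let mM := @measurable_M R.

Lemma dotc_conj (z w : R[i]) : dotc (conjc z) (conjc w) = dotc z w.
Proof. by case: z w => [a b] [c d]; rewrite /dotc/= mulrNN. Qed.

Lemma nrm_conj f : nrm leb2 M (fun x => conjc (f x)) = nrm leb2 M f.
Proof. by rewrite /nrm /rip; congr Num.sqrt; apply: eq_Rintegral => x _; rewrite dotc_conj. Qed.

Lemma L2M_conj f : L2M f -> L2M (fun x => conjc (f x)).
Proof.
move=> Lf; have [_ mN] := L2_meas (L2N mM Lf); have [[m1 _] i] := (L2P _ _ _).1 Lf.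
apply/L2P; split.
  split; first by under eq_fun do rewrite Re_conj.
  by under eq_fun do rewrite Im_conj -ImN.
by move: i; congr (integrable _ _ _); apply/funext => x; rewrite dotc_conj.
Qed.

Lemma cvg_nrm_conj (s : nat -> R * R -> R[i]) u :
  nrm leb2 M (fun x => s n x - u x) @[n --> \oo] --> (0 : R) ->
  nrm leb2 M (fun x => conjc (s n x) - conjc (u x)) @[n --> \oo] --> (0 : R).
Proof.
have E n : nrm leb2 M (fun x => conjc (s n x) - conjc (u x)) = nrm leb2 M (fun x => s n x - u x).
  by rewrite -nrm_conj; congr nrm; apply/funext => x; rewrite conjcB !conjcK.
by rewrite (eq_cvg _ _ E).
Qed.

Lemma weak_dz_conj f : L2M f -> weak_dzbar f (fun=> 0) -> weak_dz (fun x => conjc (f x)) (fun=> 0).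
Proof.
move=> Lf w phi tphi.
have [_ _ cx cy _] := test_pdiff tphi.
have [w1 w2] := weak_op_rip w tphi.
have z g : rip leb2 (M : set (mR * mR)) (fun=> 0) g = 0 := rip0l _ mM g.
have z2 : cintegral leb2 M (fun p : R * R => (fun=> 0 : R[i]) p * (phi p)%:C) = 0.
  by rewrite cintegral_rip !z.
rewrite z2 oppr0 cintegral_rip.
rewrite z oppr0 in w1; rewrite z oppr0 in w2.
set psi := fun p : R * R => conjc (_ * _ + _) in w1.
set psi2 := fun p : R * R => conjc (- 'i * _) in w2.
suff [-> ->] : rip leb2 M (fun x => conjc (f x)) (fun p => conjc ((2^-1)%:C * (derive phi p (1, 0))%:C +
      (0 -i* 2^-1) * (derive phi p (0, 1))%:C)) = rip leb2 M f psi /\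
    rip leb2 M (fun x => conjc (f x)) (fun p => conjc (- 'i * ((2^-1)%:C * (derive phi p (1, 0))%:C +
      (0 -i* 2^-1) * (derive phi p (0, 1))%:C))) = - rip leb2 M f psi2.
  by rewrite w1 w2 oppr0.
split.
  apply: eq_Rintegral => x _; rewrite -[in RHS]dotc_conj; congr dotc.
  by rewrite /psi conjcK; apply/eqP; rewrite eq_complex/=; apply/andP; split; apply/eqP; ring.
have cpsi : ccont (fun p => - 'i * ((2^-1)%:C * (derive phi p (1, 0))%:C +
    (0 +i* 2^-1) * (derive phi p (0, 1))%:C)).
  exact: (ccontZ (- 'i%R) (ccontD (ccontZ (2^-1)%:C cx) (ccontZ (0 +i* 2^-1) cy))).
rewrite -(ripNl mM Lf (ccont_L2M (ccont_conj cpsi))).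
apply: eq_Rintegral => x _; rewrite -[in RHS]dotc_conj /psi2 /dotc conjcK.
by case: (f x) => a b /=; ring.
Qed.

Lemma disk_step_conj u0 : L2M u0 -> exists r u q, exists v_ vz_ vzb_ : nat -> R * R -> R[i],
  [/\ [/\ L2M r, L2M u, L2M q & forall x, u0 x = r x + u x],
      weak_dz r (fun=> 0),
      nrm leb2 M r <= nrm leb2 M u0 /\ (nrm leb2 M u <= nrm leb2 M u0 /\ nrm leb2 M q <= nrm leb2 M u0),
      forall n, bdry0 (v_ n) (vz_ n) (vzb_ n) &
      nrm leb2 M (fun x => vzb_ n x - u x) @[n --> \oo] --> (0 : R) /\
      nrm leb2 M (fun x => vz_ n x - q x) @[n --> \oo] --> (0 : R)].
Proof.
move=> Lu0; have [r [u [q [v_ [vz_ [vzb_ [[Lr Lu Lq E] w [n1 [n2 n3]] b [c1 c2]]]]]]]] :=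
  disk_step (L2M_conj Lu0).
exists (fun x => conjc (r x)), (fun x => conjc (u x)), (fun x => conjc (q x)).
exists (fun n x => conjc (v_ n x)), (fun n x => conjc (vzb_ n x)), (fun n x => conjc (vz_ n x)).
rewrite !nrm_conj -(nrm_conj u0); split => //.
- split; try exact: L2M_conj.
  by move=> x; rewrite -conjcD -E conjcK.
- exact: weak_dz_conj.
- move=> n; have [s1 s2 s3 s4 s5] := b n; split; try exact: csm_conj.
    exact: cdiff_conj.
  by move=> p /s5 ->; exact: conjc0.
- by split; exact: cvg_nrm_conj.
Qed.

End ConjugateStep.

(** * The X-ray transform of derivatives and of L^2 limits *)

Section XrayCalculus.
Context {R : realType}.
Local Notation mR := (measurableTypeR R).
Local Notation T2 := (mR * mR)%type.
Local Notation T3 := (mR * mR * mR)%type.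
Implicit Types (u v vz vzb : R * R -> R[i]) (f g : (R * R) * R -> R[i]) (w : R * R -> R[i]).

Let mM := @measurable_M R.
Let mSM := @measurable_SM R.
Let mI := @measurable_influx R.

Lemma continuousSM_mode u k : ccont u -> continuousSM (mode u k).
Proof.
move=> [u1 u2].
have cf : ccont (fun p : (R * R) * R => u p.1).
  by split=> p; [apply: (@continuous_comp _ _ _ fst (fun x => complex.Re (u x)))
    |apply: (@continuous_comp _ _ _ fst (fun x => complex.Im (u x)))];
    first [exact: cvg_fst|exact: u1|exact: u2].
have ce : ccont (fun p : (R * R) * R => expi (k%:~R * p.2)).
  by apply: ccont_expi => p; apply: cvgMl_tmp; exact: cvg_snd.
have [c1 c2] := ccontM cf ce; split=> // x t.
by rewrite /mode/= expi_2pik.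
Qed.

Lemma continuousSMD f g : continuousSM f -> continuousSM g -> continuousSM (fun p => f p + g p).
Proof.
move=> [p1 f1 f2] [p2 g1 g2]; have [c1 c2] := ccontD (conj f1 f2) (conj g1 g2).
by split=> // x t; rewrite p1 p2.
Qed.

(* [X (v e^{il theta})], where [vz] and [vzb] are the Wirtinger derivatives of [v]. *)
Definition Xfield vz vzb (l : int) (p : (R * R) * R) : R[i] :=
  mode vz (l + 1) p + mode vzb (l - 1) p.

Lemma continuousSM_Xfield vz vzb l : csm vz -> csm vzb -> continuousSM (Xfield vz vzb l).
Proof.
by move=> /csm_ccont c1 /csm_ccont c2; apply: continuousSMD; exact: continuousSM_mode.
Qed.

Lemma is_derive_along (f : R * R -> R) (w p : R * R) (t d : R) :
  is_derive (t *: w + p) w f d -> is_derive t 1 (fun s : R => f (s *: w + p)) d.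
Proof.
have E : (fun h : R => h^-1 *: ((f \o shift (t *: w + p)) (h *: w) - f (t *: w + p))) =
    (fun h : R => h^-1 *: (((fun s : R => f (s *: w + p)) \o shift t) (h *: 1) -
       (fun s : R => f (s *: w + p)) t)).
  by apply/funext => h /=; rewrite [_%:A]mulr1 scalerDl addrA.
by case; rewrite /derivable /derive E.
Qed.

(** The direction is constant along the chord, so e^{il theta} factors out and the fundamental
    theorem of calculus applies to v. *)
Lemma xray_Xfield v vz vzb l (q : R * R) : csm vz -> csm vzb -> cdiff v vz vzb -> influx q ->
  xray_formula (Xfield vz vzb l) q = expi (l%:~R * (q.1 + pi + q.2)) *
    (v (chord q (2 * cos q.2)).1 - v (chord q 0).1).
Proof.
move=> sz szb dv iq; have [_ _ c0 _] := influxP iq.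
set th := q.1 + pi + q.2; pose e : R[i] := expi (l%:~R * th).
pose w : R * R := (cos th, sin th); pose p : R * R := (cos q.1, sin q.1).
have chE t : (chord q t).1 = t *: w + p.
  by apply: injective_projections => /=; rewrite addrC.
have XE t : zc w * (e * vz (t *: w + p)) + conjc (zc w) * (e * vzb (t *: w + p)) =
    Xfield vz vzb l (chord q t).
  rewrite /Xfield /mode chE /= -/th intrD intrB !mulrDl mulNr mul1r (expiD _ th) (expiD _ (- th)) expiN.
  rewrite -/e -[zc w]/(expi th) -[cos th -i* sin th]/(conjc (expi th)); move: (expi th) (conjc (expi th)) e => a b c; ring.
have [_ cX1 cX2] := continuousSM_Xfield l sz szb.
have ch : continuous (chord q) by exact: continuous_chord.
have dve := cdiffZ e dv.
have d1 t := is_derive_along (dve (t *: w + p) w).1.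
have d2 t := is_derive_along (dve (t *: w + p) w).2.
have g1 : continuous (fun t => complex.Re (Xfield vz vzb l (chord q t))).
  by move=> t; apply: (@continuous_comp _ _ _ (chord q) (fun p => complex.Re (Xfield vz vzb l p)));
    [exact: ch|exact: cX1].
have g2 : continuous (fun t => complex.Im (Xfield vz vzb l (chord q t))).
  by move=> t; apply: (@continuous_comp _ _ _ (chord q) (fun p => complex.Im (Xfield vz vzb l p)));
    [exact: ch|exact: cX2].
have le0 : 0 <= 2 * cos q.2 by rewrite mulr_ge0// ltW.
rewrite xray_formulaE /chord_int csegE.
rewrite (Rintegral_FTC (f := fun s => complex.Re (e * v (s *: w + p))) le0 _ g1); last first.
  by move=> t; rewrite -XE; exact: d1.
rewrite (Rintegral_FTC (f := fun s => complex.Im (e * v (s *: w + p))) le0 _ g2); last first.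
  by move=> t; rewrite -XE; exact: d2.
rewrite -!chE mulrBr -/e.
by apply/eqP; rewrite eq_complex ReD ImD ReN ImN !eqxx.
Qed.

(** The chord entering at angle beta leaves at angle beta + pi + 2 alpha, so its exit is again a
    point of the circle. *)
Lemma chord_exit (q : R * R) : (chord q (2 * cos q.2)).1 =
  (cos (q.1 + pi + q.2 + q.2), sin (q.1 + pi + q.2 + q.2)).
Proof.
rewrite /chord /=; set x := q.1 + pi + q.2.
have -> : cos q.1 = - cos (x - q.2) by rewrite /x addrK cosDpi opprK.
have -> : sin q.1 = - sin (x - q.2) by rewrite /x addrK sinDpi opprK.
by rewrite cosB sinB cosD sinD; congr (_, _); ring.
Qed.

Lemma chord_enter (q : R * R) : (chord q 0).1 = (cos q.1, sin q.1).
Proof. by rewrite /chord /= !mul0r !addr0. Qed.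

Lemma xray_bdry0 v vz vzb l (q : R * R) : bdry0 v vz vzb -> influx q ->
  xray_formula (Xfield vz vzb l) q = 0.
Proof.
move=> [_ sz szb dv v0] iq; rewrite (xray_Xfield l sz szb dv iq) chord_exit chord_enter.
by rewrite !v0 ?subrr ?mulr0// /on_circle/= cos2Dsin2.
Qed.

Lemma is_xray_ae f g w : L2 leb3 SM f -> L2 leb3 SM g -> ae_eq leb3 SM f g ->
  is_xray f w -> is_xray g w.
Proof.
move=> Lf Lg fg [Lw [u_ [cu uf uw]]]; split=> //; exists u_; split=> //.
have Lu n := continuousSM_L2 (cu n).
apply/(L2cvgP mSM Lu Lg); apply: (cvg_nrm_ae mSM Lu Lf Lg); last exact/(L2cvgP mSM Lu Lf).
have d0 : ae_eq leb3 SM (fun p => f p - g p) (fun=> 0).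
  by apply: filterS fg => p h pSM; rewrite h// subrr.
rewrite /nrm (ae_eq_rip mSM (L2_meas (L2B mSM Lf Lg)) (cmeas_cst _ 0) (L2_meas (L2B mSM Lf Lg)) d0).
by rewrite (rip0l _ mSM) sqrtr0.
Qed.

Lemma is_xrayB f y w : L2 leb3 SM f -> L2 leb3 SM y -> is_xray f w ->
  is_xray y (fun=> 0) -> is_xray (fun p => f p - y p) w.
Proof.
move=> Lf Ly [Lw [u_ [cu uf uw]]] [L0 [y_ [cy yf yw]]]; split=> //.
have Lu n := continuousSM_L2 (cu n); have Ly_ n := continuousSM_L2 (cy n).
have Iu n := xray_L2 (cu n); have Iy n := xray_L2 (cy n).
exists (fun n p => u_ n p - y_ n p).
have cs n := continuousSMB (cu n) (cy n).
have LN n : L2 leb3 SM (fun p => -1 * y_ n p) := L2Z mSM _ (Ly_ n).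
have IN n : L2 leb2 influx (fun p => -1 * xray_formula (y_ n) p) := L2Z mI _ (Iy n).
split=> //.
  apply/(L2cvgP mSM (fun n => continuousSM_L2 (cs n)) (L2B mSM Lf Ly)).
  have h1 := (L2cvgP mSM Lu Lf).1 uf.
  have h2 := cvg_nrmZ mSM (-1) Ly_ Ly ((L2cvgP mSM Ly_ Ly).1 yf).
  have := cvg_nrmD mSM Lu LN Lf (L2Z mSM (-1) Ly) h1 h2.
  rewrite (_ : (fun n => _) = (fun n => nrm leb3 SM (fun p => u_ n p - y_ n p - (f p - y p))))//.
  by apply/funext => n; apply: eq_nrm => p _; rewrite !mulN1r.
apply/(L2cvgP mI (fun n => xray_L2 (cs n)) Lw.2).
have h1 := (L2cvgP mI Iu Lw.2).1 uw.
have h2 := cvg_nrmZ mI (-1) Iy L0.2 ((L2cvgP mI Iy L0.2).1 yw).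
have := cvg_nrmD mI Iu IN Lw.2 (L2Z mI (-1) L0.2) h1 h2.
rewrite (_ : (fun n => _) = (fun n => nrm leb2 influx
  (fun p => xray_formula (fun p => u_ n p - y_ n p) p - w p)))//.
apply/funext => n; apply: eq_nrm => p _.
by rewrite !mulN1r oppr0 addr0 xray_formulaB.
Qed.

Lemma is_xray_null y (u_ : nat -> (R * R) * R -> R[i]) : L2 leb3 SM y ->
  (forall n, continuousSM (u_ n)) ->
  nrm leb3 SM (fun p => u_ n p - y p) @[n --> \oo] --> (0 : R) ->
  (forall n q, influx q -> xray_formula (u_ n) q = 0) -> is_xray y (fun=> 0).
Proof.
move=> Ly cu uy I0; split; first by split; [move=> a _ b|exact: L2_0].
exists u_; split=> //; first exact/(L2cvgP mSM (fun n => continuousSM_L2 (cu n)) Ly).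
apply/(L2cvgP mI (fun n => xray_L2 (cu n)) (L2_0 _ _)).
rewrite (_ : (fun n => _) = fun=> 0); first exact: cvg_cst.
apply/funext => n; rewrite (@eq_nrm _ _ _ _ _ _ (fun=> 0)); last by move=> q iq; rewrite I0// subr0.
by rewrite /nrm (rip0l _ mI) sqrtr0.
Qed.

(** Boundedness on continuous functions carries the Cauchy property of the approximants over to
    their transforms. *)
Lemma is_xray_exists f (u_ : nat -> (R * R) * R -> R[i]) : L2 leb3 SM f ->
  (forall n, continuousSM (u_ n)) ->
  nrm leb3 SM (fun p => u_ n p - f p) @[n --> \oo] --> (0 : R) ->
  exists w, is_xray f w.
Proof.
move=> Lf cu uf; have Lu n := continuousSM_L2 (cu n); have Iu n := xray_L2 (cu n).
have cau (e : R) : 0 < e -> exists N : nat, forall m n : nat, (N <= m)%N -> (N <= n)%N ->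
    nrm leb2 influx (fun x => xray_formula (u_ m) x - xray_formula (u_ n) x) <= e.
  move=> e0; have e20 : 0 < e / 2 by rewrite divr_gt0.
  have [N HN] := cvg_cauchy mSM Lu Lf uf e20; exists N => m n Nm Nn.
  suff : nrm leb2 (influx : set T2) (xray_formula (fun p => u_ m p - u_ n p)) <= e.
    apply: le_trans; rewrite le_eqVlt; apply/orP; left; apply/eqP.
    by apply: eq_nrm => q _; rewrite xray_formulaB.
  apply: le_trans (xray_nrm (continuousSMB (cu m) (cu n))) _.
  by have := HN m n Nm Nn; lra.
have [w [Lw wl wp]] := L2_complete mI Iu cau; exists w; split.
  (* [wp] is the pointwise invariance from [L2_complete]: points one period apart carry the same
     sequence of values. *)
  split=> // a _ b; apply: wp => n; exact: xray_formula_periodic.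
by exists u_; split=> //; [exact/(L2cvgP mSM Lu Lf)|exact/(L2cvgP mI Iu Lw)].
Qed.

Lemma nrm_mode u k : L2M u -> nrm leb3 SM (mode u k) = Num.sqrt (pi *+ 2) * nrm leb2 M u.
Proof.
move=> Lu; rewrite /nrm rip_mode// eqxx mul1r sqrtrM//.
by rewrite mulrn_wge0// pi_ge0.
Qed.

Lemma modeB u v k : mode (fun x => u x - v x) k = (fun p => mode u k p - mode v k p).
Proof. by apply/funext => p; rewrite /mode mulrBl. Qed.

Lemma cvg_nrm_mode (s : nat -> R * R -> R[i]) u k : (forall n, L2M (s n)) -> L2M u ->
  nrm leb2 M (fun x => s n x - u x) @[n --> \oo] --> (0 : R) ->
  nrm leb3 SM (fun p => mode (s n) k p - mode u k p) @[n --> \oo] --> (0 : R).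
Proof.
move=> Ls Lu su.
have E n : nrm leb3 SM (fun p => mode (s n) k p - mode u k p) =
    Num.sqrt (pi *+ 2) * nrm leb2 M (fun x => s n x - u x).
  by rewrite -modeB nrm_mode//; exact: (L2B mM (Ls n) Lu).
have h : Num.sqrt (pi *+ 2) * nrm leb2 M (fun x => s n x - u x) @[n --> \oo] --> (0 : R).
  by rewrite -[X in _ --> X](mulr0 (Num.sqrt (pi *+ 2))); exact: cvgMl_tmp.
by rewrite (eq_cvg _ _ E).
Qed.

Lemma is_xray_Xfield (v_ vz_ vzb_ : nat -> R * R -> R[i]) a b l : L2M a -> L2M b ->
  (forall n, bdry0 (v_ n) (vz_ n) (vzb_ n)) ->
  nrm leb2 M (fun x => vz_ n x - a x) @[n --> \oo] --> (0 : R) ->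
  nrm leb2 M (fun x => vzb_ n x - b x) @[n --> \oo] --> (0 : R) ->
  is_xray (Xfield a b l) (fun=> 0).
Proof.
move=> La Lb bv va vb.
have sz n : csm (vz_ n) by have [] := bv n.
have szb n : csm (vzb_ n) by have [] := bv n.
apply: (@is_xray_null _ (fun n => Xfield (vz_ n) (vzb_ n) l)).
- exact: (L2D mSM (mode_L2 _ La) (mode_L2 _ Lb)).
- by move=> n; exact: continuousSM_Xfield.
- apply: (cvg_nrmD mSM _ _ (mode_L2 _ La) (mode_L2 _ Lb)).
  + by move=> n; apply: mode_L2; exact: csm_L2M.
  + by move=> n; apply: mode_L2; exact: csm_L2M.
  + by apply: cvg_nrm_mode => // n; exact: csm_L2M.
  + by apply: cvg_nrm_mode => // n; exact: csm_L2M.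
- by move=> n q iq; exact: (xray_bdry0 l (bv n) iq).
Qed.

End XrayCalculus.

(** * Harmonic components of tensors and the gauge steps *)

Section TensorDecomposition.
Context {R : realType}.
Local Notation mR := (measurableTypeR R).
Local Notation T2 := (mR * mR)%type.
Local Notation T3 := (mR * mR * mR)%type.
Implicit Types (u v : R * R -> R[i]) (f g : (R * R) * R -> R[i]).

Let mM := @measurable_M R.
Let mSM := @measurable_SM R.

Definition deg (m j : nat) : int := m%:Z - (2 * j)%N%:Z.

Definition tens (m : nat) (G : int -> R * R -> R[i]) (p : (R * R) * R) : R[i] :=
  \sum_(j < m.+1) mode (G (deg m j)) (deg m j) p.

Lemma harmonics_deg m (j : 'I_m.+1) : harmonics m (deg m j).
Proof. by exists (j : nat) => //; rewrite -ltnS. Qed.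

Lemma harmonicsP m k : harmonics m k -> exists j : 'I_m.+1, k = deg m j.
Proof. by move=> [j jm ->]; rewrite -ltnS in jm; exists (Ordinal jm). Qed.

Lemma deg_eq m (i j : 'I_m.+1) : (deg m i == deg m j) = (i == j).
Proof.
apply/eqP/eqP => [h|->//]; apply: val_inj; move: h; rewrite /deg/=; lia.
Qed.

Lemma sum_pick (V : nmodType) m k (F : int -> V) : harmonics m k ->
  \sum_(j < m.+1) (if deg m j == k then F (deg m j) else 0) = F k.
Proof.
move=> /harmonicsP[j0 ->]; rewrite (bigD1 j0)//= eqxx big1 ?addr0// => j jj.
by rewrite deg_eq (negbTE jj).
Qed.

Lemma tens_L2 m G : (forall k, L2M (G k)) -> L2 leb3 SM (tens m G).
Proof.
move=> LG; have [|h _] := @rip_sum R m.+1 (fun=> 0) (fun j => mode (G (deg m j)) (deg m j)) (L2_0 _ _).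
  by move=> j; exact: (mode_L2 _ (LG _)).
exact: h.
Qed.

Lemma rip_tens m G k v : (forall k, L2M (G k)) -> L2M v ->
  rip leb3 SM (tens m G) (mode v k) =
  \sum_(j < m.+1) (if deg m j == k then pi *+ 2 * rip leb2 M (G (deg m j)) v else 0).
Proof.
move=> LG Lv.
have [|_ h] := @rip_sum R m.+1 (mode v k) (fun j => mode (G (deg m j)) (deg m j)) (mode_L2 k Lv).
  by move=> j; exact: (mode_L2 _ (LG _)).
rewrite ripC h; apply: eq_bigr => j _; rewrite ripC (rip_mode _ _ (LG _) Lv).
by case: eqP => _; rewrite ?mul1r// !mul0r.
Qed.

Lemma rip_tens_on m G k v : (forall k, L2M (G k)) -> L2M v -> harmonics m k ->
  rip leb3 SM (tens m G) (mode v k) = pi *+ 2 * rip leb2 M (G k) v.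
Proof.
move=> LG Lv hk; rewrite rip_tens//.
exact: (sum_pick (fun k => pi *+ 2 * rip leb2 M (G k) v) hk).
Qed.

Lemma rip_tens_off m G k v : (forall k, L2M (G k)) -> L2M v -> ~ harmonics m k ->
  rip leb3 SM (tens m G) (mode v k) = 0.
Proof.
move=> LG Lv hk; rewrite rip_tens// big1// => j _; case: eqP => // e.
by case: hk; rewrite -e; exact: harmonics_deg.
Qed.

Lemma two_pi_ge1 : 1 <= (pi : R) *+ 2.
Proof. by have := @pi_ge2 R; lra. Qed.

Lemma nrm_le_mode u k : L2M u -> nrm leb2 M u <= nrm leb3 SM (mode u k).
Proof.
move=> Lu; rewrite nrm_mode// ler_peMl ?nrm_ge0//.
by rewrite -[leLHS]sqrtr1 ler_sqrt ?two_pi_ge1//; apply: le_trans two_pi_ge1.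
Qed.

Lemma cvg_nrm_sum n (s : nat -> 'I_n -> T3 -> R[i]) (u : 'I_n -> T3 -> R[i]) :
  (forall i j, L2 leb3 SM (s i j)) -> (forall j, L2 leb3 SM (u j)) ->
  (forall j, nrm leb3 SM (fun p => s i j p - u j p) @[i --> \oo] --> (0 : R)) ->
  nrm leb3 SM (fun p => \sum_(j < n) s i j p - \sum_(j < n) u j p) @[i --> \oo] --> (0 : R).
Proof.
elim: n s u => [|n IH] s u Ls Lu su.
  rewrite (_ : (fun i => _) = fun=> 0); first exact: cvg_cst.
  apply/funext => i; rewrite (@eq_nrm _ _ _ _ _ _ (fun=> 0)); last first.
    by move=> p _; rewrite !big_ord0 subr0.
  by rewrite /nrm (rip0l _ mSM) sqrtr0.
pose wd := widen_ord (leqnSn n).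
have L1 i : L2 leb3 SM (fun p => \sum_(j < n) s i (wd j) p).
  by have [//|h _] := @rip_sum R n (fun=> 0) (fun j => s i (wd j)) (L2_0 _ _).
have L2' : L2 leb3 SM (fun p => \sum_(j < n) u (wd j) p).
  by have [//|h _] := @rip_sum R n (fun=> 0) (fun j => u (wd j)) (L2_0 _ _).
have h := IH (fun i j => s i (wd j)) (fun j => u (wd j)) (fun i j => Ls i (wd j))
  (fun j => Lu (wd j)) (fun j => su (wd j)).
have := cvg_nrmD mSM L1 (fun i => Ls i ord_max) L2' (Lu ord_max) h (su ord_max).
rewrite (_ : (fun i => _) = (fun i => nrm leb3 SM (fun p => \sum_(j < n.+1) s i j p -
   \sum_(j < n.+1) u j p)))//.
by apply/funext => i; apply: eq_nrm => p _; rewrite !big_ord_recr.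
Qed.

(** The component is found by projecting onto smooth modes of degree [k] instead of taking Fourier
    integrals: this provides the smooth approximants needed for the X-ray transform together with
    the norm bound, which uses 2pi >= 1. *)
Lemma mode_component f k : L2 leb3 SM f -> exists u (p_ : nat -> R * R -> R[i]),
  [/\ L2M u, forall n, csm (p_ n), nrm leb2 M (fun x => p_ n x - u x) @[n --> \oo] --> (0 : R),
      forall v, csm v -> rip leb3 SM f (mode v k) = rip leb3 SM (mode u k) (mode v k) &
      nrm leb2 M u <= nrm leb3 SM f].
Proof.
move=> Lf; pose S g := exists2 p, csm p & g = mode p k.
have SL g : S g -> L2 leb3 SM g by move=> [p sp ->]; apply: mode_L2; exact: csm_L2M.
have S0 : S (fun=> 0).
  by exists (fun=> 0); [exact: csm_cst|apply/funext => p; rewrite /mode mul0r].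
have SD g h : S g -> S h -> S (fun x => g x + h x).
  move=> [p sp ->] [q sq ->]; exists (fun x => p x + q x); first exact: csmD.
  by apply/funext => x; rewrite /mode mulrDl.
have SZ (t : R) g : S g -> S (fun x => t%:C * g x).
  move=> [p sp ->]; exists (fun x => t%:C * p x); first exact: csmZ.
  by apply/funext => x; rewrite /mode mulrA.
have [s [u0 [Ss Lu0 su orth]]] := L2_projection mSM S0 SD SZ SL Lf.
have Ls n := SL _ (Ss n).
have /choice[p_ hp] : forall n, exists p, csm p /\ s n = mode p k.
  by move=> n; have [p sp e] := Ss n; exists p.
have sp n : csm (p_ n) := (hp n).1.
have Lp n : L2M (p_ n) := csm_L2M (sp n).
have sE : s = (fun n => mode (p_ n) k) by apply/funext => n; exact: (hp n).2.
have cau (e : R) : 0 < e -> exists N : nat, forall m n : nat, (N <= m)%N -> (N <= n)%N ->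
    nrm leb2 M (fun x => p_ m x - p_ n x) <= e.
  move=> /(cvg_cauchy mSM Ls Lu0 su)[N HN]; exists N => m n Nm Nn.
  apply: le_trans (HN m n Nm Nn).
  apply: le_trans (nrm_le_mode k (L2B mM (Lp m) (Lp n))) _.
  by rewrite modeB sE.
have [u [Lu pu _]] := L2_complete mM Lp cau.
have mu := cvg_nrm_mode k Lp Lu pu.
have su' : nrm leb3 SM (fun p => s n p - mode u k p) @[n --> \oo] --> (0 : R).
  by rewrite sE; exact: mu.
have uu := cvg_nrm_unique mSM Ls Lu0 (mode_L2 k Lu) su su'.
exists u, p_; split => //.
  move=> v sv; have Lv := mode_L2 k (csm_L2M sv).
  rewrite -(ae_eq_rip mSM (L2_meas Lu0) (L2_meas (mode_L2 k Lu)) (L2_meas Lv) uu).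
  apply/eqP; rewrite -subr_eq0 -(ripBl mSM Lf Lu0 Lv); apply/eqP.
  by apply: orth; exists v.
apply: le_trans (nrm_le_mode k Lu) _.
have ou : rip leb3 SM (fun x => f x - u0 x) u0 = 0.
  have Lfu := L2B mSM Lf Lu0.
  by rewrite ripC; apply: (rip_lim0 mSM Ls Lu0 Lfu su) => n; rewrite ripC; exact: orth.
have [h _] := nrm_proj_le mSM Lf Lu0 ou; apply: le_trans h.
have h1 := cvg_nrm mSM Ls Lu0 su; have h2 := cvg_nrm mSM Ls (mode_L2 k Lu) su'.
by rewrite (cvg_unique _ h1 h2).
Qed.

Lemma tensor_decomposition m f : is_tensor m f -> exists G : int -> R * R -> R[i],
  [/\ forall k, L2M (G k), forall k, nrm leb2 M (G k) <= nrm leb3 SM f,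
      ae_eq leb3 SM f (tens m G) & exists w, is_xray (tens m G) w].
Proof.
move=> [[_ Lf] f0].
have /choice[G /choice[p_ hG]] := fun k => mode_component k Lf.
have LG k : L2M (G k) by have [] := hG k.
exists G; split => //.
- by move=> k; have [] := hG k.
- have Lt := tens_L2 m LG.
  have d0 : ae_eq leb3 SM (fun p => f p - tens m G p) (fun=> 0).
    apply: tensor_total => [|c a b k]; first exact: (L2B mSM Lf Lt).
    have sv : csm (fun x => c * mono a b x) by exact: csmZ (csm_mono a b).
    have Lv := csm_L2M sv.
    rewrite tmono_mode (ripBl mSM Lf Lt (mode_L2 k Lv)).
    have [hk|hk] := pselect (harmonics m k).
      rewrite rip_tens_on//; have [_ _ _ -> // _] := hG k.
      by rewrite (rip_mode _ _ (LG _) Lv) eqxx mul1r subrr.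
    rewrite rip_tens_off// subr0; apply: rip_harmonic0 => //; exact: f0.
  by apply: filterS d0 => p h pSM; apply/eqP; rewrite -subr_eq0; apply/eqP; exact: h.
- apply: (@is_xray_exists _ _ (fun n p => \sum_(j < m.+1) mode (p_ (deg m j) n) (deg m j) p)).
  + exact: tens_L2.
  + move=> n; elim: m.+1 {f0} (deg m) => [|N IH] dg.
      rewrite (_ : (fun p => _) = mode (fun=> 0) 0); first by apply: continuousSM_mode; exact: ccont_cst.
      by apply/funext => p; rewrite big_ord0 /mode mul0r.
    rewrite (_ : (fun p => _) = fun p => \sum_(j < N) mode (p_ (dg j) n) (dg j) p + mode (p_ (dg N) n) (dg N) p).
      apply: continuousSMD; first exact: IH.
      by apply: continuousSM_mode; apply: csm_ccont; have [_ + _ _ _] := hG (dg N); apply.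
    by apply/funext => p; rewrite big_ord_recr.
  + apply: cvg_nrm_sum => [n j|j|j].
    * by apply: mode_L2; apply: csm_L2M; have [_ + _ _ _] := hG (deg m j); apply.
    * exact: (mode_L2 _ (LG _)).
    * apply: cvg_nrm_mode => // [n|]; last by have [] := hG (deg m j).
      by apply: csm_L2M; have [_ + _ _ _] := hG (deg m j); apply.
Qed.

(** The effect on components of subtracting a field X(v e^{il theta}): [u] leaves degree [K] and [q]
    leaves degree [K']. *)
Definition shift2 (G : int -> R * R -> R[i]) (K K' : int) u q (k : int) (x : R * R) : R[i] :=
  G k x - ((if k == K then u x else 0) + (if k == K' then q x else 0)).

Lemma tens_shift2 m G K K' u q : harmonics m K -> harmonics m K' ->
  tens m (shift2 G K K' u q) = fun p => tens m G p - (mode u K p + mode q K' p).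
Proof.
move=> hK hK'; apply/funext => p; rewrite /tens.
rewrite -(sum_pick (fun k => mode u k p) hK) -(sum_pick (fun k => mode q k p) hK').
rewrite -big_split/= -sumrB; apply: eq_bigr => j _.
rewrite /shift2 /mode mulrBl mulrDl; congr (_ - (_ + _)).
  by case: ifP => _ //; rewrite mul0r.
by case: ifP => _ //; rewrite mul0r.
Qed.

Lemma shift2_L2 G K K' u q : (forall k, L2M (G k)) -> L2M u -> L2M q ->
  forall k, L2M (shift2 G K K' u q k).
Proof.
move=> LG Lu Lq k; have L0 : L2M (fun=> 0 : R[i]) by exact: L2_0.
have Lif (b : bool) v : L2M v -> L2M (fun x => if b then v x else 0) by case: b.
exact: (L2B mM (LG k) (L2D mM (Lif _ _ Lu) (Lif _ _ Lq))).
Qed.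

Definition xray_le m (G G' : int -> R * R -> R[i]) :=
  forall w, is_xray (tens m G) w -> is_xray (tens m G') w.

(** Degree [K] keeps the projected remainder, of norm at most B; only degree [K'] can reach twice
    the bound. *)
Lemma shift2_bound G K K' u q (B : R) : (forall k, L2M (G k)) -> L2M u -> L2M q -> K != K' ->
  (forall k, nrm leb2 M (G k) <= B) -> nrm leb2 M (fun x => G K x - u x) <= B ->
  nrm leb2 M q <= B -> forall k, nrm leb2 M (shift2 G K K' u q k) <= 2 * B.
Proof.
move=> LG Lu Lq KK' GB rB qB k; have B0 : 0 <= B := le_trans (nrm_ge0 _ _ _) (GB 0).
have [->|kK] := eqVneq k K.
  rewrite (_ : shift2 _ _ _ _ _ _ = fun x => G K x - u x); first by lra.
  by apply/funext => x; rewrite /shift2 eqxx (negbTE KK') addr0.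
have [->|kK'] := eqVneq k K'.
  rewrite (_ : shift2 _ _ _ _ _ _ = fun x => G K' x - q x).
    by apply: le_trans (nrmB mM (LG K') Lq) _; have := GB K'; lra.
  by apply/funext => x; rewrite /shift2 eq_sym (negbTE KK') eqxx add0r.
rewrite (_ : shift2 _ _ _ _ _ _ = G k); first by have := GB k; lra.
by apply/funext => x; rewrite /shift2 (negbTE kK) (negbTE kK') addr0 subr0.
Qed.

(** The field subtracted is a limit of X(v e^{i(K-1) theta}), whose transform is zero. From K > 1 it
    follows that K - 2 is still a degree of an m-tensor. *)
Lemma step_pos m G (K : int) (B : R) : (forall k, L2M (G k)) ->
  (forall k, nrm leb2 M (G k) <= B) -> 1 < K -> harmonics m K ->
  exists G', [/\ forall k, L2M (G' k), xray_le m G G', weak_dzbar (G' K) (fun=> 0),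
    forall k, k != K -> k != K - 2 -> G' k = G k & forall k, nrm leb2 M (G' k) <= 2 * B].
Proof.
move=> LG GB K1 hK.
have [r [u [q [v_ [vz_ [vzb_ [[Lr Lu Lq E] w [n1 [n2 n3]] b [c1 c2]]]]]]]] := disk_step (LG K).
have hK2 : harmonics m (K - 2) by move: hK => [j jm e]; exists j.+1; lia.
have KK : K != K - 2 by apply/eqP; lia.
have rE : (fun x => G K x - u x) = r by apply/funext => x; rewrite E addrK.
exists (shift2 G K (K - 2) u q); split.
- exact: shift2_L2.
- move=> W hW; rewrite tens_shift2//; apply: is_xrayB => //; first exact: tens_L2.
    exact: (L2D mSM (mode_L2 _ Lu) (mode_L2 _ Lq)).
  have := is_xray_Xfield (K - 1) Lu Lq b c1 c2.
  by rewrite /Xfield subrK (_ : K - 1 - 1 = K - 2)//; lia.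
- rewrite (_ : shift2 _ _ _ _ _ _ = r)// -rE; apply/funext => x.
  by rewrite /shift2 eqxx (negbTE KK) addr0.
- move=> k k1 k2; apply/funext => x.
  by rewrite /shift2 (negbTE k1) (negbTE k2) addr0 subr0.
- apply: shift2_bound => //; first by rewrite rE; exact: le_trans n1 (GB K).
  exact: le_trans n3 (GB K).
Qed.

Lemma step_neg m G (K : int) (B : R) : (forall k, L2M (G k)) ->
  (forall k, nrm leb2 M (G k) <= B) -> K < -1 -> harmonics m K ->
  exists G', [/\ forall k, L2M (G' k), xray_le m G G', weak_dz (G' K) (fun=> 0),
    forall k, k != K -> k != K + 2 -> G' k = G k & forall k, nrm leb2 M (G' k) <= 2 * B].
Proof.
move=> LG GB K1 hK.
have [r [u [q [v_ [vz_ [vzb_ [[Lr Lu Lq E] w [n1 [n2 n3]] b [c1 c2]]]]]]]] := disk_step_conj (LG K).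
have hK2 : harmonics m (K + 2) by move: hK => [j jm e]; exists j.-1; lia.
have KK : K != K + 2 by apply/eqP; lia.
have rE : (fun x => G K x - u x) = r by apply/funext => x; rewrite E addrK.
exists (shift2 G K (K + 2) u q); split.
- exact: shift2_L2.
- move=> W hW; rewrite tens_shift2//; apply: is_xrayB => //; first exact: tens_L2.
    exact: (L2D mSM (mode_L2 _ Lu) (mode_L2 _ Lq)).
  have := is_xray_Xfield (K + 1) Lq Lu b c2 c1.
  rewrite /Xfield addrK (_ : K + 1 + 1 = K + 2); last by lia.
  by rewrite (_ : (fun p => _) = fun p => mode u K p + mode q (K + 2) p)//; apply/funext => p; rewrite addrC.
- rewrite (_ : shift2 _ _ _ _ _ _ = r)// -rE; apply/funext => x.
  by rewrite /shift2 eqxx (negbTE KK) addr0.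
- move=> k k1 k2; apply/funext => x.
  by rewrite /shift2 (negbTE k1) (negbTE k2) addr0 subr0.
- apply: shift2_bound => //; first by rewrite rE; exact: le_trans n1 (GB K).
  exact: le_trans n3 (GB K).
Qed.

(** Degrees are treated downwards from m. A step at degree K alters only K and K - 2, so degrees
    already made holomorphic stay so, and degrees at most 1 are skipped. *)
Lemma steps_pos m G (B : R) (i : nat) : (forall k, L2M (G k)) ->
  (forall k, nrm leb2 M (G k) <= B) -> (i <= m.+1)%N ->
  exists G', [/\ forall k, L2M (G' k), xray_le m G G',
    forall j, (j < i)%N -> 1 < deg m j -> weak_dzbar (G' (deg m j)) (fun=> 0) &
    forall k, nrm leb2 M (G' k) <= 2 ^+ i * B].
Proof.
move=> LG GB; elim: i => [|i IH] im.
  by exists G; split=> // k; rewrite expr0 mul1r.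
have B0 : 0 <= B := le_trans (nrm_ge0 _ _ _) (GB 0).
have [|G1 [L1 x1 w1 b1]] := IH; first by lia.
have [K1|K1] := ltP 1 (deg m i); last first.
  exists G1; split => // [j ji d1|k]; last first.
    by apply: le_trans (b1 k) _; rewrite exprS -mulrA ler_peMl ?ler1n// mulr_ge0// exprn_ge0.
  by apply: w1 => //; move: ji K1 d1; rewrite /deg; lia.
have hK : harmonics m (deg m i) by exists i => //; lia.
have [G2 [L2' x2 w2 e2 b2]] := step_pos L1 b1 K1 hK.
exists G2; split => //.
- by move=> w /x1 /x2.
- move=> j ji d1; have [->//|ji'] := eqVneq j i.
  by rewrite e2; [apply: w1 => //; lia|apply/eqP; rewrite /deg; lia|apply/eqP; rewrite /deg; lia].
- by move=> k; rewrite exprS -mulrA.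
Qed.

(** Degrees are treated upwards from -m. Since K < -1 forces K + 2 <= 0, positive degrees keep the
    form given by [steps_pos]. *)
Lemma steps_neg m G (B : R) (i : nat) : (forall k, L2M (G k)) ->
  (forall k, nrm leb2 M (G k) <= B) -> (i <= m.+1)%N ->
  exists G', [/\ forall k, L2M (G' k), xray_le m G G',
    forall j, (j < i)%N -> - deg m j < -1 -> weak_dz (G' (- deg m j)) (fun=> 0),
    forall k : int, 0 < k -> G' k = G k &
    forall k, nrm leb2 M (G' k) <= 2 ^+ i * B].
Proof.
move=> LG GB; elim: i => [|i IH] im.
  by exists G; split=> // k; rewrite expr0 mul1r.
have B0 : 0 <= B := le_trans (nrm_ge0 _ _ _) (GB 0).
have [|G1 [L1 x1 w1 e1 b1]] := IH; first by lia.
have [K1|K1] := ltP (- deg m i) (-1); last first.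
  exists G1; split => // [j ji d1|k]; last first.
    by apply: le_trans (b1 k) _; rewrite exprS -mulrA ler_peMl ?ler1n// mulr_ge0// exprn_ge0.
  by apply: w1 => //; move: ji K1 d1; rewrite /deg; lia.
have hK : harmonics m (- deg m i) by exists (m - i)%N; rewrite /deg; lia.
have [G2 [L2' x2 w2 e2 b2]] := step_neg L1 b1 K1 hK.
exists G2; split => //.
- by move=> w /x1 /x2.
- move=> j ji d1; have [->//|ji'] := eqVneq j i.
  by rewrite e2; [apply: w1 => //; lia|apply/eqP; rewrite /deg; lia|apply/eqP; rewrite /deg; lia].
- by move=> k k0; rewrite e2 ?e1//; apply/eqP; move: K1 k0; clear; lia.
- by move=> k; rewrite exprS -mulrA.
Qed.

(** The constant is 2^(m+1), once for the positive and once for the negative side. *)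
Lemma normalize m G (B : R) : (forall k, L2M (G k)) -> (forall k, nrm leb2 M (G k) <= B) ->
  exists G', [/\ forall k, L2M (G' k), xray_le m G G',
    forall k, harmonics m k -> 1 < k -> weak_dzbar (G' k) (fun=> 0),
    forall k, harmonics m k -> k < -1 -> weak_dz (G' k) (fun=> 0) &
    forall k, nrm leb2 M (G' k) <= 4 ^+ m.+1 * B].
Proof.
move=> LG GB; have [G1 [L1 x1 w1 b1]] := steps_pos LG GB (leqnn m.+1).
have [G2 [L2' x2 w2 e2 b2]] := steps_neg L1 b1 (leqnn m.+1).
exists G2; split => //.
- by move=> w /x1 /x2.
- move=> k [j jm kj] k1; rewrite e2; last by move: k1; clear; lia.
  by rewrite kj; apply: w1; [lia|rewrite /deg -kj].
- move=> k [j jm kj] k1; have kE : k = - deg m (m - j) by rewrite /deg; lia.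
  by rewrite kE; apply: w2; [lia|rewrite -kE].
- by move=> k; apply: le_trans (b2 k) _; rewrite mulrA -exprMn -natrM.
Qed.

Lemma tens_is_tensor m G : (forall k, L2M (G k)) -> is_tensor m (tens m G).
Proof.
move=> LG; split.
  split; last exact: tens_L2.
  by move=> x _ t; apply: eq_bigr => j _; rewrite /mode/= expi_2pik.
move=> k hk; apply: aeW => x _.
have mc := @measurable_circle R.
have icE (c : R[i]) (i : int) : leb1.-integrable (circle : set mR)
      (EFin \o (fun t : R => complex.Re (c * expi (i%:~R * t)))) /\
    leb1.-integrable (circle : set mR) (EFin \o (fun t : R => complex.Im (c * expi (i%:~R * t)))).
  have [c1 c2] : ccont (fun t : R => c * expi (i%:~R * t)).
    apply: ccontM; first exact: ccont_cst.
    by apply: ccont_expi => p; apply: cvgMl_tmp; exact: cvg_id.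
  by rewrite circleE; split; apply: continuous_compact_integrable;
    [exact: segment_compact|exact: continuous_subspaceT|exact: segment_compact
    |exact: continuous_subspaceT].
have E (j : nat) t : mode (G (deg m j)) (deg m j) (x, t) * expi (- (k%:~R * t)) =
    G (deg m j) x * expi ((deg m j - k)%:~R * t).
  by rewrite /mode/= -mulrA -expiD; congr (_ * expi _); rewrite intrB; ring.
have Z j : (j < m.+1)%N -> cintegral leb1 (circle : set mR)
    (fun t => G (deg m j) x * expi ((deg m j - k)%:~R * t)) = 0.
  move=> jm; have jk : deg m j - k != 0.
    by rewrite subr_eq0; apply/eqP => e; apply: hk; exists j => //; rewrite -e.
  rewrite /cintegral Rintegral_expi//.
  rewrite (_ : Rintegral _ _ _ = 0)//.
  rewrite -[RHS](Rintegral_expi (- 'i * G (deg m j) x) jk).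
  by apply: eq_Rintegral => t _; rewrite -mulrA; case: (G _ x * _) => a b /=; ring.
have S N : (N <= m.+1)%N -> cintegral leb1 (circle : set mR) (fun t => \sum_(j < N)
     G (deg m j) x * expi ((deg m j - k)%:~R * t)) = 0 /\
   (leb1.-integrable (circle : set mR) (EFin \o (fun t : R => complex.Re (\sum_(j < N)
     G (deg m j) x * expi ((deg m j - k)%:~R * t)))) /\
    leb1.-integrable (circle : set mR) (EFin \o (fun t : R => complex.Im (\sum_(j < N)
     G (deg m j) x * expi ((deg m j - k)%:~R * t))))).
  elim: N => [|N IH] Nm.
    under eq_fun do rewrite big_ord0.
    rewrite (_ : (fun t : R => complex.Re _) = fun=> 0); last by apply/funext => t; rewrite big_ord0.
    rewrite (_ : (fun t : R => complex.Im _) = fun=> 0); last by apply/funext => t; rewrite big_ord0.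
    split; last by split; exact: integrable0.
    by rewrite /cintegral Rintegral_cst// mul0r.
  have [|z [i1 i2]] := IH; first exact: ltnW.
  have [j1 j2] := icE (G (deg m N) x) (deg m N - k).
  have ER : (fun t : R => complex.Re (\sum_(j < N.+1) G (deg m j) x * expi ((deg m j - k)%:~R * t))) =
    fun t => complex.Re (\sum_(j < N) G (deg m j) x * expi ((deg m j - k)%:~R * t)) +
      complex.Re (G (deg m N) x * expi ((deg m N - k)%:~R * t)).
    by apply/funext => t; rewrite big_ord_recr ReD.
  have EI : (fun t : R => complex.Im (\sum_(j < N.+1) G (deg m j) x * expi ((deg m j - k)%:~R * t))) =
    fun t => complex.Im (\sum_(j < N) G (deg m j) x * expi ((deg m j - k)%:~R * t)) +
      complex.Im (G (deg m N) x * expi ((deg m N - k)%:~R * t)).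
    by apply/funext => t; rewrite big_ord_recr ImD.
  split; last first.
    rewrite ER EI; split; [have := integrableD mc i1 j1|have := integrableD mc i2 j2];
    by congr (integrable _ _ _).
  have := Z N Nm; move: z; rewrite /cintegral ER EI !RintegralD//.
  by move=> [-> ->] [-> ->]; rewrite addr0.
rewrite /angular_harmonic (_ : (fun t => _) = fun t => \sum_(j < m.+1)
     G (deg m j) x * expi ((deg m j - k)%:~R * t)); last first.
  by apply/funext => t; rewrite /tens mulr_suml; apply: eq_bigr => j _; exact: E.
by have [-> _] := S m.+1 (leqnn _); rewrite mulr0.
Qed.

End TensorDecomposition.

(** * Trace and Poincare inequalities along chords *)

Section BoundaryInequalities.
Context {R : realType}.
Local Notation mR := (measurableTypeR R).
Local Notation T2 := (mR * mR)%type.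
Local Notation T3 := (mR * mR * mR)%type.
Implicit Types (p pz pzb : R * R -> R[i]).

Let mM := @measurable_M R.
Let mSM := @measurable_SM R.
Let mI := @measurable_influx R.
Let mC := @measurable_circle R.

Let pi0 : (0 : R) < pi := pi_gt0 R.

(** Adding the bound [C] makes the integrand nonnegative, which reduces the claim to
    [ge0_integral_periodic]. *)
Lemma Rintegral_periodic (tau : R -> R) (c C : R) : continuous tau ->
  (forall x, tau (x + pi *+ 2) = tau x) -> (forall x, `|tau x| <= C) -> 0 <= c <= pi *+ 2 ->
  Rintegral leb1 (circle : set mR) (fun x => tau (x + c)) = Rintegral leb1 (circle : set mR) tau.
Proof.
move=> ct pt bt hc.
have ctc : continuous (fun x => tau (x + c)).
  move=> x; apply: (@continuous_comp _ _ _ (fun x => x + c) tau); last exact: ct.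
  by apply: cvgD; [exact: cvg_id|exact: cvg_cst].
have int (g : R -> R) : continuous g -> (leb1 : {measure set mR -> \bar R}).-integrable circle (EFin \o g).
  move=> cg; rewrite circleE; apply: continuous_compact_integrable; first exact: segment_compact.
  exact: continuous_subspaceT.
have E (g : R -> R) : continuous g -> Rintegral leb1 (circle : set mR) g =
    Rintegral leb1 (circle : set mR) (fun x => g x + C) - C * fine (leb1 (circle : set mR)).
  move=> cg; have cC : continuous (fun _ : R => C) by move=> x; exact: cvg_cst.
  by rewrite (RintegralD mC (int _ cg) (int _ cC)) Rintegral_cst// addrK.
rewrite (E _ ctc) (E _ ct); congr (_ - _); rewrite /Rintegral; congr fine.
have := @ge0_integral_periodic R c (fun x => (tau x + C)%:E) hc.
apply.
- apply/measurable_EFinP; apply: continuous_measurable_fun => x.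
  by apply: cvgD; [exact: ct|exact: cvg_cst].
- by move=> x; rewrite lee_fin; have := bt x; rewrite ler_norml => /andP[]; lra.
- by move=> x; rewrite pt.
Qed.

(** As alpha runs over its interval, the exit angle b + pi + 2 alpha covers the circle once at speed
    2, hence the factor 1/2. *)
Lemma Rintegral_alpha (tau : R -> R) (b C : R) : continuous tau ->
  (forall x, tau (x + pi *+ 2) = tau x) -> (forall x, `|tau x| <= C) -> 0 <= b <= pi *+ 2 ->
  Rintegral leb1 ([set a | - (pi / 2) < a < pi / 2] : set mR) (fun a => tau (b + pi + a + a)) =
  2^-1 * Rintegral leb1 (circle : set mR) tau.
Proof.
move=> ct pt bt hb; rewrite -(Rintegral_periodic ct pt bt hb).
pose F (a : R) := a + a + pi; pose G x := tau (x + b).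
have cG : continuous G.
  move=> x; apply: (@continuous_comp _ _ _ (fun x => x + b) tau); last exact: ct.
  by apply: cvgD; [exact: cvg_id|exact: cvg_cst].
have cF : continuous F.
  by move=> x; apply: cvgD; [apply: cvgD; exact: cvg_id|exact: cvg_cst].
have dF (x : R) : is_derive x 1 F 2.
  have -> : F = (id + id + cst pi : R -> R) by [].
  by apply: is_derive_eq; rewrite addr0.
have F' : F^`()%classic = cst 2.
  by apply/funext => x; rewrite derive1E; have [_ ->] := dF x.
have cGF : continuous (fun a => tau (b + pi + a + a)).
  move=> x; apply: (@continuous_comp _ _ _ (fun a => b + pi + a + a) tau); last exact: ct.
  by apply: cvgD; [apply: cvgD; [exact: cvg_cst|exact: cvg_id]|exact: cvg_id].
have int : (leb1 : {measure set mR -> \bar R}).-integrable `[(- (pi / 2)), (pi / 2)]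
    (EFin \o (fun a => tau (b + pi + a + a))).
  apply: continuous_compact_integrable; first exact: segment_compact.
  exact: continuous_subspaceT.
have le0 : - (pi / 2) <= pi / 2 :> R by lra.
have := @integration_by_substitution_increasing R F G (- (pi / 2)) (pi / 2) le0.
have -> : F (- (pi / 2)) = 0 by rewrite /F; lra.
have -> : F (pi / 2) = pi *+ 2 by rewrite /F; lra.
rewrite -circleE F' => H.
have h1 : {in `[- (pi / 2), pi / 2]%R &, {homo F : x y / x < y}}.
  by move=> x y _ _ xy; rewrite /F; lra.
have h2 : {in `]- (pi / 2), pi / 2[%R, continuous (cst (2 : R) : R -> R)}.
  by move=> x _; exact: cvg_cst.
have h3 : derivable_oo_LRcontinuous F (- (pi / 2)) (pi / 2).
  split; first by move=> x _; case: (dF x).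
    by apply: cvg_at_right_filter; exact: cF.
  by apply: cvg_at_left_filter; exact: cF.
have h4 : cvg ((cst (2 : R) : R -> R) x @[x --> (- (pi / 2))^'+]) by exact: is_cvg_cst.
have h5 : cvg ((cst (2 : R) : R -> R) x @[x --> (pi / 2)^'-]) by exact: is_cvg_cst.
have {}H := H h1 h2 h4 h5 h3 (continuous_subspaceT cG).
rewrite [X in _ = _ * X]/Rintegral [X in fine X]H.
rewrite (_ : fine _ = Rintegral leb1 (`[(- (pi / 2)), (pi / 2)]%classic : set mR)
    (fun a => 2 * tau (b + pi + a + a))); last first.
  apply: eq_Rintegral => a _; rewrite fctE /= mulrC /G /F; congr (_ * tau _); ring.
rewrite RintegralZl// mulrA mulVf// mul1r alphaE.
rewrite Rintegral_itv_obnd_cbnd; last first.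
  by apply: (integrableS _ _ _ int) => //; exact: subset_itvW.
rewrite Rintegral_itv_bndo_bndc//.
by apply: (integrableS _ _ _ int) => //; apply: subset_itvl; rewrite bnd_simp.
Qed.

Definition bval p (b : R) : R[i] := p (cos b, sin b).

Lemma bval_ccont p : ccont p -> ccont (bval p).
Proof.
move=> [c1 c2].
have ccs : continuous (fun b : R => (cos b, sin b) : R * R).
  by apply: continuous_pairing; [exact: continuous_cos|exact: continuous_sin].
by split=> b; [apply: (@continuous_comp _ _ _ (fun b : R => (cos b, sin b) : R * R) (fun x => complex.Re (p x)))
  |apply: (@continuous_comp _ _ _ (fun b : R => (cos b, sin b) : R * R) (fun x => complex.Im (p x)))];
  first [exact: ccs|exact: c1|exact: c2].
Qed.

Lemma bval_periodic p b : bval p (b + pi *+ 2) = bval p b.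
Proof. by rewrite /bval cosD2pi sinD2pi. Qed.

Lemma bval_bounded (f : R * R -> R) : continuous f ->
  exists C : R, forall b, `|f (cos b, sin b)| <= C.
Proof.
move=> cf; have [C _ HC] := continuous_bounded2 cf; exists C => b.
by apply: HC; rewrite /= cos2Dsin2.
Qed.

Lemma bval_L2 p : ccont p -> L2 leb1 (circle : set mR) (bval p).
Proof.
move=> cp; have [c1 c2] := bval_ccont cp.
have [C1 H1] := bval_bounded cp.1; have [C2 H2] := bval_bounded cp.2.
apply: (L2_bounded mC (C := C1 * C1 + C2 * C2)).
- by rewrite leb1_circle ltry.
- by split; apply: measurable_funTS; exact: continuous_measurable_fun.
- move=> b _; rewrite /dotc; apply: lerD.
    by rewrite -expr2 -real_normK ?num_real// expr2 ler_pM//; exact: H1.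
  by rewrite -expr2 -real_normK ?num_real// expr2 ler_pM//; exact: H2.
Qed.

Lemma nrm_Xfield (a b : R * R -> R[i]) l : L2M a -> L2M b ->
  nrm leb3 SM (Xfield a b l) ^+ 2 = pi *+ 2 * (nrm leb2 M a ^+ 2 + nrm leb2 M b ^+ 2).
Proof.
move=> La Lb; rewrite (nrm_pythagoras mSM (mode_L2 _ La) (mode_L2 _ Lb)).
  by rewrite !nrm_mode// !exprMn sqr_sqrtr ?mulrDr// mulrn_wge0// ltW.
by rewrite rip_mode// (_ : (l + 1 == l - 1) = false) ?mul0r//; apply/eqP; lia.
Qed.

Lemma nrm_le_Xfield (a b : R * R -> R[i]) l : L2M a -> L2M b ->
  nrm leb2 M a <= nrm leb3 SM (Xfield a b l) /\ nrm leb2 M b <= nrm leb3 SM (Xfield a b l).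
Proof.
move=> La Lb; have h := nrm_Xfield l La Lb; have t := @two_pi_ge1 R.
have a0 := sqr_ge0 (nrm leb2 M a); have b0 := sqr_ge0 (nrm leb2 M b).
split; rewrite -(@ler_pXn2r _ 2%N)// ?nnegrE ?nrm_ge0// h.
  by rewrite -[leLHS]mul1r ler_pM// lerDl.
by rewrite -[leLHS]mul1r ler_pM// lerDr.
Qed.

Lemma chord_derive p pz pzb q (t : R) : cdiff p pz pzb ->
  is_derive t 1 (fun s : R => complex.Re (p (chord q s).1))
    (complex.Re (Xfield pz pzb 0 (chord q t))) /\
  is_derive t 1 (fun s : R => complex.Im (p (chord q s).1))
    (complex.Im (Xfield pz pzb 0 (chord q t))).
Proof.
move=> dp; pose th := q.1 + pi + q.2.
pose w : R * R := (cos th, sin th); pose x0 : R * R := (cos q.1, sin q.1).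
have chE s : (chord q s).1 = s *: w + x0.
  by apply: injective_projections => /=; rewrite addrC.
have XE : Xfield pz pzb 0 (chord q t) = zc w * pz (t *: w + x0) + conjc (zc w) * pzb (t *: w + x0).
  rewrite /Xfield /mode chE /= -/th add0r sub0r mul1r mulN1r expiN.
  by rewrite -[zc w]/(expi th) -[cos th -i* sin th]/(conjc (expi th)) mulrC [X in _ + X]mulrC.
have [d1 d2] := dp (t *: w + x0) w; rewrite XE.
split; [have := is_derive_along d1|have := is_derive_along d2];
  by congr (is_derive _ _ _ _); apply/funext => s; rewrite chE.
Qed.

Definition bval1 p (q : R * R) : R[i] := bval p q.1.

Lemma bval1_L2 p : ccont p -> L2 leb2 (influx : set T2) (bval1 p).
Proof.
move=> cp; have [c1 c2] := bval_ccont cp.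
have [C1 H1] := bval_bounded cp.1; have [C2 H2] := bval_bounded cp.2.
apply: (L2_bounded mI (C := C1 * C1 + C2 * C2)).
- exact: leb2_influx_lty.
- split; apply: measurable_funTS; apply: continuous_measurable2 => q;
    [apply: (@continuous_comp _ _ _ fst (fun b => complex.Re (bval p b)))
    |apply: (@continuous_comp _ _ _ fst (fun b => complex.Im (bval p b)))];
    first [exact: cvg_fst|exact: c1|exact: c2].
- move=> q _; rewrite /dotc; apply: lerD.
    by rewrite -expr2 -real_normK ?num_real// expr2 ler_pM//; exact: H1.
  by rewrite -expr2 -real_normK ?num_real// expr2 ler_pM//; exact: H2.
Qed.

Lemma leb1_alpha : leb1 ([set a : R | - (pi / 2) < a < pi / 2] : set mR) = pi%:E.
Proof.
rewrite alphaE leb1_itv (_ : - (pi / 2) < pi / 2 = true); last by have := @pi_gt0 R; move=> h; apply/idP; lra.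
by congr EFin; lra.
Qed.

Lemma rip_bval1 p : ccont p -> rip leb2 (influx : set T2) (bval1 p) (bval1 p) =
  pi * rip leb1 (circle : set mR) (bval p) (bval p).
Proof.
move=> cp; have Lp := bval1_L2 cp; have Lb := bval_L2 cp.
have mA : measurable ([set a : R | - (pi / 2) < a < pi / 2] : set mR).
  by rewrite alphaE; exact: measurable_itv.
rewrite {1}/rip; transitivity (Rintegral sleb1 circle (fun b => Rintegral sleb1
    [set a | - (pi / 2) < a < pi / 2] (fun a => dotc (bval1 p (b, a)) (bval1 p (b, a))))).
  exact: (@Rintegral_fubiniX _ _ _ _ R sleb1 sleb1 circle [set a | - (pi / 2) < a < pi / 2]
    (fun q => dotc (bval1 p q) (bval1 p q)) mC mA (L2_dot mI Lp Lp)).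
rewrite -RintegralZl//; last exact: (L2_dot mC Lb Lb).
apply: eq_Rintegral => b _.
transitivity (Rintegral leb1 ([set a : R | - (pi / 2) < a < pi / 2] : set mR)
  (fun=> dotc (bval p b) (bval p b))); first exact: eq_Rintegral.
by rewrite Rintegral_cst// leb1_alpha mulrC.
Qed.

(* The X-ray transform of [X p] is the difference of the two end values of [p];
   averaging over the exit point recovers the trace when its mean is zero. *)
Lemma trace_bound p pz pzb : csm p -> csm pz -> csm pzb -> cdiff p pz pzb ->
  cintegral leb1 (circle : set mR) (bval p) = 0 ->
  nrm leb2 (influx : set T2) (bval1 p) <= 2 * nrm leb3 SM (Xfield pz pzb 0).
Proof.
move=> sp sz szb dp mean0.
have cp := csm_ccont sp; have [c1 c2] := bval_ccont cp.
have LT := bval1_L2 cp; have cX := continuousSM_Xfield 0 sz szb.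
have LD := xray_L2 cX.
pose D (q : R * R) := bval p (q.1 + pi + q.2 + q.2) - bval p q.1.
have DE q : influx q -> xray_formula (Xfield pz pzb 0) q = D q.
  move=> iq; rewrite (xray_Xfield 0 sz szb dp iq) mul0r expi0 mul1r.
  by rewrite chord_exit chord_enter.
have mA : measurable ([set a : R | - (pi / 2) < a < pi / 2] : set mR).
  by rewrite alphaE; exact: measurable_itv.
have [C1 H1] := bval_bounded cp.1; have [C2 H2] := bval_bounded cp.2.
(* In the pairing of exit value minus entry value with the entry value, the exit term averages to
   zero over alpha, which leaves minus the squared norm; Cauchy-Schwarz then finishes. *)
have ripE : rip leb2 (influx : set T2) (xray_formula (Xfield pz pzb 0)) (bval1 p) =
    - rip leb2 (influx : set T2) (bval1 p) (bval1 p).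
  rewrite rip_bval1// {1}/rip.
  transitivity (Rintegral sleb1 circle (fun b => Rintegral sleb1
    [set a | - (pi / 2) < a < pi / 2] (fun a => dotc (xray_formula (Xfield pz pzb 0) (b, a)) (bval1 p (b, a))))).
    exact: (@Rintegral_fubiniX _ _ _ _ R sleb1 sleb1 circle [set a | - (pi / 2) < a < pi / 2]
      (fun q => dotc (xray_formula (Xfield pz pzb 0) q) (bval1 p q)) mC mA (L2_dot mI LD LT)).
  rewrite -[RHS]mulNr -RintegralZl//; last exact: (L2_dot mC (bval_L2 cp) (bval_L2 cp)).
  apply: eq_Rintegral => b /set_mem bC.
  pose t1 x := complex.Re (bval p x); pose t2 x := complex.Im (bval p x).
  transitivity (Rintegral leb1 ([set a | - (pi / 2) < a < pi / 2] : set mR) (fun a =>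
      (t1 b * t1 (b + pi + a + a) + t2 b * t2 (b + pi + a + a)) - dotc (bval p b) (bval p b))).
    apply: eq_Rintegral => a /set_mem aA; rewrite (DE (b, a) (conj bC aA)) /D /bval1 /dotc /t1 /t2/=.
    by rewrite ReD ReN ImD ImN; ring.
  have int (g : R -> R) : continuous g -> (leb1 : {measure set mR -> \bar R}).-integrable
      [set a | - (pi / 2) < a < pi / 2] (EFin \o (fun a => g (b + pi + a + a))).
    move=> cg; rewrite alphaE.
    have i : (leb1 : {measure set mR -> \bar R}).-integrable `[(- (pi / 2)), (pi / 2)]
        (EFin \o (fun a => g (b + pi + a + a))).
      apply: continuous_compact_integrable; first exact: segment_compact.
      apply: continuous_subspaceT => x.
      apply: (@continuous_comp _ _ _ (fun a => b + pi + a + a) g); last exact: cg.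
      by apply: cvgD; [apply: cvgD; [exact: cvg_cst|exact: cvg_id]|exact: cvg_id].
    by apply: (integrableS _ _ _ i) => //; exact: subset_itvW.
  have i1 := int t1 c1; have i2 := int t2 c2.
  have c0 : continuous (fun _ : R => dotc (bval p b) (bval p b)) by move=> x; exact: cvg_cst.
  have i0 := int _ c0.
  have j1 : (leb1 : {measure set mR -> \bar R}).-integrable [set a | - (pi / 2) < a < pi / 2]
      (EFin \o (fun a => t1 b * t1 (b + pi + a + a))) := integrableZl mA (t1 b) i1.
  have j2 : (leb1 : {measure set mR -> \bar R}).-integrable [set a | - (pi / 2) < a < pi / 2]
      (EFin \o (fun a => t2 b * t2 (b + pi + a + a))) := integrableZl mA (t2 b) i2.
  have j12 : (leb1 : {measure set mR -> \bar R}).-integrable [set a | - (pi / 2) < a < pi / 2]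
      (EFin \o (fun a => t1 b * t1 (b + pi + a + a) + t2 b * t2 (b + pi + a + a))) :=
    integrableD mA j1 j2.
  rewrite (RintegralB mA j12 i0) (RintegralD mA j1 j2) (RintegralZl (t1 b) mA i1) (RintegralZl (t2 b) mA i2).
  have p1 x : t1 (x + pi *+ 2) = t1 x by rewrite /t1 bval_periodic.
  have p2 x : t2 (x + pi *+ 2) = t2 x by rewrite /t2 bval_periodic.
  rewrite (Rintegral_alpha c1 p1 H1 bC) (Rintegral_alpha c2 p2 H2 bC).
  have -> : Rintegral leb1 (circle : set mR) t1 = 0 by move: mean0 => /(congr1 (@complex.Re R)).
  have -> : Rintegral leb1 (circle : set mR) t2 = 0 by move: mean0 => /(congr1 (@complex.Im R)).
  by rewrite !mulr0 addr0 sub0r Rintegral_cst// leb1_alpha mulNr mulrC.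
have := CauchySchwarz mI LD LT; rewrite ripE normrN -nrm_sqr ger0_norm ?sqr_ge0// => h.
apply: le_trans (xray_nrm cX).
have [n0|n0] := eqVneq (nrm leb2 (influx : set T2) (bval1 p)) 0; first by rewrite n0 nrm_ge0.
by move: h; rewrite expr2 ler_pM2r// lt0r n0 nrm_ge0.
Qed.

Lemma nrm_bval p : ccont p -> nrm leb1 (circle : set mR) (bval p) <=
  nrm leb2 (influx : set T2) (bval1 p).
Proof.
move=> cp; rewrite /nrm rip_bval1// ler_wsqrtr// ler_peMl ?rip_ge0//.
by have := @pi_ge2 R; lra.
Qed.

(** Integrate the derivative of (L - t)|p|^2 along a chord of length L = 2 cos alpha: it vanishes at
    the exit and leaves L|p|^2 at the entry. *)
Lemma chord_poincare p pz pzb (q : R * R) : csm p -> csm pz -> csm pzb -> cdiff p pz pzb ->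
  influx q -> chord_int (fun x => dotc (p x.1) (p x.1)) q <=
    4 * cos q.2 * dotc (bval p q.1) (bval p q.1) +
    16 * chord_int (fun x => dotc (Xfield pz pzb 0 x) (Xfield pz pzb 0 x)) q.
Proof.
move=> sp sz szb dp iq; have [_ _ c0 _] := influxP iq.
pose L := 2 * cos q.2; have L0 : 0 <= L by rewrite mulr_ge0// ltW.
have L2 : L <= 2 by rewrite /L; have := cos_le1 q.2; lra.
pose a t : R := complex.Re (p (chord q t).1); pose b t : R := complex.Im (p (chord q t).1).
pose x t : R := complex.Re (Xfield pz pzb 0 (chord q t)).
pose y t : R := complex.Im (Xfield pz pzb 0 (chord q t)).
have da (t : R) : is_derive t 1 a (x t) := (chord_derive q t dp).1.
have db (t : R) : is_derive t 1 b (y t) := (chord_derive q t dp).2.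
have ca : continuous a := is_derive1_continuous da.
have cb : continuous b := is_derive1_continuous db.
have [_ X1 X2] := continuousSM_Xfield 0 sz szb.
have cx : continuous x.
  by move=> t; apply: (@continuous_comp _ _ _ (chord q) (fun z => complex.Re (Xfield pz pzb 0 z))); [exact: continuous_chord|exact: X1].
have cy : continuous y.
  by move=> t; apply: (@continuous_comp _ _ _ (chord q) (fun z => complex.Im (Xfield pz pzb 0 z))); [exact: continuous_chord|exact: X2].
pose H t := (L - t) * (a t * a t + b t * b t).
pose H' t := - (a t * a t + b t * b t) + (L - t) * (2 * (a t * x t + b t * y t)).
have dH (t : R) : is_derive t 1 H (H' t).
  have -> : H = ((cst L - id) * (a * a + b * b))%R by [].
  apply: is_derive_eq; rewrite /GRing.scale/= /H'.
  rewrite -[(_ * _ + _ * _) t]/(a t * a t + b t * b t) -[(cst L - id) t]/(L - t); ring.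
have cc (f g : R -> R) : continuous f -> continuous g -> continuous (fun t => f t * g t).
  by move=> cf cg t; apply: cvgM; [exact: cf|exact: cg].
have cD (f g : R -> R) : continuous f -> continuous g -> continuous (fun t => f t + g t).
  by move=> cf cg t; apply: cvgD; [exact: cf|exact: cg].
have cst_c (k : R) : continuous (fun _ : R => k) by move=> t; exact: cvg_cst.
have cN (f : R -> R) : continuous f -> continuous (fun t => - f t).
  by move=> cf t; apply: cvgN; exact: cf.
have cpp := cD _ _ (cc _ _ ca ca) (cc _ _ cb cb).
have cxx := cD _ _ (cc _ _ cx cx) (cc _ _ cy cy).
have cpx := cD _ _ (cc _ _ ca cx) (cc _ _ cb cy).
have cLt : continuous (fun t : R => L - t).
  by apply: cD => //; apply: cN => t; exact: cvg_id.
have cH' : continuous H' := cD _ _ (cN _ cpp) (cc _ _ cLt (cc _ _ (cst_c 2) cpx)).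
have int (g : R -> R) : continuous g -> (leb1 : {measure set mR -> \bar R}).-integrable (cseg q) (EFin \o g).
  move=> cg; rewrite csegE; apply: continuous_compact_integrable; first exact: segment_compact.
  exact: continuous_subspaceT.
have mq := measurable_cseg q.
(* With L - t <= 2, the cross term 2(L - t) p.Xp is at most |p|^2/2 + 8|Xp|^2; half of |p|^2
   survives with the right sign. *)
pose K t := 8 * (x t * x t + y t * y t) + (- 2^-1) * (a t * a t + b t * b t).
have cK : continuous K := cD _ _ (cc _ _ (cst_c 8) cxx) (cc _ _ (cst_c (- 2^-1)) cpp).
have le : Rintegral leb1 (cseg q : set mR) H' <= Rintegral leb1 (cseg q : set mR) K.
  apply: (le_Rintegral mq (int _ cH') (int _ cK)) => t; rewrite /cseg/= -/L => /andP[t0 tL].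
  rewrite /H' /K; move: (a t) (b t) (x t) (y t) => a' b' x' y'.
  have l0 : 0 <= L - t by lra.
  have l2 : L - t <= 2 by lra.
  move: (L - t) l0 l2 => s s0 s2.
  have h1 := sqr_ge0 (a' - 2 * s * x'); have h2 := sqr_ge0 (b' - 2 * s * y').
  have ss : s ^+ 2 <= 4.
    by rewrite (_ : 4 = 2 ^+ 2); [rewrite lerXn2r ?nnegrE|rewrite -natrX].
  have h3 : s ^+ 2 * (x' * x' + y' * y') <= 4 * (x' * x' + y' * y').
    by rewrite ler_wpM2r// addr_ge0// -expr2 sqr_ge0.
  by rewrite !expr2 in h1 h2 h3 *; nra.
rewrite {1}csegE (Rintegral_FTC L0 dH cH') in le.
have HL : H L = 0 by rewrite /H subrr mul0r.
have H0 : H 0 = L * dotc (bval p q.1) (bval p q.1).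
  by rewrite /H subr0 /a /b chord_enter.
rewrite HL H0 sub0r in le.
have KE : Rintegral leb1 (cseg q : set mR) K =
    8 * chord_int (fun x => dotc (Xfield pz pzb 0 x) (Xfield pz pzb 0 x)) q +
    (- 2^-1) * chord_int (fun x => dotc (p x.1) (p x.1)) q.
  rewrite (RintegralD mq (int _ (cc _ _ (cst_c 8) cxx)) (int _ (cc _ _ (cst_c (- 2^-1)) cpp))).
  by rewrite (RintegralZl 8 mq (int _ cxx)) (RintegralZl (- 2^-1) mq (int _ cpp)).
rewrite KE /L in le; lra.
Qed.

(** The chordwise inequality is integrated with the Santalo weight and the entry term is controlled
    by [trace_bound]. This gives 4 * 4 + 16 = 32 for the square, rounded up to 36. *)
Lemma poincare p pz pzb : csm p -> csm pz -> csm pzb -> cdiff p pz pzb ->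
  cintegral leb1 (circle : set mR) (bval p) = 0 ->
  nrm leb2 M p <= 6 * nrm leb3 SM (Xfield pz pzb 0).
Proof.
move=> sp sz szb dp mean0; have cp := csm_ccont sp.
have cX := continuousSM_Xfield 0 sz szb; have cm := continuousSM_mode 0 cp.
apply: le_trans (nrm_le_mode 0 (csm_L2M sp)) _.
rewrite -(@ler_pXn2r _ 2%N)// ?nnegrE ?mulr_ge0 ?nrm_ge0// exprMn.
have tb := trace_bound sp sz szb dp mean0.
have tb2 : nrm leb2 (influx : set T2) (bval1 p) ^+ 2 <= 4 * nrm leb3 SM (Xfield pz pzb 0) ^+ 2.
  have -> : 4 * nrm leb3 SM (Xfield pz pzb 0) ^+ 2 = (2 * nrm leb3 SM (Xfield pz pzb 0)) ^+ 2.
    by rewrite exprMn -natrX.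
  by rewrite lerXn2r// ?nnegrE ?mulr_ge0 ?nrm_ge0.
have rX := rcont_dot cX cX; have rm := rcont_dot cm cm.
have LT := bval1_L2 cp.
have iX := chord_int_integrable rX; have im := chord_int_integrable rm.
have iT := L2_dot mI LT LT.
suff : nrm leb3 SM (mode p 0) ^+ 2 <= 4 * nrm leb2 (influx : set T2) (bval1 p) ^+ 2 +
    16 * nrm leb3 SM (Xfield pz pzb 0) ^+ 2.
  have := sqr_ge0 (nrm leb3 SM (Xfield pz pzb 0)).
  rewrite (_ : (6 : R) ^+ 2 = 36); last by rewrite -natrX.
  by move: tb2; move: (_ ^+ 2) => u; move: (_ ^+ 2) => v; move: (_ ^+ 2) => w; lra.
rewrite !nrm_sqr {1}/rip (Rsantalo rm) {2}/rip (Rsantalo rX) {1}/rip.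
rewrite -(RintegralZl 4 mI iT) -(RintegralZl 16 mI iX).
have j1 := integrableZl mI 4 iT; have j2 := integrableZl mI 16 iX.
rewrite -(RintegralD mI j1 j2); apply: (le_Rintegral mI im (integrableD mI j1 j2)).
move=> q iq /=; have [_ _ c0 _] := influxP iq; have c1 := cos_le1 q.2.
have -> : chord_int (fun x => dotc (mode p 0 x) (mode p 0 x)) q =
    chord_int (fun x => dotc (p x.1) (p x.1)) q.
  by congr chord_int; apply/funext => x; rewrite /mode dotcM dot_expi mulr1.
have h := chord_poincare sp sz szb dp iq.
have g := dotc_ge0 (bval p q.1).
have h2 : cos q.2 * chord_int (fun x => dotc (p x.1) (p x.1)) q <= cos q.2 *
  (4 * cos q.2 * dotc (bval p q.1) (bval p q.1) +
    16 * chord_int (fun x => dotc (Xfield pz pzb 0 x) (Xfield pz pzb 0 x)) q) by rewrite ler_pM2l.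
apply: le_trans h2 _; rewrite mulrDr; apply: lerD; last first.
  by rewrite mulrCA.
rewrite /bval1; move: (dotc _ _) g => e e0; move: (cos q.2) c0 c1 => c c0 c1.
by have := mulr_ge0 e0 (ltW c0); have c2 : c * c <= 1 := mulr_ile1 (ltW c0) (ltW c0) c1 c1; nra.
Qed.

End BoundaryInequalities.

(** * Splitting the degrees 1 and -1 into solenoidal and potential parts *)

Section OddDecomposition.
Context {R : realType}.
Local Notation mR := (measurableTypeR R).
Local Notation T2 := (mR * mR)%type.
Local Notation T3 := (mR * mR * mR)%type.
Implicit Types (p pz pzb a b : R * R -> R[i]).

Let mM := @measurable_M R.
Let mSM := @measurable_SM R.
Let mC := @measurable_circle R.

Lemma Xfield_L2 a b l : L2M a -> L2M b -> L2 leb3 SM (Xfield a b l).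
Proof. by move=> La Lb; exact: (L2D mSM (mode_L2 _ La) (mode_L2 _ Lb)). Qed.

Lemma XfieldD a b a' b' l : (fun x => Xfield a b l x + Xfield a' b' l x) =
  Xfield (fun x => a x + a' x) (fun x => b x + b' x) l.
Proof. by apply/funext => q; rewrite /Xfield /mode !mulrDl addrACA. Qed.

Lemma XfieldB a b a' b' l : (fun x => Xfield a b l x - Xfield a' b' l x) =
  Xfield (fun x => a x - a' x) (fun x => b x - b' x) l.
Proof. by apply/funext => q; rewrite /Xfield /mode !mulrBl opprD addrACA. Qed.

Lemma XfieldZ c a b l : (fun x => c * Xfield a b l x) =
  Xfield (fun x => c * a x) (fun x => c * b x) l.
Proof. by apply/funext => q; rewrite /Xfield /mode mulrDr !mulrA. Qed.

Lemma Xfield0 l : Xfield (fun=> 0) (fun=> 0) l = (fun=> 0 : R[i]).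
Proof. by apply/funext => q; rewrite /Xfield /mode !mul0r addr0. Qed.

Lemma rip_Xfield a b a' b' l : L2M a -> L2M b -> L2M a' -> L2M b' ->
  rip leb3 SM (Xfield a b l) (Xfield a' b' l) =
  pi *+ 2 * (rip leb2 M a a' + rip leb2 M b b').
Proof.
move=> La Lb La' Lb'; have L k (u : R * R -> R[i]) : L2M u -> L2 leb3 SM (mode u k) by move=> Lu; exact: mode_L2.
rewrite (ripDl mSM (L _ _ La) (L _ _ Lb) (Xfield_L2 _ La' Lb')).
rewrite (ripDr mSM (L _ _ La') (L _ _ Lb') (L _ _ La)) (ripDr mSM (L _ _ La') (L _ _ Lb') (L _ _ Lb)).
rewrite !rip_mode// !eqxx (_ : (l + 1 == l - 1) = false); last by apply/eqP; lia.
rewrite (_ : (l - 1 == l + 1) = false); last by apply/eqP; lia.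
by rewrite !mul0r addr0 add0r !mul1r mulrDr.
Qed.

Lemma nrm_unit (d : measure_display) (T : measurableType d) (mu : {measure set T -> \bar R})
  (D : set T) (c : R[i]) (u : T -> R[i]) : dotc c c = 1 ->
  nrm mu D (fun x => c * u x) = nrm mu D u.
Proof.
move=> c1; rewrite /nrm; congr Num.sqrt; apply: eq_Rintegral => x _.
by rewrite mulrC dotcM c1 mulr1.
Qed.

Lemma dotc_i : dotc ('i : R[i]) 'i = 1 /\ dotc (- 'i : R[i]) (- 'i) = 1.
Proof. by rewrite /dotc /=; split; ring. Qed.

Lemma complexiE_sqr : ('i : R[i]) * 'i = -1.
Proof. by rewrite -expr2 sqr_i. Qed.

Lemma complexi_cancel (c u v : R[i]) :
  - 'i * ('i * c * (u * v)) = u * (c * v) /\ 'i * ('i * c * (u * v)) = - (u * (c * v)).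
Proof.
split; first by transitivity (- ('i * 'i) * (u * (c * v))); [ring|rewrite complexiE_sqr opprK mul1r].
by transitivity ('i * 'i * (u * (c * v))); [ring|rewrite complexiE_sqr mulN1r].
Qed.

Lemma Xperp_Xfield a b : Xperp (fun x => a x + b x) (fun x => 'i * (a x - b x)) =
  Xfield (fun x => - 'i * a x) (fun x => 'i * b x) 0 :> ((R * R) * R -> R[i]).
Proof.
have h : (- 2^-1 : R)%:C = - (2^-1 : R[i]) by rewrite rmorphN fmorphV rmorph_nat.
have h' : (2^-1 : R)%:C = (2^-1 : R[i]) by rewrite fmorphV rmorph_nat.
rewrite XperpE; apply/funext => q; rewrite /Xfield add0r sub0r; congr (mode _ _ _ + mode _ _ _).
  by apply/funext => x; rewrite /Xp_pos h; field.
by apply/funext => x; rewrite /Xp_neg h'; field.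
Qed.

Lemma Xfield_cvg (a_ b_ : nat -> R * R -> R[i]) a b l : (forall n, L2M (a_ n)) ->
  (forall n, L2M (b_ n)) -> L2M a -> L2M b ->
  nrm leb2 M (fun x => a_ n x - a x) @[n --> \oo] --> (0 : R) ->
  nrm leb2 M (fun x => b_ n x - b x) @[n --> \oo] --> (0 : R) ->
  nrm leb3 SM (fun x => Xfield (a_ n) (b_ n) l x - Xfield a b l x) @[n --> \oo] --> (0 : R).
Proof.
move=> La_ Lb_ La Lb ha hb.
apply: (cvg_nrmD mSM (fun n => mode_L2 _ (La_ n)) (fun n => mode_L2 _ (Lb_ n)) (mode_L2 _ La) (mode_L2 _ Lb));
  exact: cvg_nrm_mode.
Qed.

(** Up to a constant, the inner product is the integral of the Jacobian of p and conj(v), and v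
    vanishes on the circle. *)
Lemma rip_perp_bdry0 p pz pzb v vz vzb : csm p -> csm pz -> csm pzb -> cdiff p pz pzb ->
  bdry0 v vz vzb ->
  rip leb3 SM (Xfield (fun x => - 'i * pz x) (fun x => 'i * pzb x) 0) (Xfield vz vzb 0) = 0.
Proof.
move=> sp sz szb dp [sv svz svzb dv v0].
have L1 := csm_L2M (csmZ (- 'i%R) sz); have L2 := csm_L2M (csmZ 'i%R szb).
have L3 := csm_L2M svz; have L4 := csm_L2M svzb.
rewrite (rip_Xfield 0 L1 L2 L3 L4) /rip.
have i1 := L2_dot mM L1 L3; have i2 := L2_dot mM L2 L4.
rewrite -(RintegralD mM i1 i2).
have w0 x : on_circle x -> conjc (v x) = 0 by move=> /v0 ->; rewrite conjc0.
have := int_jacobian0 (- 'i%R) sp (csm_conj sv) dp (cdiff_conj dv) w0.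
move=> E; rewrite (_ : Rintegral _ _ _ = 0) ?mulr0// -[RHS]E.
apply: eq_Rintegral => x _; move: (pz x) (pzb x) (vz x) (vzb x) => [a1 a2] [b1 b2] [c1 c2] [d1 d2].
by rewrite /dotc/=; ring.
Qed.

Lemma cintegral_circleB (g h : R -> R[i]) : ccont g -> ccont h ->
  cintegral leb1 (circle : set mR) (fun x => g x - h x) =
  cintegral leb1 (circle : set mR) g - cintegral leb1 (circle : set mR) h.
Proof.
move=> [c1 c2] [d1 d2].
have int (f : R -> R) : continuous f -> (leb1 : {measure set mR -> \bar R}).-integrable circle (EFin \o f).
  move=> cf; rewrite circleE; apply: continuous_compact_integrable; first exact: segment_compact.
  exact: continuous_subspaceT.
rewrite /cintegral; apply/eqP; rewrite eq_complex/=; apply/andP; split; apply/eqP.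
  rewrite -(RintegralB mC (int _ c1) (int _ d1)).
  by apply: eq_Rintegral => x _; rewrite ReD ReN.
rewrite -(RintegralB mC (int _ c2) (int _ d2)).
by apply: eq_Rintegral => x _; rewrite ImD ImN.
Qed.

Lemma cintegral_circle_cst (c : R[i]) :
  cintegral leb1 (circle : set mR) (fun=> c) = (pi *+ 2)%:C * c.
Proof.
rewrite /cintegral !Rintegral_cst// leb1_circle/=.
by case: c => x y /=; apply/eqP; rewrite eq_complex/=; apply/andP; split; apply/eqP; ring.
Qed.

Lemma cintegral_circle_lim (g_ : nat -> R -> R[i]) g :
  (forall n, L2 leb1 (circle : set mR) (g_ n)) -> L2 leb1 (circle : set mR) g ->
  nrm leb1 (circle : set mR) (fun x => g_ n x - g x) @[n --> \oo] --> (0 : R) ->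
  (forall n, cintegral leb1 (circle : set mR) (g_ n) = 0) ->
  cintegral leb1 (circle : set mR) g = 0.
Proof.
move=> Lg_ Lg hg g0.
have L1 (c : R[i]) : L2 leb1 (circle : set mR) (fun=> c).
  apply: (L2_bounded mC (C := dotc c c)) => //; first by rewrite leb1_circle ltry.
have E (h : R -> R[i]) : cintegral leb1 (circle : set mR) h =
    rip leb1 (circle : set mR) h (fun=> 1) +i* rip leb1 (circle : set mR) h (fun=> 'i).
  by rewrite /cintegral /rip; congr (_ +i* _); apply: eq_Rintegral => x _; rewrite /dotc/=; ring.
have z c : (forall n, rip leb1 (circle : set mR) (g_ n) (fun=> c) = 0) ->
    rip leb1 (circle : set mR) g (fun=> c) = 0 by exact: (rip_lim0 mC Lg_ Lg (L1 c) hg).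
have gz n := g0 n; rewrite E !z// => n; have := gz n; rewrite E => /eqP;
  by rewrite eq_complex => /andP[/eqP h1 /eqP h2].
Qed.

(** Only the gradients are assumed Cauchy. After normalization, [poincare] and [trace_bound] make
    the potentials and their boundary values Cauchy too, so that limit, weak gradient and trace
    share one approximating sequence. *)
Lemma potential_limit (p_ pz_ pzb_ : nat -> R * R -> R[i]) :
  (forall n, [/\ csm (p_ n), csm (pz_ n), csm (pzb_ n) & cdiff (p_ n) (pz_ n) (pzb_ n)]) ->
  (forall e : R, 0 < e -> exists N, forall m n, (N <= m)%N -> (N <= n)%N ->
    nrm leb3 SM (fun x => Xfield (pz_ m) (pzb_ m) 0 x - Xfield (pz_ n) (pzb_ n) 0 x) <= e) ->
  exists f a b, [/\ L2M a, L2M b, H1dot f (fun x => a x + b x) (fun x => 'i * (a x - b x)),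
    nrm leb2 M (fun x => pz_ n x - a x) @[n --> \oo] --> (0 : R) &
    nrm leb2 M (fun x => pzb_ n x - b x) @[n --> \oo] --> (0 : R)].
Proof.
move=> hp cau.
(* The mean of the boundary values; subtracting it leaves the gradient unchanged and enforces the
   zero mean in [H1dot]. *)
pose k n : R[i] := ((pi *+ 2)^-1)%:C * cintegral leb1 (circle : set mR) (bval (p_ n)).
pose P n (x : R * R) : R[i] := p_ n x - k n.
have hP n : [/\ csm (P n), csm (pz_ n), csm (pzb_ n) & cdiff (P n) (pz_ n) (pzb_ n)].
  have [h1 h2 h3 h4] := hp n; split=> //; first by apply: csmB => //; exact: csm_cst.
  by apply: cdiff_ext (cdiffD h4 (cdiff_cst (- k n))) _ _ => x; rewrite addr0.
have k0 n : cintegral leb1 (circle : set mR) (bval (P n)) = 0.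
  have [h1 _ _ _] := hp n.
  rewrite (cintegral_circleB (bval_ccont (csm_ccont h1)) (ccont_cst (k n))).
  rewrite cintegral_circle_cst /k mulrA -rmorphM/= mulfV.
    by rewrite rmorph1 mul1r subrr.
  by rewrite mulrn_eq0 /= gt_eqF ?pi_gt0.
have LP n : L2M (P n) by have [h _ _ _] := hP n; exact: csm_L2M.
have Lz n : L2M (pz_ n) by have [_ h _ _] := hP n; exact: csm_L2M.
have Lzb n : L2M (pzb_ n) by have [_ _ h _] := hP n; exact: csm_L2M.
have Lt n : L2 leb1 (circle : set mR) (bval (P n)).
  by have [h _ _ _] := hP n; exact: bval_L2 (csm_ccont h).
have diff m n : [/\ csm (fun x => P m x - P n x), csm (fun x => pz_ m x - pz_ n x),
    csm (fun x => pzb_ m x - pzb_ n x),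
    cdiff (fun x => P m x - P n x) (fun x => pz_ m x - pz_ n x) (fun x => pzb_ m x - pzb_ n x) &
    cintegral leb1 (circle : set mR) (bval (fun x => P m x - P n x)) = 0].
  have [h1 h2 h3 h4] := hP m; have [i1 i2 i3 i4] := hP n; split; try exact: csmB.
    rewrite (_ : (fun x => P m x - P n x) = fun x => P m x + (-1) * P n x).
      by apply: cdiff_ext (cdiffD h4 (cdiffZ (-1) i4)) _ _ => x; rewrite mulN1r.
    by apply/funext => x; rewrite mulN1r.
  have := cintegral_circleB (bval_ccont (csm_ccont h1)) (bval_ccont (csm_ccont i1)).
  by rewrite !k0 subrr.
have C1 (e : R) : 0 < e -> exists N : nat, forall m n : nat, (N <= m)%N -> (N <= n)%N ->
    nrm leb2 M (fun x => pz_ m x - pz_ n x) <= e /\ nrm leb2 M (fun x => pzb_ m x - pzb_ n x) <= e.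
  move=> /cau[N HN]; exists N => m n hm hn; have [_ s1 s2 _ _] := diff m n.
  have := HN m n hm hn; rewrite XfieldB => h.
  have [a b] := nrm_le_Xfield 0 (csm_L2M s1) (csm_L2M s2).
  by split; [exact: le_trans a h|exact: le_trans b h].
have Cz (e : R) : 0 < e -> exists N : nat, forall m n : nat, (N <= m)%N -> (N <= n)%N ->
    nrm leb2 M (fun x => pz_ m x - pz_ n x) <= e.
  by move=> /C1[N HN]; exists N => m n hm hn; have [] := HN m n hm hn.
have Czb (e : R) : 0 < e -> exists N : nat, forall m n : nat, (N <= m)%N -> (N <= n)%N ->
    nrm leb2 M (fun x => pzb_ m x - pzb_ n x) <= e.
  by move=> /C1[N HN]; exists N => m n hm hn; have [] := HN m n hm hn.
have CP (e : R) : 0 < e -> exists N : nat, forall m n : nat, (N <= m)%N -> (N <= n)%N ->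
    nrm leb2 M (fun x => P m x - P n x) <= e.
  move=> e0; have [|N HN] := cau (6^-1 * e); first by rewrite mulr_gt0.
  exists N => m n hm hn; have [s0 s1 s2 d i] := diff m n; have := HN m n hm hn.
  by rewrite XfieldB; have := poincare s0 s1 s2 d i; lra.
have Ct (e : R) : 0 < e -> exists N : nat, forall m n : nat, (N <= m)%N -> (N <= n)%N ->
    nrm leb1 (circle : set mR) (fun x => bval (P m) x - bval (P n) x) <= e.
  move=> e0; have [|N HN] := cau (2^-1 * e); first by rewrite mulr_gt0.
  exists N => m n hm hn; have [s0 s1 s2 d i] := diff m n; have := HN m n hm hn.
  rewrite XfieldB; have := trace_bound s0 s1 s2 d i; have := nrm_bval (csm_ccont s0).
  by rewrite /bval; lra.
have [a [La ha _]] := L2_complete mM Lz Cz; have [b [Lb hb _]] := L2_complete mM Lzb Czb.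
have [f [Lf hf _]] := L2_complete mM LP CP; have [tau [Ltau htau ptau]] := L2_complete mC Lt Ct.
exists f, a, b; split=> //.
have Lgx n : L2M (fun x => pz_ n x + pzb_ n x) := L2D mM (Lz n) (Lzb n).
have Lgy n : L2M (fun x => 'i * (pz_ n x - pzb_ n x)) := L2Z mM _ (L2B mM (Lz n) (Lzb n)).
have Lx : L2M (fun x => a x + b x) := L2D mM La Lb.
have Ly : L2M (fun x => 'i * (a x - b x)) := L2Z mM _ (L2B mM La Lb).
have hx : nrm leb2 M (fun x => (pz_ n x + pzb_ n x) - (a x + b x)) @[n --> \oo] --> (0 : R).
  exact: (cvg_nrmD mM Lz Lzb La Lb ha hb).
have hy : nrm leb2 M (fun x => 'i * (pz_ n x - pzb_ n x) - 'i * (a x - b x)) @[n --> \oo] --> (0 : R).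
  have hbN := cvg_nrmZ mM (-1) Lzb Lb hb.
  have := cvg_nrmZ mM 'i%R (fun n => L2D mM (Lz n) (L2Z mM (-1) (Lzb n))) (L2D mM La (L2Z mM (-1) Lb))
    (cvg_nrmD mM Lz (fun n => L2Z mM (-1) (Lzb n)) La (L2Z mM (-1) Lb) ha hbN).
  by under [in X in X -> _]eq_fun do under eq_fun do rewrite !mulN1r.
split; first split=> //.
- apply: (weak_op_lim LP Lgx Lf Lx _ hf hx) => n; have [h1 h2 h3 h4] := hP n.
  by have [] := csm_weak_grad h1 h2 h3 h4.
- apply: (weak_op_lim LP Lgy Lf Ly _ hf hy) => n; have [h1 h2 h3 h4] := hP n.
  by have [] := csm_weak_grad h1 h2 h3 h4.
exists tau; last exact: (cintegral_circle_lim Lt Ltau htau k0).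
split=> //; first by move=> t; apply: ptau => n; exact: bval_periodic.
exists P; split.
- by move=> n; have [h _ _ _] := hP n; exact: csm_csmooth.
- exact/(L2cvgP mM LP Lf).
- rewrite (_ : (fun n => _) = fun n x => pz_ n x + pzb_ n x); last first.
    by apply/funext => n; apply/funext => x; have [_ _ _ d] := hP n; rewrite (cderiveE d).1.
  exact/(L2cvgP mM Lgx Lx).
- rewrite (_ : (fun n => _) = fun n x => 'i * (pz_ n x - pzb_ n x)); last first.
    by apply/funext => n; apply/funext => x; have [_ _ _ d] := hP n; rewrite (cderiveE d).2.
  exact/(L2cvgP mM Lgy Ly).
- exact/(L2cvgP mC Lt Ltau).
Qed.

(** Two successive projections, onto fields X v with v zero on the circle and then onto fields
    X_perp p. The two families are mutually orthogonal, so the second projection preserves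
    orthogonality to the first family, and the final remainder is killed by [diagonal_recursion]. *)
Lemma solenoidal_limit u1 u2 : L2M u1 -> L2M u2 ->
  exists f a b Y, [/\ L2M a /\ L2M b, H1dot f (fun x => a x + b x) (fun x => 'i * (a x - b x)),
    L2 leb3 SM Y /\ is_xray Y (fun=> 0),
    ae_eq leb3 SM (Xfield u1 u2 0)
      (fun q => Xfield (fun x => - 'i * a x) (fun x => 'i * b x) 0 q + Y q) &
    nrm leb2 M a <= nrm leb3 SM (Xfield u1 u2 0) /\
    nrm leb2 M b <= nrm leb3 SM (Xfield u1 u2 0)].
Proof.
move=> Lu1 Lu2; pose F := Xfield u1 u2 0; have LF : L2 leb3 SM F := Xfield_L2 0 Lu1 Lu2.
pose S1 (g : T3 -> R[i]) := exists v vz vzb, bdry0 v vz vzb /\ g = Xfield vz vzb 0.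
have S1L g : S1 g -> L2 leb3 SM g.
  by move=> [v [vz [vzb [[_ h1 h2 _ _] ->]]]]; apply: Xfield_L2; exact: csm_L2M.
have S10 : S1 (fun=> 0).
  by exists (fun=> 0), (fun=> 0), (fun=> 0); split; [exact: bdry0_0|rewrite Xfield0].
have S1D g h : S1 g -> S1 h -> S1 (fun x => g x + h x).
  move=> [v [vz [vzb [hv ->]]]] [w [wz [wzb [hw ->]]]].
  exists (fun x => v x + w x), (fun x => vz x + wz x), (fun x => vzb x + wzb x).
  by split; [exact: bdry0D|rewrite XfieldD].
have S1Z (t : R) g : S1 g -> S1 (fun x => t%:C * g x).
  move=> [v [vz [vzb [hv ->]]]].
  exists (fun x => t%:C * v x), (fun x => t%:C * vz x), (fun x => t%:C * vzb x).
  by split; [exact: bdry0Z|rewrite XfieldZ].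
have [s1 [Y [Ss1 LY s1Y orth1]]] := L2_projection mSM S10 S1D S1Z S1L LF.
have Ls1 n := S1L _ (Ss1 n).
pose r x := F x - Y x; have Lr : L2 leb3 SM r := L2B mSM LF LY.
have rY : rip leb3 SM r Y = 0.
  by rewrite ripC; apply: (rip_lim0 mSM Ls1 LY Lr s1Y) => n; rewrite ripC; exact: orth1.
have [_ nr] := nrm_proj_le mSM LF LY rY.
pose S2 (g : T3 -> R[i]) := exists p pz pzb, [/\ csm p, csm pz, csm pzb & cdiff p pz pzb] /\
  g = Xfield (fun x => - 'i * pz x) (fun x => 'i * pzb x) 0.
have S2L g : S2 g -> L2 leb3 SM g.
  by move=> [p [pz [pzb [[_ h1 h2 _] ->]]]]; apply: Xfield_L2; apply: csm_L2M; exact: csmZ.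
have S20 : S2 (fun=> 0).
  exists (fun=> 0), (fun=> 0), (fun=> 0); split; first by split; [exact: csm_cst..|exact: cdiff_cst].
  by rewrite !mulr0 Xfield0.
have S2D g h : S2 g -> S2 h -> S2 (fun x => g x + h x).
  move=> [p [pz [pzb [[h1 h2 h3 h4] ->]]]] [q [qz [qzb [[i1 i2 i3 i4] ->]]]].
  exists (fun x => p x + q x), (fun x => pz x + qz x), (fun x => pzb x + qzb x).
  split; first by split; try exact: csmD; exact: cdiffD.
  by rewrite XfieldD; congr Xfield; apply/funext => x; rewrite mulrDr.
have S2Z (t : R) g : S2 g -> S2 (fun x => t%:C * g x).
  move=> [p [pz [pzb [[h1 h2 h3 h4] ->]]]].
  exists (fun x => t%:C * p x), (fun x => t%:C * pz x), (fun x => t%:C * pzb x).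
  split; first by split; try exact: csmZ; exact: cdiffZ.
  by rewrite XfieldZ; congr Xfield; apply/funext => x; rewrite mulrCA.
have [s2 [r1 [Ss2 Lr1 s2r1 orth2]]] := L2_projection mSM S20 S2D S2Z S2L Lr.
have Ls2 n := S2L _ (Ss2 n).
have Lr2 : L2 leb3 SM (fun x => r x - r1 x) := L2B mSM Lr Lr1.
have rr1 : rip leb3 SM (fun x => r x - r1 x) r1 = 0.
  by rewrite ripC; apply: (rip_lim0 mSM Ls2 Lr1 Lr2 s2r1) => n; rewrite ripC; exact: orth2.
have [nr1 _] := nrm_proj_le mSM Lr Lr1 rr1.
have r2S1 g : S1 g -> rip leb3 SM (fun x => r x - r1 x) g = 0.
  move=> Sg; have Lg := S1L _ Sg; rewrite (ripBl mSM Lr Lr1 Lg) (orth1 _ Sg) sub0r.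
  rewrite (rip_lim0 mSM Ls2 Lr1 Lg s2r1) ?oppr0// => n.
  have [p [pz [pzb [[h1 h2 h3 h4] ->]]]] := Ss2 n; have [v [vz [vzb [hv ->]]]] := Sg.
  exact: (rip_perp_bdry0 h1 h2 h3 h4 hv).
have sm (c : R[i]) x y : csm (fun z => c * mono x y z : R[i]) by exact: csmZ (csm_mono x y).
have Lm (c : R[i]) x y := csm_L2M (sm c x y).
(* Every field involved lives in degrees 1 and -1, so other modes see nothing of the remainder. *)
have Xmode w k : L2M w -> k != 1 -> k != -1 -> rip leb3 SM (fun x => r x - r1 x) (mode w k) = 0.
  move=> Lw k1 k2; have Lk := mode_L2 k Lw.
  have X0 g h : L2M g -> L2M h -> rip leb3 SM (Xfield g h 0) (mode w k) = 0.
    move=> Lg Lh; rewrite (ripDl mSM (mode_L2 _ Lg) (mode_L2 _ Lh) Lk) !rip_mode//.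
    by rewrite add0r sub0r eq_sym (negbTE k1) eq_sym (negbTE k2) !mul0r addr0.
  rewrite (ripBl mSM Lr Lr1 Lk) (ripBl mSM LF LY Lk) X0//.
  rewrite (rip_lim0 mSM Ls1 LY Lk s1Y) => [|n].
    rewrite (rip_lim0 mSM Ls2 Lr1 Lk s2r1) ?subr0// => n.
    have [p [pz [pzb [[h1 h2 h3 h4] ->]]]] := Ss2 n.
    by apply: X0; apply: csm_L2M; exact: csmZ.
  have [v [vz [vzb [[_ h1 h2 _ _] ->]]]] := Ss1 n.
  by apply: X0; exact: csm_L2M.
have r20 : ae_eq leb3 SM (fun x => r x - r1 x) (fun=> 0).
  apply: (tensor_total Lr2) => c j l k; rewrite tmono_mode.
  pose P (a b : nat) := rip leb3 SM (fun x => r x - r1 x) (mode (fun x => c * mono a b x) 1).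
  pose N (a b : nat) := rip leb3 SM (fun x => r x - r1 x) (mode (fun x => c * mono a b x) (-1)).
  have XE A B : L2M A -> L2M B -> rip leb3 SM (fun x => r x - r1 x) (Xfield A B 0) =
      rip leb3 SM (fun x => r x - r1 x) (mode A 1) + rip leb3 SM (fun x => r x - r1 x) (mode B (-1)).
    move=> LA LB; rewrite /Xfield add0r sub0r.
    exact: (ripDr mSM (mode_L2 _ LA) (mode_L2 _ LB) Lr2).
  (* Tested with the potential i c z^j zbar^l, whose factor i cancels those of X_perp. The terms
     with coefficient 0 only serve to match the shape expected by [rip_mode_comb]. *)
  have NP (j' l' : nat) : l'%:R * N j' l'.-1 = j'%:R * P j'.-1 l'.
    have : rip leb3 SM (fun x => r x - r1 x)
        (Xfield (fun x => j'%:R%:C * (c * mono j'.-1 l' x) - 0%:C * (c * mono 0 0 x))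
          (fun x => 0%:C * (c * mono 0 0 x) - l'%:R%:C * (c * mono j' l'.-1 x)) 0) = 0.
      apply: orth2; exists (fun x => 'i * c * mono j' l' x),
        (fun x => 'i * c * (j'%:R * mono j'.-1 l' x)), (fun x => 'i * c * (l'%:R * mono j' l'.-1 x)).
      split.
        split; try by do ?apply: csmZ; exact: csm_mono.
        exact: cdiffZ (cdiff_mono j' l').
      congr (Xfield _ _ 0); apply/funext => x; rewrite -!natrC rmorph0 mul0r ?subr0 ?sub0r.
        by rewrite (complexi_cancel _ _ _).1.
      by rewrite (complexi_cancel _ _ _).2.
    rewrite XE; try exact: (L2B mM (L2Z mM _ (Lm _ _ _)) (L2Z mM _ (Lm _ _ _))).
    rewrite !rip_mode_comb// -/(P j'.-1 l') -/(N j' l'.-1) !mul0r subr0 sub0r => /eqP.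
    by rewrite subr_eq0 => /eqP.
  have rec (j' l' : nat) : j'%:R * P j'.-1 l' + l'%:R * N j' l'.-1 =
      j'.+1%:R * P j' l'.+1 + l'.+1%:R * N j'.+1 l'.
    have := r2S1 _ (ex_intro _ _ (ex_intro _ _ (ex_intro _ _ (conj (bdry0_mono c j' l') erefl)))).
    rewrite XE; try exact: (L2B mM (L2Z mM _ (Lm _ _ _)) (L2Z mM _ (Lm _ _ _))).
    rewrite !rip_mode_comb// -/(P j'.-1 l') -/(P j' l'.+1) -/(N j' l'.-1) -/(N j'.+1 l') => h.
    by apply/eqP; rewrite -subr_eq0 -[X in _ == X]h; apply/eqP; ring.
  have [HP HN] := diagonal_recursion NP rec j l.
  have [->|k1] := eqVneq k 1; first exact: HP.
  by have [->|k2] := eqVneq k (-1); [exact: HN|exact: Xmode].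
have /choice[p_ /choice[pz_ /choice[pzb_ hs]]] := Ss2.
have Lz n : L2M (pz_ n) by have [[_ h _ _] _] := hs n; exact: csm_L2M.
have Lzb n : L2M (pzb_ n) by have [[_ _ h _] _] := hs n; exact: csm_L2M.
have [di1 di2] := dotc_i.
(* The factors -i and i have modulus 1, so X_perp p and X p have the same norm and the Cauchy
   property passes to the gradients. *)
have cau (e : R) : 0 < e -> exists N, forall m n, (N <= m)%N -> (N <= n)%N ->
    nrm leb3 SM (fun x => Xfield (pz_ m) (pzb_ m) 0 x - Xfield (pz_ n) (pzb_ n) 0 x) <= e.
  move=> /(cvg_cauchy mSM Ls2 Lr1 s2r1)[N HN]; exists N => m n hm hn.
  apply: le_trans (HN m n hm hn); rewrite (hs m).2 (hs n).2 !XfieldB.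
  have La : L2M (fun x => pz_ m x - pz_ n x) := L2B mM (Lz m) (Lz n).
  have Lb : L2M (fun x => pzb_ m x - pzb_ n x) := L2B mM (Lzb m) (Lzb n).
  have -> : (fun x => - 'i * pz_ m x - - 'i * pz_ n x) = (fun x => - 'i * (pz_ m x - pz_ n x)).
    by apply/funext => x; rewrite mulrBr.
  have -> : (fun x => 'i * pzb_ m x - 'i * pzb_ n x) = (fun x => 'i * (pzb_ m x - pzb_ n x)).
    by apply/funext => x; rewrite mulrBr.
  rewrite -(@ler_pXn2r _ 2%N)// ?nnegrE ?nrm_ge0// (nrm_Xfield 0 La Lb).
  by rewrite (nrm_Xfield 0 (L2Z mM _ La) (L2Z mM _ Lb)) !nrm_unit.
have [f [a [b [La Lb Hf ha hb]]]] := potential_limit (fun n => (hs n).1) cau.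
have La' : L2M (fun x => - 'i * a x) := L2Z mM _ La.
have Lb' : L2M (fun x => 'i * b x) := L2Z mM _ Lb.
have LX : L2 leb3 SM (Xfield (fun x => - 'i * a x) (fun x => 'i * b x) 0) := Xfield_L2 0 La' Lb'.
have sX : nrm leb3 SM (fun x => s2 n x - Xfield (fun x => - 'i * a x) (fun x => 'i * b x) 0 x)
    @[n --> \oo] --> (0 : R).
  rewrite (_ : (fun n => nrm _ _ _) = fun n => nrm leb3 SM (fun x =>
      Xfield (fun x => - 'i * pz_ n x) (fun x => 'i * pzb_ n x) 0 x -
      Xfield (fun x => - 'i * a x) (fun x => 'i * b x) 0 x)); last first.
    by apply/funext => n; rewrite (hs n).2.
  exact: (Xfield_cvg 0 (fun n => L2Z mM _ (Lz n)) (fun n => L2Z mM _ (Lzb n)) La' Lb'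
    (cvg_nrmZ mM (- 'i%R) Lz La ha) (cvg_nrmZ mM 'i%R Lzb Lb hb)).
have r1X := cvg_nrm_unique mSM Ls2 Lr1 LX s2r1 sX.
have nX : nrm leb3 SM (Xfield (fun x => - 'i * a x) (fun x => 'i * b x) 0) = nrm leb3 SM r1.
  exact: (cvg_unique _ (cvg_nrm mSM Ls2 LX sX) (cvg_nrm mSM Ls2 Lr1 s2r1)).
exists f, a, b, Y; split=> //.
- split=> //; have Y0 n : exists v vz vzb, bdry0 v vz vzb /\ s1 n = Xfield vz vzb 0 := Ss1 n.
  apply: (is_xray_null LY _ s1Y) => [n|n q iq].
    by have [v [vz [vzb [[_ h1 h2 _ _] ->]]]] := Y0 n; exact: continuousSM_Xfield.
  by have [v [vz [vzb [hv ->]]]] := Y0 n; exact: xray_bdry0 hv iq.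
- apply: filterS2 r20 r1X => q h1 h2 qSM; rewrite -(h2 qSM).
  by have /eqP := h1 qSM; rewrite subr_eq0 /r => /eqP <-; rewrite subrK.
have [n1 n2] := nrm_le_Xfield 0 La' Lb'; rewrite nX !nrm_unit// in n1 n2.
by split; [exact: le_trans n1 (le_trans nr1 nr)|exact: le_trans n2 (le_trans nr1 nr)].
Qed.

End OddDecomposition.

(** * Assembly of the normal form and of the norm bound *)

Section Reduction.
Context {R : realType}.
Local Notation mR := (measurableTypeR R).
Local Notation T2 := (mR * mR)%type.
Local Notation T3 := (mR * mR * mR)%type.

Let mM := @measurable_M R.
Let mSM := @measurable_SM R.

Lemma ae_eq_nrm (f g : T3 -> R[i]) : L2 leb3 SM f -> L2 leb3 SM g -> ae_eq leb3 SM f g ->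
  nrm leb3 SM f = nrm leb3 SM g.
Proof.
move=> Lf Lg fg; have [mf mg] := (L2_meas Lf, L2_meas Lg).
by rewrite /nrm (ae_eq_rip mSM mf mg mf fg) ripC (ae_eq_rip mSM mf mg mg fg).
Qed.

Lemma ae_eq_sym_SM (f g : T3 -> R[i]) : ae_eq leb3 SM f g -> ae_eq leb3 SM g f.
Proof. by move=> h; apply: filterS h => p e pSM; rewrite e. Qed.

Lemma nrm_tens m (G : int -> R * R -> R[i]) (B : R) : (forall k, L2M (G k)) ->
  (forall k, nrm leb2 M (G k) <= B) ->
  nrm leb3 SM (tens m G) <= m.+1%:R * (Num.sqrt (pi *+ 2) * B).
Proof.
move=> LG GB; rewrite /tens.
suff : forall n, nrm leb3 SM (fun p => \sum_(j < n) mode (G (deg m j)) (deg m j) p) <=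
    n%:R * (Num.sqrt (pi *+ 2) * B) by exact.
elim=> [|n IH].
  rewrite (@eq_nrm _ _ _ _ _ _ (fun=> 0)); last by move=> p _; rewrite big_ord0.
  by rewrite mul0r /nrm (rip0l _ mSM) sqrtr0.
rewrite (_ : (fun p => _) = (fun p => \sum_(j < n) mode (G (deg m j)) (deg m j) p +
  mode (G (deg m n)) (deg m n) p)); last by apply/funext => p; rewrite big_ord_recr.
have [|LS _] := @rip_sum R n (fun=> 0) (fun j => mode (G (deg m j)) (deg m j)) (L2_0 _ _).
  by move=> j; exact: (mode_L2 _ (LG _)).
apply: le_trans (nrmD mSM LS (mode_L2 _ (LG _))) _.
rewrite -natr1 mulrDl mul1r lerD// (nrm_mode _ (LG _)) ler_wpM2l ?sqrtr_ge0//.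
Qed.

(** Passing from m to m + 2 adds one degree at each end; this drives the regrouping of degrees into
    pairs k, -k. *)
Lemma sum_degSS m (F : int -> R[i]) : \sum_(j < m.+3) F (deg m.+2 j) =
  \sum_(j < m.+1) F (deg m j) + (F m.+2%:Z + F (- m.+2%:Z)).
Proof.
rewrite big_ord_recl big_ord_recr/= addrCA; congr (_ + (F _ + F _)).
- by apply: eq_bigr => j _; congr F; rewrite /deg/= /bump/=; lia.
- by rewrite /deg muln0 subr0.
- by rewrite /deg/= /bump/=; lia.
Qed.

Lemma sum_deg_even n (F : int -> R[i]) : \sum_(j < n.*2.+1) F (deg n.*2 j) =
  F 0 + \sum_(1 <= j < n.+1) (F (2 * j)%N%:Z + F (- (2 * j)%N%:Z)).
Proof.
elim: n => [|n IH]; first by rewrite big_ord1 big_geq// addr0.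
rewrite doubleS sum_degSS IH [in RHS]big_nat_recr//= [in RHS]addrA.
by rewrite (_ : n.*2.+2 = 2 * n.+1)%N//; lia.
Qed.

Lemma sum_deg_odd n (F : int -> R[i]) : \sum_(j < n.*2.+2) F (deg n.*2.+1 j) =
  (F 1 + F (-1)) + \sum_(1 <= j < n.+1) (F (2 * j).+1%:Z + F (- (2 * j).+1%:Z)).
Proof.
elim: n => [|n IH]; first by rewrite big_ord_recl big_ord1 big_geq// addr0.
rewrite doubleS sum_degSS IH [in RHS]big_nat_recr//= [in RHS]addrA.
by rewrite (_ : n.*2.+3 = (2 * n.+1).+1)%N//; lia.
Qed.

(** There are m+1 modes, each costing a factor sqrt(2pi) over its component. A second sqrt(2pi),
    with the 2, comes from bounding the joint field of degrees 1 and -1, and 4^(m+1) from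
    [normalize]. *)
Definition reduction_bound m : R :=
  m.+1%:R * (Num.sqrt (pi *+ 2) * (Num.sqrt (pi *+ 2) * (2 * 4 ^+ m.+1))).

Lemma reduction_exists m f : is_tensor m f -> exists g, reduces_to m f g /\
  nrm leb3 SM g <= reduction_bound m * nrm leb3 SM f.
Proof.
move=> tf; have Lf : L2 leb3 SM f by have [[]] := tf.
have [G [LG GB fG [w hw]]] := tensor_decomposition tf.
have [H [LH GH Hp Hn HB]] := normalize m LG GB.
have fw : is_xray f w := is_xray_ae (tens_L2 m LG) Lf (ae_eq_sym_SM fG) hw.
have Hw := GH _ hw.
set B := 4 ^+ m.+1 * nrm leb3 SM f in HB.
have B0 : 0 <= B by rewrite mulr_ge0 ?nrm_ge0// exprn_ge0.
set s : R := Num.sqrt (pi *+ 2).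
have s1 : 1 <= s by rewrite -[leLHS]sqrtr1 ler_sqrt ?two_pi_ge1//; apply: le_trans two_pi_ge1.
have CE : reduction_bound m * nrm leb3 SM f = m.+1%:R * (s * (s * (2 * B))).
  by rewrite /reduction_bound /B -/s; ring.
have BB : B <= s * (2 * B).
  by rewrite -[leLHS]mul1r ler_pM// ler_peMl//; lra.
have mE := odd_double_half m; case om : (odd m) in mE; last first.
  exists (tens m H); split; last first.
    by rewrite CE; apply: nrm_tens => // k; exact: le_trans (HB k) BB.
  split; [exact: tens_is_tensor|by exists w|rewrite /normal_form om].
  rewrite add0n in mE.
  exists (H 0), H; split => //.
    move=> j /andP[j1 jn] k.
    have hk : harmonics m k by exists (m./2 - j)%N; rewrite /k; lia.
    have hk' : harmonics m (- k) by exists (m./2 + j)%N; rewrite /k; lia.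
    split; first by exists (H k); split => //; [apply: Hp => //; rewrite /k; lia|exact: aeW].
    by exists (H (- k)); split => //; [apply: Hn => //; rewrite /k; lia|exact: aeW].
  apply: aeW => p _; rewrite /tens; have := sum_deg_even m./2 (fun k => mode (H k) k p).
  by rewrite mE => ->; congr (_ + _); rewrite /mode mul0r expi0 mulr1.
rewrite add1n in mE.
have [u [a [b [Y [[La Lb] Hu [LY xY] FE [na nb]]]]]] := solenoidal_limit (LH 1) (LH (-1)).
(* Degrees 1 and -1 are replaced by the two components of X_perp of the potential; the others are
   already in normal form. *)
pose K k (x : R * R) : R[i] :=
  if k == 1 then - 'i * a x else if k == -1 then 'i * b x else H k x.
have K1 : K 1 = fun x => - 'i * a x by [].
have K2 : K (-1) = fun x => 'i * b x by [].
have KH (k : int) : k != 1 -> k != -1 -> K k = H k.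
  by move=> k1 k2; apply/funext => x; rewrite /K (negbTE k1) (negbTE k2).
have LK k : L2M (K k).
  have [->|k1] := eqVneq k 1; first by rewrite K1; exact: (L2Z mM _ La).
  have [->|k2] := eqVneq k (-1); first by rewrite K2; exact: (L2Z mM _ Lb).
  by rewrite KH.
have [di1 di2] := @dotc_i R.
have nF : nrm leb3 SM (Xfield (H 1) (H (-1)) 0) <= s * (2 * B).
  apply: le_trans (nrmD mSM (mode_L2 _ (LH 1)) (mode_L2 _ (LH (-1)))) _.
  rewrite !nrm_mode// -/s -mulrDr ler_wpM2l//; first by rewrite sqrtr_ge0.
  by have := HB 1; have := HB (-1); lra.
have KB k : nrm leb2 M (K k) <= s * (2 * B).
  have [->|k1] := eqVneq k 1; first by rewrite K1 nrm_unit//; exact: le_trans na nF.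
  have [->|k2] := eqVneq k (-1); first by rewrite K2 nrm_unit//; exact: le_trans nb nF.
  by rewrite KH//; exact: le_trans (HB k) BB.
have tE (G' : int -> R * R -> R[i]) p : tens m G' p = Xfield (G' 1) (G' (-1)) 0 p +
    \sum_(1 <= j < m./2.+1) (mode (G' (2 * j).+1%:Z) (2 * j).+1%:Z p +
      mode (G' (- (2 * j).+1%:Z)) (- (2 * j).+1%:Z) p).
  by rewrite /tens; have := sum_deg_odd m./2 (fun k => mode (G' k) k p); rewrite mE => ->.
(* The replacement amounts to subtracting [Y], whose X-ray transform is zero. *)
have KY : ae_eq leb3 SM (fun p => tens m H p - Y p) (tens m K).
  apply: filterS FE => p e pSM; rewrite !tE e// K1 K2 addrAC addrK; congr (_ + _).
  by apply: eq_big_nat => j /andP[j1 _]; rewrite !KH//; apply/eqP; lia.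
exists (tens m K); split; last by rewrite CE; exact: nrm_tens.
split; first exact: tens_is_tensor.
  exists w; split=> //.
  apply: is_xray_ae KY (is_xrayB (tens_L2 m LH) LY Hw xY); last exact: tens_L2.
  exact: (L2B mSM (tens_L2 m LH) LY).
rewrite /normal_form om.
exists u, (fun x => a x + b x), (fun x => 'i * (a x - b x)), K; split => //.
  move=> j /andP[j1 jn] k.
  have hk : harmonics m k by exists (m./2 - j)%N; rewrite /k; lia.
  have hk' : harmonics m (- k) by exists (m./2 + j).+1; rewrite /k; lia.
  have E1 : K k = H k by apply: KH; apply/eqP; rewrite /k; lia.
  have E2 : K (- k) = H (- k) by apply: KH; apply/eqP; rewrite /k; lia.
  split; first by exists (H k); split => //; [apply: Hp => //; rewrite /k; lia|rewrite E1; exact: aeW].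
  by exists (H (- k)); split => //; [apply: Hn => //; rewrite /k; lia|rewrite E2; exact: aeW].
by apply: aeW => p _; rewrite tE Xperp_Xfield K1 K2.
Qed.

End Reduction.

Theorem theorem1 (R : realType) (m : nat) :
  (forall f : (R * R) * R -> R[i], is_tensor m f ->
     exists g, reduces_to m f g /\
       forall g', reduces_to m f g' -> ae_eq leb3 SM g' g) /\
  (exists C : R, forall f g : (R * R) * R -> R[i],
     is_tensor m f -> reduces_to m f g ->
     (L2norm leb3 SM g <= C%:E * L2norm leb3 SM f)%E).
Proof.
split=> [f tf|].
  have [g [fg _]] := reduction_exists tf; exists g; split=> // g'.
  by apply: reduction_unique fg; case: tf.
(* The bound was obtained for one constructed reduction only; uniqueness transfers it to an
   arbitrary [g]. *)
exists (reduction_bound m) => f g tf fg; have [g0 [fg0 n0]] := reduction_exists tf.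
have Lf : L2 leb3 SM f by have [[]] := tf.
have Lg : L2 leb3 SM g by have [[[]]] := fg.
have Lg0 : L2 leb3 SM g0 by have [[[]]] := fg0.
rewrite (L2norm_nrm (@measurable_SM R) Lf) (L2norm_nrm (@measurable_SM R) Lg) -EFinM lee_fin.
by rewrite (ae_eq_nrm Lg Lg0)//; apply: reduction_unique fg0 fg; case: tf.
Qed.
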